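(* Let $\mathbf{k}$ be an algebraically closed field with $\mathrm{char}(\mathbf{k})\neq 2$, let $S=\mathbf{k}[x,y,z]$ with the standard grading, and let $\mathcal{H}=\mathcal{H}^{\mathfrak{h}}(S)$ be the standard graded Hilbert scheme parametrizing homogeneous ideals $I\subseteq S$ such that $S/I$ has Hilbert function $\mathfrak{h}=(1,3,4,4,3,3,3,\ldots)$ (i.e. $I_0=I_1=0$, $\dim_{\mathbf{k}} I_2=2$, $\dim_{\mathbf{k}} I_3=6$, and $\dim_{\mathbf{k}} I_d=\binom{d+2}{2}-3$ for $d\ge 4$). Then $\mathcal{H}$ is the union of two irreducible components, each of dimension $8$, and the lexicographic point of $\mathcal{H}$ lies in the intersection of these two components; in particular, the lexicographic point is a singular point of $\mathcal{H}$.
   Context: The lexicographic order on monomials is taken with $x>y>z$. A lexicographic ideal is a monomial ideal $L$ such that each graded component $L_d$ is spanned by the $\dim_{\mathbf{k}} L_d$ lexicographically largest monomials of degree $d$; there is a unique lexicographic ideal in $\mathcal{H}$, and the point it defines is called the lexicographic point. *)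

(* Defs.v *)
From HB Require Import structures.
From mathcomp Require Import all_boot all_order all_algebra.
From mathcomp Require Import mpoly.
Set Implicit Arguments. Unset Strict Implicit. Unset Printing Implicit Defensive.
Import GRing.Theory.
Local Open Scope ring_scope.

Section Defs.
Variable k : fieldType.

Definition S := {mpoly k[3]}.

Definition ideal_pred := S -> Prop.

(* p is homogeneous of degree d (0 is homogeneous of every degree) *)
Definition homog_of (d : nat) (p : S) : Prop :=
  forall m, m \in msupp p -> mdeg m = d.

Definition hcomp (d : nat) (p : S) : S :=
  \sum_(m <- msupp p | mdeg m == d) p@_m *: 'X_[m].

Definition is_hideal (I : ideal_pred) : Prop :=
  [/\ I 0,
      (forall p q, I p -> I q -> I (p + q)),
      (forall p q, I q -> I (p * q)) &
      (forall d p, I p -> I (hcomp d p))].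

Definition lin_indep (s : seq S) : Prop :=
  forall c : 'I_(size s) -> k,
    \sum_(i < size s) c i *: s`_i = 0 -> forall i, c i = 0.

Definition basis_of (I : ideal_pred) (d : nat) (s : seq S) : Prop :=
  [/\ (forall p, p \in s -> I p /\ homog_of d p),
      lin_indep s &
      (forall p, I p -> homog_of d p ->
         exists c : 'I_(size s) -> k, p = \sum_(i < size s) c i *: s`_i)].

(* dim_k I_d prescribed by the Hilbert function h = (1,3,4,4,3,3,3,...) *)
Definition hdim (d : nat) : nat :=
  if (d < 2)%N then 0%N
  else if d == 2%N then 2%N
  else if d == 3%N then 6%N
  else ('C(d.+2, 2) - 3)%N.

(* the (k-points of the) standard graded Hilbert scheme H^h(S) *)
Definition Hpt (I : ideal_pred) : Prop :=
  is_hideal I /\ forall d, exists s, basis_of I d s /\ size s = hdim d.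

Definition subH := ideal_pred -> Prop.
Definition sub_incl (A B : subH) : Prop := forall I, A I -> B I.

Definition graded_basis (I : ideal_pred) (b : nat -> seq S) : Prop :=
  forall d, basis_of I d (b d).

(* Zariski-closed subsets of H: zero loci of polynomials in finitely many
   coordinates (d, i, m) = coefficient of monomial m in the i-th basis vector
   of I_d, required to vanish for every choice of bases (i.e. the closed
   subsets of H for its embedding in a product of Grassmannians). *)
Definition closedH (C : subH) : Prop :=
  sub_incl C Hpt /\
  exists (n : nat) (var : 'I_n -> nat * nat * 'X_{1..3}) (F : {mpoly k[n]} -> Prop),
    forall I, C I <->
      (Hpt I /\ forall b, graded_basis I b -> forall f, F f ->
         f.@[fun j : 'I_n => let: (d, i, m) := var j in (nth 0 (b d) i)@_m] = 0).

Definition irreducibleH (Z : subH) : Prop :=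
  [/\ sub_incl Z Hpt, (exists I, Z I) &
      forall C1 C2, closedH C1 -> closedH C2 ->
        sub_incl Z (fun I => C1 I \/ C2 I) -> sub_incl Z C1 \/ sub_incl Z C2].

Definition componentH (Z : subH) : Prop :=
  irreducibleH Z /\
  forall W, irreducibleH W -> sub_incl Z W -> sub_incl W Z.

Definition strict_incl (A B : subH) : Prop := sub_incl A B /\ ~ sub_incl B A.

Definition has_chain (Z : subH) (n : nat) : Prop :=
  exists c : nat -> subH,
    (forall i, (i <= n)%N -> [/\ closedH (c i), irreducibleH (c i) & sub_incl (c i) Z])
    /\ (forall i, (i < n)%N -> strict_incl (c i) (c i.+1)).

Definition dimH (Z : subH) (n : nat) : Prop := has_chain Z n /\ ~ has_chain Z n.+1.

Definition lex_gt (m m' : 'X_{1..3}) : Prop :=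
  let x := (ord0 : 'I_3) in let y := (inord 1 : 'I_3) in let z := (inord 2 : 'I_3) in
  (m x > m' x)%N \/ (m x = m' x /\ (m y > m' y)%N)
  \/ (m x = m' x /\ m y = m' y /\ (m z > m' z)%N).

Definition is_lex (L : ideal_pred) : Prop :=
  [/\ is_hideal L,
      (forall p, L p <-> forall m, m \in msupp p -> L 'X_[m]) &
      (forall m m', mdeg m = mdeg m' -> lex_gt m' m -> L 'X_[m] -> L 'X_[m'])].

End Defs.

(* Main.v *)
Require Import Defs.
From HB Require Import structures.
From mathcomp Require Import all_boot all_order all_algebra.
From mathcomp Require Import mpoly.
From mathcomp Require Import ring zify.
From Stdlib Require Import Classical ClassicalEpsilon FunctionalExtensionality PropExtensionality.
Set Implicit Arguments. Unset Strict Implicit. Unset Printing Implicit Defensive.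
Import GRing.Theory.
Local Open Scope ring_scope.

(** A point [I] is governed by its pencil of conics [I_2] and by a plane scheme of length 3, whose
    ideal agrees with [I] from degree 4 on. There are two ways to fill eight dimensions. Three
    non-collinear points lie on a net of conics (six parameters); a coprime pencil in the net (two
    parameters) spans six cubics and so determines [I]. Alternatively, three points lie on a line (2
    + 3 parameters), the conics are that line times the lines through a further point (two
    parameters), these span only five cubics, and the sixth cubic brings one more parameter. The
    polynomial families [fam1] and [fam2] parametrise dense parts [X1] and [X2] of these two sets,
    and the components are the closures of [X1] and [X2].

    That the closures cover everything is [Hpt_classification]. If [I_2] has no linear syzygy, it
    can be normalised in general coordinates, where [pencil_chart] recognises [I] as a member of the
    first family; [coprime_pencil] returns to the original coordinates by a limit. Otherwise
    [I_2 = l <x, y>] for a linear form [l]. If [l S_3] lies in [I], dimension counts show that [I]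
    is in degrees at least 4 the ideal of three points on [l], and an arc in [X2] tends to [I]
    ([line_type]). If not, counts on the line [l = 0] produce a conic completing the pencil to a
    net, and an arc in [X1] tends to [I] ([point_type]). The hypothesis on the characteristic enters
    in [pencilP_generic].

    The classification also shows that [I_4] generates all higher pieces ([regular]). Hence the
    topology defined by coordinates in all degrees is that of the 20-dimensional subspaces
    [I_2 + I_3 + I_4] of the 35-dimensional space of polynomials of degree at most 4
    ([closedH_closedG], [closedG_closedH]). There, images of polynomial families are irreducible
    ([family_irr]) and limits along polynomial arcs stay in closed sets ([closed_limit]).

    Dimension 8 means a longest chain of irreducible closed sets of length 8. Longer chains are
    impossible: the functions separating successive members are algebraically independent, but nine
    functions of eight parameters are dependent ([closure_no_chain]). A chain of length 8 comes from
    the coordinate flag in the parameter space ([closure_chain]). The vanishing of a resultant on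
    [X2] separates the first closure from the second, and equality of dimensions excludes the other
    inclusion.

    The lexicographic ideal is [lexI = (x^2, x y, x z^2, y^4, y^3 z)]. It contains [x S_3], so
    [line_type] puts it in the second component, and it is the limit of the explicit arc [lex_arc]
    in the first. A point on two components is singular. *)

Local Notation basis_of := Defs.basis_of.


(** * Polynomial functions on arbitrary parameter sets *)

Section PolynomialFunctions.
Variable k : fieldType.

(** Generated over any set [A] with coordinate functions [co], so that lines, parameter spaces,
    matrices and pairs of forms are treated alike and composition ([pf_comp]) is an induction. *)
Inductive pfun (A T : Type) (co : T -> A -> k) : (A -> k) -> Prop :=
| pf_const c : pfun co (fun=> c)
| pf_coord t : pfun co (co t)
| pf_add f g : pfun co f -> pfun co g -> pfun co (fun a => f a + g a)
| pf_mul f g : pfun co f -> pfun co g -> pfun co (fun a => f a * g a).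

Section Closure.
Variables (A T : Type) (co : T -> A -> k).

Lemma pf_ext f g : pfun co f -> f =1 g -> pfun co g.
Proof. by move=> pf /functional_extensionality <-. Qed.

Lemma pf_opp f : pfun co f -> pfun co (fun a => - f a).
Proof.
move=> pf; apply: pf_ext (pf_mul (pf_const co (-1)) pf) _ => a.
by rewrite mulN1r.
Qed.

Lemma pf_sub f g : pfun co f -> pfun co g -> pfun co (fun a => f a - g a).
Proof. by move=> pf pg; apply: pf_add => //; apply: pf_opp. Qed.

Lemma pf_exp f n : pfun co f -> pfun co (fun a => f a ^+ n).
Proof.
move=> pf; elim: n => [|n IH].
  by apply: pf_ext (pf_const co 1) _ => a; rewrite expr0.
by apply: pf_ext (pf_mul pf IH) _ => a; rewrite exprS.
Qed.

Lemma pf_sum (I : Type) (r : seq I) (P : pred I) (F : I -> A -> k) :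
  (forall i, P i -> pfun co (F i)) -> pfun co (fun a => \sum_(i <- r | P i) F i a).
Proof.
move=> pF; elim: r => [|i r IH].
  by apply: pf_ext (pf_const co 0) _ => a; rewrite big_nil.
case Pi: (P i); last by apply: pf_ext IH _ => a; rewrite big_cons Pi.
by apply: pf_ext (pf_add (pF i Pi) IH) _ => a; rewrite big_cons Pi.
Qed.

Lemma pf_prod (I : Type) (r : seq I) (P : pred I) (F : I -> A -> k) :
  (forall i, P i -> pfun co (F i)) -> pfun co (fun a => \prod_(i <- r | P i) F i a).
Proof.
move=> pF; elim: r => [|i r IH].
  by apply: pf_ext (pf_const co 1) _ => a; rewrite big_nil.
case Pi: (P i); last by apply: pf_ext IH _ => a; rewrite big_cons Pi.
by apply: pf_ext (pf_mul (pF i Pi) IH) _ => a; rewrite big_cons Pi.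
Qed.

Lemma pf_mulmx m n p (M : A -> 'M[k]_(m, n)) (N : A -> 'M[k]_(n, p)) :
  (forall i j, pfun co (fun a => M a i j)) ->
  (forall i j, pfun co (fun a => N a i j)) ->
  forall i j, pfun co (fun a => (M a *m N a) i j).
Proof.
move=> pM pN i j.
apply: pf_ext (_ : pfun co (fun a => \sum_l M a i l * N a l j)) _ => [|a].
  by apply: pf_sum => l _; apply: pf_mul.
by rewrite mxE.
Qed.

Lemma pf_det n (M : A -> 'M[k]_n) :
  (forall i j, pfun co (fun a => M a i j)) -> pfun co (fun a => \det (M a)).
Proof.
move=> pM; apply: pf_sum => s _; apply: pf_mul; first exact: pf_const.
by apply: pf_prod.
Qed.

Lemma pf_adj n (M : A -> 'M[k]_n) :
  (forall i j, pfun co (fun a => M a i j)) ->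
  forall i j, pfun co (fun a => (\adj (M a)) i j).
Proof.
move=> pM i j.
apply: pf_ext (_ : pfun co (fun a => cofactor (M a) j i)) _ => [|a].
  apply: pf_mul; first exact: pf_const.
  by apply: pf_det => i' j'; apply: pf_ext (pM (lift j i') (lift i j')) _ => a; rewrite !mxE.
by rewrite mxE.
Qed.

Lemma pf_comp (B U : Type) (co' : U -> B -> k) (h : A -> B) f :
  (forall u, pfun co (fun a => co' u (h a))) -> pfun co' f -> pfun co (fun a => f (h a)).
Proof.
move=> ph; elim=> [c|u|f1 g1 _ pf _ pg|f1 g1 _ pf _ pg].
- exact: pf_const.
- exact: ph.
- exact: pf_add.
- exact: pf_mul.
Qed.

End Closure.

Definition line_co : unit -> k -> k := fun _ s => s.
Definition vec_co n : 'I_n -> ('I_n -> k) -> k := fun i t => t i.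
Arguments vec_co : clear implicits.
Definition mx_co r N : 'I_r * 'I_N -> 'M[k]_(r, N) -> k := fun ij M => M ij.1 ij.2.
Arguments mx_co : clear implicits.

Lemma pf_poly f : pfun line_co f -> exists P : {poly k}, forall s, f s = P.[s].
Proof.
elim=> [c|[]|f1 g1 _ [P hP] _ [Q hQ]|f1 g1 _ [P hP] _ [Q hQ]].
- by exists c%:P => s; rewrite hornerC.
- by exists 'X => s; rewrite hornerX.
- by exists (P + Q) => s; rewrite hornerD hP hQ.
- by exists (P * Q) => s; rewrite hornerM hP hQ.
Qed.

Lemma poly_pf (P : {poly k}) : pfun line_co (fun s => P.[s]).
Proof.
apply: pf_ext (_ : pfun line_co (fun s => \sum_(i < size P) P`_i * s ^+ i)) _ => [|s].
  by apply: pf_sum => i _; apply: pf_mul; [apply: pf_const|apply: pf_exp; apply: (pf_coord line_co tt)].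
by rewrite horner_coef.
Qed.

Lemma pf_mpoly n f : pfun (vec_co n) f -> exists P : {mpoly k[n]}, forall t, f t = P.@[t].
Proof.
elim=> [c|i|f1 g1 _ [P hP] _ [Q hQ]|f1 g1 _ [P hP] _ [Q hQ]].
- by exists c%:MP => s; rewrite mevalC.
- by exists 'X_i => s; rewrite mevalXU.
- by exists (P + Q) => s; rewrite mevalD hP hQ.
- by exists (P * Q) => s; rewrite mevalM hP hQ.
Qed.

Lemma mpoly_pf n (P : {mpoly k[n]}) : pfun (vec_co n) (fun t => P.@[t]).
Proof.
apply: pf_ext (_ : pfun (vec_co n) (fun t => \sum_(m <- msupp P) P@_m * \prod_i t i ^+ m i)) _ => [|s].
  apply: pf_sum => m _; apply: pf_mul; first exact: pf_const.
  by apply: pf_prod => i _; apply: pf_exp; apply: (pf_coord (vec_co n) i).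
by rewrite mevalE.
Qed.

Definition lin_path n (t t' : 'I_n -> k) (s : k) : 'I_n -> k := fun i => t i + s * (t' i - t i).

Lemma lin_path0 n (t t' : 'I_n -> k) : lin_path t t' 0 = t.
Proof. by apply: functional_extensionality => i; rewrite /lin_path mul0r addr0. Qed.

Lemma lin_path1 n (t t' : 'I_n -> k) : lin_path t t' 1 = t'.
Proof. by apply: functional_extensionality => i; rewrite /lin_path mul1r addrC subrK. Qed.

Lemma pf_line n (t t' : 'I_n -> k) f :
  pfun (vec_co n) f -> pfun line_co (fun s => f (lin_path t t' s)).
Proof.
apply: pf_comp => i; apply: pf_add; first exact: pf_const.
by apply: pf_mul; [apply: (pf_coord line_co tt)|apply: pf_const].
Qed.

(* Homogenisation: [v] is replaced by [v / l] and denominators are cleared. *)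
Lemma pf_homogenize (A T : Type) (co : T -> A -> k) (B U : Type) (cob : U -> B -> k)
    (h : B -> T -> k) (l : B -> k) :
  (forall u, pfun cob (fun b => h b u)) -> pfun cob l ->
  forall f, pfun co f -> exists n g, pfun cob g /\
    forall b a, l b != 0 -> (forall t, co t a = h b t / l b) -> g b = l b ^+ n * f a.
Proof.
move=> ph pl f; elim=> [c|t|f1 f2 _ [n1 [g1 [p1 e1]]] _ [n2 [g2 [p2 e2]]]
    |f1 f2 _ [n1 [g1 [p1 e1]]] _ [n2 [g2 [p2 e2]]]].
- by exists 0, (fun=> c); split=> [|b a _ _]; [apply: pf_const|rewrite expr0 mul1r].
- exists 1, (fun b => h b t); split=> // b a l0 ->.
  by rewrite expr1 mulrC divfK.
- exists (n1 + n2)%N, (fun b => g1 b * l b ^+ n2 + g2 b * l b ^+ n1); split.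
    by apply: pf_add; apply: pf_mul => //; apply: pf_exp.
  move=> b a l0 eh; rewrite (e1 b a) // (e2 b a) // exprD; ring.
- exists (n1 + n2)%N, (fun b => g1 b * g2 b); split; first exact: pf_mul.
  move=> b a l0 eh; rewrite (e1 b a) // (e2 b a) // exprD; ring.
Qed.

End PolynomialFunctions.
Arguments vec_co {k} n.
Arguments mx_co {k} r N.
Arguments line_co {k}.

(** The polynomial [e * 'X + 1] is not constant, so it has a root, and [e] does not vanish there. *)
Lemma closed_field_nonroot (k : closedFieldType) (e : {poly k}) :
  e != 0 -> exists s, e.[s] != 0.
Proof.
move=> e0; have : size (e * 'X + 1) != 1%N.
  by rewrite -polyC1 size_MXaddC (negPf e0) /= eqSS size_poly_eq0.
case/closed_rootP => s; rewrite /root hornerD hornerMX hornerC => /eqP h.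
by exists s; apply/eqP => es; move: h; rewrite es mul0r add0r; apply/eqP/oner_neq0.
Qed.

(** Density of the nonempty open subsets of the affine line, on which every limit argument below
    rests. *)
Lemma poly_eq0_dense (k : closedFieldType) (e P : {poly k}) :
  e != 0 -> (forall s, e.[s] != 0 -> P.[s] = 0) -> P = 0.
Proof.
move=> e0 h; apply/eqP; apply: contraT => P0.
have [s] := closed_field_nonroot (mulf_neq0 e0 P0).
by rewrite hornerM mulf_eq0 negb_or => /andP[es]; rewrite h ?eqxx.
Qed.

(** * Linear dependence and algebraic dependence of fractions *)

Section LinearDependence.
Variable k : fieldType.

Lemma left_kernel_nz m n (A : 'M[k]_(m, n)) : (n < m)%N -> exists2 c : 'rV_m, c != 0 & c *m A = 0.
Proof.
move=> nm; have : kermx A != 0.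
  rewrite -mxrank_eq0 mxrank_ker subn_eq0 -ltnNge.
  exact: leq_ltn_trans (rank_leq_col A) nm.
case/rowV0Pn => c /sub_kermxP cA c0; exists c => //.
Qed.

Lemma mnm_le_mdeg n (m : 'X_{1..n}) i : (m i <= mdeg m)%N.
Proof. by rewrite mdegE (bigD1 i) //= leq_addr. Qed.

Lemma card_bmultinom n b : (#|{: 'X_{1..n < b}}| <= b ^ n)%N.
Proof.
pose f (m : 'X_{1..n < b}) : {ffun 'I_n -> 'I_b} :=
  [ffun i => Ordinal (leq_ltn_trans (mnm_le_mdeg (bmnm m) i) (bmdeg m))].
have fi : injective f.
  move=> m1 m2 /ffunP h; apply/val_inj/mnmP => i.
  by have := h i; rewrite !ffunE => /(congr1 val).
by have := leq_card f fi; rewrite card_ffun !card_ord.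
Qed.

Definition degle n (d : nat) (p : {mpoly k[n]}) := forall m, (d < mdeg m)%N -> p@_m = 0.

Lemma degle_exists n (p : {mpoly k[n]}) : exists d, degle d p.
Proof.
exists (msize p) => m h; apply: memN_msupp_eq0; apply: contraTN h => /msize_mdeg_lt h.
by rewrite -leqNgt ltnW.
Qed.

Lemma degle_le n d d' (p : {mpoly k[n]}) : (d <= d')%N -> degle d p -> degle d' p.
Proof. by move=> h hp m hm; apply: hp; apply: leq_ltn_trans hm. Qed.

Lemma degleM n d d' (p q : {mpoly k[n]}) : degle d p -> degle d' q -> degle (d + d') (p * q).
Proof.
move=> hp hq m hm; rewrite mcoeffM big1 // => [[m1 m2]] /= /eqP em.
case: (ltnP d (mdeg m1)) => h1; first by rewrite hp ?mul0r.
have := congr1 mdeg em; rewrite mdegD => E.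
by rewrite hq ?mulr0 //; lia.
Qed.

Lemma degle1 n : degle 0 (1 : {mpoly k[n]}).
Proof. by move=> m; rewrite mcoeff1 -mdeg_eq0 lt0n => /negPf ->. Qed.

Lemma degleX n d (p : {mpoly k[n]}) e : degle d p -> degle (d * e) (p ^+ e).
Proof.
move=> hp; elim: e => [|e IH]; first by rewrite muln0 expr0; apply: degle1.
by rewrite mulnS exprS; apply: degleM.
Qed.

Lemma degle_prod n (I : Type) (r : seq I) (d : I -> nat) (F : I -> {mpoly k[n]}) :
  (forall i, degle (d i) (F i)) -> degle (\sum_(i <- r) d i)%N (\prod_(i <- r) F i).
Proof.
move=> h; elim: r => [|i r IH]; first by rewrite !big_nil; apply: degle1.
by rewrite !big_cons; apply: degleM.
Qed.

(* Counting: there are [L ^ n.+1] monomials of partial degrees below [L] in the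
   [n.+1] fractions, whereas numerators over the common denominator [D ^+ w] live
   in a space of dimension at most [(w * K + 1) ^ n] with [w] linear in [L]. *)
Lemma fractions_algebraic_dependence n (A : 'I_n.+1 -> {mpoly k[n]}) (D : {mpoly k[n]}) :
  exists P : {mpoly k[n.+1]}, P != 0 /\ exists w, (forall m, m \in msupp P -> (mdeg m <= w)%N)
    /\ \sum_(m <- msupp P) P@_m *: (D ^+ (w - mdeg m) * \prod_j A j ^+ m j) = 0.
Proof.
have [K [KD KA]] : exists K, degle K D /\ forall j, degle K (A j).
  have [d hd] := degle_exists D.
  have ex j : {d | degle d (A j)} by apply: constructive_indefinite_description; apply: degle_exists.
  exists (d + \sum_j sval (ex j))%N; split; first exact: degle_le (leq_addr _ _) hd.
  move=> j; apply: degle_le (svalP (ex j)).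
  by rewrite (bigD1 j) //=; lia.
(* These choices give [w * K + 1 <= L * c] and [c ^ n < L], hence [(w * K + 1) ^ n < L ^ n.+1]. *)
pose c := (n.+1 * K).+1; pose L := (c ^ n).+1; pose w := (n.+1 * L)%N.
pose T := {ffun 'I_n.+1 -> 'I_L}.
pose mo (e : T) : 'X_{1..n.+1} := [multinom (e i : nat) | i < n.+1].
have moE e i : mo e i = e i by rewrite mnmE.
have mo_inj : injective mo.
  by move=> e e' /mnmP h; apply/ffunP => i; apply/val_inj; have := h i; rewrite !moE.
have mo_deg e : (mdeg (mo e) <= w)%N.
  rewrite mdegE (@leq_trans (\sum_(i < n.+1) L)%N) //.
    by apply: leq_sum => i _; rewrite moE ltnW.
  by rewrite sum_nat_const card_ord.
pose V (e : T) := D ^+ (w - mdeg (mo e)) * \prod_j A j ^+ mo e j.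
have Vdeg e : degle (w * K) (V e).
  have : degle (K * (w - mdeg (mo e)) + \sum_j K * mo e j)%N (V e).
    by apply: degleM; [apply: degleX | apply: degle_prod => j; apply: degleX].
  apply: degle_le; rewrite -big_distrr /= -mdegE -mulnDr subnK // mulnC //.
pose b := (w * K).+1.
pose M := \matrix_(i < #|{: T}|, j < #|{: 'X_{1..n < b}}|) (V (enum_val i))@_(enum_val j).
have [|u u0 uM] := @left_kernel_nz _ _ M.
  apply: leq_ltn_trans (card_bmultinom n b) _.
  rewrite card_ffun !card_ord.
  apply: (@leq_ltn_trans ((L * c) ^ n)); last first.
    by rewrite expnMn expnS mulnC ltn_pmul2r // expn_gt0.
  by case: (n) => // n'; rewrite leq_exp2r // /b /w /c; nia.
pose u' e := u 0 (enum_rank e).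
pose P := \sum_(e : T) u' e *: 'X_[mo e] : {mpoly k[n.+1]}.
have PE e : P@_(mo e) = u' e.
  rewrite /P raddf_sum (bigD1 e) //= mcoeffZ mcoeffX eqxx mulr1 big1 ?addr0 // => e' ne.
  by rewrite mcoeffZ mcoeffX (inj_eq mo_inj) (negPf ne) mulr0.
have Psupp m : m \in msupp P -> exists e, m = mo e.
  rewrite mcoeff_msupp => h; apply: NNPP => hn; case/negP: h.
  rewrite /P raddf_sum /= big1 // => e _; rewrite mcoeffZ mcoeffX.
  by case: eqP => [E|]; [case: hn; exists e | rewrite mulr0].
exists P; split.
  apply: contra_neq u0 => P0; apply/rowP => i.
  by have := PE (enum_val i); rewrite P0 mcoeff0 /u' enum_valK mxE.
exists w; split=> [m /Psupp[e ->] //|].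
have -> : \sum_(m <- msupp P) P@_m *: (D ^+ (w - mdeg m) * \prod_j A j ^+ m j)
        = \sum_(e : T) u' e *: V e.
  pose g m := P@_m *: (D ^+ (w - mdeg m) * \prod_j A j ^+ m j).
  rewrite -/(\sum_(m <- _) g m).
  transitivity (\sum_(m <- [seq mo e | e <- enum {: T}]) g m); last first.
    rewrite big_map big_enum /=; apply: eq_bigr => e _.
    by rewrite /g PE.
  rewrite [RHS](bigID (fun m => m \in msupp P)) /= [X in _ = _ + X]big1 ?addr0.
    rewrite -[RHS]big_filter; apply: perm_big; apply: uniq_perm; first exact: msupp_uniq.
      by rewrite filter_uniq // map_inj_uniq // enum_uniq.
    move=> m; rewrite mem_filter; case hm: (m \in msupp P) => //=.
    by have [e ->] := Psupp _ hm; rewrite map_f // mem_enum.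
  by move=> m hm; rewrite /g (memN_msupp_eq0 hm) scale0r.
apply/mpolyP => m; rewrite mcoeff0 raddf_sum /=.
under eq_bigr do rewrite mcoeffZ.
case: (ltnP (mdeg m) b) => hm; last by rewrite big1 // => e _; rewrite Vdeg ?mulr0.
have := congr1 (fun R : 'rV_ _ => R 0 (enum_rank (BMultinom hm))) uM.
rewrite !mxE => E; rewrite -[RHS]E (reindex (@enum_val T T)) /=; last first.
  by apply: onW_bij; apply: enum_val_bij.
apply: eq_bigr => i _.
by rewrite /u' enum_valK mxE enum_rankK.
Qed.

End LinearDependence.

(** * Zariski topology on a set of subspaces: closures, limits, irreducible families *)

Section AbstractTopology.
Variable k : closedFieldType.
Variables (r N : nat) (Pt : Type) (Hs : Pt -> Prop) (B : Pt -> 'M[k]_(r, N)).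
Hypothesis B_free : forall J, Hs J -> row_free (B J).
Implicit Types (C Z : Pt -> Prop) (J : Pt) (g : 'M[k]_(r, N) -> k).

(** A point is seen through the row space of [B J]. Testing all [T *m B J] makes the condition
    independent of the basis; singular [T] add nothing, being limits of invertible ones. This is the
    topology of the Grassmannian. *)
Definition closedG C := exists G : ('M[k]_(r, N) -> k) -> Prop,
  (forall g, G g -> pfun (mx_co r N) g) /\
  forall J, C J <-> (Hs J /\ forall g, G g -> forall T : 'M_r, g (T *m B J) = 0).

Definition irrG Z := [/\ (forall J, Z J -> Hs J), (exists J, Z J) &
  forall C1 C2, closedG C1 -> closedG C2 ->
    (forall J, Z J -> C1 J \/ C2 J) -> (forall J, Z J -> C1 J) \/ (forall J, Z J -> C2 J)].

Definition cl Z J := forall C, closedG C -> (forall J', Z J' -> C J') -> C J.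

Lemma cl_incl Z J : Z J -> cl Z J.
Proof. by move=> ZJ C _; apply. Qed.

Lemma closedG_Hs : closedG Hs.
Proof. by exists (fun=> False); split=> // J; split=> [h|[]]. Qed.

Lemma closedG_sub C J : closedG C -> C J -> Hs J.
Proof. by case=> G [_ h] /h[]. Qed.

Lemma cl_sub Z J : (forall J, Z J -> Hs J) -> cl Z J -> Hs J.
Proof. by move=> h; apply; [apply: closedG_Hs|]. Qed.

Lemma cl_closed Z : (forall J, Z J -> Hs J) -> closedG (cl Z).
Proof.
move=> ZH; exists (fun g => pfun (mx_co r N) g /\
  forall J, Z J -> forall T : 'M_r, g (T *m B J) = 0).
split=> [g []//|J]; split=> [cJ|[HJ h] C [G [pG hC]] ZC].
  split=> [|g [pg hg] T]; first exact: cl_sub cJ.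
  have cl1 : closedG (fun J => Hs J /\ forall T : 'M_r, g (T *m B J) = 0).
    exists (fun g' => g' = g); split=> [g' ->//|J'].
    by split=> -[HJ' h]; (split; [exact: HJ'|]); [move=> _ ->|move=> T'; apply: h].
  have [J' ZJ'|_] := cJ _ cl1; last exact.
  by split; [apply: ZH|apply: hg].
apply/hC; split=> // g Gg; apply: h; split; first exact: pG.
by move=> J' /ZC/hC[_]; apply.
Qed.

Lemma cl_min Z C : closedG C -> (forall J, Z J -> C J) -> forall J, cl Z J -> C J.
Proof. by move=> cC h J; apply. Qed.

Lemma closedG_union C1 C2 : closedG C1 -> closedG C2 -> closedG (fun J => C1 J \/ C2 J).
Proof.
move=> [G1 [p1 h1]] [G2 [p2 h2]].
pose G g := exists g1 g2 (T2 : 'M_r), [/\ G1 g1, G2 g2 & g = fun M => g1 M * g2 (T2 *m M)].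
(* Both factors must be tested on independent frames, whence the twist [T2]. *)
pose G' g := exists g1 g2 (T1 T2 : 'M_r), [/\ G1 g1, G2 g2 & g = fun M => g1 (T1 *m M) * g2 (T2 *m M)].
exists G'; split=> [g [g1 [g2 [T1 [T2 [G1g G2g ->]]]]]|J].
  have tw (T : 'M_r) g' : pfun (mx_co r N) g' -> pfun (mx_co r N) (fun M => g' (T *m M)).
    apply: pf_comp => -[i j]; apply: (pf_mulmx (co := mx_co r N) (M := fun=> T) (N := id)) => i' j'.
      exact: pf_const.
    exact: (pf_coord _ (i', j')).
  by apply: pf_mul; apply: tw; [apply: p1|apply: p2].
split=> [[/h1[HJ h]|/h2[HJ h]]|[HJ h]].
- split=> // g [g1 [g2 [T1 [T2 [G1g G2g ->]]]]] T.
  by rewrite mulmxA h // mul0r.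
- split=> // g [g1 [g2 [T1 [T2 [G1g G2g ->]]]]] T.
  by rewrite [T2 *m _]mulmxA h // mulr0.
apply: NNPP => /not_or_and[/h1 n1 /h2 n2].
have {}n1 : exists g1 T1, G1 g1 /\ g1 (T1 *m B J) <> 0.
  apply: NNPP => hn; apply: n1; split=> // g1 G1g T1; apply: NNPP => e.
  by apply: hn; exists g1, T1.
have {}n2 : exists g1 T1, G2 g1 /\ g1 (T1 *m B J) <> 0.
  apply: NNPP => hn; apply: n2; split=> // g1 G1g T1; apply: NNPP => e.
  by apply: hn; exists g1, T1.
case: n1 n2 => [g1 [T1 [G1g e1]]] [g2 [T2 [G2g e2]]].
have /(h _)/(_ 1%:M) : G' (fun M => g1 (T1 *m M) * g2 (T2 *m M)).
  by exists g1, g2, T1, T2.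
by rewrite !mul1mx => /eqP; rewrite mulf_eq0 => /orP[] /eqP.
Qed.

Lemma irr_cl Z : irrG Z -> irrG (cl Z).
Proof.
move=> [ZH [J ZJ] hZ]; split; first by move=> J'; apply: cl_sub.
  by exists J; apply: cl_incl.
move=> C1 C2 c1 c2 h; case: (hZ C1 C2 c1 c2).
- by move=> J' /cl_incl/h.
- by move=> h1; left; apply: cl_min.
- by move=> h1; right; apply: cl_min.
Qed.

(** The basis of [J] extends to a polynomial matrix with rows in the subspaces [fam a]. No [ok a0]
    is required, so [J] may be a limit of the family rather than a member. *)
Definition liftable (A T : Type) (co : T -> A -> k) (ok : A -> Prop) (fam : A -> Pt) (a0 : A) J :=
  exists M : A -> 'M_(r, N), [/\ forall i j, pfun co (fun a => M a i j), M a0 = B J &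
    forall a, ok a -> exists T : 'M_r, M a = T *m B (fam a)].

Lemma pf_twist (A T : Type) (co : T -> A -> k) (M : A -> 'M[k]_(r, N)) (U : 'M_r) g :
  pfun (mx_co r N) g -> (forall i j, pfun co (fun a => M a i j)) ->
  pfun co (fun a => g (U *m M a)).
Proof.
move=> pg pM; apply: (pf_comp (co' := mx_co r N) (h := fun a => U *m M a)) => // -[i j].
by apply: (pf_mulmx (co := co) (M := fun=> U)) => // i' j'; apply: pf_const.
Qed.

(** Along the lift an equation of [C] becomes a polynomial in [s] that vanishes on a dense open set,
    hence also at [s0]. All degenerations below are placed in closures in this way. *)
Lemma closed_limit C (e : {poly k}) fam s0 J : closedG C -> e != 0 -> Hs J ->
  (forall s, e.[s] != 0 -> C (fam s)) ->
  liftable line_co (fun s => e.[s] != 0) fam s0 J -> C J.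
Proof.
move=> [G [pG hC]] e0 HJ hfam [M [pM M0 hM]]; apply/hC; split=> // g Gg U.
have [P hP] := pf_poly (pf_twist U (pG g Gg) pM).
rewrite -M0 hP (poly_eq0_dense e0 (P := P)) ?horner0 // => s es.
have [T hT] := hM s es; have /hC[_ /(_ g Gg (U *m T))] := hfam s es.
by rewrite -hP hT mulmxA.
Qed.

(* The points [fam s] of a curve are infinitely many, so closed sets containing none of
   the two limits [J0], [J1] cannot cover them. *)
Lemma curve_closure X K (e : {poly k}) fam s0 s1 J0 J1 :
  closedG K -> e != 0 -> Hs J0 -> Hs J1 ->
  (forall s, e.[s] != 0 -> ~ K (fam s) -> X (fam s)) ->
  (forall s, e.[s] != 0 -> Hs (fam s)) -> ~ K J1 ->
  liftable line_co (fun s => e.[s] != 0) fam s0 J0 ->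
  liftable line_co (fun s => e.[s] != 0) fam s1 J1 -> cl X J0.
Proof.
move=> cK e0 H0 H1 hX hH nK [M0 [p0 M00 h0]] [M1 [p1 M11 h1]] C cC XC.
case: cC (XC) => G [pG hC] _; apply/hC; split=> // g Gg U.
have [P hP] := pf_poly (pf_twist U (pG g Gg) p0).
case: cK (nK) => GK [pK hK] /hK nK'.
have [gK [V [GgK gV]]] : exists gK V, GK gK /\ gK (V *m B J1) <> 0.
  apply: NNPP => hn; apply: nK'; split=> // g' Gg' V; apply: NNPP => nV.
  by apply: hn; exists g', V.
have [Q hQ] := pf_poly (pf_twist V (pK gK GgK) p1).
have Q0 : Q != 0 by apply/eqP => Q0; apply: gV; rewrite -M11 hQ Q0 horner0.
rewrite -M00 hP (poly_eq0_dense (mulf_neq0 e0 Q0) (P := P)) ?horner0 // => s.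
rewrite hornerM mulf_eq0 negb_or => /andP[es Qs].
have [T hT] := h0 s es; have [T1 hT1] := h1 s es.
have /hX : ~ K (fam s).
  move=> /hK[_ /(_ gK GgK (V *m T1))]; rewrite -mulmxA -hT1 hQ; apply/eqP/Qs.
by move=> /(_ es)/XC/hC[_ /(_ g Gg (U *m T))]; rewrite -hP hT mulmxA.
Qed.

Section Families.
Variables (n : nat) (fam : ('I_n -> k) -> Pt) (ok : ('I_n -> k) -> Prop).
Hypothesis ok_line : forall t t', ok t -> ok t' ->
  exists2 e : {poly k}, e != 0 & forall s, e.[s] != 0 -> ok (lin_path t t' s).
Hypothesis ok_Hs : forall t, ok t -> Hs (fam t).
Hypothesis ok_lift : forall t, ok t -> liftable (vec_co n) ok fam t (fam t).

Lemma family_nonvanishing C t : closedG C -> ok t -> ~ C (fam t) ->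
  exists2 f, pfun (vec_co n) f & f t <> 0 /\ forall t', ok t' -> f t' <> 0 -> ~ C (fam t').
Proof.
move=> [G [pG hC]] okt /hC nC.
have [g [U [Gg gU]]] : exists g U, G g /\ g (U *m B (fam t)) <> 0.
  apply: NNPP => hn; apply: nC; split; first exact: ok_Hs.
  by move=> g Gg U; apply: NNPP => e; apply: hn; exists g, U.
have [M [pM Mt hM]] := ok_lift okt.
exists (fun t => g (U *m M t)); first exact: pf_twist (pG g Gg) pM.
split=> [|t' okt' gt /hC[_ h]]; first by rewrite Mt.
by have [T hT] := hM t' okt'; apply: gt; rewrite hT mulmxA h.
Qed.

Lemma family_two_open f1 f2 t1 t2 : pfun (vec_co n) f1 -> pfun (vec_co n) f2 ->
  ok t1 -> ok t2 -> f1 t1 <> 0 -> f2 t2 <> 0 -> exists t, [/\ ok t, f1 t <> 0 & f2 t <> 0].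
Proof.
move=> p1 p2 ok1 ok2 h1 h2.
have [e e0 he] := ok_line ok1 ok2.
have [P1 hP1] := pf_poly (pf_line t1 t2 p1); have [P2 hP2] := pf_poly (pf_line t1 t2 p2).
have P10 : P1 != 0 by apply/eqP => P0; apply: h1; rewrite -(lin_path0 t1 t2) hP1 P0 horner0.
have P20 : P2 != 0 by apply/eqP => P0; apply: h2; rewrite -(lin_path1 t1 t2) hP2 P0 horner0.
have [s] := closed_field_nonroot (mulf_neq0 e0 (mulf_neq0 P10 P20)).
rewrite !hornerM !mulf_eq0 !negb_or => /and3P[es /eqP q1 /eqP q2].
by exists (lin_path t1 t2 s); rewrite hP1 hP2; split=> //; apply: he.
Qed.

Definition fam_image J := exists2 t, ok t & J = fam t.

(** Two nonempty open sets of parameters meet, because they meet on the line joining a point of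
    each; [ok_line] is the trace on lines of the openness of [ok]. *)
Lemma family_irr : (exists t, ok t) -> irrG fam_image.
Proof.
move=> [t0 ok0]; split; first by move=> J [t /ok_Hs h ->].
  by exists (fam t0), t0.
move=> C1 C2 c1 c2 h; apply: NNPP => /not_or_and[n1 n2].
have [t1 [ok1 nC1]] : exists t, ok t /\ ~ C1 (fam t).
  apply: NNPP => hn; apply: n1 => J [t okt ->]; apply: NNPP => nC.
  by apply: hn; exists t.
have [t2 [ok2 nC2]] : exists t, ok t /\ ~ C2 (fam t).
  apply: NNPP => hn; apply: n2 => J [t okt ->]; apply: NNPP => nC.
  by apply: hn; exists t.
have [f1 p1 [ft1 hf1]] := family_nonvanishing c1 ok1 nC1.
have [f2 p2 [ft2 hf2]] := family_nonvanishing c2 ok2 nC2.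
have [t [okt /(hf1 _ okt) ? /(hf2 _ okt) ?]] := family_two_open p1 p2 ok1 ok2 ft1 ft2.
by case: (h (fam t)) => //; exists t.
Qed.

End Families.

(* The affine chart of the Grassmannian on which the [r] coordinates selected by [Q] form a basis. *)
Section Chart.
Variable Q : 'M[k]_(N, r).

Definition chart J M := M *m Q = 1%:M /\ exists T : 'M_r, M = T *m B J.

Definition vanish Z g := forall J M, Z J -> chart J M -> g M = 0.

Lemma chart_span J M M' : chart J M -> (exists T : 'M_r, M' = T *m B J) -> M' = (M' *m Q) *m M.
Proof.
move=> [MQ [T eM]] [T' ->].
have := MQ; rewrite eM -mulmxA => /mulmx1C h.
by rewrite -(mulmxA T') !mulmxA -(mulmxA T') -(mulmxA T') h mulmx1.
Qed.

Lemma chart_uniq J M M' : chart J M -> chart J M' -> M = M'.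
Proof. by move=> cM [M'Q h']; rewrite [RHS](chart_span cM h') M'Q mul1mx. Qed.

Lemma chart_of_det J M : \det (M *m Q) != 0 -> (exists T : 'M_r, M = T *m B J) ->
  chart J (invmx (M *m Q) *m M).
Proof.
move=> d0 [T eM]; split; last by exists (invmx (M *m Q) *m T); rewrite -mulmxA -eM.
by rewrite -mulmxA mulVmx // unitmxE unitfE.
Qed.

Lemma pf_detQ (A U : Type) (co : U -> A -> k) (M : A -> 'M[k]_(r, N)) :
  (forall i j, pfun co (fun a => M a i j)) -> pfun co (fun a => \det (M a *m Q)).
Proof.
move=> pM; apply: pf_det; apply: pf_mulmx => // i j; exact: pf_const.
Qed.

(** By Cramer the normalised matrix has polynomial entries over the single denominator
    [\det (M a *m Q)]. *)
Lemma chart_clear_denominators (A U : Type) (co : U -> A -> k) (M : A -> 'M[k]_(r, N)) g :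
  (forall i j, pfun co (fun a => M a i j)) -> pfun (mx_co r N) g ->
  exists n G, pfun co G /\ forall a, \det (M a *m Q) != 0 ->
    G a = \det (M a *m Q) ^+ n * g (invmx (M a *m Q) *m M a).
Proof.
move=> pM pg.
pose h a (ij : 'I_r * 'I_N) := (\adj (M a *m Q) *m M a) ij.1 ij.2.
have ph u : pfun co (fun a => h a u).
  apply: pf_mulmx => //; apply: pf_adj; apply: pf_mulmx => // i j; exact: pf_const.
have [n [G [pG hG]]] := pf_homogenize ph (pf_detQ pM) pg.
exists n, G; split=> // a d0; apply: hG => // -[i j].
rewrite /mx_co /h /= /invmx unitmxE unitfE d0 -scalemxAl mxE mulrC //.
Qed.

(** A further factor [\det (M *m Q)] makes the cleared polynomial vanish outside the chart, so that
    it can serve as an equation at all frames. *)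
Lemma vanish_closed g : pfun (mx_co r N) g ->
  closedG (fun J => Hs J /\ forall M, chart J M -> g M = 0).
Proof.
move=> pg.
have pid i j : pfun (mx_co r N) (fun M : 'M[k]_(r, N) => id M i j).
  exact: (pf_coord _ (i, j)).
have [n [G [pG hG]]] := chart_clear_denominators pid pg.
pose f M := \det (M *m Q) * G M.
exists (fun g' => g' = f); split=> [_ ->|J].
  by apply: pf_mul => //; apply: (@pf_detQ _ _ _ id).
split=> -[HJ h]; split=> //.
  move=> _ -> T; rewrite /f; case: (eqVneq (\det (T *m B J *m Q)) 0) => [->|d0].
    by rewrite mul0r.
  rewrite hG // h ?mulr0 //; apply: chart_of_det => //; by exists T.
move=> M [MQ [T eM]]; have := h f erefl T; rewrite -eM /f MQ det1 mul1r.
by rewrite (hG M) MQ ?det1 ?oner_eq0 // expr1n mul1r invmx1 mul1mx.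
Qed.

(** The ideal of an irreducible set in the chart is prime. *)
Lemma vanish_mul Z g1 g2 : irrG Z -> pfun (mx_co r N) g1 -> pfun (mx_co r N) g2 ->
  vanish Z (fun M => g1 M * g2 M) -> vanish Z g1 \/ vanish Z g2.
Proof.
move=> [ZH _ hZ] p1 p2 h.
case: (hZ _ _ (vanish_closed p1) (vanish_closed p2)).
- move=> J ZJ; have HJ := ZH J ZJ; apply: NNPP => /not_or_and[n1 n2].
  have [M1 [c1 e1]] : exists M, chart J M /\ g1 M <> 0.
    apply: NNPP => hn; apply: n1; split=> // M cM; apply: NNPP => e; apply: hn; by exists M.
  apply: n2; split=> // M cM; have := h J M ZJ cM.
  by rewrite -(chart_uniq c1 cM) => /eqP; rewrite mulf_eq0 => /orP[]/eqP.
- by move=> hh; left => J M ZJ cM; have [_] := hh J ZJ; apply.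
- by move=> hh; right => J M ZJ cM; have [_] := hh J ZJ; apply.
Qed.

(** By irreducibility [C'] is not covered by [C] and the complement of the chart, so it has a point
    in the chart outside [C]. An equation of [C] that fails there, twisted by a constant matrix,
    separates. *)
Lemma chart_separation C C' J0 M0 : closedG C -> irrG C' -> chart J0 M0 -> C' J0 ->
  ~ (forall J, C' J -> C J) ->
  exists2 g, pfun (mx_co r N) g & vanish C g /\ ~ vanish C' g.
Proof.
move=> cC [C'H _ iC'] c0 C'0 nC.
have [J [C'J nCJ [M cM]]] : exists J, [/\ C' J, ~ C J & exists M, chart J M].
  apply: NNPP => hn.
  (* For the constant 1 the closed set of [vanish_closed] is the complement of the chart. *)
  case: (iC' C _ cC (vanish_closed (pf_const _ 1))) => //.
    move=> J C'J; apply: NNPP => /not_or_and[nCJ n2]; apply: hn; exists J; split=> //.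
    apply: NNPP => nM; apply: n2; split=> [|M cM]; first exact: C'H.
    by case: nM; exists M.
  by move=> /(_ J0 C'0)[_ /(_ M0 c0)/eqP]; rewrite oner_eq0.
case: cC nCJ => G [pG hC] /hC nCJ.
have [g [U [Gg gU]]] : exists g U, G g /\ g (U *m B J) <> 0.
  apply: NNPP => hn; apply: nCJ; split; first exact: C'H.
  by move=> g Gg U; apply: NNPP => e; apply: hn; exists g, U.
have eU : U *m B J = (U *m B J *m Q) *m M by apply: chart_span cM _; exists U.
pose A := U *m B J *m Q.
exists (fun M => g (A *m M)).
  apply: pf_twist (pG g Gg) _ => i j; exact: (pf_coord _ (i, j)).
split=> [J' M' /hC[_ h] [_ [T ->]]|h]; first by rewrite mulmxA h.
by apply: gU; rewrite eU; apply: (h J).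
Qed.

End Chart.

(** * Upper bound for the dimension of the closure of a family *)

Section DimensionBound.
Variables (n : nat) (fam : ('I_n -> k) -> Pt) (ok : ('I_n -> k) -> Prop).
Hypothesis ok_line : forall t t', ok t -> ok t' ->
  exists2 e : {poly k}, e != 0 & forall s, e.[s] != 0 -> ok (lin_path t t' s).
Hypothesis ok_Hs : forall t, ok t -> Hs (fam t).
Hypothesis ok_lift : forall t, ok t -> liftable (vec_co n) ok fam t (fam t).

Local Notation X := (fam_image fam ok).

(** Pulled back to the parameters, the [n.+1] functions are fractions in [n] variables with a common
    denominator, hence algebraically dependent. The relation holds where the denominator is nonzero,
    and then on the whole closure by density. *)
Lemma family_dependence Q J0 M0 (gs : 'I_n.+1 -> 'M[k]_(r, N) -> k) :
  (forall j, pfun (mx_co r N) (gs j)) -> cl X J0 -> chart Q J0 M0 ->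
  exists2 P : {mpoly k[n.+1]}, P != 0 & vanish Q (cl X) (fun M => P.@[fun j => gs j M]).
Proof.
move=> pgs clJ0 c0.
have XH J : X J -> Hs J by case=> t /ok_Hs h ->.
have [t1 [ok1 [M1 c1]]] : exists t, ok t /\ exists M, chart Q (fam t) M.
  apply: NNPP => hn.
  have := clJ0 _ (vanish_closed Q (pf_const _ 1)).
  case=> [J [t okt ->]|_ /(_ M0 c0)/eqP]; last by rewrite oner_eq0.
  split=> [|M cM]; first exact: ok_Hs.
  by case: hn; exists t; split=> //; exists M.
have lift1 t M : ok t -> chart Q (fam t) M -> exists L : ('I_n -> k) -> 'M_(r, N),
    [/\ forall i j, pfun (vec_co n) (fun a => L a i j), L t = M &
    forall a, ok a -> exists T : 'M_r, L a = T *m B (fam a)].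
  move=> okt [_ [T ->]]; have [L [pL Lt hL]] := ok_lift okt.
  exists (fun a => T *m L a); split; last 2 first.
  - by rewrite Lt.
  - by move=> a /hL[T' ->]; exists (T *m T'); rewrite mulmxA.
  by apply: pf_mulmx => // i j; apply: pf_const.
have [L [pL Lt hL]] := lift1 _ _ ok1 c1.
have ex j : {ng : nat * (('I_n -> k) -> k) | pfun (vec_co n) ng.2 /\
    forall a, \det (L a *m Q) != 0 ->
    ng.2 a = \det (L a *m Q) ^+ ng.1 * gs j (invmx (L a *m Q) *m L a)}.
  apply: constructive_indefinite_description.
  have [m [G h]] := chart_clear_denominators Q pL (pgs j); by exists (m, G).
pose nn := (\sum_j (sval (ex j)).1)%N.
have [D hD] := pf_mpoly (pf_detQ Q pL).
have exA j : {A : {mpoly k[n]} | forall a, D.@[a] != 0 ->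
    A.@[a] = D.@[a] ^+ nn * gs j (invmx (L a *m Q) *m L a)}.
  apply: constructive_indefinite_description.
  have [p1 h1] := svalP (ex j); have [A hA] := pf_mpoly p1.
  exists (A * D ^+ (nn - (sval (ex j)).1)) => a; rewrite -hD => d0.
  rewrite mevalM rmorphXn /= -hA h1 // -hD mulrAC -exprD subnKC //.
  by rewrite /nn (bigD1 j) //= leq_addr.
have [P [P0 [w [Pw PA]]]] := fractions_algebraic_dependence (fun j => sval (exA j)) (D ^+ nn).
exists P => //.
pose pg M := P.@[fun j => gs j M].
have ppg : pfun (mx_co r N) pg.
  by apply: (pf_comp (co' := vec_co n.+1) (h := fun M j => gs j M) (f := fun t => P.@[t])) => //; apply: mpoly_pf.
have rel a : ok a -> D.@[a] != 0 -> pg (invmx (L a *m Q) *m L a) = 0.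
  move=> oka Da; set M := _ *m _.
  have /(congr1 (meval a)) := PA; rewrite meval0 raddf_sum /= => E.
  have : D.@[a] ^+ (nn * w) * pg M = 0.
    rewrite -[RHS]E /pg mevalE mulr_sumr; apply: eq_big_seq => m mP.
    rewrite mevalZ mevalM !rmorphXn rmorph_prod /= mulrCA; congr (_ * _).
    have -> : \prod_i (sval (exA i) ^+ m i).@[a] = D.@[a] ^+ (nn * mdeg m) * \prod_i gs i M ^+ m i.
      rewrite mdegE big_distrr /= -prodrXr -big_split /=; apply: eq_bigr => j _.
      by rewrite rmorphXn /= (svalP (exA j)) // exprMn -exprM.
    by rewrite mulrA -exprM -exprD -mulnDr subnK // Pw.
  by move=> /eqP; rewrite mulf_eq0 expf_eq0 (negPf Da) andbF /= => /eqP.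
move=> J M clJ cM.
have := clJ _ (vanish_closed Q ppg); case=> [J' [t' ok' ->]|_]; last by apply.
split=> [|M' cM']; first exact: ok_Hs.
apply: NNPP => ng.
(* The lift [L] may degenerate at [t']. A lift based at [t'] and a parameter at which both are
   nondegenerate transfer the relation. *)
have [L' [pL' Lt' hL']] := lift1 _ _ ok' cM'.
have [m [G [pG hG]]] := chart_clear_denominators Q pL' ppg.
have M'Q : M' *m Q = 1%:M by case: cM'.
have M1Q : M1 *m Q = 1%:M by case: c1.
have [||t [okt ft Dt]] := family_two_open (t2 := t1) ok_line (pf_mul pG (pf_detQ Q pL')) (pf_detQ Q pL) ok' ok1.
- by rewrite hG Lt' M'Q det1 ?oner_eq0 // expr1n mul1r mulr1 invmx1 mul1mx.
- by rewrite Lt M1Q det1; apply/eqP/oner_neq0.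
have {ft} /andP[Gt D't] : (G t != 0) && (\det (L' t *m Q) != 0).
  by rewrite -negb_or -mulf_eq0; apply/eqP.
move: Gt; rewrite hG // mulf_eq0 negb_or => /andP[_ /eqP]; apply.
have cc' : chart Q (fam t) (invmx (L' t *m Q) *m L' t) by apply: chart_of_det => //; apply: hL'.
have cc : chart Q (fam t) (invmx (L t *m Q) *m L t).
  by apply: chart_of_det; [apply/eqP|apply: hL].
by rewrite (chart_uniq cc' cc) rel // -hD; apply/eqP.
Qed.

(** Induction along the chain. The part of a relation on [c i.+1] that is free of [gs i] is a
    relation on [c i], where [gs i] vanishes. If that part is zero, [gs i] divides the relation and
    can be cancelled, since the ideal of [c i.+1] is prime and does not contain it. *)
Lemma chain_independence Q J0 M0 (c : nat -> Pt -> Prop) m (gs : 'I_m -> 'M[k]_(r, N) -> k) :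
  (forall i, (i <= m)%N -> irrG (c i)) -> (forall i, (i < m)%N -> forall J, c i J -> c i.+1 J) ->
  c 0 J0 -> chart Q J0 M0 ->
  (forall j, pfun (mx_co r N) (gs j)) ->
  (forall j : 'I_m, vanish Q (c j) (gs j)) -> (forall j : 'I_m, ~ vanish Q (c j.+1) (gs j)) ->
  forall i, (i <= m)%N -> forall P : {mpoly k[m]}, P != 0 ->
    (forall mm, mm \in msupp P -> forall j : 'I_m, (i <= j)%N -> mm j = 0%N) ->
    ~ vanish Q (c i) (fun M => P.@[fun j => gs j M]).
Proof.
move=> irr inc c0 ch pgs van nvan; elim=> [|i IH] im P P0 hP h.
  have e : P = (P@_0%MM)%:MP.
    apply/mpolyP => mm; rewrite mcoeffC; case: (eqVneq mm 0%MM) => [->|ne]; first by rewrite mulr1.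
    rewrite mulr0; apply: memN_msupp_eq0; apply: contra ne => mP.
    by apply/eqP/mnmP => j; rewrite mnm0E; apply: hP.
  have := h J0 M0 c0 ch; rewrite e mevalC => z; move: P0.
  by rewrite e z mpolyC0 eqxx.
pose io := Ordinal im.
have ppg (R : {mpoly k[m]}) : pfun (mx_co r N) (fun M => R.@[fun j => gs j M]).
  by apply: (pf_comp (co' := vec_co m) (h := fun M j => gs j M) (f := fun t => R.@[t])) => //; apply: mpoly_pf.
have [b] := ubnP (msize P); elim: b P P0 hP h => // b IHb P P0 hP h szP.
case: (boolP (has (fun mm : 'X_{1..m} => mm io == 0%N) (msupp P))) => [/hasP[mm mmP /eqP mm0]|/hasPn allpos].
  pose P1 := \sum_(mm <- msupp P | mm io == 0%N) P@_mm *: 'X_[mm].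
  have P1E mm' : P1@_mm' = if mm' io == 0%N then P@_mm' else 0.
    rewrite /P1 raddf_sum /=.
    under eq_bigr do rewrite mcoeffZ mcoeffX.
    case: (boolP (mm' \in msupp P)) => hm; last first.
      rewrite (memN_msupp_eq0 hm) if_same big_seq_cond big1 // => m1 /andP[m1P _].
      by case: eqP => [E|]; [rewrite E (negPf hm) in m1P|rewrite mulr0].
    rewrite (bigID (pred1 mm')) /= [X in _ + X]big1 ?addr0 => [|m1 /andP[_ /negPf ->]]; last by rewrite mulr0.
    case: ifP => E.
      rewrite (eq_bigl (pred1 mm')) => [|m1 /=]; last by case: (eqVneq m1 mm') => [->|]; rewrite ?E ?andbF.
      by rewrite -big_filter filter_pred1_uniq ?msupp_uniq // big_seq1 eqxx mulr1.
    rewrite big1 // => m1 /andP[e1 /eqP e2]; by rewrite e2 E in e1.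
  apply: (IH _ P1).
  - exact: ltnW.
  - apply/eqP => E; have := P1E mm; rewrite E mcoeff0 mm0 eqxx => /esym/eqP.
    by rewrite mcoeff_eq0 mmP.
  - move=> m1; rewrite mcoeff_msupp P1E; case: (m1 io =P 0%N) => [e1|_]; last by rewrite eqxx.
    move=> m1P j; rewrite leq_eqVlt => /orP[/eqP e|lt]; last by apply: hP; rewrite // mcoeff_msupp.
    by rewrite (_ : j = io) //; apply: val_inj; rewrite /= -?e ?e.
  move=> J M cJ cM; rewrite -(h J M (inc i im J cJ) cM) {1}/P1 raddf_sum [in RHS]mevalE /=.
  rewrite [RHS](bigID (fun mm : 'X_{1..m} => mm io == 0%N)) /= [X in _ = _ + X]big1 ?addr0.
    by apply: eq_bigr => m1 _; rewrite mevalZ mevalX.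
  move=> m1 m1io; rewrite (bigD1 io) //= (van io J M cJ cM) expr0n (negPf m1io).
  by rewrite mul0r mulr0.
pose P1 := \sum_(mm <- msupp P) P@_mm *: 'X_[(mm - U_(io))%MM].
have PE : P = P1 * 'X_io.
  rewrite [LHS]mpolyE /P1 mulr_suml; apply: eq_big_seq => mm mmP.
  rewrite -scalerAl -mpolyXD submK // lep1mP; exact: allpos.
have P10 : P1 != 0 by apply: contraNneq P0 => e; rewrite PE e mul0r.
have hP1 (mm : 'X_{1..m}) (j : 'I_m) : mm \in msupp P1 -> (i.+1 <= j)%N -> mm j = 0%N.
  move=> mm1 ij; have : (mm + U_(io))%MM \in msupp P.
    by rewrite PE addmC mcoeff_msupp mcoeffMX -mcoeff_msupp.
  move/hP => /(_ j ij); rewrite mnmDE; lia.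
have := @vanish_mul Q (c i.+1) (fun M => P1.@[fun j => gs j M]) (gs io) (irr _ im) (ppg _) (pgs _).
case=> [J M cJ cM|h1|]; last exact: (nvan io).
  by rewrite -(h J M cJ cM) [in RHS]PE mevalM mevalXU.
apply: (IHb P1) => //; first by move=> mm mm1 j ij; apply: (hP1 mm j).
have X0 : 'X_io != 0 :> {mpoly k[m]} by rewrite -msize_poly_eq0 msizeX.
by move: szP; rewrite PE msizeM // msizeX mdeg1 addn2.
Qed.

(** A point [J0] of the smallest set lies in all members, so a single chart around [J0] sees every
    strict inclusion. The [n.+1] separating functions would be both independent and dependent. *)
Lemma closure_no_chain (c : nat -> Pt -> Prop) :
  (forall i, (i <= n.+1)%N -> [/\ closedG (c i), irrG (c i) & forall J, c i J -> cl X J]) ->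
  (forall i, (i < n.+1)%N -> (forall J, c i J -> c i.+1 J) /\ ~ (forall J, c i.+1 J -> c i J)) ->
  False.
Proof.
move=> hc hs.
have [_ [_ [J0 c0] _] _] := hc 0 isT.
have c0i i : (i <= n.+1)%N -> c i J0.
  by elim: i => // i IH im; have [inc _] := hs i im; apply/inc/IH/ltnW.
have HJ0 : Hs J0 by have [/closedG_sub h _ _] := hc 0 isT; apply: h.
have /row_freeP[Q BQ] := B_free HJ0.
have ch : chart Q J0 (B J0) by split=> //; exists 1%:M; rewrite mul1mx.
have ex (j : 'I_n.+1) : {g | [/\ pfun (mx_co r N) g, vanish Q (c j) g & ~ vanish Q (c j.+1) g]}.
  apply: constructive_indefinite_description.
  have [c1 _ _] := hc j (ltnW (ltn_ord j)); have [_ i1 _] := hc j.+1 (ltn_ord j).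
  have [_ ns] := hs j (ltn_ord j).
  by have [g pg [v nv]] := chart_separation c1 i1 ch (c0i _ (ltn_ord j)) ns; exists g.
have pgs j : pfun (mx_co r N) (sval (ex j)) by case: (svalP (ex j)).
have clJ0 : cl X J0 by have [_ _] := hc 0 isT; apply.
have [P P0 hP] := family_dependence pgs clJ0 ch.
apply: (@chain_independence Q J0 (B J0) c n.+1 (fun j => sval (ex j)) _ _ c0 ch pgs _ _ n.+1 _ P) => //.
- by move=> i /hc[].
- by move=> i /hs[].
- by move=> j; case: (svalP (ex j)).
- by move=> j; case: (svalP (ex j)).
- by move=> mm _ j; rewrite leqNgt ltn_ord.
- by move=> J M cJ cM; apply: (hP J) => //; have [_ _] := hc n.+1 (leqnn _); apply.
Qed.

End DimensionBound.

(** * Chains of full length in the closure of a family *)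

Section Chains.
Variables (n : nat) (fam : ('I_n -> k) -> Pt) (ok : ('I_n -> k) -> Prop).
Hypothesis ok_line : forall t t', ok t -> ok t' ->
  exists2 e : {poly k}, e != 0 & forall s, e.[s] != 0 -> ok (lin_path t t' s).
Hypothesis ok_Hs : forall t, ok t -> Hs (fam t).
Hypothesis ok_lift : forall t, ok t -> liftable (vec_co n) ok fam t (fam t).
Hypothesis ok0 : ok (fun=> 0).

Let flag i t := ok t /\ forall j : 'I_n, (i <= j)%N -> t j = 0.

(* The chain consists of the closures of the images of the coordinate subspaces. *)
Lemma closure_chain (K : 'I_n -> Pt -> Prop) :
  (forall j, closedG (K j)) ->
  (forall (j : 'I_n) t, ok t -> (forall i : 'I_n, (j <= i)%N -> t i = 0) -> K j (fam t)) ->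
  (forall j : 'I_n, exists t, [/\ ok t, forall i : 'I_n, (j < i)%N -> t i = 0 & ~ K j (fam t)]) ->
  exists c : nat -> Pt -> Prop,
    (forall i, (i <= n)%N -> [/\ closedG (c i), irrG (c i) & forall J, c i J -> cl (fam_image fam ok) J])
    /\ (forall i, (i < n)%N -> (forall J, c i J -> c i.+1 J) /\ ~ (forall J, c i.+1 J -> c i J)).
Proof.
move=> cK hK nK; exists (fun i => cl (fam_image fam (flag i))).
have HX i J : fam_image fam (flag i) J -> Hs J by case=> t [/ok_Hs h _] ->.
split=> [i im|i im].
  split; first exact/cl_closed/HX.
    apply: irr_cl; apply: family_irr.
    - move=> t t' [okt t0] [okt' t'0]; have [e e0 he] := ok_line okt okt'.
      exists e => // s es; split; first exact: he.
      by move=> j ij; rewrite /lin_path t0 // t'0 // subr0 mulr0 addr0.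
    - by move=> t [/ok_Hs].
    - move=> t [okt _]; have [M [pM Mt hM]] := ok_lift okt; exists M; split=> // a [/hM].
      by [].
    - by exists (fun=> 0).
  move=> J; apply: cl_min; first by apply: cl_closed => J' [t /ok_Hs h ->].
  by move=> J' [t [okt _] ->]; apply: cl_incl; exists t.
split.
  move=> J; apply: cl_min; first exact/cl_closed/HX.
  move=> J' [t [okt t0] ->]; apply: cl_incl; exists t => //; split=> // j ij.
  by apply: t0; apply: ltnW.
pose io := Ordinal im; have [t [okt t0 nKt]] := nK io => h; apply: nKt.
apply: (h (fam t)) (cK io) _; first by apply: cl_incl; exists t.
by move=> J [t' [okt' t'0] ->]; apply: hK.
Qed.

End Chains.
End AbstractTopology.

(** * Linear combinations, spans and the exchange lemma *)

Section SpanTools.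
Variables (k : fieldType) (V : lmodType k).
Implicit Types (s t : seq V) (p : V).

(** Coefficients are indexed by [nat], with arbitrary values beyond the length, so that
    concatenation and shifts need no casts. *)
Definition lcomb (c : nat -> k) s := \sum_(i < size s) c i *: s`_i.
Definition spanS s p := exists c, p = lcomb c s.
Definition freeS s := forall c, lcomb c s = 0 -> forall i, (i < size s)%N -> c i = 0.

Lemma lcomb_nil c : lcomb c [::] = 0.
Proof. by rewrite /lcomb big_ord0. Qed.

Lemma lcomb_cons c a s : lcomb c (a :: s) = c 0%N *: a + lcomb (fun i => c i.+1) s.
Proof. by rewrite /lcomb big_ord_recl. Qed.

Lemma lcomb_cat c s t : lcomb c (s ++ t) = lcomb c s + lcomb (fun i => c (size s + i)%N) t.
Proof.
elim: s c => [|a s IH] c /=; first by rewrite lcomb_nil add0r.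
by rewrite !lcomb_cons IH addrA.
Qed.

Lemma lcomb_closed (P : V -> Prop) c s :
  P 0 -> (forall p q, P p -> P q -> P (p + q)) -> (forall a p, P p -> P (a *: p)) ->
  (forall p, p \in s -> P p) -> P (lcomb c s).
Proof.
move=> P0 PD PZ hs; elim: s c hs => [|a s IH] c hs; first by rewrite lcomb_nil.
rewrite lcomb_cons; apply: PD; first by apply/PZ/hs/mem_head.
by apply: IH => p ps; apply: hs; rewrite inE ps orbT.
Qed.

Lemma spanS_mem s p : p \in s -> spanS s p.
Proof.
elim: s => [//|a s IH]; rewrite inE => /orP[/eqP ->|/IH[c ->]].
  exists (fun i => (i == 0%N)%:R); rewrite lcomb_cons scale1r /lcomb big1 ?addr0 // => i _.
  by rewrite scale0r.
exists (fun i => if i is j.+1 then c j else 0); by rewrite lcomb_cons scale0r add0r.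
Qed.

Lemma spanS0 s : spanS s 0.
Proof. by exists (fun=> 0); rewrite /lcomb big1 // => i _; rewrite scale0r. Qed.

Lemma spanSD s p q : spanS s p -> spanS s q -> spanS s (p + q).
Proof.
move=> [c ->] [c' ->]; exists (fun i => c i + c' i); rewrite /lcomb -big_split /=.
by apply: eq_bigr => i _; rewrite scalerDl.
Qed.

Lemma spanSZ s a p : spanS s p -> spanS s (a *: p).
Proof.
move=> [c ->]; exists (fun i => a * c i); rewrite /lcomb scaler_sumr.
by apply: eq_bigr => i _; rewrite scalerA.
Qed.

Lemma spanSB s p q : spanS s p -> spanS s q -> spanS s (p - q).
Proof. by move=> hp hq; rewrite -scaleN1r; apply/spanSD/spanSZ. Qed.

Lemma spanS_sum s (I : Type) (r : seq I) (P : pred I) (F : I -> V) :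
  (forall i, P i -> spanS s (F i)) -> spanS s (\sum_(i <- r | P i) F i).
Proof. by move=> h; apply: big_ind => //; [apply: spanS0|move=> p q; apply: spanSD]. Qed.

Lemma spanS_trans s t p : (forall q, q \in s -> spanS t q) -> spanS s p -> spanS t p.
Proof.
move=> h [c ->]; apply: lcomb_closed => //; first exact: spanS0.
  by move=> *; apply: spanSD.
by move=> *; apply: spanSZ.
Qed.

Lemma spanS_catl s t p : spanS s p -> spanS (s ++ t) p.
Proof. by apply: spanS_trans => q qs; apply: spanS_mem; rewrite mem_cat qs. Qed.

Lemma spanS_catr s t p : spanS t p -> spanS (s ++ t) p.
Proof. by apply: spanS_trans => q qs; apply: spanS_mem; rewrite mem_cat qs orbT. Qed.

Lemma spanS_cat s t p : spanS (s ++ t) p -> exists p1 p2, [/\ spanS s p1, spanS t p2 & p = p1 + p2].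
Proof. by move=> [c ->]; rewrite lcomb_cat; do 2!eexists; split; [eexists|eexists|]. Qed.

Lemma spanS_cons a s p : spanS (a :: s) p <-> exists b, spanS s (p - b *: a).
Proof.
split=> [[c ->]|[b [c h]]].
  by exists (c 0%N); rewrite lcomb_cons addrC addKr; eexists.
exists (fun i => if i is j.+1 then c j else b); rewrite lcomb_cons.
by rewrite -h addrC subrK.
Qed.

Lemma spanS_nil p : spanS [::] p -> p = 0.
Proof. by case=> c ->; rewrite lcomb_nil. Qed.

Lemma freeS_cons a s : freeS (a :: s) <-> freeS s /\ ~ spanS s a.
Proof.
split=> [h|[fs ns] c].
  split=> [c c0 i si|[c e]].
    have := h (fun i => if i is j.+1 then c j else 0).
    by rewrite lcomb_cons scale0r add0r => /(_ c0 i.+1); apply.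
  have := h (fun i => if i is j.+1 then - c j else 1).
  rewrite lcomb_cons scale1r e /lcomb -big_split /= => /(_ _ 0%N isT) h1.
  have : (1 : k) = 0 by apply: h1; rewrite big1 // => i _; rewrite scaleNr subrr.
  by apply/eqP/oner_neq0.
rewrite lcomb_cons => e; have c0 : c 0%N = 0.
  apply: NNPP => /eqP c0; apply: ns.
  have -> : a = - (c 0%N)^-1 *: lcomb (fun i => c i.+1) s.
    move/eqP: e; rewrite addr_eq0 => /eqP e.
    by rewrite scaleNr -scalerN -e scalerA mulVf // scale1r.
  by apply: spanSZ; eexists.
move: e; rewrite c0 scale0r add0r => /fs h [//|i]; rewrite ltnS; exact: h.
Qed.

Lemma freeS_nil : freeS [::].
Proof. by move=> c _ i. Qed.

Lemma freeS_cat_inv s t c : freeS (s ++ t) -> spanS s (lcomb c t) ->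
  forall i, (i < size t)%N -> c i = 0.
Proof.
move=> f [d e] i it; pose c' j := if (j < size s)%N then - d j else c (j - size s)%N.
have := f c'; rewrite lcomb_cat.
have -> : lcomb (fun i => c' (size s + i)%N) t = lcomb c t.
  by apply: eq_bigr => j _; rewrite /c' ltnNge leq_addr /= addKn.
rewrite e /lcomb -big_split /= big1 => [|j _].
  move/(_ erefl (size s + i)%N); rewrite size_cat ltn_add2l it => /(_ isT).
  by rewrite /c' ltnNge leq_addr /= addKn.
by rewrite /c' ltn_ord scaleNr addNr.
Qed.

Lemma freeS_cat s t : freeS s -> (forall c, spanS s (lcomb c t) -> forall i, (i < size t)%N -> c i = 0) ->
  freeS (s ++ t).
Proof.
move=> fs ht c; rewrite lcomb_cat => e.
have ct i : (i < size t)%N -> c (size s + i)%N = 0.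
  apply: (ht (fun i => c (size s + i)%N)).
  move/eqP: e; rewrite addrC addr_eq0 => /eqP ->; rewrite -scaleN1r; apply: spanSZ; by eexists.
move: e; rewrite [X in _ + X]/lcomb big1 ?addr0; last by move=> i _; rewrite ct ?scale0r.
move=> /fs h i; rewrite size_cat => hi; case: (ltnP i (size s)) => [/h //|si].
by rewrite -(subnKC si) ct // ltn_subLR.
Qed.

Lemma span_matrix s t : (forall p, p \in s -> spanS t p) ->
  exists A : 'M[k]_(size s, size t), forall i : 'I_(size s), s`_i = \sum_j A i j *: t`_j.
Proof.
move=> h; have ex (i : 'I_(size s)) : {c | s`_i = lcomb c t}.
  by apply: constructive_indefinite_description; apply: h; apply: mem_nth.
exists (\matrix_(i, j) sval (ex i) j) => i; rewrite [LHS](svalP (ex i)).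
by apply: eq_bigr => j _; rewrite mxE.
Qed.

Lemma lcomb_matrix s t (A : 'M[k]_(size s, size t)) (c : 'rV_(size s)) :
  (forall i : 'I_(size s), s`_i = \sum_j A i j *: t`_j) ->
  \sum_i c 0 i *: s`_i = \sum_j (c *m A) 0 j *: t`_j.
Proof.
move=> h; under eq_bigr do rewrite h scaler_sumr.
rewrite exchange_big /=; apply: eq_bigr => j _; rewrite mxE scaler_suml.
by apply: eq_bigr => i _; rewrite scalerA.
Qed.

Definition row_coef n (c : 'rV[k]_n) (i : nat) : k := if insub i is Some j then c 0 j else 0.

Lemma row_coefE n (c : 'rV[k]_n) (i : 'I_n) : row_coef c i = c 0 i.
Proof. by rewrite /row_coef valK. Qed.

Lemma lcomb_row s (c : 'rV_(size s)) : lcomb (row_coef c) s = \sum_i c 0 i *: s`_i.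
Proof. by apply: eq_bigr => i _; rewrite row_coefE. Qed.

Lemma row_coef0 n (c : 'rV[k]_n) : (forall i, (i < n)%N -> row_coef c i = 0) -> c = 0.
Proof. by move=> h; apply/rowP => i; rewrite mxE -(h i) ?row_coefE. Qed.

Lemma steinitz_dep s t : (forall p, p \in s -> spanS t p) -> (size t < size s)%N -> ~ freeS s.
Proof.
move=> /span_matrix[A hA] /(left_kernel_nz A)[c c0 cA] fs; case/eqP: c0.
apply: row_coef0; apply: fs; rewrite lcomb_row (lcomb_matrix c hA) cA.
by rewrite big1 // => j _; rewrite mxE scale0r.
Qed.

Lemma steinitz_free s t : (size t <= size s)%N -> (forall p, p \in s -> spanS t p) -> freeS s -> freeS t.
Proof.
elim: t s => [|a t IH] s; first by move=> *; apply: freeS_nil.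
move=> sz h fs; apply: NNPP => nf.
have [t' sz' ht'] : exists2 t', size t' = size t & forall p, spanS (a :: t) p -> spanS t' p.
  have [c [c0 [i [si ci]]]] : exists c, lcomb c (a :: t) = 0 /\ exists i, (i < size (a :: t))%N /\ c i <> 0.
    apply: NNPP => hn; apply: nf => c c0 i si; apply: NNPP => ci; apply: hn.
    by exists c; split=> //; exists i.
  exists (take i (a :: t) ++ drop i.+1 (a :: t)).
    by rewrite size_cat size_take size_drop si /=; move: si => /=; lia.
  move=> p; apply: spanS_trans => q.
  have ec : a :: t = take i (a :: t) ++ (a :: t)`_i :: drop i.+1 (a :: t).
    by rewrite -drop_nth // cat_take_drop.
  rewrite [X in _ \in X]ec mem_cat inE => /or3P[h1|/eqP ->|h1]; last 2 first.
  - have e := c0; rewrite [X in lcomb c X]ec lcomb_cat lcomb_cons size_take si addn0 in e.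
    have -> : (a :: t)`_i = - (c i)^-1 *: (lcomb c (take i (a :: t)) +
        lcomb (fun j => c (i + j.+1)%N) (drop i.+1 (a :: t))).
      move: e; rewrite addrCA => /eqP; rewrite addr_eq0 => /eqP e.
      by rewrite scaleNr -scalerN -e scalerA mulVf ?scale1r //; apply/eqP.
    by apply: spanSZ; apply: spanSD; [apply: spanS_catl|apply: spanS_catr]; eexists.
  - by apply: spanS_mem; rewrite mem_cat h1 orbT.
  - by apply: spanS_mem; rewrite mem_cat h1.
apply: (steinitz_dep (s := s) (t := t')) => //; last by rewrite sz'.
by move=> p /h/ht'.
Qed.

Lemma steinitz_span s t p : (size t <= size s)%N -> (forall p, p \in s -> spanS t p) -> freeS s ->
  spanS t p -> spanS s p.
Proof.
move=> sz h fs tp; apply: NNPP => np.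
apply: (steinitz_dep (s := p :: s) (t := t)) => //; last by apply/freeS_cons.
by move=> q; rewrite inE => /orP[/eqP ->|/h].
Qed.

End SpanTools.

(** * Monomials in three variables *)

Definition mon (a b c : nat) : 'X_{1..3} := [multinom [tuple a; b; c]].
Notation i0 := (@Ordinal 3 0 isT).
Notation i1 := (@Ordinal 3 1 isT).
Notation i2 := (@Ordinal 3 2 isT).

Lemma ord3 (i : 'I_3) : [\/ i = i0, i = i1 | i = i2].
Proof.
by case: i => [[|[|[|//]]] h]; [constructor 1|constructor 2|constructor 3]; apply: val_inj.
Qed.

Lemma mon_eta (m : 'X_{1..3}) : m = mon (m i0) (m i1) (m i2).
Proof. by apply/mnmP => i; case: (ord3 i) => ->; rewrite [RHS]multinomE. Qed.

Lemma mon0 a b c : mon a b c i0 = a. Proof. by rewrite multinomE. Qed.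
Lemma mon1 a b c : mon a b c i1 = b. Proof. by rewrite multinomE. Qed.
Lemma mon2 a b c : mon a b c i2 = c. Proof. by rewrite multinomE. Qed.
Definition monE := (mon0, mon1, mon2).

Lemma monP (m m' : 'X_{1..3}) : (m = m') <-> [/\ m i0 = m' i0, m i1 = m' i1 & m i2 = m' i2].
Proof. by split=> [->//|[e0 e1 e2]]; rewrite (mon_eta m) e0 e1 e2 -mon_eta. Qed.

Lemma eq_mon a b c a' b' c' : (mon a b c == mon a' b' c') = [&& a == a', b == b' & c == c'].
Proof.
apply/eqP/and3P => [/monP[]|[/eqP -> /eqP -> /eqP -> //]].
by rewrite !monE => -> -> ->.
Qed.

Lemma mdeg_mon a b c : mdeg (mon a b c) = (a + b + c)%N.
Proof. by rewrite mdegE !big_ord_recl big_ord0 /= addn0 addnA. Qed.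

Lemma mdeg3 (m : 'X_{1..3}) : mdeg m = (m i0 + m i1 + m i2)%N.
Proof. by rewrite {1}(mon_eta m) mdeg_mon. Qed.

Lemma addmon a b c a' b' c' : (mon a b c + mon a' b' c')%MM = mon (a + a') (b + b') (c + c').
Proof. by apply/monP; rewrite !mnmDE !monE. Qed.

Definition mons d : seq 'X_{1..3} :=
  [seq mon p.1 p.2 (d - p.1 - p.2) | p <- [seq (a, b) | a <- iota 0 d.+1, b <- iota 0 (d - a).+1]].

Lemma mem_mons d m : (m \in mons d) = (mdeg m == d).
Proof.
apply/mapP/eqP => [[[a b] /allpairsPdep[a' [b' [ha hb [-> ->]]]] ->]|<-].
  by rewrite mdeg_mon /=; move: ha hb; rewrite !mem_iota; lia.
exists (m i0, m i1).
  apply/allpairsPdep; exists (m i0), (m i1); rewrite !mem_iota mdeg3; split=> //; lia.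
by rewrite mdeg3 {1}(mon_eta m) /=; congr mon; lia.
Qed.

Lemma uniq_mons d : uniq (mons d).
Proof.
rewrite map_inj_in_uniq.
  apply: allpairs_uniq_dep; [exact: iota_uniq|by move=> *; apply: iota_uniq|].
  by move=> [a b] [a' b'] _ _ /= [-> ->].
move=> [a b] [a' b'] _ _ /= /monP; rewrite !monE /=; case=> -> -> //.
Qed.

(** * Forms in three variables and their coefficients *)

Section Polys.
Variable k : fieldType.
Local Notation S := {mpoly k[3]}.
Implicit Types (p q : S).

Lemma size_mons d : size (mons d) = 'C(d.+2, 2).
Proof.
rewrite size_map size_allpairs_dep.
have -> : [seq size (iota 0 (d - x).+1) | x <- iota 0 d.+1] = [seq (d - x).+1 | x <- iota 0 d.+1].
  by apply: eq_map => x; rewrite size_iota.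
rewrite sumnE big_map -[iota 0 d.+1]/(index_iota 0 d.+1) big_mkord.
rewrite (reindex_inj rev_ord_inj) /= -triangular_sum big_mkord [RHS]big_ord_recl add0n.
by apply: eq_bigr => i _; rewrite subSS subKn // -ltnS.
Qed.

Definition X3 : S := 'X_[mon 1 0 0].
Definition Y3 : S := 'X_[mon 0 1 0].
Definition Z3 : S := 'X_[mon 0 0 1].

Lemma homogP d p : homog_of d p <-> forall m, p@_m != 0 -> mdeg m = d.
Proof. by split=> h m; have := h m; rewrite mcoeff_msupp. Qed.

Lemma homog_coef d p m : homog_of d p -> mdeg m != d -> p@_m = 0.
Proof. by move=> /homogP h; apply: contra_neq_eq => /h. Qed.

Lemma homog0 d : homog_of d (0 : S).
Proof. by apply/homogP => m; rewrite mcoeff0 eqxx. Qed.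

Lemma homogD d p q : homog_of d p -> homog_of d q -> homog_of d (p + q).
Proof.
move=> hp hq; apply/homogP => m; rewrite mcoeffD => h; apply: contraNeq h => ne.
by rewrite !(homog_coef _ ne) // addr0.
Qed.

Lemma homogZ d a p : homog_of d p -> homog_of d (a *: p).
Proof.
move=> hp; apply/homogP => m; rewrite mcoeffZ => h; apply: contraNeq h => ne.
by rewrite (homog_coef _ ne) // mulr0.
Qed.

Lemma homogN d p : homog_of d p -> homog_of d (- p).
Proof. by rewrite -scaleN1r; apply: homogZ. Qed.

Lemma homogB d p q : homog_of d p -> homog_of d q -> homog_of d (p - q).
Proof. by move=> hp /homogN; apply: homogD. Qed.

Lemma homogX m d : mdeg m = d -> homog_of d ('X_[m] : S).
Proof. by move=> <-; apply/homogP => m'; rewrite mcoeffX; case: (m =P m') => [->//|_]; rewrite eqxx. Qed.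

Lemma homog_mon a b c d : (a + b + c)%N = d -> homog_of d ('X_[mon a b c] : S).
Proof. by move=> h; apply: homogX; rewrite mdeg_mon. Qed.

Lemma homogM d e p q : homog_of d p -> homog_of e q -> homog_of (d + e) (p * q).
Proof.
move=> hp hq; apply/homogP => m; rewrite mcoeffM => h; apply: contraNeq h => ne.
rewrite big1 // => [[m1 m2]] /= /eqP em.
case: (mdeg m1 =P d) => [e1|/eqP /(homog_coef hp) ->]; last by rewrite mul0r.
rewrite (homog_coef hq) ?mulr0 //; apply: contraNneq ne => e2.
by rewrite em mdegD e1 e2.
Qed.

Lemma homog_sum d (I : Type) (r : seq I) (P : pred I) (F : I -> S) :
  (forall i, P i -> homog_of d (F i)) -> homog_of d (\sum_(i <- r | P i) F i).
Proof. by move=> h; apply: big_ind => //; [apply: homog0|move=> *; apply: homogD]. Qed.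

Lemma homog_lcomb d c (s : seq S) : (forall p, p \in s -> homog_of d p) -> homog_of d (lcomb c s).
Proof. by apply: lcomb_closed => *; [apply: homog0|apply: homogD|apply: homogZ]. Qed.

Lemma homog_span d p : homog_of d p -> p = \sum_(m <- mons d) p@_m *: 'X_[m].
Proof.
move=> hp; apply/mpolyP => m; rewrite raddf_sum /=.
under eq_bigr do rewrite mcoeffZ mcoeffX.
case: (mdeg m =P d) => [e|/eqP e].
  rewrite (bigD1_seq m) ?uniq_mons ?mem_mons ?e //= eqxx mulr1 big1 ?addr0 // => m' ne.
  by rewrite (negPf ne) mulr0.
rewrite (homog_coef hp) // big_seq big1 // => m'; rewrite mem_mons => /eqP e'.
by case: eqP => [E|]; [rewrite -E e' eqxx in e|rewrite mulr0].
Qed.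

Lemma mcoeff_hcomp d p m : (hcomp d p)@_m = if mdeg m == d then p@_m else 0.
Proof.
rewrite /hcomp raddf_sum /=; under eq_bigr do rewrite mcoeffZ mcoeffX.
case: ifP => e.
  case: (boolP (m \in msupp p)) => hm.
    rewrite big_mkcond (bigD1_seq m) ?msupp_uniq //= e eqxx mulr1 big1 ?addr0 // => m' ne.
    by rewrite (negPf ne) mulr0; case: ifP.
  rewrite memN_msupp_eq0 // big_seq_cond big1 // => m' /andP[h' _].
  by case: eqP => [E|]; [rewrite E (negPf hm) in h'|rewrite mulr0].
rewrite big1 // => m' e'; case: eqP => [E|]; last by rewrite mulr0.
by rewrite E e in e'.
Qed.

Lemma hcomp_homog d p : homog_of d (hcomp d p).
Proof. by apply/homogP => m; rewrite mcoeff_hcomp; case: ifP => [/eqP //|_]; rewrite eqxx. Qed.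

Lemma hcomp_id d p : homog_of d p -> hcomp d p = p.
Proof.
move=> hp; apply/mpolyP => m; rewrite mcoeff_hcomp; case: eqP => // /eqP e.
by rewrite (homog_coef hp).
Qed.

Lemma hcomp_ne d e p : homog_of d p -> d != e -> hcomp e p = 0.
Proof.
move=> hp ne; apply/mpolyP => m; rewrite mcoeff_hcomp mcoeff0; case: eqP => // em.
by rewrite (homog_coef hp) // em eq_sym.
Qed.

Lemma hcompD d p q : hcomp d (p + q) = hcomp d p + hcomp d q.
Proof. by apply/mpolyP => m; rewrite mcoeffD !mcoeff_hcomp mcoeffD; case: ifP; rewrite ?addr0. Qed.

Lemma hcompZ d a p : hcomp d (a *: p) = a *: hcomp d p.
Proof. by apply/mpolyP => m; rewrite mcoeffZ !mcoeff_hcomp mcoeffZ; case: ifP; rewrite ?mulr0. Qed.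

Lemma hcomp0 d : hcomp d (0 : S) = 0.
Proof. by apply/mpolyP => m; rewrite mcoeff_hcomp mcoeff0 if_same. Qed.

Lemma hcomp_sum d (I : Type) (r : seq I) (P : pred I) (F : I -> S) :
  hcomp d (\sum_(i <- r | P i) F i) = \sum_(i <- r | P i) hcomp d (F i).
Proof. exact: (big_morph (hcomp d) (hcompD d) (hcomp0 d)). Qed.

Lemma hcompM d e a p : homog_of e a -> hcomp (e + d) (a * p) = a * hcomp d p.
Proof.
move=> ha; apply/mpolyP => m; rewrite mcoeff_hcomp !mcoeffM; case: ifP => em.
  apply: eq_bigr => -[m1 m2] /= /eqP E; rewrite mcoeff_hcomp.
  case: (mdeg m1 =P e) => [e1|/eqP /(homog_coef ha) ->]; last by rewrite !mul0r.
  have := congr1 mdeg E; rewrite mdegD e1 => E'.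
  have em' := eqP em; have -> // : (mdeg m2 == d) = true.
  by apply/eqP/(@addnI e); rewrite -em' -E'.
rewrite big1 // => -[m1 m2] /= /eqP E; rewrite mcoeff_hcomp.
case: (mdeg m1 =P e) => [e1|/eqP /(homog_coef ha) ->]; last by rewrite !mul0r.
have := congr1 mdeg E; rewrite mdegD e1; case: (mdeg m2 =P d) => [->|]; last by rewrite mulr0.
by move=> E2; rewrite E2 eqxx in em.
Qed.

Lemma hcomp_decomp p n : (msize p <= n)%N -> p = \sum_(d < n) hcomp d p.
Proof.
move=> sz; apply/mpolyP => m; rewrite raddf_sum /=.
under eq_bigr do rewrite mcoeff_hcomp.
case: (ltnP (mdeg m) n) => h.
  rewrite (bigD1 (Ordinal h)) //= eqxx big1 ?addr0 // => d ne; case: (mdeg m =P d) => // e.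
  by case/eqP: ne; apply: val_inj; rewrite /= e.
rewrite memN_msupp_eq0; last by apply: contraTN sz => /msize_mdeg_lt; rewrite -ltnNge; lia.
by rewrite big1 // => d _; case: (mdeg m =P d) => // e; have := ltn_ord d; rewrite -e ltnNge h.
Qed.

Lemma coefXS a b c p : (X3 * p)@_(mon a.+1 b c) = p@_(mon a b c).
Proof. by rewrite mulrC -[mon a.+1 b c]/(mon (1 + a) (0 + b) (0 + c)) -addmon mcoeffMX. Qed.
Lemma coefYS a b c p : (Y3 * p)@_(mon a b.+1 c) = p@_(mon a b c).
Proof. by rewrite mulrC -[mon a b.+1 c]/(mon (0 + a) (1 + b) (0 + c)) -addmon mcoeffMX. Qed.
Lemma coefZS a b c p : (Z3 * p)@_(mon a b c.+1) = p@_(mon a b c).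
Proof. by rewrite mulrC -[mon a b c.+1]/(mon (0 + a) (0 + b) (1 + c)) -addmon mcoeffMX. Qed.

Lemma coefMX0 (m m' : 'X_{1..3}) p i : (m i < m' i)%N -> ('X_[m'] * p)@_m = 0.
Proof.
move=> h; rewrite mcoeffM big1 // => -[m1 m2] /= /eqP E; rewrite mcoeffX.
case: eqP => [e|]; last by rewrite mul0r.
have := congr1 (fun u : 'X_{1..3} => u i) E; rewrite -e mnmDE => Ei.
by move: h; rewrite [X in (X < _)%N]Ei ltnNge leq_addr.
Qed.

Lemma coefX0 b c p : (X3 * p)@_(mon 0 b c) = 0.
Proof. by apply: (@coefMX0 _ _ _ i0); rewrite !monE. Qed.
Lemma coefY0 a c p : (Y3 * p)@_(mon a 0 c) = 0.
Proof. by apply: (@coefMX0 _ _ _ i1); rewrite !monE. Qed.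
Lemma coefZ0 a b p : (Z3 * p)@_(mon a b 0) = 0.
Proof. by apply: (@coefMX0 _ _ _ i2); rewrite !monE. Qed.

Lemma coef_mon a b c a' b' c' : ('X_[mon a b c] : S)@_(mon a' b' c') = [&& a == a', b == b' & c == c']%:R.
Proof. by rewrite mcoeffX eq_mon. Qed.

Definition coefvar := (coefXS, coefYS, coefZS, coefX0, coefY0, coefZ0).

Lemma mulmon a b c a' b' c' : 'X_[mon a b c] * 'X_[mon a' b' c'] = 'X_[mon (a + a') (b + b') (c + c')] :> S.
Proof. by rewrite -mpolyXD addmon. Qed.

Lemma mon_exp a b c : 'X_[mon a b c] = X3 ^+ a * Y3 ^+ b * Z3 ^+ c :> S.
Proof.
rewrite /X3 /Y3 /Z3 !mpolyXn -!mpolyXD; congr 'X_[_]; apply/monP.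
by rewrite !mnmDE !mulmnE !monE !mul0n !mul1n !addn0.
Qed.

Definition lin (a b c : k) : S := a *: X3 + b *: Y3 + c *: Z3.

Lemma homogX3 : homog_of 1 X3. Proof. exact: homog_mon. Qed.
Lemma homogY3 : homog_of 1 Y3. Proof. exact: homog_mon. Qed.
Lemma homogZ3 : homog_of 1 Z3. Proof. exact: homog_mon. Qed.

Lemma homog_lin a b c : homog_of 1 (lin a b c).
Proof. by do !apply: homogD; apply: homogZ; apply: homog_mon. Qed.

Lemma homog1_lin p : homog_of 1 p -> p = lin p@_(mon 1 0 0) p@_(mon 0 1 0) p@_(mon 0 0 1).
Proof.
move=> hp; rewrite [LHS](homog_span hp) /mons /= !big_cons big_nil addr0 /lin.
by rewrite addrC [X in X + _ = _]addrC.
Qed.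

Lemma coef_linM a b c p m : (lin a b c * p)@_m = a * (X3 * p)@_m + b * (Y3 * p)@_m + c * (Z3 * p)@_m.
Proof. by rewrite /lin !mulrDl -!scalerAl !mcoeffD !mcoeffZ. Qed.

Lemma homog0_const p : homog_of 0 p -> p = (p@_0%MM)%:MP.
Proof.
move=> hp; apply/mpolyP => m; rewrite mcoeffC; case: eqVneq => [->|ne]; first by rewrite mulr1.
by rewrite (homog_coef hp) ?mulr0 // mdeg_eq0.
Qed.

(* Induction on monomials reduces ideal membership of products to the three variables. *)
Lemma mul_ind (P : S -> Prop) : (forall p q, P p -> P q -> P (p + q)) ->
  (forall a p, P p -> P (a *: p)) ->
  (forall p, P p -> [/\ P (X3 * p), P (Y3 * p) & P (Z3 * p)]) ->
  P 0 -> forall a p, P p -> P (a * p).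
Proof.
move=> PD PZ PX P0 a p Pp; rewrite [a]mpolyE mulr_suml.
apply: big_ind => // m _; rewrite -scalerAl; apply: PZ.
rewrite (mon_eta m) mon_exp -!mulrA.
have hX n q : P q -> P (X3 ^+ n * q).
  by elim: n => [|n IH] Pq; rewrite ?expr0 ?mul1r // exprS -mulrA; case: (PX _ (IH Pq)).
have hY n q : P q -> P (Y3 ^+ n * q).
  by elim: n => [|n IH] Pq; rewrite ?expr0 ?mul1r // exprS -mulrA; case: (PX _ (IH Pq)).
have hZ n q : P q -> P (Z3 ^+ n * q).
  by elim: n => [|n IH] Pq; rewrite ?expr0 ?mul1r // exprS -mulrA; case: (PX _ (IH Pq)).
by apply/hX/hY/hZ.
Qed.

Definition graded_pred (D : nat -> S -> Prop) : ideal_pred k := fun p => forall d, D d (hcomp d p).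

Definition lin_closed (P : S -> Prop) :=
  [/\ P 0, forall p q, P p -> P q -> P (p + q) & forall a p, P p -> P (a *: p)].

Lemma graded_hideal D : (forall d, lin_closed (D d)) ->
  (forall d p, homog_of d p -> D d p -> [/\ D d.+1 (X3 * p), D d.+1 (Y3 * p) & D d.+1 (Z3 * p)]) ->
  is_hideal (graded_pred D).
Proof.
move=> DL DX.
have D0 d : D d 0 by case: (DL d).
have DD d p q : D d p -> D d q -> D d (p + q) by case: (DL d) => _ h _; apply: h.
have DZ d a p : D d p -> D d (a *: p) by case: (DL d) => _ _; apply.
have P0 : graded_pred D 0 by move=> d; rewrite hcomp0.
have PD p q : graded_pred D p -> graded_pred D q -> graded_pred D (p + q).
  by move=> hp hq d; rewrite hcompD; apply: DD.
split=> // [a p|d p hp e].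
  apply: mul_ind => //.
    by move=> b q hq d; rewrite hcompZ; apply: DZ.
  move=> q hq; split=> -[|d].
  all: try by rewrite (_ : hcomp 0 _ = 0) //; apply/mpolyP => m; rewrite mcoeff_hcomp mcoeff0;
    case: eqP => // /eqP; rewrite mdeg_eq0 => /eqP ->; rewrite -[0%MM]/(0%MM); 
    rewrite (mon_eta 0%MM) !mnm0E ?coefvar.
  - by rewrite (hcompM _ _ homogX3); case: (DX d (hcomp d q) (@hcomp_homog d q) (hq d)).
  - by rewrite (hcompM _ _ homogY3); case: (DX d (hcomp d q) (@hcomp_homog d q) (hq d)).
  - by rewrite (hcompM _ _ homogZ3); case: (DX d (hcomp d q) (@hcomp_homog d q) (hq d)).
case: (d =P e) => [<-|/eqP ne]; first by rewrite hcomp_id //; apply: hcomp_homog.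
by rewrite (hcomp_ne (@hcomp_homog d p) ne).
Qed.

Lemma graded_homog D d p : (forall d, D d 0) -> homog_of d p -> graded_pred D p <-> D d p.
Proof.
move=> D0 hp; split=> [/(_ d)|h e]; first by rewrite hcomp_id.
case: (d =P e) => [<-|/eqP ne]; first by rewrite hcomp_id.
by rewrite (hcomp_ne hp ne).
Qed.

End Polys.

(** * Homogeneous ideals and dimension counts in a single degree *)

Section Points.
Variable k : fieldType.
Local Notation S := {mpoly k[3]}.
Implicit Types (p q : S) (I : ideal_pred k).

Section Ideal.
Variables (I : ideal_pred k) (HI : is_hideal I).

Lemma hi0 : I 0. Proof. by case: HI. Qed.
Lemma hiD p q : I p -> I q -> I (p + q). Proof. by case: HI => _ h _ _; apply: h. Qed.
Lemma hiM p q : I q -> I (p * q). Proof. by case: HI => _ _ h _; apply: h. Qed.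
Lemma hiZ a p : I p -> I (a *: p). Proof. by rewrite -mul_mpolyC; apply: hiM. Qed.
Lemma hiB p q : I p -> I q -> I (p - q).
Proof. by move=> hp hq; rewrite -scaleN1r; apply/hiD/hiZ. Qed.
Lemma hihc d p : I p -> I (hcomp d p). Proof. by case: HI => _ _ _; apply. Qed.
Lemma hi_lcomb c s : (forall p, p \in s -> I p) -> I (lcomb c s).
Proof. by apply: lcomb_closed; [exact: hi0|exact: hiD|exact: hiZ]. Qed.
Lemma hi_sum (J : Type) (r : seq J) (P : pred J) (F : J -> S) :
  (forall i, P i -> I (F i)) -> I (\sum_(i <- r | P i) F i).
Proof. by move=> h; apply: big_ind => //; [exact: hi0|exact: hiD]. Qed.

Lemma hi_homog p : (forall d, I (hcomp d p)) -> I p.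
Proof. by move=> h; rewrite (hcomp_decomp (leqnn (msize p))); apply: hi_sum. Qed.

End Ideal.

Lemma nth_coef n (c : 'I_n -> k) : exists c' : nat -> k, forall i : 'I_n, c i = c' i.
Proof.
exists (fun i => if insub i is Some j then c j else 0) => i.
by rewrite insubT //= => h; congr c; apply: val_inj.
Qed.

Lemma lin_indepP (s : seq S) : lin_indep s <-> freeS s.
Proof.
split=> [h c e i si|h c e i].
  by apply: (h (fun i => c i) e (Ordinal si)).
have [c' hc'] := nth_coef c; rewrite hc'; apply: h => //.
by rewrite /lcomb -[RHS]e; apply: eq_bigr => j _; rewrite hc'.
Qed.

Lemma basis_ofP I d s : basis_of I d s <->
  [/\ forall p, p \in s -> I p /\ homog_of d p, freeS s &
      forall p, I p -> homog_of d p -> spanS s p].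
Proof.
split=> -[h1 /lin_indepP h2 h3]; split=> // p Ip hp; have [c ->] := h3 p Ip hp.
  have [c' hc'] := nth_coef c; exists c'; by apply: eq_bigr => i _; rewrite hc'.
by exists (fun i => c i).
Qed.

Lemma mons_span d p : homog_of d p -> spanS [seq 'X_[m] : S | m <- mons d] p.
Proof.
move=> hp; rewrite (homog_span hp) big_seq; apply: spanS_sum => m md.
by apply/spanSZ/spanS_mem/map_f.
Qed.

(* A family with a dual family of linear forms is free. *)
Lemma free_dual (s : seq S) (f : nat -> S -> k) :
  (forall i c, (i < size s)%N -> f i (lcomb c s) = c i) -> (forall i, f i 0 = 0) -> freeS s.
Proof. by move=> h f0 c e i si; rewrite -(h i c si) e f0. Qed.

Lemma lcomb_coef c (s : seq S) m : (lcomb c s)@_m = \sum_(i < size s) c i * (s`_i)@_m.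
Proof. by rewrite /lcomb raddf_sum /=; apply: eq_bigr => i _; rewrite mcoeffZ. Qed.

Lemma free_triangular (ms : seq 'X_{1..3}) (F : 'X_{1..3} -> S) : uniq ms ->
  (forall m m', m \in ms -> m' \in ms -> (F m)@_m' = (m == m')%:R) ->
  freeS [seq F m | m <- ms].
Proof.
move=> um hF; apply: (@free_dual _ (fun i p => p@_(nth 0%MM ms i))) => [i c|i]; last by rewrite mcoeff0.
rewrite size_map => si; rewrite lcomb_coef size_map (bigD1 (Ordinal si)) //=.
rewrite (nth_map 0%MM) // hF ?mem_nth // eqxx mulr1 big1 ?addr0 // => j nej.
rewrite (nth_map 0%MM) // hF ?mem_nth // nth_uniq //.
by case: eqP => [e|]; [case/eqP: nej; apply: val_inj|rewrite mulr0].
Qed.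

Lemma mons_free d : freeS [seq 'X_[m] : S | m <- mons d].
Proof. by apply: free_triangular; [exact: uniq_mons|move=> *; rewrite mcoeffX]. Qed.

(** The forms ['X_[m] - r m] with [m] non-standard are free because each has its own non-standard
    monomial. They span because a member of [I], minus its combination of them, is supported on
    [std]. *)
Lemma standard_basis I d (std : seq 'X_{1..3}) (r : 'X_{1..3} -> S) : lin_closed I ->
  uniq std -> (forall m, m \in std -> mdeg m = d) ->
  (forall m, mdeg m = d -> m \notin std -> [/\ homog_of d (r m), I ('X_[m] - r m) &
     forall m', m' \notin std -> (r m)@_m' = 0]) ->
  (forall p, I p -> homog_of d p -> (forall m, m \notin std -> p@_m = 0) -> p = 0) ->
  exists s, basis_of I d s /\ size s = ('C(d.+2, 2) - size std)%N.
Proof.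
move=> [I0 ID IZ] ustd dstd hr hs.
pose ns := [seq m <- mons d | m \notin std].
have nsP m : m \in ns -> mdeg m = d /\ m \notin std.
  by rewrite mem_filter mem_mons => /andP[-> /eqP ->].
exists [seq 'X_[m] - r m | m <- ns]; split; last first.
  rewrite size_map size_filter -(size_mons) -(count_predC (mem std) (mons d)).
  rewrite -[in RHS](_ : count (mem std) (mons d) = size std) ?addKn //.
  rewrite -size_filter; apply: perm_size; apply: uniq_perm => //.
    by rewrite filter_uniq // uniq_mons.
  move=> m; rewrite mem_filter mem_mons /=; case: (boolP (m \in std)) => // h.
  by rewrite dstd ?eqxx.
apply/basis_ofP; split.
- move=> p /mapP[m /nsP[dm nm] ->]; have [hh Ih _] := hr m dm nm; split=> //.
  by apply: homogB => //; apply: homogX.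
- apply: free_triangular; first by rewrite filter_uniq // uniq_mons.
  move=> m m' /nsP[dm nm] /nsP[_ nm']; have [_ _ h] := hr m dm nm.
  by rewrite mcoeffB mcoeffX h // subr0.
move=> p Ip hp; set s := map _ _.
pose q := \sum_(m <- ns) p@_m *: ('X_[m] - r m).
have qs : spanS s q.
  rewrite /q big_seq; apply: spanS_sum => m mn; apply/spanSZ/spanS_mem.
  by apply/mapP; exists m.
suff -> : p = q by [].
have hq : I q /\ homog_of d q.
  rewrite /q big_seq; split.
    by apply: big_ind => // m /nsP[dm nm]; apply: IZ; case: (hr m dm nm).
  apply: homog_sum => m /nsP[dm nm]; apply/homogZ/homogB; first exact: homogX.
  by case: (hr m dm nm).
apply/eqP; rewrite -subr_eq0; apply/eqP; apply: hs.
- by rewrite -scaleN1r; apply: ID => //; apply: IZ; case: hq.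
- by apply: homogB => //; case: hq.
move=> m nm; case: (mdeg m =P d) => [dm|/eqP dm]; last first.
  by rewrite mcoeffB (homog_coef hp dm) (homog_coef (proj2 hq) dm) subrr.
rewrite mcoeffB /q raddf_sum /= (bigD1_seq m) /=; last 2 first.
- by rewrite mem_filter nm mem_mons dm eqxx.
- by rewrite filter_uniq // uniq_mons.
rewrite mcoeffZ mcoeffB mcoeffX eqxx; have [_ _ ->] := hr m dm nm; last by [].
rewrite subr0 mulr1 big_seq_cond big1 ?addr0 ?subrr // => m' /andP[/nsP[dm' nm'] ne].
rewrite mcoeffZ mcoeffB mcoeffX (negPf ne); have [_ _ ->] := hr m' dm' nm'; last by [].
by rewrite subr0 mulr0.
Qed.

Section Hpoint.
Variables (I : ideal_pred k) (HI : Hpt I).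

Lemma Hpt_hideal : is_hideal I. Proof. by case: HI. Qed.

Lemma Hpt_basis d : exists s, [/\ size s = hdim d, forall p, p \in s -> I p /\ homog_of d p, freeS s &
  forall p, I p -> homog_of d p -> spanS s p].
Proof. by case: HI => _ /(_ d)[s [/basis_ofP[? ? ?] ?]]; exists s. Qed.

Lemma Hpt_dep d s : (forall p, p \in s -> I p /\ homog_of d p) -> (hdim d < size s)%N -> ~ freeS s.
Proof.
have [t [st _ _ ht]] := Hpt_basis d; rewrite -st => hs.
by apply: steinitz_dep => p /hs[? ?]; apply: ht.
Qed.

Lemma Hpt_span d s : (forall p, p \in s -> I p /\ homog_of d p) -> (hdim d <= size s)%N -> freeS s ->
  forall p, I p -> homog_of d p -> spanS s p.
Proof.
have [t [st _ _ ht]] := Hpt_basis d; rewrite -st => hs sz fs p Ip hp.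
by apply: (steinitz_span sz _ fs) => [q /hs[? ?]|]; apply: ht.
Qed.

(** Otherwise a basis of [I_d] followed by [t] would be free and too long for [S_d]. *)
Lemma Hpt_relation d t : (forall p, p \in t -> homog_of d p) -> ('C(d.+2, 2) < hdim d + size t)%N ->
  exists c, I (lcomb c t) /\ exists2 i, (i < size t)%N & c i != 0.
Proof.
move=> ht sz; have [u [su hu fu _]] := Hpt_basis d.
apply: NNPP => hn; apply: (@steinitz_dep _ _ (u ++ t) [seq 'X_[m] | m <- mons d]).
- by move=> p; rewrite mem_cat => /orP[/hu[_ h]|/ht h]; apply: mons_span.
- by rewrite size_cat size_map (size_mons) su.
apply: freeS_cat => // c h i si; apply: NNPP => /eqP ci; apply: hn; exists c; split; last by exists i.
by case: h => c' ->; apply: (hi_lcomb Hpt_hideal) => p /hu[].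
Qed.

(** A basis of [I_d] followed by [t] spans [S_d] and is not longer than its dimension, which leaves
    no room for a relation. *)
Lemma Hpt_codim d t : (hdim d + size t <= 'C(d.+2, 2))%N ->
  (forall p, homog_of d p -> exists a, [/\ I a, homog_of d a & spanS t (p - a)]) ->
  forall c, I (lcomb c t) -> homog_of d (lcomb c t) -> forall i, (i < size t)%N -> c i = 0.
Proof.
move=> sz h c Ic hc i si; have [u [su hu fu hu']] := Hpt_basis d.
apply: (freeS_cat_inv (s := u) (t := t)) si; last exact: hu'.
apply: (@steinitz_free _ _ [seq 'X_[m] | m <- mons d]) (@mons_free d).
  by rewrite size_cat su size_map (size_mons).
move=> p /mapP[m]; rewrite mem_mons => /eqP dm ->.
have [a [Ia ha ta]] := h _ (homogX dm).
rewrite -(subrK a 'X_[m]) addrC; apply: spanSD.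
  by apply/spanS_catl/hu'.
exact: spanS_catr.
Qed.

End Hpoint.

Lemma Hpt_eq I J : Hpt I -> Hpt J -> (forall d p, homog_of d p -> I p -> J p) -> forall p, I p <-> J p.
Proof.
move=> HI HJ h; have IJ p : I p -> J p.
  move=> Ip; apply: (hi_homog (Hpt_hideal HJ)) => d.
  by apply: (h d); [exact: hcomp_homog|exact: (hihc (Hpt_hideal HI))].
move=> p; split; first exact: IJ.
move=> Jp; apply: (hi_homog (Hpt_hideal HI)) => d.
have [u [su hu fu _]] := Hpt_basis HI d.
have [||||c ->] := @Hpt_span J HJ d u _ _ fu (hcomp d p).
- by move=> q /hu[? ?]; split=> //; apply: IJ.
- by rewrite su.
- exact: (hihc (Hpt_hideal HJ)).
- exact: hcomp_homog.
by apply: (hi_lcomb (Hpt_hideal HI)) => q /hu[].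
Qed.

Lemma Hpt_low I : Hpt I -> forall d p, (d < 2)%N -> homog_of d p -> I p -> p = 0.
Proof.
move=> HI d p d2 hp Ip; have [u [su _ _ hu]] := Hpt_basis HI d.
move: su; rewrite /hdim d2 => /eqP; rewrite size_eq0 => /eqP u0.
by have := hu p Ip hp; rewrite u0 => /spanS_nil.
Qed.

Lemma hdim2 : hdim 2 = 2. Proof. by []. Qed.
Lemma hdim3 : hdim 3 = 6. Proof. by []. Qed.
Lemma hdim_ge4 d : (4 <= d)%N -> hdim d = ('C(d.+2, 2) - 3)%N.
Proof. by case: d => [|[|[|[|d]]]]. Qed.

Lemma bin2S d : 'C(d.+3, 2) = ('C(d.+2, 2) + d.+2)%N.
Proof. by rewrite binS bin1. Qed.

End Points.

(** * Comparison of the topology of all degrees with that of degrees at most 4 *)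

Section Link.
Variable k : closedFieldType.
Local Notation S := {mpoly k[3]}.
Implicit Types (p q : S) (I : ideal_pred k).

(** Points become subspaces of the polynomials of degree at most 4, of dimension [20 = 2 + 6 + 12],
    the sum of the dimensions in degrees 2, 3 and 4. *)
Definition N5 := #|{: 'X_{1..3 < 5}}|.
Definition rowpoly (v : 'rV[k]_N5) : S := \sum_j v 0 j *: 'X_[bmnm (enum_val j)].
Definition polyrow p : 'rV[k]_N5 := \row_j p@_(bmnm (enum_val j)).
Definition low p := forall m, (4 < mdeg m)%N -> p@_m = 0.

Lemma rowpoly_coef v (m : 'X_{1..3 < 5}) : (rowpoly v)@_m = v 0 (enum_rank m).
Proof.
rewrite /rowpoly raddf_sum /= (bigD1 (enum_rank m)) //= enum_rankK mcoeffZ mcoeffX eqxx mulr1.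
rewrite big1 ?addr0 // => j ne; rewrite mcoeffZ mcoeffX (inj_eq val_inj).
case: eqP => [e|]; last by rewrite mulr0.
by case/eqP: ne; rewrite -e enum_valK.
Qed.

Lemma low_rowpoly v : low (rowpoly v).
Proof.
move=> m h; rewrite /rowpoly raddf_sum /= big1 // => j _; rewrite mcoeffZ mcoeffX.
case: eqP => [e|]; last by rewrite mulr0.
by have := bmdeg (enum_val j); rewrite e ltnNge h.
Qed.

Lemma low_eq p q : low p -> low q -> (forall m : 'X_{1..3 < 5}, p@_m = q@_m) -> p = q.
Proof.
move=> lp lq h; apply/mpolyP => m; case: (ltnP (mdeg m) 5) => hm.
  exact: (h (BMultinom hm)).
by rewrite lp ?lq.
Qed.

Lemma rowpolyK v : polyrow (rowpoly v) = v.
Proof. by apply/rowP => j; rewrite mxE rowpoly_coef enum_valK. Qed.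

Lemma polyrowK p : low p -> rowpoly (polyrow p) = p.
Proof.
move=> lp; apply: low_eq => // [|m]; first exact: low_rowpoly.
by rewrite rowpoly_coef mxE enum_rankK.
Qed.

Lemma low_homog d p : (d <= 4)%N -> homog_of d p -> low p.
Proof. by move=> d4 hp m h; apply: (homog_coef hp); lia. Qed.

Lemma rowpolyD u v : rowpoly (u + v) = rowpoly u + rowpoly v.
Proof. by rewrite /rowpoly -big_split /=; apply: eq_bigr => j _; rewrite mxE scalerDl. Qed.

Lemma rowpolyZ a v : rowpoly (a *: v) = a *: rowpoly v.
Proof. by rewrite /rowpoly scaler_sumr; apply: eq_bigr => j _; rewrite mxE scalerA. Qed.

Lemma rowpoly0 : rowpoly 0 = 0.
Proof. by rewrite /rowpoly big1 // => j _; rewrite mxE scale0r. Qed.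

Lemma rowpoly_mul n (w : 'rV_n) (M : 'M_(n, N5)) : rowpoly (w *m M) = \sum_i w 0 i *: rowpoly (row i M).
Proof.
rewrite mulmx_sum_row (big_morph rowpoly rowpolyD rowpoly0).
by apply: eq_bigr => i _; rewrite rowpolyZ.
Qed.

Lemma low_basis_exists I : Hpt I -> exists M : 'M[k]_(20, N5),
  row_free M /\ forall v, I (rowpoly v) <-> exists w, v = w *m M.
Proof.
move=> HI; have hI := Hpt_hideal HI.
have [b2 [s2 h2 f2 p2]] := Hpt_basis HI 2; have [b3 [s3 h3 f3 p3]] := Hpt_basis HI 3.
have [b4 [s4 h4 f4 p4]] := Hpt_basis HI 4.
pose u := b2 ++ (b3 ++ b4).
have su : size u = 20 by rewrite !size_cat s2 s3 s4.
have hz d e p : d != e -> homog_of d p -> homog_of e p -> p = 0.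
  move=> de hd he; apply/mpolyP => m; rewrite mcoeff0; case: (mdeg m =P d) => [em|/eqP em].
    by apply: (homog_coef he); rewrite em.
  exact: (homog_coef hd).
have span_h d b p : (forall q, q \in b -> I q /\ homog_of d q) -> spanS b p -> homog_of d p.
  by move=> hb [c ->]; apply: homog_lcomb => q /hb[].
have f34 : freeS (b3 ++ b4).
  apply: freeS_cat => // c h i si; apply: f4 => //.
  by apply: (hz 3 4) => //; [apply: span_h h3 h|apply: span_h h4 _; eexists].
have fu : freeS u.
  apply: freeS_cat => // c h i si; apply: f34 => //.
  have hh := span_h _ _ _ h2 h.
  have /(congr1 (hcomp 2)) : lcomb c (b3 ++ b4) = lcomb c (b3 ++ b4) by [].
  rewrite {1}(hcomp_id hh) lcomb_cat hcompD => ->.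
  rewrite (@hcomp_ne _ 3 2) ?(@hcomp_ne _ 4 2) ?addr0 //; apply: homog_lcomb => q; by [case/h3|case/h4].
have uI p : p \in u -> I p by rewrite !mem_cat => /or3P[/h2[]|/h3[]|/h4[]].
have ulow p : p \in u -> low p.
  by rewrite !mem_cat => /or3P[/h2[_ h]|/h3[_ h]|/h4[_ h]]; apply: low_homog h.
have Iu p : I p -> low p -> spanS u p.
  move=> Ip lp; have sz : (msize p <= 5)%N.
    rewrite leqNgt; apply/negP => h; have p0 : p != 0 by apply: contraTneq h => ->; rewrite msize0.
    have h5 : (4 < mdeg (mlead p))%N by rewrite -ltnS mlead_deg.
    by have /eqP := lp _ h5; rewrite mleadc_eq0 (negPf p0).
  rewrite (hcomp_decomp sz); apply: spanS_sum => -[d hd] _ /=.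
  have Ihc : I (hcomp d p) by apply: (hihc hI).
  have hhc := @hcomp_homog k d p.
  case: d hd Ihc hhc => [|[|[|[|[|//]]]]] _ Ihc hhc.
  - by rewrite (Hpt_low HI _ hhc Ihc) //; apply: spanS0.
  - by rewrite (Hpt_low HI _ hhc Ihc) //; apply: spanS0.
  - by apply/spanS_catl/p2.
  - by apply/spanS_catr/spanS_catl/p3.
  - by apply/spanS_catr/spanS_catr/p4.
pose M : 'M[k]_(20, N5) := \matrix_(i < 20) polyrow u`_i.
have rM (i : 'I_20) : rowpoly (row i M) = u`_i.
  by rewrite rowK polyrowK //; apply: ulow; rewrite mem_nth // su.
have lM w : rowpoly (w *m M) = lcomb (row_coef w) u.
  rewrite rowpoly_mul /lcomb su; apply: eq_bigr => i _; by rewrite rM row_coefE.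
exists M; split=> [|v].
  apply/row_freeP; apply: NNPP => hn.
  have : kermx M != 0.
    apply: contra_notN hn => /eqP /(congr1 mxrank) e; apply/row_freeP.
    by move: e; rewrite mxrank_ker mxrank0 /row_free => /eqP; rewrite subn_eq0 eqn_leq rank_leq_row.
  case/rowV0Pn => w /sub_kermxP wM; case/eqP; apply: row_coef0 => i hi.
  by apply: fu; rewrite ?su // -lM wM rowpoly0.
split=> [Iv|[w ->]]; last by rewrite lM; apply: (hi_lcomb hI).
have [c hc] := Iu _ Iv (low_rowpoly v).
exists (\row_i c i); rewrite -[LHS]rowpolyK hc -[RHS]rowpolyK lM; congr polyrow.
apply: eq_bigr => -[i hi] _ /=; rewrite su in hi; rewrite /row_coef.
by case: insubP => [j _ <-|]; [rewrite mxE|rewrite hi].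
Qed.

(** Any basis will do, since [closedG] tests every [T *m lowbasis I]. *)
Definition lowbasis I : 'M[k]_(20, N5) :=
  epsilon (inhabits 0) (fun M => row_free M /\ forall v, I (rowpoly v) <-> exists w, v = w *m M).

Lemma lowbasisP I : Hpt I -> row_free (lowbasis I) /\
  forall v, I (rowpoly v) <-> exists w, v = w *m lowbasis I.
Proof. by move=> /low_basis_exists h; apply: (epsilon_spec _ _ h). Qed.

Lemma lowbasis_free I : Hpt I -> row_free (lowbasis I).
Proof. by case/lowbasisP. Qed.

Lemma lowbasis_rows I n (M : 'M_(n, N5)) : Hpt I ->
  (forall i, I (rowpoly (row i M))) <-> exists T, M = T *m lowbasis I.
Proof.
move=> /lowbasisP[_ h]; split=> [hM|[T ->] i]; last first.
  by apply/h; exists (row i T); rewrite row_mul.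
have ex i : {w | row i M = w *m lowbasis I}.
  by apply: constructive_indefinite_description; apply/h.
exists (\matrix_i sval (ex i)); apply/row_matrixP => i.
by rewrite row_mul rowK; exact: (svalP (ex i)).
Qed.

(** The ideal generated by [I_4], as the intersection of the ideals containing it; membership is
    thus an induction principle. *)
Definition gen4 I p := forall Q : S -> Prop, Q 0 -> (forall p q, Q p -> Q q -> Q (p + q)) ->
  (forall a p, Q p -> Q (a * p)) -> (forall b, I b -> homog_of 4 b -> Q b) -> Q p.

(* Points of the Hilbert scheme are determined by their components of degree at most 4. *)
Definition regular I := forall d p, (4 <= d)%N -> I p -> homog_of d p -> gen4 I p.

Lemma graded_basis_exists I : Hpt I -> exists b, graded_basis I b.
Proof.
move=> [_ h]; have ex d : {s | basis_of I d s}.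
  by apply: constructive_indefinite_description; have [s []] := h d; exists s.
by exists (fun d => sval (ex d)) => d; apply: svalP.
Qed.

Lemma basis_size I d s : Hpt I -> basis_of I d s -> size s = hdim d.
Proof.
move=> HI /basis_ofP[h1 h2 h3]; apply/eqP; rewrite eqn_leq; apply/andP; split; rewrite leqNgt; apply/negP => h.
  exact: (Hpt_dep HI h1 h).
have [t [st ht ft _]] := Hpt_basis HI d.
by apply: (@steinitz_dep _ _ t s) => // [q /ht[]|]; [apply: h3|rewrite st].
Qed.

Lemma lcomb_size n c (s : seq S) : size s = n -> lcomb c s = \sum_(i < n) c i *: s`_i.
Proof. by move=> <-. Qed.

Section Closed.
Variables (n : nat) (var : 'I_n -> nat * nat * 'X_{1..3}).

Definition coords (w : nat -> nat -> S) (j : 'I_n) : k := let: (d, i, m) := var j in (w d i)@_m.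

(** Arbitrary sequences in [I_d] in place of bases; the zeros from [hdim d] on match the default
    value of [nth]. *)
Definition tup I (w : nat -> nat -> S) := forall d i,
  [/\ I (w d i), homog_of d (w d i) & (hdim d <= i)%N -> w d i = 0].

Lemma coordsE (b : nat -> seq S) :
  (fun j => let: (d, i, m) := var j in (nth 0 (b d) i)@_m) = coords (fun d i => (b d)`_i).
Proof. by []. Qed.

(* An arbitrary tuple [w] is the limit at [s = 0] of the frames [w + s b]. *)
Lemma closed_tuples I (f : {mpoly k[n]}) w : Hpt I ->
  (forall b, graded_basis I b -> f.@[coords (fun d i => (b d)`_i)] = 0) ->
  tup I w -> f.@[coords w] = 0.
Proof.
move=> HI hf tw; have [b hb] := graded_basis_exists HI.
have sb d : size (b d) = hdim d by apply: basis_size (hb d).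
have exT d : {T : 'M[k]_(hdim d) | forall i : 'I_(hdim d), w d i = \sum_j T i j *: (b d)`_j}.
  apply: constructive_indefinite_description.
  have /basis_ofP[_ _ hs] := hb d.
  have ex (i : 'I_(hdim d)) : {c | w d i = lcomb c (b d)}.
    by apply: constructive_indefinite_description; apply: hs; case: (tw d i).
  exists (\matrix_(i, j) sval (ex i) j) => i; rewrite [LHS](svalP (ex i)) (lcomb_size _ (sb d)).
  by apply: eq_bigr => j _; rewrite mxE.
pose T d := sval (exT d).
(* Where [e] is nonzero, [T d + s] is invertible in each of the finitely many degrees occurring in
   [var], so [w + s b] is a basis there; [bs] falls back on [b] in the other degrees. *)
pose e : {poly k} := \prod_(j < n) char_poly (- T (var j).1.1).
have e0 : e != 0 by apply/prodf_neq0 => j _; apply/monic_neq0/char_poly_monic.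
have detT d s : (char_poly (- T d)).[s] = \det (T d + s%:M).
  rewrite -[_.[s]]/(horner_eval s _) /char_poly -det_map_mx; congr (\det _).
  apply/matrixP => i j; rewrite !mxE -[LHS]/(horner_eval s _) /horner_eval.
  by rewrite hornerD hornerN hornerMn hornerX hornerC opprK addrC.
pose fr s d := mkseq (fun i => w d i + s *: (b d)`_i) (hdim d).
have frE s d i : (fr s d)`_i = w d i + s *: (b d)`_i.
  case: (ltnP i (hdim d)) => h; first by rewrite nth_mkseq.
  by rewrite nth_default ?size_mkseq // nth_default ?sb //; case: (tw d i) => _ _ ->; rewrite // scaler0 addr0.
have frB s d : \det (T d + s%:M) != 0 -> basis_of I d (fr s d).
  move=> dn; have /basis_ofP[hb1 hb2 hb3] := hb d.
  have hfr q : q \in fr s d -> I q /\ homog_of d q.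
    move/(nthP 0) => [i]; rewrite size_mkseq => hi <-; rewrite frE; case: (tw d i) => Iw hw _.
    have /hb1[Ib hbi] : (b d)`_i \in b d by rewrite mem_nth ?sb.
    by split; [apply: (hiD (Hpt_hideal HI)) => //; apply: (hiZ (Hpt_hideal HI))|apply: homogD => //; apply: homogZ].
  have ffr : freeS (fr s d).
    move=> c; pose cr : 'rV_(hdim d) := \row_i c i.
    have -> : lcomb c (fr s d) = lcomb (row_coef (cr *m (T d + s%:M))) (b d).
      rewrite /lcomb size_mkseq sb.
      transitivity (\sum_(i < hdim d) \sum_(j < hdim d) (c i * (T d + s%:M) i j) *: (b d)`_j).
        apply: eq_bigr => i _; rewrite frE (svalP (exT d)) -/(T d).
        under [RHS]eq_bigr do rewrite -scalerA.
        rewrite -scaler_sumr; congr (_ *: _).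
        rewrite [X in _ + X = _](_ : _ = \sum_j (s%:M i j : k) *: (b d)`_j).
          by rewrite -big_split /=; apply: eq_bigr => j _; rewrite [in RHS]mxE scalerDl.
        rewrite (bigD1 i) //= mxE eqxx mulr1n big1 ?addr0 // => j /negPf ne.
        by rewrite mxE eq_sym ne mulr0n scale0r.
      rewrite exchange_big /=; apply: eq_bigr => j _; rewrite row_coefE mxE scaler_suml.
      by apply: eq_bigr => i _; rewrite !mxE.
    move=> /hb2 h0; have {h0} /(congr1 (mulmx^~ (invmx (T d + s%:M)))) : cr *m (T d + s%:M) = 0.
      by apply: row_coef0 => i hi; apply: h0; rewrite sb.
    rewrite mulmxK ?unitmxE ?unitfE // mul0mx => cr0 i; rewrite size_mkseq => hi.
    by have := congr1 (fun R : 'rV_(hdim d) => R 0 (Ordinal hi)) cr0; rewrite !mxE.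
  apply/basis_ofP; split=> // p Ip hp.
  by apply: (Hpt_span HI hfr) => //; rewrite size_mkseq.
have pP : pfun line_co (fun s => f.@[coords (fun d i => w d i + s *: (b d)`_i)]).
  apply: (pf_comp (co' := vec_co n) (h := fun s => coords (fun d i => w d i + s *: (b d)`_i))
     (f := fun t => f.@[t])); last exact: mpoly_pf.
  move=> j; rewrite /vec_co /coords; case: (var j) => [[d i] m].
  apply: pf_ext (_ : pfun line_co (fun s => (w d i)@_m + s * ((b d)`_i)@_m)) _ => [|s].
    by apply: pf_add; [apply: pf_const|apply: pf_mul; [apply: (pf_coord line_co tt)|apply: pf_const]].
  by rewrite mcoeffD mcoeffZ.
have [P hP] := pf_poly pP.
have -> : f.@[coords w] = P.[0].
  rewrite -hP; congr (f.@[coords _]).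
  by do 2!apply: functional_extensionality => ?; rewrite scale0r addr0.
rewrite (poly_eq0_dense e0 (P := P)) ?horner0 // => s; rewrite horner_prod => /prodf_neq0 es.
pose bs d := if \det (T d + s%:M) != 0 then fr s d else b d.
have hbs : graded_basis I bs by move=> d; rewrite /bs; case: ifP => [/frB|_] //.
rewrite -hP -(hf bs hbs); congr (f.@[_]); apply: functional_extensionality => j.
rewrite /coords; case E: (var j) => [[d i] m]; rewrite /bs -detT.
by have := es j isT; rewrite E /= => ->; rewrite frE.
Qed.

End Closed.

Hypothesis all_regular : forall I, Hpt I -> regular I.

Lemma generated I d p : Hpt I -> I p -> homog_of d p ->
  exists A : 'I_20 -> S, p = \sum_l A l * rowpoly (row l (lowbasis I)).
Proof.
move=> HI Ip hp; have [_ hB] := lowbasisP HI.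
have lowgen q : I q -> low q -> exists A : 'I_20 -> S, q = \sum_l A l * rowpoly (row l (lowbasis I)).
  move=> Iq lq; have /hB[w e] : I (rowpoly (polyrow q)) by rewrite polyrowK.
  exists (fun l => (w 0 l)%:MP); rewrite -(polyrowK lq) e rowpoly_mul.
  by apply: eq_bigr => l _; rewrite mul_mpolyC.
case: (leqP d 4) => d4; first by apply: lowgen => //; apply: low_homog hp.
apply: (all_regular HI (ltnW d4) Ip hp (Q := fun q => exists A : 'I_20 -> S, q = \sum_l A l * rowpoly (row l (lowbasis I)))).
- by exists (fun=> 0); rewrite big1 // => l _; rewrite mul0r.
- move=> q1 q2 [A1 ->] [A2 ->]; exists (fun l => A1 l + A2 l); rewrite -big_split /=.
  by apply: eq_bigr => l _; rewrite mulrDl.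
- move=> a q [A ->]; exists (fun l => a * A l); rewrite mulr_sumr.
  by apply: eq_bigr => l _; rewrite mulrA.
- by move=> b Ib hb; apply: lowgen => //; apply: low_homog hb.
Qed.

Lemma pf_mpoly_mulL (A T : Type) (co : T -> A -> k) (q : S) (F : A -> S) m :
  (forall m, pfun co (fun a => (F a)@_m)) -> pfun co (fun a => (q * F a)@_m).
Proof.
move=> pF; apply: pf_ext (_ : pfun co (fun a =>
  \sum_(kk : 'X_{1..3 < (mdeg m).+1, (mdeg m).+1} | m == (kk.1 + kk.2)%MM) q@_kk.1 * (F a)@_kk.2)) _.
  by apply: pf_sum => kk _; apply: pf_mul; [apply: pf_const|apply: pF].
by move=> a; rewrite mcoeffM.
Qed.

Lemma pf_rowpoly (A T : Type) (co : T -> A -> k) (M : A -> 'rV[k]_N5) m :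
  (forall j, pfun co (fun a => M a 0 j)) -> pfun co (fun a => (rowpoly (M a))@_m).
Proof.
move=> pM; apply: pf_ext (_ : pfun co (fun a => \sum_j M a 0 j * ('X_[bmnm (enum_val j)] : S)@_m)) _ => [|a].
  by apply: pf_sum => j _; apply: pf_mul => //; apply: pf_const.
by rewrite /rowpoly raddf_sum /=; apply: eq_bigr => j _; rewrite mcoeffZ.
Qed.

(** By regularity every element of [I_d] is a combination of the low basis with polynomial
    coefficients [A]. For fixed [A] the coordinates are polynomial functions of the low basis, and
    any choice of [A] gives a tuple in [I], to which [closed_tuples] applies. *)
Lemma closedH_closedG (C : subH k) : closedH C -> closedG (@Hpt k) lowbasis C.
Proof.
move=> [CH [n [var [F hC]]]].
pose w (A : nat -> nat -> 'I_20 -> S) (M : 'M[k]_(20, N5)) d i :=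
  if (i < hdim d)%N then hcomp d (\sum_l A d i l * rowpoly (row l M)) else 0.
exists (fun g => exists f A, F f /\ g = fun M => f.@[coords var (w A M)]); split.
  move=> _ [f [A [_ ->]]].
  apply: (pf_comp (co' := vec_co n) (h := fun M => coords var (w A M)) (f := fun t => f.@[t])); last exact: mpoly_pf.
  move=> j; rewrite /vec_co /coords /w; case: (var j) => [[d i] m].
  case: (i < hdim d)%N; last by apply: pf_ext (pf_const _ 0) _ => M; rewrite mcoeff0.
  case e: (mdeg m == d); last by apply: pf_ext (pf_const _ 0) _ => M; rewrite mcoeff_hcomp e.
  apply: pf_ext (_ : pfun _ (fun M => \sum_l (A d i l * rowpoly (row l M))@_m)) _ => [|M]; last first.
    by rewrite mcoeff_hcomp e raddf_sum.
  apply: pf_sum => l _; apply: pf_mpoly_mulL => m'; apply: pf_rowpoly => j'.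
  by apply: pf_ext (pf_coord _ (l, j')) _ => M; rewrite mxE.
move=> I; rewrite hC; split=> -[HI h]; split=> //.
  move=> _ [f [A [Ff ->]]] T; apply: (closed_tuples HI); first by move=> b hb; apply: h.
  move=> d i; rewrite /w; case: ltnP => hi; last by split=> //; [apply: (hi0 (Hpt_hideal HI))|apply: homog0].
  split=> //; last exact: hcomp_homog.
  apply: (hihc (Hpt_hideal HI)); apply: (hi_sum (Hpt_hideal HI)) => l _; apply: (hiM (Hpt_hideal HI)).
  by move: l; apply/(lowbasis_rows _ HI); exists T.
move=> b hb f Ff.
have ex d i : {A : 'I_20 -> S | (b d)`_i = \sum_l A l * rowpoly (row l (lowbasis I))}.
  apply: constructive_indefinite_description; have /basis_ofP[h1 _ _] := hb d.
  case: (ltnP i (size (b d))) => hi; last first.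
    exists (fun=> 0); rewrite nth_default // big1 // => l _; by rewrite mul0r.
  by have [Ib hbi] := h1 _ (mem_nth 0 hi); apply: generated hbi.
have := h (fun M => f.@[coords var (w (fun d i => sval (ex d i)) M)]) _ 1%:M.
rewrite mul1mx => <-; last by exists f, (fun d i => sval (ex d i)).
congr (f.@[_]); apply: functional_extensionality => j; rewrite /coords; case: (var j) => [[d i] m].
congr (_@_m); rewrite /w; have sb := basis_size HI (hb d).
case: ltnP => hi; last by rewrite nth_default ?sb.
rewrite -(svalP (ex d i)) hcomp_id //; have /basis_ofP[h1 _ _] := hb d.
by have [] := h1 _ (mem_nth 0 (_ : (i < size (b d))%N)); rewrite ?sb.
Qed.

(** The rows of [T *m lowbasis I] are combinations, with constant coefficients [c], of the bases in
    the five degrees below 5. None of these bases has more than 12 elements, the size in degree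
    4. *)
Lemma closedG_closedH (C : subH k) : closedG (@Hpt k) lowbasis C -> closedH C.
Proof.
move=> [G [pG hC]]; split; first by move=> I /hC[].
pose T0 : finType := ('I_5 * 'I_12 * 'X_{1..3 < 5})%type.
pose var (j : 'I_#|T0|) : nat * nat * 'X_{1..3} :=
  let: (d, i, m) := enum_val j in (val d, val i, val m).
pose Mc (c : 'I_20 -> 'I_5 -> 'I_12 -> k) (v : 'I_#|T0| -> k) : 'M[k]_(20, N5) :=
  \matrix_(l, j) \sum_d \sum_i c l d i * v (enum_rank (d, i, enum_val j)).
exists #|T0|, var, (fun f => exists g c, G g /\ forall v, f.@[v] = g (Mc c v)) => I.
have McE c b l : graded_basis I b -> rowpoly (row l (Mc c (coords var (fun d i => (b d)`_i)))) =
    \sum_d \sum_i c l d i *: (b d)`_i.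
  move=> hb; apply: low_eq; first exact: low_rowpoly.
    move=> m h; rewrite raddf_sum big1 // => d _; rewrite raddf_sum big1 // => i _ /=.
    rewrite mcoeffZ; case: (ltnP i (size (b d))) => hi; last by rewrite nth_default // mcoeff0 mulr0.
    have /basis_ofP[h1 _ _] := hb d; have [_ hbi] := h1 _ (mem_nth 0 hi).
    by rewrite (homog_coef hbi) ?mulr0 //; have := ltn_ord d; lia.
  move=> m; rewrite rowpoly_coef !mxE raddf_sum; apply: eq_bigr => d _.
  rewrite raddf_sum; apply: eq_bigr => i _ /=; rewrite mcoeffZ; congr (_ * _).
  by rewrite /coords /var !enum_rankK.
split=> [/hC[HI h]|[HI h]].
  split=> // b hb f [g [c [Gg hf]]]; rewrite hf.
  have [T eT] : exists T, Mc c (coords var (fun d i => (b d)`_i)) = T *m lowbasis I.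
    apply/(lowbasis_rows _ HI) => l; rewrite McE //.
    apply: (hi_sum (Hpt_hideal HI)) => d _; apply: (hi_sum (Hpt_hideal HI)) => i _.
    apply: (hiZ (Hpt_hideal HI)); case: (ltnP i (size (b d))) => hi.
      have /basis_ofP[h1 _ _] := hb d; by have [] := h1 _ (mem_nth 0 hi).
    by rewrite nth_default //; apply: (hi0 (Hpt_hideal HI)).
  by rewrite coordsE eT; apply: h.
apply/hC; split=> // g Gg T; have [b hb] := graded_basis_exists HI.
have ex l d : {c : 'I_12 -> k | hcomp d (rowpoly (row l (T *m lowbasis I))) = \sum_i c i *: (b d)`_i} + {~~ (d < 5)%N}.
  case: (boolP (d < 5)%N) => hd; [left|by right].
  apply: constructive_indefinite_description; have /basis_ofP[h1 h2 h3] := hb d.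
  have [||c ->] := h3 (hcomp d (rowpoly (row l (T *m lowbasis I)))).
  - apply: (hihc (Hpt_hideal HI)); move: l; apply/(lowbasis_rows _ HI); by exists T.
  - exact: hcomp_homog.
  exists (fun i => if (i < size (b d))%N then c i else 0).
  have sz : (size (b d) <= 12)%N by rewrite (basis_size HI (hb d)); case: (d) hd => [|[|[|[|[|//]]]]].
  rewrite /lcomb (big_ord_widen 12 (fun i => c i *: (b d)`_i)) // [LHS]big_mkcond /=.
  by apply: eq_bigr => i _; case: ifP; rewrite // scale0r.
pose c l (d : 'I_5) i := if ex l d is inleft s then sval s i else 0.
have [f hf] : exists f : {mpoly k[#|T0|]}, forall v, g (Mc c v) = f.@[v].
  apply: pf_mpoly; apply: (pf_comp (co' := mx_co 20 N5) (h := Mc c)) (pG g Gg) => -[l j].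
  apply: pf_ext (_ : pfun _ (fun v => \sum_d \sum_i c l d i * v (enum_rank (d, i, enum_val j)))) _.
    apply: pf_sum => d _; apply: pf_sum => i _; apply: pf_mul; first exact: pf_const.
    exact: (pf_coord (vec_co _) _).
  by move=> v; rewrite /mx_co mxE.
have := h b hb f (ex_intro _ g (ex_intro _ c (conj Gg (fun v => esym (hf v))))).
rewrite -hf => <-.
congr g; apply/row_matrixP => l; rewrite -[LHS]rowpolyK -[RHS]rowpolyK; congr polyrow.
rewrite coordsE McE //; apply: low_eq; first exact: low_rowpoly.
  move=> m hm; rewrite raddf_sum big1 // => d _; rewrite raddf_sum big1 // => i _ /=.
  rewrite mcoeffZ; case: (ltnP i (size (b d))) => hi; last by rewrite nth_default // mcoeff0 mulr0.
  have /basis_ofP[h1 _ _] := hb d; have [_ hbi] := h1 _ (mem_nth 0 hi).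
  by rewrite (homog_coef hbi) ?mulr0 //; have := ltn_ord d; lia.
move=> m; rewrite [RHS]raddf_sum (bigD1 (Ordinal (bmdeg m))) //= [X in _ + X]big1 ?addr0; last first.
  move=> d ne; rewrite raddf_sum big1 // => i _ /=; rewrite mcoeffZ.
  case: (ltnP i (size (b d))) => hi; last by rewrite nth_default // mcoeff0 mulr0.
  have /basis_ofP[h1 _ _] := hb d; have [_ hbi] := h1 _ (mem_nth 0 hi).
  rewrite (homog_coef hbi) ?mulr0 //; apply: contra ne => /eqP e; apply/eqP/val_inj.
  by rewrite /= e.
rewrite /c /=; case: (ex l _) => [[c' hc'] /=|]; last by rewrite /= bmdeg.
by rewrite -hc' mcoeff_hcomp eqxx.
Qed.

End Link.

(** * Polynomial sections of families of ideals *)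

Section Sections.
Variable k : closedFieldType.
Local Notation S := {mpoly k[3]}.
Implicit Types (p q : S) (I : ideal_pred k).
Local Notation liftable := (@liftable k 20 N5 (ideal_pred k) (@lowbasis k)).

Section OneFamily.
Variables (A T : Type) (co : T -> A -> k).

Definition psec (F : A -> S) := forall m, pfun co (fun a => (F a)@_m).

Lemma psec_const p : psec (fun=> p).
Proof. by move=> m; apply: pf_const. Qed.

Lemma psecD F G : psec F -> psec G -> psec (fun a => F a + G a).
Proof. by move=> pF pG m; apply: pf_ext (pf_add (pF m) (pG m)) _ => a; rewrite mcoeffD. Qed.

Lemma psecZ f F : pfun co f -> psec F -> psec (fun a => f a *: F a).
Proof. by move=> pf pF m; apply: pf_ext (pf_mul pf (pF m)) _ => a; rewrite mcoeffZ. Qed.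

Lemma psecN F : psec F -> psec (fun a => - F a).
Proof. by move=> pF m; apply: pf_ext (pf_opp (pF m)) _ => a; rewrite mcoeffN. Qed.

Lemma psecB F G : psec F -> psec G -> psec (fun a => F a - G a).
Proof. by move=> pF pG; apply: psecD => //; apply: psecN. Qed.

Lemma psecM F G : psec F -> psec G -> psec (fun a => F a * G a).
Proof.
move=> pF pG m; apply: pf_ext (_ : pfun co (fun a =>
  \sum_(kk : 'X_{1..3 < (mdeg m).+1, (mdeg m).+1} | m == (kk.1 + kk.2)%MM) (F a)@_kk.1 * (G a)@_kk.2)) _.
  by apply: pf_sum => kk _; apply: pf_mul; [apply: pF|apply: pG].
by move=> a; rewrite mcoeffM.
Qed.

Lemma psecX F n : psec F -> psec (fun a => F a ^+ n).
Proof.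
move=> pF; elim: n => [|n IH] m.
  by apply: pf_ext (psec_const 1 m) _ => a; rewrite expr0.
by apply: pf_ext (psecM pF IH m) _ => a; rewrite exprS.
Qed.

Lemma psec_sum (J : Type) (r : seq J) (P : pred J) (F : J -> A -> S) :
  (forall i, P i -> psec (F i)) -> psec (fun a => \sum_(i <- r | P i) F i a).
Proof.
move=> pF m; apply: pf_ext (_ : pfun co (fun a => \sum_(i <- r | P i) (F i a)@_m)) _ => [|a].
  by apply: pf_sum => i Pi; apply: pF.
by rewrite raddf_sum.
Qed.

Lemma psec_prod (J : Type) (r : seq J) (F : J -> A -> S) :
  (forall i, psec (F i)) -> psec (fun a => \prod_(i <- r) F i a).
Proof.
move=> pF; elim: r => [|i r IH] m.
  by apply: pf_ext (psec_const 1 m) _ => a; rewrite big_nil.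
by apply: pf_ext (psecM (pF i) IH m) _ => a; rewrite big_cons.
Qed.

Lemma psec_ext F G : psec F -> F =1 G -> psec G.
Proof. by move=> pF /functional_extensionality <-. Qed.

Lemma psec_hcomp d F : psec F -> psec (fun a => hcomp d (F a)).
Proof.
move=> pF m; case e: (mdeg m == d).
  by apply: pf_ext (pF m) _ => a; rewrite mcoeff_hcomp e.
by apply: pf_ext (pf_const _ 0) _ => a; rewrite mcoeff_hcomp e.
Qed.

Variables (ok : A -> Prop) (fam : A -> ideal_pred k).

(** The base parameter [a0] need not satisfy [ok], so [p] may belong to a limit of the ideals
    [fam a]. *)
Definition lifts a0 p := exists F, [/\ psec F, F a0 = p & forall a, ok a -> fam a (F a)].

Hypothesis fam_ideal : forall a, ok a -> is_hideal (fam a).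

Lemma lifts_gen a0 F : psec F -> (forall a, ok a -> fam a (F a)) -> lifts a0 (F a0).
Proof. by move=> pF h; exists F. Qed.

Lemma lifts0 a0 : lifts a0 0.
Proof. by exists (fun=> 0); split=> [|//|a /fam_ideal/hi0]; first exact: psec_const. Qed.

Lemma liftsD a0 p q : lifts a0 p -> lifts a0 q -> lifts a0 (p + q).
Proof.
move=> [F [pF <- hF]] [G [pG <- hG]]; exists (fun a => F a + G a).
by split=> // [|a oka]; [apply: psecD|apply: hiD; [exact: fam_ideal|exact: hF|exact: hG]].
Qed.

Lemma liftsM a0 p q : lifts a0 q -> lifts a0 (p * q).
Proof.
move=> [F [pF <- hF]]; exists (fun a => p * F a).
by split=> // [|a oka]; [apply: psecM => //; apply: psec_const|apply: hiM; [exact: fam_ideal|exact: hF]].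
Qed.

Lemma liftsZ a0 c q : lifts a0 q -> lifts a0 (c *: q).
Proof. by rewrite -mul_mpolyC; apply: liftsM. Qed.

Lemma lifts_lcomb a0 c s : (forall p, p \in s -> lifts a0 p) -> lifts a0 (lcomb c s).
Proof. by apply: lcomb_closed; [exact: lifts0|exact: liftsD|move=> *; exact: liftsZ]. Qed.

Lemma rowpoly_trunc p : rowpoly (polyrow p) = \sum_(d < 5) hcomp d p.
Proof.
apply: low_eq => [||m]; first exact: low_rowpoly.
  move=> m h; rewrite raddf_sum big1 // => d _ /=; rewrite mcoeff_hcomp.
  by case: eqP => // e; have := ltn_ord d; rewrite -e ltnNge h.
rewrite rowpoly_coef mxE enum_rankK raddf_sum (bigD1 (Ordinal (bmdeg m))) //=.
rewrite mcoeff_hcomp eqxx big1 ?addr0 // => d ne; rewrite mcoeff_hcomp; case: eqP => // e.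
by case/eqP: ne; apply: val_inj; rewrite /= e.
Qed.

Lemma lifts_liftable a0 I : (forall a, ok a -> Hpt (fam a)) -> Hpt I ->
  (forall d p, (d <= 4)%N -> I p -> homog_of d p -> lifts a0 p) -> liftable co ok fam a0 I.
Proof.
move=> famH HI h.
have lI p : I p -> low p -> lifts a0 p.
  move=> Ip lp; rewrite -(polyrowK lp) rowpoly_trunc.
  apply: big_ind => [|*|d _]; [exact: lifts0|exact: liftsD|].
  by apply: (h d); [rewrite -ltnS|apply: hihc => //; exact: Hpt_hideal|exact: hcomp_homog].
have BI : forall i, I (rowpoly (row i (lowbasis I))).
  by apply/(lowbasis_rows _ HI); exists 1%:M; rewrite mul1mx.
have ex i : {F | [/\ psec F, F a0 = rowpoly (row i (lowbasis I)) & forall a, ok a -> fam a (F a)]}.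
  apply: constructive_indefinite_description; apply: lI => //; exact: low_rowpoly.
exists (fun a => \matrix_i polyrow (sval (ex i) a)); split=> [i j||a oka].
- have [pF _ _] := svalP (ex i).
  by apply: pf_ext (pF (bmnm (enum_val j))) _ => a; rewrite !mxE.
- apply/row_matrixP => i; rewrite rowK; have [_ -> _] := svalP (ex i).
  by rewrite rowpolyK.
apply/(lowbasis_rows _ (famH a oka)) => i; rewrite rowK rowpoly_trunc.
have hI := Hpt_hideal (famH a oka).
by apply: (hi_sum hI) => d _; apply: (hihc hI); have [_ _] := svalP (ex i); apply.
Qed.

End OneFamily.

End Sections.

(** * Linear changes of coordinates *)

Section LinearAction.
Variable k : closedFieldType.
Local Notation S := {mpoly k[3]}.
Implicit Types (p q : S) (I : ideal_pred k) (M : 'M[k]_3).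
Local Notation closedG := (@closedG k 20 N5 (ideal_pred k) (@Hpt k) (@lowbasis k)).
Local Notation cl := (@cl k 20 N5 (ideal_pred k) (@Hpt k) (@lowbasis k)).

Definition linrow (u : 'rV[k]_3) : S := \sum_j u 0 j *: 'X_j.
Definition subst M p : S := p \mPo [tuple linrow (row i M) | i < 3].

HB.instance Definition _ M := GRing.RMorphism.copy (subst M) (comp_mpoly [tuple linrow (row i M) | i < 3]).

Lemma substZ M a p : subst M (a *: p) = a *: subst M p.
Proof. exact: comp_mpolyZ. Qed.

Lemma substX M i : subst M 'X_i = linrow (row i M).
Proof. by rewrite /subst comp_mpolyXU -tnth_nth tnth_mktuple. Qed.

Lemma substC M a : subst M a%:MP = a%:MP.
Proof. exact: comp_mpolyC. Qed.

Lemma subst_lin M u : subst M (linrow u) = linrow (u *m M).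
Proof.
rewrite /linrow rmorph_sum /=.
under eq_bigr do rewrite substZ substX /linrow scaler_sumr.
rewrite exchange_big /=; apply: eq_bigr => j _; rewrite mxE scaler_suml.
by apply: eq_bigr => i _; rewrite !mxE scalerA.
Qed.

Lemma subst_ext (f g : {rmorphism S -> S}) : (forall a, f a%:MP = g a%:MP) ->
  (forall i, f 'X_i = g 'X_i) -> f =1 g.
Proof.
move=> hC hX p; rewrite [p]mpolyE !rmorph_sum; apply: eq_bigr => m _.
rewrite -mul_mpolyC !rmorphM /= hC; congr (_ * _).
rewrite mpolyXE_id !rmorph_prod; apply: eq_bigr => i _; by rewrite !rmorphXn /= hX.
Qed.

Lemma subst_comp M M' p : subst M' (subst M p) = subst (M *m M') p.
Proof.
rewrite -[LHS]/((subst M' \o subst M) p); apply: subst_ext => [a|i] /=; first by rewrite !substC.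
by rewrite !substX subst_lin row_mul.
Qed.

Lemma linrow_delta i : linrow (row i 1%:M) = 'X_i.
Proof.
rewrite /linrow (bigD1 i) //= !mxE eqxx scale1r big1 ?addr0 // => j ne.
by rewrite !mxE eq_sym (negPf ne) scale0r.
Qed.

Lemma subst1 p : subst 1%:M p = p.
Proof.
rewrite -[RHS]/(idfun p); apply: subst_ext => [a|i] /=; first by rewrite substC.
by rewrite substX linrow_delta.
Qed.

Lemma substK M p : M \in unitmx -> subst (invmx M) (subst M p) = p.
Proof. by move=> u; rewrite subst_comp mulmxV // subst1. Qed.
Lemma substVK M p : M \in unitmx -> subst M (subst (invmx M) p) = p.
Proof. by move=> u; rewrite subst_comp mulVmx // subst1. Qed.

Lemma homog_linrow u : homog_of 1 (linrow u).
Proof. by apply: homog_sum => j _; apply: homogZ; apply: homogX; rewrite mdeg1. Qed.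

Lemma homog_exp d n p : homog_of d p -> homog_of (d * n) (p ^+ n).
Proof.
move=> hp; elim: n => [|n IH]; first by rewrite muln0 expr0 -mpolyX0; apply: homogX; rewrite mdeg0.
by rewrite exprS mulnS; apply: homogM.
Qed.

Lemma homog_subst d M p : homog_of d p -> homog_of d (subst M p).
Proof.
move=> hp; rewrite [p]mpolyE rmorph_sum big_seq /=; apply: homog_sum => m mp.
rewrite substZ; apply: homogZ; have <- : mdeg m = d by apply: hp.
rewrite mpolyXE_id rmorph_prod mdegE /=.
apply: (big_ind2 (fun p n => homog_of n p)) => [|p1 n1 p2 n2|i _].
- by rewrite -mpolyX0; apply: homogX; rewrite mdeg0.
- exact: homogM.
rewrite rmorphXn /= substX -[X in homog_of X _]mul1n.
by apply: homog_exp; apply: homog_linrow.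
Qed.

Lemma hcomp_subst d M p : hcomp d (subst M p) = subst M (hcomp d p).
Proof.
rewrite {1}(hcomp_decomp (leqnn (msize p))) rmorph_sum hcomp_sum /=.
case: (ltnP d (msize p)) => h.
  rewrite (bigD1 (Ordinal h)) //= hcomp_id ?big1 ?addr0 //; last by apply/homog_subst/hcomp_homog.
  move=> i ne; apply: (@hcomp_ne _ i); first by apply/homog_subst/hcomp_homog.
  by apply: contra ne => /eqP e; apply/eqP/val_inj.
have -> : hcomp d p = 0.
  apply/mpolyP => m; rewrite mcoeff_hcomp mcoeff0; case: eqP => // e.
  by apply: memN_msupp_eq0; apply: contraTN h => /msize_mdeg_lt; rewrite -ltnNge e.
rewrite rmorph0 big1 // => i _; apply: (@hcomp_ne _ i); first by apply/homog_subst/hcomp_homog.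
by rewrite neq_ltn (leq_trans (ltn_ord i) h).
Qed.

Definition act M I : ideal_pred k := fun p => exists2 r, I r & p = subst M r.

Lemma actP M I p : M \in unitmx -> act M I p <-> I (subst (invmx M) p).
Proof.
by move=> u; split=> [[r Ir ->]|h]; [rewrite substK|exists (subst (invmx M) p); rewrite ?substVK].
Qed.

Lemma act_mem M I p : I p -> act M I (subst M p).
Proof. by move=> Ip; exists p. Qed.

Lemma ideal_ext I J : (forall p, I p <-> J p) -> I = J.
Proof. by move=> h; apply: functional_extensionality => p; apply/propositional_extensionality/h. Qed.

Lemma act_comp M M' I : act M' (act M I) = act (M *m M') I.
Proof.
apply: ideal_ext => p; split=> [[_ [r Ir ->] ->]|[r Ir ->]].
  by exists r => //; rewrite subst_comp.
by exists (subst M r); [exists r|rewrite subst_comp].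
Qed.

Lemma act1 I : act 1%:M I = I.
Proof. by apply: ideal_ext => p; split=> [[r Ir ->]|Ip]; [rewrite subst1|exists p; rewrite ?subst1]. Qed.

Lemma actK M I : M \in unitmx -> act (invmx M) (act M I) = I.
Proof. by move=> u; rewrite act_comp mulmxV // act1. Qed.
Lemma actVK M I : M \in unitmx -> act M (act (invmx M) I) = I.
Proof. by move=> u; rewrite act_comp mulVmx // act1. Qed.

Lemma lcomb_subst M c s : subst M (lcomb c s) = lcomb c (map (subst M) s).
Proof.
rewrite /lcomb size_map rmorph_sum; apply: eq_bigr => i _ /=.
by rewrite substZ (nth_map 0).
Qed.

Lemma free_subst M s : M \in unitmx -> freeS s -> freeS (map (subst M) s).
Proof.
move=> u fs c; rewrite -lcomb_subst size_map => /(congr1 (subst (invmx M))).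
by rewrite substK // rmorph0; apply: fs.
Qed.

Lemma Hpt_act M I : M \in unitmx -> Hpt I -> Hpt (act M I).
Proof.
move=> u [hI hb]; split.
  split.
  - by exists 0; rewrite ?rmorph0 //; apply: hi0.
  - by move=> p q [r Ir ->] [r' Ir' ->]; exists (r + r'); rewrite ?rmorphD //; apply: hiD.
  - by move=> p q /(actP _ _ u) h; apply/(actP _ _ u); rewrite rmorphM; apply: hiM.
  - by move=> d p [r Ir ->]; rewrite hcomp_subst; apply: act_mem; exact: (hihc hI).
move=> d; have [s [/basis_ofP[h1 h2 h3] ss]] := hb d.
exists (map (subst M) s); split; last by rewrite size_map.
apply/basis_ofP; split.
- by move=> p /mapP[q /h1[Iq hq] ->]; split; [apply: act_mem|apply: homog_subst].
- exact: free_subst.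
by move=> p [r Ir ->] /(@homog_subst _ (invmx M)); rewrite substK // => /(h3 _ Ir)[c ->]; exists c; rewrite lcomb_subst.
Qed.

Lemma low_subst M p : low p -> low (subst M p).
Proof.
move=> lp m hm; have := mcoeff_hcomp (mdeg m) (subst M p) m; rewrite eqxx => <-.
rewrite hcomp_subst (_ : hcomp _ p = 0) ?rmorph0 ?mcoeff0 //.
by apply/mpolyP => m'; rewrite mcoeff_hcomp mcoeff0; case: eqP => // e; rewrite lp // e.
Qed.

Lemma rowpoly_subst M : exists R : 'M[k]_N5, forall v, rowpoly (v *m R) = subst M (rowpoly v).
Proof.
exists (\matrix_i polyrow (subst M (rowpoly (delta_mx 0 i)))) => v.
rewrite rowpoly_mul [in RHS](matrix_sum_delta v) big_ord1.
rewrite (big_morph (@rowpoly k) (@rowpolyD k) (@rowpoly0 k)) rmorph_sum; apply: eq_bigr => i _ /=.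
by rewrite rowK polyrowK ?rowpolyZ ?substZ //; apply/low_subst/low_rowpoly.
Qed.

Lemma closed_act M C : M \in unitmx -> closedG C -> closedG (fun I => Hpt I /\ C (act M I)).
Proof.
move=> u [G [pG hC]]; have [R hR] := rowpoly_subst M.
exists (fun g => exists2 g0, G g0 & g = fun T => g0 (T *m R)); split.
  move=> _ [g0 Gg0 ->]; apply: (pf_comp (co' := mx_co 20 N5) (h := fun T => T *m R)) (pG _ Gg0) => -[i j].
  apply: (pf_mulmx (co := mx_co 20 N5) (M := id) (N := fun=> R)) => i' j'; last exact: pf_const.
  exact: (pf_coord _ (i', j')).
move=> I; split=> [[HI /hC[_ h]]|[HI h]]; split=> //.
  move=> _ [g0 Gg0 ->] T.
  have hT i : I (rowpoly (row i (T *m lowbasis I))).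
    by move: i; apply/(lowbasis_rows _ HI); exists T.
  have [T' ->] : exists T', T *m lowbasis I *m R = T' *m lowbasis (act M I).
    by apply/(lowbasis_rows _ (Hpt_act u HI)) => i; rewrite row_mul hR; apply/act_mem/hT.
  exact: h.
apply/hC; split; first exact: Hpt_act.
move=> g Gg T; have [T' eT] : exists T', T *m lowbasis (act M I) = T' *m lowbasis I *m R.
  have [R' hR'] := rowpoly_subst (invmx M).
  have hT i : act M I (rowpoly (row i (T *m lowbasis (act M I)))).
    by move: i; apply/(lowbasis_rows _ (Hpt_act u HI)); exists T.
  have [T' eT'] : exists T', T *m lowbasis (act M I) *m R' = T' *m lowbasis I.
    by apply/(lowbasis_rows _ HI) => i; rewrite row_mul hR'; apply/(actP _ _ u)/hT.
  exists T'; rewrite -eT'; apply/row_matrixP => i; rewrite -[LHS]rowpolyK -[RHS]rowpolyK; congr polyrow.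
  by rewrite [in RHS]row_mul hR [in RHS]row_mul hR' substVK.
by rewrite eT; apply: (h (fun T => g (T *m R))); exists g.
Qed.

(** The points with translate in [cl X] form a closed set, so it is enough that this set contains
    [X]. *)
Lemma cl_act (X : subH k) M : M \in unitmx -> (forall J, X J -> Hpt J) -> (forall J, X J -> cl X (act M J)) ->
  forall J, cl X J -> cl X (act M J).
Proof.
move=> u XH h J /(_ _ (closed_act u (cl_closed _ XH)))[J' XJ'|//].
by split; [apply: XH|apply: h].
Qed.

Lemma psec_subst (A T : Type) (co : T -> A -> k) (M : A -> 'M[k]_3) (F : A -> S) d :
  (forall i j, pfun co (fun a => M a i j)) -> psec co F -> (forall a, homog_of d (F a)) ->
  psec co (fun a => subst (M a) (F a)).
Proof.
move=> pM pF hF.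
apply: psec_ext (_ : psec co (fun a => \sum_(m <- mons d) (F a)@_m *: \prod_i linrow (row i (M a)) ^+ m i)) _.
  apply: psec_sum => m _; apply: psecZ => //; apply: psec_prod => i; apply: psecX.
  apply: psec_sum => j _; apply: psecZ; last exact: psec_const.
  by apply: pf_ext (pM i j) _ => a; rewrite mxE.
move=> a; rewrite [in RHS](homog_span (hF a)) rmorph_sum; apply: eq_bigr => m _ /=.
rewrite substZ mpolyXE_id rmorph_prod; congr (_ *: _); apply: eq_bigr => i _.
by rewrite rmorphXn /= substX.
Qed.

Definition mxline (M0 M1 : 'M[k]_3) s := M0 + s *: (M1 - M0).

Lemma pf_mxline M0 M1 i j : pfun line_co (fun s => mxline M0 M1 s i j).
Proof.
apply: pf_ext (_ : pfun line_co (fun s => M0 i j + s * (M1 i j - M0 i j))) _ => [|s].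
  by apply: pf_add; [apply: pf_const|apply: pf_mul; [apply: (pf_coord line_co tt)|apply: pf_const]].
by rewrite !mxE.
Qed.

(* Closed conditions on a moving translate of a point can be tested at one translate. *)
Lemma cl_translate (X K : subH k) I M : closedG K -> M \in unitmx -> Hpt I ->
  (forall M', M' \in unitmx -> ~ K (act M' I) -> X (act M' I)) -> ~ K (act M I) -> cl X I.
Proof.
move=> cK u HI hX nK.
have [e he] : exists e : {poly k}, forall s, \det (mxline 1%:M M s) = e.[s].
  by apply: pf_poly; apply: pf_det => i j; apply: pf_mxline.
have es s : e.[s] != 0 -> mxline 1%:M M s \in unitmx by rewrite -he unitmxE unitfE.
have e0 : e != 0.
  by apply/eqP => e0; have := he 0; rewrite e0 horner0 /mxline scale0r addr0 det1 => /eqP; rewrite oner_eq0.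
have ln1 : mxline 1%:M M 1 = M by rewrite /mxline scale1r addrC subrK.
have ln0 : mxline 1%:M M 0 = 1%:M by rewrite /mxline scale0r addr0.
pose fam s := act (mxline 1%:M M s) I.
have lft s0 : mxline 1%:M M s0 \in unitmx -> liftable (@lowbasis k) line_co (fun s => e.[s] != 0) fam s0 (fam s0).
  move=> u0; apply: lifts_liftable => [s /es us|s /es us||d p d4 Ip hp].
  - by apply: Hpt_hideal; apply: Hpt_act.
  - exact: Hpt_act.
  - exact: Hpt_act.
  case: Ip hp => r Ir -> hr; exists (fun s => subst (mxline 1%:M M s) r); split=> // [|s _].
    apply: (@psec_subst _ _ _ _ _ d) => //; [exact: pf_mxline|exact: psec_const|move=> _].
    by rewrite -[r](substK _ u0); apply: homog_subst.
  exact: act_mem.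
apply: (curve_closure (s0 := 0) (s1 := 1) (fam := fam) (J1 := act M I) cK e0 HI) => //.
- exact: Hpt_act.
- by move=> s /es us; apply: hX.
- by move=> s /es us; apply: Hpt_act.
- by have := lft 0; rewrite /fam ln0 act1; apply; apply: unitmx1.
- by have := lft 1; rewrite /fam ln1; apply.
Qed.

End LinearAction.

(** * Ideals given from degree 4 on by a scheme of length 3 *)

Section Models.
Variable k : fieldType.
Local Notation S := {mpoly k[3]}.
Local Notation X := (X3 k).
Local Notation Y := (Y3 k).
Local Notation Z := (Z3 k).
Implicit Types (p q : S).

Lemma homogXM d p : homog_of d p -> homog_of d.+1 (X * p).
Proof. by move=> hp; apply: (homogM (@homogX3 k) hp). Qed.
Lemma homogYM d p : homog_of d p -> homog_of d.+1 (Y * p).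
Proof. by move=> hp; apply: (homogM (@homogY3 k) hp). Qed.
Lemma homogZM d p : homog_of d p -> homog_of d.+1 (Z * p).
Proof. by move=> hp; apply: (homogM (@homogZ3 k) hp). Qed.

Lemma homog_split d p : homog_of d.+1 p -> exists p0 p1 p2,
  [/\ homog_of d p0, homog_of d p1, homog_of d p2 & p = X * p0 + Y * p1 + Z * p2].
Proof.
move=> hp; rewrite (homog_span hp) big_seq.
pose P q := exists p0 p1 p2, [/\ homog_of d p0, homog_of d p1, homog_of d p2 & q = X * p0 + Y * p1 + Z * p2].
apply: (big_ind P) => [|q q' [a0 [a1 [a2 [h0 h1 h2 ->]]]] [b0 [b1 [b2 [g0 g1 g2 ->]]]]|m].
- by exists 0, 0, 0; split; try exact: homog0; rewrite !mulr0 !addr0.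
- by exists (a0 + b0), (a1 + b1), (a2 + b2); split; try exact: homogD; ring.
rewrite mem_mons mdeg3 => /eqP dm; set c0 := p@_m; rewrite (mon_eta m).
case: (m i0) dm => [|a] dm; last first.
  exists (c0 *: 'X_[mon a (m i1) (m i2)]), 0, 0; split; try exact: homog0.
    by apply/homogZ/homog_mon; lia.
  by rewrite !mulr0 !addr0 -scalerAr mulmon.
case: (m i1) dm => [|b] dm; last first.
  exists 0, (c0 *: 'X_[mon 0 b (m i2)]), 0; split; try exact: homog0.
    by apply/homogZ/homog_mon; lia.
  by rewrite !mulr0 !addr0 add0r -scalerAr mulmon.
case: (m i2) dm => [//|c] dm.
exists 0, 0, (c0 *: 'X_[mon 0 0 c]); split; try exact: homog0.
  by apply/homogZ/homog_mon; lia.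
by rewrite !mulr0 !add0r -scalerAr mulmon.
Qed.

Lemma homog_ind (P : nat -> S -> Prop) e : (forall d p q, P d p -> P d q -> P d (p + q)) ->
  (forall p, homog_of e p -> P e p) ->
  (forall d p, (e <= d)%N -> homog_of d p -> P d p -> [/\ P d.+1 (X * p), P d.+1 (Y * p) & P d.+1 (Z * p)]) ->
  forall d p, (e <= d)%N -> homog_of d p -> P d p.
Proof.
move=> PD Pe PX d p ed; rewrite -(subnKC ed); elim: (d - e)%N p => [|n IH] p; first by rewrite addn0; apply: Pe.
rewrite addnS => /homog_split[p0 [p1 [p2 [h0 h1 h2 ->]]]].
have le := leq_addr n e.
apply: (PD); first apply: (PD).
- by case: (PX _ p0 le h0 (IH _ h0)).
- by case: (PX _ p1 le h1 (IH _ h1)).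
- by case: (PX _ p2 le h2 (IH _ h2)).
Qed.

Section Evaluation.
Variables (A B : 'M[k]_3).
Hypothesis AB : A * B = B * A.

(** Row vectors are elements of the coordinate algebra of a length 3 scheme in the plane [z = 1]:
    [delta_mx 0 i0] stands for 1, and [A], [B] are the multiplications by [x] and [y]. Then [evd d]
    is the evaluation of forms of degree [d]. *)
Definition evmon (m : 'X_{1..3}) : 'rV[k]_3 := delta_mx 0 i0 *m (A ^+ m i0 * B ^+ m i1).
Definition evd d p : 'rV[k]_3 := \sum_(m <- mons d) p@_m *: evmon m.

Lemma evdD d p q : evd d (p + q) = evd d p + evd d q.
Proof. by rewrite /evd -big_split; apply: eq_bigr => m _; rewrite mcoeffD scalerDl. Qed.

Lemma evdZ d a p : evd d (a *: p) = a *: evd d p.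
Proof. by rewrite /evd scaler_sumr; apply: eq_bigr => m _; rewrite mcoeffZ scalerA. Qed.

Lemma evd0 d : evd d 0 = 0.
Proof. by rewrite /evd big1 // => m _; rewrite mcoeff0 scale0r. Qed.

Lemma evdN d p : evd d (- p) = - evd d p.
Proof. by rewrite -scaleN1r evdZ scaleN1r. Qed.

Lemma evdB d p q : evd d (p - q) = evd d p - evd d q.
Proof. by rewrite evdD evdN. Qed.

Lemma evdX m : evd (mdeg m) 'X_[m] = evmon m.
Proof.
rewrite /evd (bigD1_seq m) ?uniq_mons ?mem_mons //= mcoeffX eqxx scale1r big1 ?addr0 // => m' ne.
by rewrite mcoeffX eq_sym (negPf ne) scale0r.
Qed.

Lemma evd_mon a b c d : d = (a + b + c)%N -> evd d 'X_[mon a b c] = delta_mx 0 i0 *m (A ^+ a * B ^+ b).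
Proof. by move=> ->; rewrite -mdeg_mon evdX /evmon !monE. Qed.

Lemma evd_mul d (p : S) v (C : 'M[k]_3) : homog_of d p -> mdeg v = 1%N ->
  (forall m, evmon (v + m)%MM = evmon m *m C) -> evd d.+1 ('X_[v] * p) = evd d p *m C.
Proof.
move=> hp dv hv; rewrite {1}(homog_span hp) mulr_sumr.
rewrite (big_morph (evd d.+1) (evdD d.+1) (evd0 d.+1)) mulmx_suml big_seq [RHS]big_seq.
apply: eq_bigr => m; rewrite mem_mons => /eqP dm.
by rewrite -scalerAr evdZ -mpolyXD -scalemxAl -hv -evdX mdegD dv dm.
Qed.

Lemma evdXM d p : homog_of d p -> evd d.+1 (X * p) = evd d p *m A.
Proof.
move=> hp; apply: evd_mul => //; first by rewrite mdeg_mon.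
move=> m; rewrite /evmon !mnmDE !monE add0n -mulmxA; congr (_ *m _).
rewrite mulmxE add1n exprSr -mulrA -[in RHS]mulrA; congr (_ * _); exact: (commrX (m i1) AB).
Qed.

Lemma evdYM d p : homog_of d p -> evd d.+1 (Y * p) = evd d p *m B.
Proof.
move=> hp; apply: evd_mul => //; first by rewrite mdeg_mon.
by move=> m; rewrite /evmon !mnmDE !monE add0n -mulmxA mulmxE -mulrA -exprSr.
Qed.

Lemma evdZM d p : homog_of d p -> evd d.+1 (Z * p) = evd d p.
Proof.
move=> hp; rewrite -[RHS]mulmx1; apply: evd_mul => //; first by rewrite mdeg_mon.
by move=> m; rewrite /evmon !mnmDE !monE !add0n mulmx1.
Qed.

Variables (W2 W3 : S -> Prop).
Hypotheses (W2l : lin_closed W2) (W3l : lin_closed W3).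
Hypothesis W23 : forall p, homog_of 2 p -> W2 p -> [/\ W3 (X * p), W3 (Y * p) & W3 (Z * p)].
Hypothesis W3e : forall p, homog_of 3 p -> W3 p -> evd 3 p = 0.

(** From degree 4 on this is the saturated ideal of the scheme, of codimension 3; in degrees 2 and 3
    it is a prescribed smaller space. *)
Definition piece d p : Prop := match d with 0 | 1 => p = 0 | 2 => W2 p | 3 => W3 p | _ => evd d p = 0 end.
Definition model : ideal_pred k := graded_pred piece.

Lemma piece_ge4 d p : (4 <= d)%N -> piece d p = (evd d p = 0).
Proof. by case: d => [|[|[|[|d]]]]. Qed.

Lemma lin_eq0 : lin_closed (fun p : S => p = 0).
Proof. by split=> // [p q -> ->|a p ->]; rewrite ?addr0 ?scaler0. Qed.

Lemma lin_evd d : lin_closed (fun p => evd d p = 0).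
Proof.
by split=> [|p q e1 e2|a p e]; rewrite ?evd0 ?evdD ?evdZ ?e1 ?e2 ?e ?addr0 ?scaler0.
Qed.

Lemma lin_piece d : lin_closed (piece d).
Proof. by case: d => [|[|[|[|d]]]] //=; [exact: lin_eq0|exact: lin_eq0|exact: lin_evd]. Qed.

Lemma piece_lin0 d : piece d 0.
Proof. by case: (lin_piece d). Qed.

Lemma model_homog d p : homog_of d p -> model p <-> piece d p.
Proof. by apply: graded_homog => e; apply: piece_lin0. Qed.

Lemma model_hideal : is_hideal model.
Proof.
apply: graded_hideal => [d|d p hp]; first exact: lin_piece.
case: d p hp => [|[|[|[|d]]]] p hp /=.
- by move=> ->; rewrite !mulr0.
- by move=> ->; rewrite !mulr0; case: W2l.
- exact: W23.
- by move=> /(W3e hp) e; rewrite (evdXM hp) (evdYM hp) (evdZM hp) e !mul0mx.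
- by move=> e; rewrite (evdXM hp) (evdYM hp) (evdZM hp) e !mul0mx.
Qed.

Lemma model_basis d s : basis_of (piece d) d s -> basis_of model d s.
Proof.
move=> /basis_ofP[h1 h2 h3]; apply/basis_ofP; split=> //.
  by move=> p /h1[Dp hp]; split=> //; apply/(model_homog hp).
by move=> p /[swap] hp /(model_homog hp) Dp; apply: h3.
Qed.

(* [st d i] are monomials of degree [d] mapped to the standard basis of [k^3]. *)
Lemma model_Hpt (st : nat -> 'I_3 -> 'X_{1..3}) :
  (forall d i, (4 <= d)%N -> mdeg (st d i) = d /\ evmon (st d i) = delta_mx 0 i) ->
  (exists s, basis_of W2 2 s /\ size s = 2) -> (exists s, basis_of W3 3 s /\ size s = 6) -> Hpt model.
Proof.
move=> hst [s2 [b2 z2]] [s3 [b3 z3]]; split; first exact: model_hideal.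
move=> d; suff [s [bs ss]] : exists s, basis_of (piece d) d s /\ size s = hdim d.
  by exists s; split=> //; apply: model_basis.
case: d => [|[|[|[|d]]]].
- exists [::]; split=> //; apply/basis_ofP; split=> [p //||p -> _]; [exact: freeS_nil|exact: spanS0].
- exists [::]; split=> //; apply/basis_ofP; split=> [p //||p -> _]; [exact: freeS_nil|exact: spanS0].
- by exists s2.
- by exists s3.
pose D := d.+4; pose std := [seq st D i | i <- enum 'I_3].
have std_inj : injective (st D).
  move=> i j e; have [_ ei] := hst D i isT; have [_ ej] := hst D j isT.
  move: ei; rewrite e ej => /rowP/(_ j); rewrite !mxE !eqxx /=.
  by case: (j =P i) => // _ /eqP; rewrite oner_eq0.
pose r m := \sum_(i < 3) (evmon m) 0 i *: ('X_[st D i] : S).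
have rE m m' : (r m)@_m' = \sum_(i < 3) (evmon m) 0 i * (st D i == m')%:R.
  by rewrite raddf_sum; apply: eq_bigr => i _ /=; rewrite mcoeffZ mcoeffX.
have evr (v : 'rV_3) : evd D (\sum_(i < 3) v 0 i *: ('X_[st D i] : S)) = v.
  rewrite (big_morph (evd D) (evdD D) (evd0 D)) [RHS]row_sum_delta; apply: eq_bigr => i _.
  by rewrite evdZ; have [dd <-] := hst D i isT; rewrite -{1}dd evdX.
have [s [bs ss]] : exists s, basis_of (fun p => evd D p = 0) D s /\ size s = ('C(D.+2, 2) - size std)%N.
  apply: (standard_basis (r := r)) => //.
  - exact: lin_evd.
  - by rewrite map_inj_uniq // enum_uniq.
  - by move=> m /mapP[i _ ->]; case: (hst D i isT).
  - move=> m dm nm; split.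
    + by apply: homog_sum => i _; apply/homogZ/homogX; case: (hst D i isT).
    + by rewrite evdB -{1}dm evdX evr subrr.
    move=> m' nm'; rewrite rE big1 // => i _; case: eqP => [e|]; last by rewrite mulr0.
    by case/negP: nm'; rewrite -e map_f // mem_enum.
  - move=> p ep hp hz.
    have pE : p = \sum_(i < 3) p@_(st D i) *: 'X_[st D i].
      apply/mpolyP => m; rewrite raddf_sum /=.
      under eq_bigr do rewrite mcoeffZ mcoeffX.
      case: (boolP (m \in std)) => [/mapP[i _ ->]|nm].
        rewrite (bigD1 i) //= eqxx mulr1 big1 ?addr0 // => j ne.
        by rewrite (inj_eq std_inj) (negPf ne) mulr0.
      rewrite hz // big1 // => i _; case: eqP => [e|]; last by rewrite mulr0.
      by case/negP: nm; rewrite -e map_f // mem_enum.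
    move: ep; rewrite {1}pE -[X in evd D X](_ : \sum_(i < 3) (\row_i p@_(st D i)) 0 i *: 'X_[st D i] = _).
      rewrite evr => /rowP e; rewrite pE big1 // => i _; have := e i; rewrite !mxE => ->.
      by rewrite scale0r.
    by apply: eq_bigr => i _; rewrite mxE.
by exists s; split=> //; rewrite ss size_map size_enum_ord.
Qed.

End Evaluation.
Arguments evdXM {A B} AB {d p}.
Arguments evdYM {A B d p}.
Arguments evdZM {A B d p}.

Definition mx3 (rows : seq (seq k)) : 'M[k]_3 := \matrix_(i, j) nth 0 (nth [::] rows i) j.

Lemma freeS_coef2 (p q : S) m m' : p@_m = 1 -> q@_m = 0 -> p@_m' = 0 -> q@_m' = 1 -> freeS [:: p; q].
Proof.
move=> p1 q1 p2 q2 c e [|[|//]] _.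
  have := congr1 (mcoeff m) e; rewrite !lcomb_cons lcomb_nil addr0 mcoeff0 mcoeffD !mcoeffZ p1 q1.
  by rewrite mulr1 mulr0 addr0.
have := congr1 (mcoeff m') e; rewrite !lcomb_cons lcomb_nil addr0 mcoeff0 mcoeffD !mcoeffZ p2 q2.
by rewrite mulr1 mulr0 add0r.
Qed.

Lemma lin_span2 (q1 q2 : S) : lin_closed (fun p => exists a b : k, p = a *: q1 + b *: q2).
Proof.
split=> [|p q [a [b ->]] [c [d ->]]|t p [a [b ->]]].
- by exists 0, 0; rewrite !scale0r addr0.
- by exists (a + c), (b + d); rewrite !scalerDl addrACA.
- by exists (t * a), (t * b); rewrite scalerDr !scalerA.
Qed.

Lemma linD (a b c : k) a' b' c' : lin a b c + lin a' b' c' = lin (a + a') (b + b') (c + c').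
Proof. by rewrite /lin !scalerDl; ring. Qed.
Lemma linZ (t a b c : k) : t *: lin a b c = lin (t * a) (t * b) (t * c).
Proof. by rewrite /lin !scalerDr !scalerA. Qed.

Definition syz_span (q1 q2 : S) p := exists a b, [/\ homog_of 1 a, homog_of 1 b & p = a * q1 + b * q2].

Lemma lin_syz (q1 q2 : S) : lin_closed (syz_span q1 q2).
Proof.
split=> [|p q [a [b [ha hb ->]]] [c [d [hc hd ->]]]|t p [a [b [ha hb ->]]]].
- by exists 0, 0; split; try exact: homog0; ring.
- by exists (a + c), (b + d); split; try exact: homogD; ring.
- by exists (t *: a), (t *: b); split; try exact: homogZ; rewrite -!mul_mpolyC; ring.
Qed.

Definition six (q1 q2 : S) := [:: X * q1; Y * q1; Z * q1; X * q2; Y * q2; Z * q2].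

Lemma six_lcomb (q1 q2 : S) c : lcomb c (six q1 q2) =
  lin (c 0%N) (c 1%N) (c 2%N) * q1 + lin (c 3%N) (c 4%N) (c 5%N) * q2.
Proof. by rewrite !lcomb_cons lcomb_nil addr0 /lin -!mul_mpolyC; ring. Qed.

Lemma six_span (q1 q2 : S) p : syz_span q1 q2 p -> spanS (six q1 q2) p.
Proof.
move=> [a [b [/homog1_lin -> /homog1_lin -> ->]]].
exists (nth 0 [:: a@_(mon 1 0 0); a@_(mon 0 1 0); a@_(mon 0 0 1); b@_(mon 1 0 0); b@_(mon 0 1 0); b@_(mon 0 0 1)]).
by rewrite six_lcomb.
Qed.

Lemma six_basis (q1 q2 : S) : homog_of 2 q1 -> homog_of 2 q2 -> freeS (six q1 q2) ->
  basis_of (syz_span q1 q2) 3 (six q1 q2).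
Proof.
move=> h1 h2 fs; apply/basis_ofP; split=> // [p|p h _]; last exact: six_span.
have o := @homog0 k 1.
have hX := @homogX3 k; have hY := @homogY3 k; have hZ := @homogZ3 k.
rewrite !inE => /or4P[/eqP ->|/eqP ->|/eqP ->|/or3P[/eqP ->|/eqP ->|/eqP ->]];
  (split; last by [apply: homogXM|apply: homogYM|apply: homogZM]).
- by exists X, 0; split=> //; ring.
- by exists Y, 0; split=> //; ring.
- by exists Z, 0; split=> //; ring.
- by exists 0, X; split=> //; ring.
- by exists 0, Y; split=> //; ring.
- by exists 0, Z; split=> //; ring.
Qed.

(* The restrictions of [q1] and [q2] to the line [z = 0] are coprime. *)
Definition normal_pencil (la mu : k) (q1 q2 : S) :=
  [/\ homog_of 2 q1, homog_of 2 q2,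
      [/\ q1@_(mon 2 0 0) = 1, q1@_(mon 1 1 0) = 0 & q1@_(mon 0 2 0) = la] &
      [/\ q2@_(mon 2 0 0) = 0, q2@_(mon 1 1 0) = 1 & q2@_(mon 0 2 0) = mu]].

(** On [z = 0] the forms are [x^2 + la y^2] and [y (x + mu y)], with resultant [la + mu^2]. The
    coefficients of a linear syzygy therefore vanish on [z = 0]; they are multiples of [z], and
    dividing by [z] leaves a linear relation between [q1] and [q2]. *)
Lemma normal_pencil_free la mu q1 q2 : normal_pencil la mu q1 q2 -> la + mu ^+ 2 != 0 -> freeS (six q1 q2).
Proof.
move=> [h1 h2 [a1 a2 a3] [b1 b2 b3]] nz c; rewrite six_lcomb => e.
have C a b d := congr1 (mcoeff (mon a b d)) e.
move: (C 3 0 0) (C 2 1 0) (C 1 2 0) (C 0 3 0) (C 2 0 1) (C 1 1 1) => {C}.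
rewrite !mcoeffD !mcoeff0 !coef_linM !coefvar a1 a2 a3 b1 b2 b3.
rewrite !(mulr0, mulr1, addr0, add0r) => e0 e1 e2 e3 e4 e5.
move: e2 e3 e4 e5; rewrite e0 !(mul0r, mulr0, addr0, add0r).
have -> : c 3%N = - c 1%N by apply/eqP; rewrite -addr_eq0 addrC e1.
move=> e2 e3; have e4' : c 4%N = mu * c 1%N.
  by move/eqP: e2; rewrite mulNr addrC subr_eq0 => /eqP ->; rewrite mulrC.
have c1 : c 1%N = 0.
  have : (la + mu ^+ 2) * c 1%N = 0 by rewrite -e3 e4'; ring.
  by move/eqP; rewrite mulf_eq0 (negPf nz) => /eqP.
rewrite e4' c1 !(mul0r, mulr0, addr0, add0r, oppr0) => c2 c5.
have c3 : c 3%N = 0 by move: e1; rewrite c1 add0r.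
by move=> [|[|[|[|[|[|//]]]]]] _ //; rewrite e4' c1 mulr0.
Qed.

Section Chart.
Variables (c1 c2 d1 d2 f1 f2 la mu : k).

(** In an algebra with basis [1, x, y] put [x^2 = c0 + c1 x + c2 y], [x y = d0 + d1 x + d2 y],
    [y^2 = f0 + f1 x + f2 y]. Comparing [x (x y)] with [y x^2] and [x y^2] with [y (x y)] forces
    these values of the constant terms. *)
Definition ch_c0 := d1 * c2 + d2 ^+ 2 - c1 * d2 - c2 * f2.
Definition ch_d0 := c2 * f1 - d1 * d2.
Definition ch_f0 := d1 ^+ 2 + d2 * f1 - f1 * c1 - f2 * d1.

Definition chX := mx3 [:: [:: 0; 1; 0]; [:: ch_c0; c1; c2]; [:: ch_d0; d1; d2]].
Definition chY := mx3 [:: [:: 0; 0; 1]; [:: ch_d0; d1; d2]; [:: ch_f0; f1; f2]].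

Lemma chXY : chX * chY = chY * chX.
Proof.
apply/matrixP => i j; rewrite -mulmxE !mxE !big_ord_recl !big_ord0 !mxE.
by case: (ord3 i) => ->; case: (ord3 j) => -> /=; rewrite /ch_c0 /ch_d0 /ch_f0; ring.
Qed.

Definition ch_n1 : S := X * X - Z * lin c1 c2 ch_c0.
Definition ch_n2 : S := X * Y - Z * lin d1 d2 ch_d0.
Definition ch_n3 : S := Y * Y - Z * lin f1 f2 ch_f0.
Definition ch_q1 := ch_n1 + la *: ch_n3.
Definition ch_q2 := ch_n2 + mu *: ch_n3.

(** The six structure constants describe three points off a line together with the net [n1, n2, n3]
    of conics through them; [la] and [mu] are affine coordinates on the pencils in the net. *)
Definition chartI := model chX chY (fun p => exists a b, p = a *: ch_q1 + b *: ch_q2) (syz_span ch_q1 ch_q2).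

Definition row3 (a b c : k) : 'rV[k]_3 := \row_j [:: a; b; c]`_j.

Lemma row3P (v : 'rV[k]_3) : v = row3 (v 0 i0) (v 0 i1) (v 0 i2).
Proof. by apply/rowP => j; rewrite mxE; case: (ord3 j) => ->. Qed.

Lemma row3D a b c a' b' c' : row3 a b c + row3 a' b' c' = row3 (a + a') (b + b') (c + c').
Proof. by apply/rowP => j; rewrite !mxE; case: (ord3 j) => ->. Qed.
Lemma row3Z t a b c : t *: row3 a b c = row3 (t * a) (t * b) (t * c).
Proof. by apply/rowP => j; rewrite !mxE; case: (ord3 j) => ->. Qed.

Lemma row3_chX a b c : row3 a b c *m chX = row3 (b * ch_c0 + c * ch_d0) (a + b * c1 + c * d1) (b * c2 + c * d2).
Proof.
apply/rowP => j; rewrite !mxE !big_ord_recl !big_ord0 !mxE.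
by case: (ord3 j) => -> /=; ring.
Qed.

Lemma row3_chY a b c : row3 a b c *m chY = row3 (b * ch_d0 + c * ch_f0) (b * d1 + c * f1) (a + b * d2 + c * f2).
Proof.
apply/rowP => j; rewrite !mxE !big_ord_recl !big_ord0 !mxE.
by case: (ord3 j) => -> /=; ring.
Qed.

Lemma delta_row3 : delta_mx 0 i0 = row3 1 0 0.
Proof. by apply/rowP => j; rewrite !mxE; case: (ord3 j) => ->. Qed.

Lemma evd1_lin (A B : 'M[k]_3) a b c : evd A B 1 (lin a b c) =
  c *: delta_mx 0 i0 + a *: (delta_mx 0 i0 *m A) + b *: (delta_mx 0 i0 *m B).
Proof.
rewrite /lin !evdD !evdZ !evd_mon // !expr0 !expr1 !mulr1 !mul1r mulmx1.
by rewrite addrC addrA.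
Qed.

Lemma ch_evd1 a b c : evd chX chY 1 (lin a b c) = row3 c a b.
Proof.
rewrite evd1_lin delta_row3 row3_chX row3_chY !row3Z !row3D; congr row3; ring.
Qed.

Lemma ch_evdZlin a b c : evd chX chY 2 (Z * lin a b c) = row3 c a b.
Proof. by rewrite (evdZM (@homog_lin k _ _ _)) ch_evd1. Qed.

Lemma linX1 : X = lin 1 0 0. Proof. by rewrite /lin !scale0r scale1r !addr0. Qed.
Lemma linY1 : Y = lin 0 1 0. Proof. by rewrite /lin !scale0r scale1r !addr0 add0r. Qed.
Lemma linZ1 : Z = lin 0 0 1. Proof. by rewrite /lin !scale0r scale1r !add0r. Qed.

Lemma ch_evd_n1 : evd chX chY 2 ch_n1 = 0.
Proof.
rewrite evdB ch_evdZlin (evdXM chXY (@homogX3 k)) {1}linX1 ch_evd1 row3_chX.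
by apply/rowP => j; rewrite !mxE; case: (ord3 j) => -> /=; ring.
Qed.
Lemma ch_evd_n2 : evd chX chY 2 ch_n2 = 0.
Proof.
rewrite evdB ch_evdZlin (evdXM chXY (@homogY3 k)) {1}linY1 ch_evd1 row3_chX.
by apply/rowP => j; rewrite !mxE; case: (ord3 j) => -> /=; ring.
Qed.
Lemma ch_evd_n3 : evd chX chY 2 ch_n3 = 0.
Proof.
rewrite evdB ch_evdZlin (evdYM (@homogY3 k)) {1}linY1 ch_evd1 row3_chY.
by apply/rowP => j; rewrite !mxE; case: (ord3 j) => -> /=; ring.
Qed.

Lemma homog_n1 : homog_of 2 ch_n1.
Proof. by apply: homogB; [apply: homogXM (@homogX3 k)|apply/homogZM/homog_lin]. Qed.
Lemma homog_n2 : homog_of 2 ch_n2.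
Proof. by apply: homogB; [apply: homogXM (@homogY3 k)|apply/homogZM/homog_lin]. Qed.
Lemma homog_n3 : homog_of 2 ch_n3.
Proof. by apply: homogB; [apply: homogYM (@homogY3 k)|apply/homogZM/homog_lin]. Qed.
Lemma homog_q1 : homog_of 2 ch_q1. Proof. by apply/homogD/homogZ/homog_n3; apply: homog_n1. Qed.
Lemma homog_q2 : homog_of 2 ch_q2. Proof. by apply/homogD/homogZ/homog_n3; apply: homog_n2. Qed.

Lemma ch_evd_q1 : evd chX chY 2 ch_q1 = 0.
Proof. by rewrite evdD evdZ ch_evd_n1 ch_evd_n3 scaler0 addr0. Qed.
Lemma ch_evd_q2 : evd chX chY 2 ch_q2 = 0.
Proof. by rewrite evdD evdZ ch_evd_n2 ch_evd_n3 scaler0 addr0. Qed.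

Lemma ch_normal_pencil : normal_pencil la mu ch_q1 ch_q2.
Proof.
split; [exact: homog_q1|exact: homog_q2| |].
  split; rewrite mcoeffD mcoeffZ !mcoeffB !coefvar; rewrite ?coef_mon /=; ring.
split; rewrite mcoeffD mcoeffZ !mcoeffB !coefvar; rewrite ?coef_mon /=; ring.
Qed.

Lemma evd_lin_mul (A B : 'M[k]_3) d a p : A * B = B * A -> homog_of 1 a -> homog_of d p -> evd A B d p = 0 ->
  evd A B d.+1 (a * p) = 0.
Proof.
move=> AB /homog1_lin -> hp e; rewrite /lin !mulrDl -!scalerAl !evdD !evdZ.
by rewrite evdXM // evdYM // evdZM // e !mul0mx !scaler0 !addr0.
Qed.

Definition ch_std (d : nat) (i : 'I_3) : 'X_{1..3} :=
  nth 0%MM [:: mon 0 0 d; mon 1 0 d.-1; mon 0 1 d.-1] i.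

Lemma ch_stdP d i : (4 <= d)%N -> mdeg (ch_std d i) = d /\ evmon chX chY (ch_std d i) = delta_mx 0 i.
Proof.
move=> d4; case: (ord3 i) => ->; rewrite /ch_std /= /evmon ?mdeg_mon !monE; (split; first by lia).
- by rewrite !expr0 mulr1 mulmx1.
- rewrite expr0 expr1 mulr1 delta_row3 row3_chX; apply/rowP => j; rewrite !mxE.
  by case: (ord3 j) => -> /=; ring.
- rewrite expr0 expr1 mul1r delta_row3 row3_chY; apply/rowP => j; rewrite !mxE.
  by case: (ord3 j) => -> /=; ring.
Qed.

Lemma chartI_hideal : is_hideal chartI.
Proof.
apply: model_hideal.
- exact: chXY.
- exact: lin_span2.
- exact: lin_syz.
- move=> p _ [a [b ->]]; have hX := @homogX3 k; have hY := @homogY3 k; have hZ := @homogZ3 k.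
  split.
  + by exists (a *: X), (b *: X); split; try exact: homogZ; rewrite -!mul_mpolyC; ring.
  + by exists (a *: Y), (b *: Y); split; try exact: homogZ; rewrite -!mul_mpolyC; ring.
  + by exists (a *: Z), (b *: Z); split; try exact: homogZ; rewrite -!mul_mpolyC; ring.
move=> p _ [a [b [ha hb ->]]]; rewrite evdD.
by rewrite !evd_lin_mul ?addr0 //; [exact: chXY|exact: homog_q2|exact: ch_evd_q2|exact: chXY|exact: homog_q1|exact: ch_evd_q1].
Qed.

Lemma chart_Hpt : la + mu ^+ 2 != 0 -> Hpt chartI.
Proof.
move=> nz; have [hi _] := (chartI_hideal, I).
have [_ _ [a1 a2 a3] [b1 b2 b3]] := ch_normal_pencil.
apply: (@model_Hpt chX chY) ch_stdP _ _.
- exact: chXY.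
- exact: lin_span2.
- exact: lin_syz.
- move=> p hp [a [b ->]]; have hX := @homogX3 k; have hY := @homogY3 k; have hZ := @homogZ3 k.
  split.
  + by exists (a *: X), (b *: X); split; try exact: homogZ; rewrite -!mul_mpolyC; ring.
  + by exists (a *: Y), (b *: Y); split; try exact: homogZ; rewrite -!mul_mpolyC; ring.
  + by exists (a *: Z), (b *: Z); split; try exact: homogZ; rewrite -!mul_mpolyC; ring.
- move=> p _ [a [b [ha hb ->]]]; rewrite evdD.
  by rewrite !evd_lin_mul ?addr0 //; [exact: chXY|exact: homog_q2|exact: ch_evd_q2|exact: chXY|exact: homog_q1|exact: ch_evd_q1].
- exists [:: ch_q1; ch_q2]; split=> //; apply/basis_ofP; split.
  + move=> p; rewrite !inE => /orP[/eqP ->|/eqP ->].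
      by split; [exists 1, 0; rewrite scale1r scale0r addr0|exact: homog_q1].
    by split; [exists 0, 1; rewrite scale1r scale0r add0r|exact: homog_q2].
  + exact: freeS_coef2 a1 b1 a2 b2.
  + move=> p [a [b ->]] _; exists (nth 0 [:: a; b]).
    by rewrite !lcomb_cons lcomb_nil addr0.
- exists (six ch_q1 ch_q2); split=> //; apply: six_basis; [exact: homog_q1|exact: homog_q2|].
  exact: normal_pencil_free ch_normal_pencil nz.
Qed.

End Chart.

End Models.
Arguments evdXM {k A B} AB {d p}.
Arguments evdYM {k A B d p}.
Arguments evdZM {k A B d p}.

(** * Structure constants of an ideal with quotient spanned by [z^3 x], [z^3 y], [z^4] in degree
    4 *)

Section Recognition.
Variable k : closedFieldType.
Local Notation S := {mpoly k[3]}.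
Local Notation X := (X3 k).
Local Notation Y := (Y3 k).
Local Notation Z := (Z3 k).
Implicit Types (p q : S) (I : ideal_pred k).

Lemma homogZX n d p : homog_of d p -> homog_of (n + d) (Z ^+ n * p).
Proof.
move=> hp; elim: n => [|n IH]; first by rewrite expr0 mul1r.
by rewrite exprS -mulrA; apply: homogZM.
Qed.

Lemma quad_form q : homog_of 2 q -> q = q@_(mon 2 0 0) *: (X * X) + q@_(mon 1 1 0) *: (X * Y) +
  q@_(mon 0 2 0) *: (Y * Y) + Z * lin q@_(mon 1 0 1) q@_(mon 0 1 1) q@_(mon 0 0 2).
Proof.
move=> hq; rewrite {1}(homog_span hq) /mons /= !big_cons big_nil addr0 /lin /X3 /Y3 /Z3.
by rewrite !mulrDr -!scalerAr !mulmon /=; ring.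
Qed.

Lemma lcomb3 a b c (u v w : S) : lcomb (nth 0 [:: a; b; c]) [:: u; v; w] = a *: u + b *: v + c *: w.
Proof. by rewrite !lcomb_cons lcomb_nil addr0 addrA. Qed.

Lemma lin_neq0 a b c : lin a b c = 0 :> S -> [/\ a = 0, b = 0 & c = 0].
Proof.
move=> e; have C u v w := congr1 (mcoeff (mon u v w)) e.
move: (C 1 0 0) (C 0 1 0) (C 0 0 1) => {C}; rewrite /lin !mcoeffD !mcoeffZ !mcoeff0 /X3 /Y3 /Z3 !coef_mon /=.
by rewrite !mulr0 !mulr1 !addr0 !add0r.
Qed.

Section ZReduced.
Variables (I : ideal_pred k) (HI : Hpt I).
Hypothesis zred : forall p, homog_of 4 p ->
  exists a l, [/\ I a, homog_of 4 a, homog_of 1 l & p = a + Z ^+ 3 * l].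

Let hI := Hpt_hideal HI.

Lemma zred_gen d p : (4 <= d)%N -> homog_of d p ->
  exists a l, [/\ gen4 I a, I a, homog_of d a, homog_of 1 l & p = a + Z ^+ d.-1 * l].
Proof.
move: d p; apply: homog_ind => [d p q [a [l [ga Ia ha hl ->]]] [b [m [gb Ib hb hm ->]]]|p hp|d p d4 hp [a [l [ga Ia ha hl ->]]]].
- exists (a + b), (l + m); split; last by ring.
  + by move=> Q Q0 QD QM Qb; apply: (QD); [apply: ga|apply: gb].
  + exact: hiD.
  + exact: homogD.
  + exact: homogD.
- have [a [l [Ia ha hl ->]]] := zred hp; exists a, l; split=> //.
  by move=> Q _ _ _; apply.
have step v : homog_of 1 v -> (forall q e, homog_of e q -> homog_of e.+1 (v * q)) ->
    exists a' l', [/\ gen4 I a', I a', homog_of d.+1 a', homog_of 1 l' & v * (a + Z ^+ d.-1 * l) = a' + Z ^+ d * l'].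
  move=> hv vM; have h4 : homog_of 4 (Z ^+ 2 * (v * l)).
    by apply: (@homogZX 2 2); apply: vM.
  have [b [m [Ib hb hm e]]] := zred h4.
  exists (v * a + Z ^+ (d - 3)%N * b), m; split=> //.
  + move=> Q Q0 QD QM Qb; apply: (QD); apply: (QM); [exact: ga|exact: Qb].
  + by apply: hiD => //; apply: hiM.
  + apply: homogD; first exact: vM.
    by have := @homogZX (d - 3)%N _ _ hb; rewrite (_ : (d - 3 + 4)%N = d.+1) //; lia.
  rewrite mulrDr -addrA; congr (_ + _).
  move: (d - 3)%N (subnK (ltnW d4)) => n <-.
  have -> : (n + 3).-1 = (n + 2)%N by rewrite addnS.
  rewrite !exprD (_ : v * _ = Z ^+ n * (Z ^+ 2 * (v * l))); first by rewrite e; ring.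
  by ring.
by split; [apply: step (@homogX3 k) _ => *; apply: homogXM|apply: step (@homogY3 k) _ => *; apply: homogYM|
  apply: step (@homogZ3 k) _ => *; apply: homogZM].
Qed.

Lemma zred_indep d l : (4 <= d)%N -> homog_of 1 l -> I (Z ^+ d.-1 * l) -> l = 0.
Proof.
move=> d4 hl Il; rewrite (homog1_lin hl); set a := l@__; set b := l@__; set c := l@__.
have el : Z ^+ d.-1 * l = lcomb (nth 0 [:: a; b; c]) [:: Z ^+ d.-1 * X; Z ^+ d.-1 * Y; Z ^+ d.-1 * Z].
  by rewrite lcomb3 {1}(homog1_lin hl) /lin !mulrDr -!scalerAr.
have hd p : homog_of 1 p -> homog_of d (Z ^+ d.-1 * p).
  by move=> hp; have := @homogZX d.-1 _ _ hp; rewrite addn1 prednK //; lia.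
have := @Hpt_codim _ I HI d [:: Z ^+ d.-1 * X; Z ^+ d.-1 * Y; Z ^+ d.-1 * Z] _ _ (nth 0 [:: a; b; c]).
rewrite -el => h; have {}h i : (i < 3)%N -> nth 0 [:: a; b; c] i = 0.
  apply: h => //; last exact: hd.
  - by rewrite (hdim_ge4 d4) /= subnK // (leq_trans (_ : 3 <= 'C(6, 2))%N) // leq_bin2l.
  move=> p hp; have [a' [m [_ Ia' ha' hm ->]]] := zred_gen d4 hp.
  exists a'; split=> //; rewrite addrC addKr.
  exists (nth 0 [:: m@_(mon 1 0 0); m@_(mon 0 1 0); m@_(mon 0 0 1)]).
  by rewrite lcomb3 {1}(homog1_lin hm) /lin !mulrDr -!scalerAr.
have -> : a = 0 by apply: (h 0%N).
have -> : b = 0 by apply: (h 1%N).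
have -> : c = 0 by apply: (h 2%N).
by rewrite /lin !scale0r !addr0.
Qed.

Lemma zred_regular : regular I.
Proof.
move=> d p d4 Ip hp; have [a [l [ga Ia ha hl e]]] := zred_gen d4 hp.
have l0 : l = 0.
  apply: (zred_indep d4 hl); rewrite (_ : _ * l = p - a); first exact: hiB.
  by rewrite e addrC addKr.
by rewrite e l0 mulr0 addr0.
Qed.

(* The coordinate algebra of the three points cut out by [I] in degrees at least 4, as
   commuting multiplications by [x/z] and [y/z]. *)
Lemma zred_chart : exists c1 c2 d1 d2 f1 f2,
  (forall d p, (0 < d)%N -> I p -> homog_of d p -> evd (chX c1 c2 d1 d2 f1 f2) (chY c1 c2 d1 d2 f1 f2) d p = 0)
  /\ [/\ I (Z ^+ 2 * ch_n1 c1 c2 d1 d2 f2), I (Z ^+ 2 * ch_n2 c2 d1 d2 f1) & I (Z ^+ 2 * ch_n3 c1 d1 d2 f1 f2)].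
Proof.
have hXX : homog_of 4 (Z ^+ 2 * (X * X)) by apply: (@homogZX 2 2); apply: homogXM (@homogX3 k).
have hXY : homog_of 4 (Z ^+ 2 * (X * Y)) by apply: (@homogZX 2 2); apply: homogXM (@homogY3 k).
have hYY : homog_of 4 (Z ^+ 2 * (Y * Y)) by apply: (@homogZX 2 2); apply: homogYM (@homogY3 k).
have [ac [lc [Iac _ hlc ec]]] := zred hXX.
have [ad [ld [Iad _ hld ed]]] := zred hXY.
have [af [lf [Iaf _ hlf ef]]] := zred hYY.
move: ec ed ef; rewrite (homog1_lin hlc) (homog1_lin hld) (homog1_lin hlf).
move: lc@__ lc@__ lc@__ ld@__ ld@__ ld@__ lf@__ lf@__ lf@__ => c0 c2 c1 d0 d2 d1 f0 f2 f1 ec ed ef.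
have Ic : I (Z ^+ 2 * (X * X) - Z ^+ 3 * lin c1 c2 c0) by rewrite ec addrK.
have Id : I (Z ^+ 2 * (X * Y) - Z ^+ 3 * lin d1 d2 d0) by rewrite ed addrK.
have If : I (Z ^+ 2 * (Y * Y) - Z ^+ 3 * lin f1 f2 f0) by rewrite ef addrK.
pose vX a b c := lin (a * c1 + b * d1 + c) (a * c2 + b * d2) (a * c0 + b * d0) : S.
pose vY a b c := lin (a * d1 + b * f1) (a * d2 + b * f2 + c) (a * d0 + b * f0) : S.
have redX a b c : I (Z ^+ 3 * (X * lin a b c) - Z ^+ 4 * vX a b c).
  rewrite (_ : _ - _ = (a%:MP * Z) * (Z ^+ 2 * (X * X) - Z ^+ 3 * lin c1 c2 c0) +
    (b%:MP * Z) * (Z ^+ 2 * (X * Y) - Z ^+ 3 * lin d1 d2 d0)).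
    by apply: (hiD hI); apply: hiM.
  by rewrite /vX /lin -!mul_mpolyC; ring.
have redY a b c : I (Z ^+ 3 * (Y * lin a b c) - Z ^+ 4 * vY a b c).
  rewrite (_ : _ - _ = (a%:MP * Z) * (Z ^+ 2 * (X * Y) - Z ^+ 3 * lin d1 d2 d0) +
    (b%:MP * Z) * (Z ^+ 2 * (Y * Y) - Z ^+ 3 * lin f1 f2 f0)).
    by apply: (hiD hI); apply: hiM.
  by rewrite /vY /lin -!mul_mpolyC; ring.
have ind5 a b c : I (Z ^+ 4 * lin a b c) -> [/\ a = 0, b = 0 & c = 0].
  by move=> h; apply: lin_neq0; apply: (@zred_indep 5) => //; apply: homog_lin.
(* The two reductions of [x^2 y] differ by a multiple of [z^4] by a linear form, which lies in [I]
   and must be zero: this is associativity. *)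
have [e1 e2 e3] : [/\ d1 * c1 + d2 * d1 + d0 - (c1 * d1 + c2 * f1) = 0,
    d1 * c2 + d2 * d2 - (c1 * d2 + c2 * f2 + c0) = 0 & d1 * c0 + d2 * d0 - (c1 * d0 + c2 * f0) = 0].
  apply: ind5.
  have h1 : I (Z ^+ 3 * (X * lin d1 d2 d0) - Z ^+ 3 * (Y * lin c1 c2 c0)).
    rewrite (_ : _ - _ = Y * (Z ^+ 2 * (X * X) - Z ^+ 3 * lin c1 c2 c0) - X * (Z ^+ 2 * (X * Y) - Z ^+ 3 * lin d1 d2 d0)).
      by apply: (hiB hI); apply: hiM.
    by ring.
  rewrite (_ : _ * _ = (Z ^+ 3 * (X * lin d1 d2 d0) - Z ^+ 3 * (Y * lin c1 c2 c0)) -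
     (Z ^+ 3 * (X * lin d1 d2 d0) - Z ^+ 4 * vX d1 d2 d0) + (Z ^+ 3 * (Y * lin c1 c2 c0) - Z ^+ 4 * vY c1 c2 c0)).
    by apply: (hiD hI) => //; apply: (hiB hI).
  by rewrite /vX /vY /lin -!mul_mpolyC; ring.
have [e4 e5 e6] : [/\ f1 * c1 + f2 * d1 + f0 - (d1 * d1 + d2 * f1) = 0,
    f1 * c2 + f2 * d2 - (d1 * d2 + d2 * f2 + d0) = 0 & f1 * c0 + f2 * d0 - (d1 * d0 + d2 * f0) = 0].
  apply: ind5.
  have h1 : I (Z ^+ 3 * (X * lin f1 f2 f0) - Z ^+ 3 * (Y * lin d1 d2 d0)).
    rewrite (_ : _ - _ = Y * (Z ^+ 2 * (X * Y) - Z ^+ 3 * lin d1 d2 d0) - X * (Z ^+ 2 * (Y * Y) - Z ^+ 3 * lin f1 f2 f0)).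
      by apply: (hiB hI); apply: hiM.
    by ring.
  rewrite (_ : _ * _ = (Z ^+ 3 * (X * lin f1 f2 f0) - Z ^+ 3 * (Y * lin d1 d2 d0)) -
     (Z ^+ 3 * (X * lin f1 f2 f0) - Z ^+ 4 * vX f1 f2 f0) + (Z ^+ 3 * (Y * lin d1 d2 d0) - Z ^+ 4 * vY d1 d2 d0)).
    by apply: (hiD hI) => //; apply: (hiB hI).
  by rewrite /vX /vY /lin -!mul_mpolyC; ring.
have ec0 : c0 = ch_c0 c1 c2 d1 d2 f2.
  by apply/eqP; rewrite -subr_eq0; apply/eqP; rewrite -[RHS]oppr0 -e2 /ch_c0; ring.
have ed0 : d0 = ch_d0 c2 d1 d2 f1.
  by apply/eqP; rewrite -subr_eq0; apply/eqP; rewrite -[RHS]e1 /ch_d0; ring.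
have ef0 : f0 = ch_f0 c1 d1 d2 f1 f2.
  by apply/eqP; rewrite -subr_eq0; apply/eqP; rewrite -[RHS]e4 /ch_f0; ring.
exists c1, c2, d1, d2, f1, f2; split; last first.
  rewrite /ch_n1 /ch_n2 /ch_n3 -ec0 -ed0 -ef0.
  split.
  + by rewrite (_ : _ * _ = Z ^+ 2 * (X * X) - Z ^+ 3 * lin c1 c2 c0) //; ring.
  + by rewrite (_ : _ * _ = Z ^+ 2 * (X * Y) - Z ^+ 3 * lin d1 d2 d0) //; ring.
  + by rewrite (_ : _ * _ = Z ^+ 2 * (Y * Y) - Z ^+ 3 * lin f1 f2 f0) //; ring.
set A := chX _ _ _ _ _ _; set B := chY _ _ _ _ _ _.
have AB : A * B = B * A by apply: chXY.
pose linv (v : 'rV[k]_3) : S := lin (v 0 i1) (v 0 i2) (v 0 i0).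
have linvE a b c : linv (row3 c a b) = lin a b c by rewrite /linv !mxE.
have linvD u v : linv (u + v) = linv u + linv v by rewrite /linv linD !mxE.
(* Evaluation computes the normal form modulo [I]; the factor [z^3] lifts forms of low degree into
   the range where normal forms are unique. *)
have key d p : (1 <= d)%N -> homog_of d p -> I (Z ^+ 3 * p - Z ^+ d.+2 * linv (evd A B d p)).
  move: d p; apply: homog_ind => [d p q hp hq|p hp|d p d1' hp hI'].
  - rewrite evdD linvD (_ : _ - _ = (Z ^+ 3 * p - Z ^+ d.+2 * linv (evd A B d p)) +
      (Z ^+ 3 * q - Z ^+ d.+2 * linv (evd A B d q))); last by ring.
    exact: (hiD hI).
  - rewrite (homog1_lin hp) ch_evd1 linvE subrr; exact: (hi0 hI).
  have shift v (w : S) : I (Z ^+ 3 * (v * linv (evd A B d p)) - Z ^+ 4 * w) -> I (Z ^+ 3 * (v * p) - Z ^+ d.+3 * w).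
    move=> h; rewrite (_ : _ - _ = v * (Z ^+ 3 * p - Z ^+ d.+2 * linv (evd A B d p)) +
      Z ^+ d.-1 * (Z ^+ 3 * (v * linv (evd A B d p)) - Z ^+ 4 * w)).
      by apply: (hiD hI); apply: hiM.
    have -> : d.+3 = (d.-1 + 4)%N by lia.
    have -> : d.+2 = (d.-1 + 3)%N by lia.
    by rewrite !exprD; ring.
  split.
  - rewrite (evdXM AB hp); apply: shift; set v := evd A B d p.
    rewrite (row3P v) row3_chX !linvE.
    have := redX (v 0 i1) (v 0 i2) (v 0 i0); rewrite /vX -ec0 -ed0.
    by rewrite [_ * c1 + _ + _]addrC addrA.
  - rewrite (evdYM hp); apply: shift; set v := evd A B d p.
    rewrite (row3P v) row3_chY !linvE.
    have := redY (v 0 i1) (v 0 i2) (v 0 i0); rewrite /vY -ef0 -ed0.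
    by rewrite [v 0 i1 * d2 + _ + _]addrC addrA.
  - rewrite (evdZM hp); apply: shift.
    rewrite (_ : _ - _ = 0); first exact: (hi0 hI).
    by ring.
move=> d p d0' Ip hp; have := key d p d0' hp.
move=> h; have : I (Z ^+ d.+2 * linv (evd A B d p)).
  rewrite (_ : _ * _ = Z ^+ 3 * p - (Z ^+ 3 * p - Z ^+ d.+2 * linv (evd A B d p))); last by ring.
  by apply: (hiB hI) => //; apply: hiM.
move/(@zred_indep d.+3 _ _ (homog_lin (a:=_) (b:=_) (c:=_)))/lin_neq0 => [|a0 b0 c0'] //.
rewrite (row3P (evd A B d p)) a0 b0 c0'.
by apply/rowP => j; rewrite !mxE; case: (ord3 j) => ->.
Qed.

End ZReduced.
End Recognition.

(** * Ideals with a pencil of conics coprime on [z = 0] *)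

Section Pencils.
Variable k : closedFieldType.
Local Notation S := {mpoly k[3]}.
Local Notation X := (X3 k).
Local Notation Y := (Y3 k).
Local Notation Z := (Z3 k).
Implicit Types (p q : S) (I : ideal_pred k).

Section NormalPencil.
Variables (I : ideal_pred k) (HI : Hpt I) (la mu : k) (q1 q2 : S).
Hypotheses (npq : normal_pencil la mu q1 q2) (nz : la + mu ^+ 2 != 0) (Iq1 : I q1) (Iq2 : I q2).

Let hI := Hpt_hideal HI.
Let h1 : homog_of 2 q1. Proof. by case: npq. Qed.
Let h2 : homog_of 2 q2. Proof. by case: npq. Qed.

Lemma pencil_low : exists l1 l2, [/\ homog_of 1 l1, homog_of 1 l2,
  q1 = X * X + la *: (Y * Y) + Z * l1 & q2 = X * Y + mu *: (Y * Y) + Z * l2].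
Proof.
have [_ _ [a1 a2 a3] [b1 b2 b3]] := npq.
exists (lin q1@_(mon 1 0 1) q1@_(mon 0 1 1) q1@_(mon 0 0 2)).
exists (lin q2@_(mon 1 0 1) q2@_(mon 0 1 1) q2@_(mon 0 0 2)).
split; try exact: homog_lin.
  by rewrite {1}(quad_form h1) a1 a2 a3 scale1r scale0r addr0.
by rewrite {1}(quad_form h2) b1 b2 b3 scale1r scale0r add0r.
Qed.

(** Coprime binary quadrics generate all binary cubics. Explicitly, [(la + mu^2) y^3] is a
    combination of [q1] and [q2] up to multiples of [z], and [x y^2], [x^2 y], [x^3] follow in
    turn. *)
Lemma pencil_zdiv3 p : homog_of 3 p -> exists a q, [/\ I a, homog_of 3 a, homog_of 2 q & p = a + Z * q].
Proof.
move=> hp; have [l1 [l2 [hl1 hl2 e1 e2]]] := pencil_low.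
pose P q := exists a r, [/\ I a, homog_of 3 a, homog_of 2 r & q = a + Z * r].
have PD q r : P q -> P r -> P (q + r).
  move=> [a [b [Ia ha hb ->]]] [c [d [Ic hc hd ->]]]; exists (a + c), (b + d).
  by split; [exact: hiD|exact: homogD|exact: homogD|ring].
have PZ c q : P q -> P (c *: q).
  move=> [a [b [Ia ha hb ->]]]; exists (c *: a), (c *: b).
  by split; [exact: hiZ|exact: homogZ|exact: homogZ|rewrite -!mul_mpolyC; ring].
have PI q : I q -> homog_of 3 q -> P q.
  by move=> Iq hq; exists q, 0; split=> //; [exact: homog0|rewrite mulr0 addr0].
have Pz q : homog_of 2 q -> P (Z * q).
  by move=> hq; exists 0, q; split=> //; [exact: (hi0 hI)|exact: homog0|rewrite add0r].
have Pz' q : homog_of 2 q -> P (- (Z * q)) by move=> hq; rewrite -scaleN1r; apply/PZ/Pz.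
have hX := homogXM; have hY := homogYM.
have PYY : P (Y * (Y * Y)).
  have -> : Y * (Y * Y) = (la + mu ^+ 2)^-1 *: (Y * q1 - X * q2 + mu *: (Y * q2) -
      Z * (Y * l1 - X * l2 + mu *: (Y * l2))).
    apply: (scalerI nz); rewrite scalerA divff // scale1r e1 e2 -!mul_mpolyC mpolyCD rmorphXn /=; ring.
  apply/PZ/PD.
    apply: (PI); last by apply: homogD; [apply: homogB; [apply: hY|apply: hX]|apply/homogZ/hY].
    by apply: (hiD hI); [apply: (hiB hI); apply: hiM|apply: (hiZ hI); apply: hiM].
  apply: (Pz'); apply: homogD; first by apply: homogB; [apply: hY|apply: hX].
  by apply/homogZ/hY.
have PXYY : P (X * (Y * Y)).
  have -> : X * (Y * Y) = Y * q2 - mu *: (Y * (Y * Y)) - Z * (Y * l2) by rewrite e2 -!mul_mpolyC; ring.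
  apply: (PD); last by apply: (Pz'); apply: hY.
  apply: (PD); last by rewrite -scaleNr; apply: (PZ).
  by apply: (PI); [apply: hiM|apply: hY].
have PXXY : P (X * (X * Y)).
  have -> : X * (X * Y) = X * q2 - mu *: (X * (Y * Y)) - Z * (X * l2) by rewrite e2 -!mul_mpolyC; ring.
  apply: (PD); last by apply: (Pz'); apply: hX.
  apply: (PD); last by rewrite -scaleNr; apply: (PZ).
  by apply: (PI); [apply: hiM|apply: hX].
have PXXX : P (X * (X * X)).
  have -> : X * (X * X) = X * q1 - la *: (X * (Y * Y)) - Z * (X * l1) by rewrite e1 -!mul_mpolyC; ring.
  apply: (PD); last by apply: (Pz'); apply: hX.
  apply: (PD); last by rewrite -scaleNr; apply: (PZ).
  by apply: (PI); [apply: hiM|apply: hX].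
have Pv v (hv : homog_of 1 v) r : homog_of 2 r -> P (v * (X * X)) -> P (v * (X * Y)) -> P (v * (Y * Y)) -> P (v * r).
  move=> hr a b c; rewrite (quad_form hr); set l := lin _ _ _.
  have hl : homog_of 1 l by apply: homog_lin.
  move: l hl => l hl; rewrite !mulrDr -!scalerAr.
  apply: (PD); last by rewrite mulrCA; apply: (Pz); apply: (homogM hv).
  by do 2?apply: (PD); apply: (PZ).
have [p0 [p1 [p2 [g0 g1 g2 ->]]]] := homog_split hp.
apply: (PD); last by apply: (Pz).
apply: (PD).
  by apply: (Pv) => //; apply: homogX3.
apply: (Pv); [exact: homogY3|by []| | |].
- by rewrite mulrCA [Y * X]mulrC.
- by rewrite mulrCA.
- by [].
Qed.

Lemma pencil_zdiv d p : (3 <= d)%N -> homog_of d p ->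
  exists a q, [/\ I a, homog_of d a, homog_of d.-1 q & p = a + Z * q].
Proof.
move: d p; apply: homog_ind => [d p q [a [b [Ia ha hb ->]]] [c [e [Ic hc he ->]]]|p|d p d3 hp [a [q [Ia ha hq ->]]]].
- exists (a + c), (b + e); by split; [exact: hiD|exact: homogD|exact: homogD|ring].
- exact: pencil_zdiv3.
have ed : d = d.-1.+1 by lia.
split.
- exists (X * a), (X * q); split; [exact: hiM|exact: homogXM|by rewrite /= [d in homog_of d _]ed; apply: homogXM|ring].
- exists (Y * a), (Y * q); split; [exact: hiM|exact: homogYM|by rewrite /= [d in homog_of d _]ed; apply: homogYM|ring].
- exists (Z * a), (Z * q); split; [exact: hiM|exact: homogZM|by rewrite /= [d in homog_of d _]ed; apply: homogZM|ring].
Qed.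

(** Repeated division by [z] ends with a quadric, so four forms span the quotient, one more than its
    dimension. *)
Lemma pencil_span d p : (4 <= d)%N -> homog_of d p -> exists a c l,
  [/\ I a, homog_of d a, homog_of 1 l & p = a + c *: (Z ^+ (d - 2) * (Y * Y)) + Z ^+ d.-1 * l].
Proof.
have [l1 [l2 [hl1 hl2 e1 e2]]] := pencil_low.
have quad q : homog_of 2 q -> exists a c l, [/\ I a, homog_of 2 a, homog_of 1 l & q = a + c *: (Y * Y) + Z * l].
  move=> hq; rewrite (quad_form hq); set u := q@__; set v := q@__; set w := q@__; set l := lin _ _ _.
  exists (u *: q1 + v *: q2), (w - u * la - v * mu), (l - u *: l1 - v *: l2); split.
  - by apply: (hiD hI); apply: (hiZ hI).
  - by apply: homogD; apply: homogZ.
  - by apply: homogB; [apply: homogB; [apply: homog_lin|apply: homogZ]|apply: homogZ].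
  by rewrite e1 e2; move: l u v w => l u v w; rewrite -!mul_mpolyC !mpolyCB !mpolyCM; ring.
have gen n q : homog_of (n + 2) q -> exists a c l,
    [/\ I a, homog_of (n + 2) a, homog_of 1 l & q = a + c *: (Z ^+ n * (Y * Y)) + Z ^+ n.+1 * l].
  elim: n q => [|n IH] q hq.
    by have [a [c [l [Ia ha hl ->]]]] := quad q hq; exists a, c, l; rewrite expr0 expr1 mul1r.
  have [||a [r [Ia ha hr ->]]] := @pencil_zdiv (n.+1 + 2) q; [by lia|by []|].
  have [b [c [l [Ib hb hl ->]]]] := IH r hr.
  exists (a + Z * b), c, l; split=> //.
  - by apply: (hiD hI) => //; apply: hiM.
  - by apply: homogD => //; apply: homogZM.
  - by rewrite -!mul_mpolyC !exprS; move: (Z ^+ n) => w; ring.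
move=> d4 hp; have [|a [c [l [Ia ha hl e]]]] := gen (d - 2)%N p; first by rewrite subnK // ltnW // ltnW.
exists a, c, l; split=> //; first by rewrite -(subnK (ltnW (ltnW d4))).
by rewrite e; congr (_ + _ * _); congr (_ ^+ _); lia.
Qed.

(* Otherwise the quotient in degree 5 would be spanned by at most two elements. *)
Lemma pencil_zred p : homog_of 4 p -> exists a l, [/\ I a, homog_of 4 a, homog_of 1 l & p = a + Z ^+ 3 * l].
Proof.
have [l1 [l2 [hl1 hl2 e1 e2]]] := pencil_low.
suff [b [m [Ib hb hm eY]]] : exists b m, [/\ I b, homog_of 4 b, homog_of 1 m & Z ^+ 2 * (Y * Y) = b + Z ^+ 3 * m].
  move=> hp; have [//|a [c [l [Ia ha hl ->]]]] := @pencil_span 4 p _ hp.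
  exists (a + c *: b), (c *: m + l); rewrite [(4 - 2)%N]/= eY; split.
  - by apply: (hiD hI) => //; apply: (hiZ hI).
  - by apply: homogD => //; apply: homogZ.
  - by apply: homogD => //; apply: homogZ.
  - by rewrite -!mul_mpolyC; ring.
have hYY : homog_of 2 (Y * Y) by apply: homogYM (@homogY3 k).
have hz d q : homog_of 1 q -> homog_of d.+1 (Z ^+ d * q) by move=> hq; rewrite -addn1; apply: homogZX.
have hzX d : homog_of d.+1 (Z ^+ d * X) by apply: hz; apply: homogX3.
have hzY d : homog_of d.+1 (Z ^+ d * Y) by apply: hz; apply: homogY3.
have hzZ d : homog_of d.+1 (Z ^+ d * Z) by apply: hz; apply: homogZ3.
have [||c [Ic [i i4 ci]]] := @Hpt_relation _ I HI 4 [:: Z ^+ 2 * (Y * Y); Z ^+ 3 * X; Z ^+ 3 * Y; Z ^+ 3 * Z].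
- move=> q; rewrite !inE => /or4P[] /eqP ->; [exact: (@homogZX _ 2 2)|exact: hzX|exact: hzY|exact: hzZ].
- by [].
pose l := lin (c 1%N) (c 2%N) (c 3%N) : S.
have {}Ic : I (c 0%N *: (Z ^+ 2 * (Y * Y)) + Z ^+ 3 * l).
  move: Ic; rewrite !lcomb_cons lcomb_nil; congr I; rewrite /l /lin -!mul_mpolyC; ring.
have hl : homog_of 1 l by apply: homog_lin.
case: (eqVneq (c 0%N) 0) => [c0|c0]; last first.
  exists ((c 0%N)^-1 *: (c 0%N *: (Z ^+ 2 * (Y * Y)) + Z ^+ 3 * l)), (- ((c 0%N)^-1 *: l)); split.
  - exact: (hiZ hI).
  - by apply/homogZ/homogD; [apply/homogZ/(@homogZX _ 2 2)|apply: hz].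
  - by apply/homogN/homogZ.
  rewrite scalerDr scalerA mulVf // scale1r mulrN scalerAr; ring.
exfalso; move: Ic; rewrite c0 scale0r add0r => Il.
have codim d t : (4 <= d)%N -> size t = 3 ->
    (forall q, homog_of d q -> exists a, [/\ I a, homog_of d a & spanS t (q - a)]) ->
    forall c, I (lcomb c t) -> homog_of d (lcomb c t) -> forall i, (i < 3)%N -> c i = 0.
  move=> d4 st ht c' Ic' hc' j j3; apply: (@Hpt_codim _ I HI d t) => //; rewrite ?st //.
  by rewrite (hdim_ge4 d4) subnK // (leq_trans (_ : 3 <= 'C(6, 2))%N) // leq_bin2l.
(* If [z^3 y^2] were reducible too, the three forms [z^4 x], [z^4 y], [z^5] would be independent in
   degree 5, against the relation [z^4 l]. *)
have fromY : ~ exists b m, [/\ I b, homog_of 5 b, homog_of 1 m & Z ^+ 3 * (Y * Y) = b + Z ^+ 4 * m].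
  move=> [b [m [Ib hb hm eY]]].
  have h := @codim 5 [:: Z ^+ 4 * X; Z ^+ 4 * Y; Z ^+ 4 * Z] isT erefl _ (nth 0 [:: c 1%N; c 2%N; c 3%N]).
  have el : lcomb (nth 0 [:: c 1%N; c 2%N; c 3%N]) [:: Z ^+ 4 * X; Z ^+ 4 * Y; Z ^+ 4 * Z] = Z ^+ 4 * l.
    by rewrite lcomb3 /l /lin !mulrDr -!scalerAr.
  have {}h j : (j < 3)%N -> nth 0 [:: c 1%N; c 2%N; c 3%N] j = 0.
    apply: h; rewrite ?el; last exact: hz.
      move=> q hq; have [//|a [e [n [Ia ha hn ->]]]] := @pencil_span 5 q _ hq.
      exists (a + e *: b); rewrite [(5 - 2)%N]/= eY; split.
      - by apply: (hiD hI) => //; apply: (hiZ hI).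
      - by apply: homogD => //; apply: homogZ.
      have -> : a + e *: (b + Z ^+ 4 * m) + Z ^+ 5.-1 * n - (a + e *: b) = Z ^+ 4 * (e *: m + n).
        by rewrite -!mul_mpolyC /=; ring.
      have hmn : homog_of 1 (e *: m + n) by apply: homogD => //; apply: homogZ.
      rewrite (homog1_lin hmn); exists (nth 0 [:: (e *: m + n)@_(mon 1 0 0); (e *: m + n)@_(mon 0 1 0); (e *: m + n)@_(mon 0 0 1)]).
      by rewrite lcomb3 /lin !mulrDr -!scalerAr.
    by rewrite exprS -mulrA; apply: hiM.
  case: i i4 ci => [|[|[|[|//]]]] _ /eqP; apply; rewrite ?c0 //.
  - exact: (h 0%N).
  - exact: (h 1%N).
  - exact: (h 2%N).
have nonz (e : k) m : homog_of 1 m -> I (e *: (Z ^+ 3 * (Y * Y)) + Z ^+ 4 * m) -> e = 0.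
  move=> hm Ie; apply/eqP; apply: contraT => e0; case: fromY.
  exists (e^-1 *: (e *: (Z ^+ 3 * (Y * Y)) + Z ^+ 4 * m)), (- (e^-1 *: m)); split.
  - exact: (hiZ hI).
  - by apply/homogZ/homogD; [apply/homogZ/(@homogZX _ 3 2)|apply: hz].
  - by apply/homogN/homogZ.
  rewrite scalerDr scalerA mulVf // scale1r mulrN scalerAr; ring.
(* The products of [z^3 l] with [y] and with [x] must not involve [z^3 y^2]. As [la + mu^2] is
   nonzero, this leaves [z^4] in [I], and then the quotient in degree 6 is zero. *)
have a2 : c 2%N - mu * c 1%N = 0.
  apply: (nonz _ (c 3%N *: Y - c 1%N *: l2)); first by apply: homogB; apply: homogZ => //; apply: homogY3.
  have -> : (c 2%N - mu * c 1%N) *: (Z ^+ 3 * (Y * Y)) + Z ^+ 4 * (c 3%N *: Y - c 1%N *: l2) =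
     Y * (Z ^+ 3 * l) - c 1%N *: (Z ^+ 3 * q2).
    by rewrite e2 /l /lin -!mul_mpolyC mpolyCB mpolyCM; ring.
  by apply: (hiB hI); [apply: hiM|apply: (hiZ hI); apply: hiM].
have a1 : - la * c 1%N - mu * c 2%N = 0.
  apply: (nonz _ (c 3%N *: X - c 1%N *: l1 - c 2%N *: l2)).
    by apply: homogB; [apply: homogB|]; apply: homogZ => //; apply: homogX3.
  have -> : (- la * c 1%N - mu * c 2%N) *: (Z ^+ 3 * (Y * Y)) + Z ^+ 4 * (c 3%N *: X - c 1%N *: l1 - c 2%N *: l2) =
     X * (Z ^+ 3 * l) - c 1%N *: (Z ^+ 3 * q1) - c 2%N *: (Z ^+ 3 * q2).
    by rewrite e1 e2 /l /lin -!mul_mpolyC mpolyCB !mpolyCM mpolyCN; ring.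
  by apply: (hiB hI); [apply: (hiB hI); [apply: hiM|apply: (hiZ hI); apply: hiM]|apply: (hiZ hI); apply: hiM].
have c2E : c 2%N = mu * c 1%N by apply/eqP; rewrite -subr_eq0 a2.
have c1E : c 1%N = 0.
  have : (la + mu ^+ 2) * c 1%N = 0 by rewrite -[RHS]oppr0 -a1 c2E; ring.
  by move/eqP; rewrite mulf_eq0 (negPf nz) => /eqP.
have c3 : c 3%N != 0.
  by case: i i4 ci => [|[|[|[|//]]]] _; rewrite ?c0 ?c2E ?c1E ?mulr0 ?eqxx.
have Iz : I (Z ^+ 4).
  have := hiZ hI (c 3%N)^-1 Il; rewrite /l c2E c1E mulr0 /lin !scale0r !add0r -scalerAr scalerA.
  by rewrite mulVf // scale1r -exprSr.
have := @codim 6 [:: 0; 0; 0] isT erefl _ (fun=> 1).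
have -> : lcomb (fun=> 1) [:: 0; 0; 0] = 0 :> S by rewrite !lcomb_cons lcomb_nil !scaler0 !addr0.
move=> h; have := h _ (hi0 hI) (@homog0 k 6) 0%N isT; suff hh : forall q : S, homog_of 6 q ->
   exists a : Defs.S k, [/\ I a, homog_of 6 a & spanS [:: 0; 0; 0] (q - a)].
  by move/(_ hh)/eqP; rewrite oner_eq0.
move=> q hq; exists q; split=> //; last by rewrite subrr; apply: spanS0.
have [//|a [e [n [Ia ha hn ->]]]] := @pencil_span 6 q _ hq.
have -> : a + e *: (Z ^+ (6 - 2) * (Y * Y)) + Z ^+ 6.-1 * n = a + e *: (Y * Y * Z ^+ 4) + Z * n * Z ^+ 4.
  by rewrite -!mul_mpolyC /= exprS; move: (Z ^+ 4) => w; ring.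
by do 2?apply: (hiD hI) => //; [apply: (hiZ hI)|]; apply: hiM.
Qed.

(** All of [I] evaluates to zero at the three points. This determines the [z]-terms of [q1] and [q2]
    from the structure constants, and equal dimensions give the rest. *)
Lemma pencil_chart : exists c1 c2 d1 d2 f1 f2, I = chartI c1 c2 d1 d2 f1 f2 la mu.
Proof.
have [c1 [c2 [d1 [d2 [f1 [f2 [hev _]]]]]]] := zred_chart HI pencil_zred.
exists c1, c2, d1, d2, f1, f2; apply: ideal_ext.
have HJ := chart_Hpt c1 c2 d1 d2 f1 f2 nz.
apply: Hpt_eq => // d p hp Ip; set A := chX _ _ _ _ _ _ in hev *; set B := chY _ _ _ _ _ _ in hev *.
have AB : A * B = B * A by apply: chXY.
have [l1 [l2 [hl1 hl2 e1 e2]]] := pencil_low.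
have eq1 : q1 = ch_q1 c1 c2 d1 d2 f1 f2 la.
  have := hev 2 q1 isT Iq1 h1; rewrite /ch_q1 e1 => e.
  have /eqP : evd A B 2 (q1 - ch_q1 c1 c2 d1 d2 f1 f2 la) = 0.
    by rewrite evdB hev // ch_evd_q1 subrr.
  rewrite e1 /ch_q1 /ch_n1 /ch_n3 (homog1_lin hl1); set u := l1@__; set v := l1@__; set w := l1@__.
  rewrite (_ : _ - _ = Z * (lin u v w + (lin c1 c2 (ch_c0 c1 c2 d1 d2 f2) + la *: lin f1 f2 (ch_f0 c1 d1 d2 f1 f2)))); last first.
    by move: u v w (ch_c0 _ _ _ _ _) (ch_f0 _ _ _ _ _) => u v w a0 g0; rewrite /lin -!mul_mpolyC; ring.
  rewrite linZ !linD ch_evdZlin => /eqP/rowP h0.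
  have := h0 i0; have := h0 i1; have := h0 i2; rewrite !mxE /= => h2' h1' h0'.
  apply/eqP; rewrite -subr_eq0; apply/eqP.
  rewrite (_ : _ - _ = Z * (lin u v w + (lin c1 c2 (ch_c0 c1 c2 d1 d2 f2) + la *: lin f1 f2 (ch_f0 c1 d1 d2 f1 f2)))); last first.
    by clear h0 h0' h1' h2'; move: u v w (ch_c0 _ _ _ _ _) (ch_f0 _ _ _ _ _) => u v w a0 g0; rewrite /lin -!mul_mpolyC; ring.
  by rewrite linZ !linD h2' h1' h0' /lin !scale0r !addr0 mulr0.
have eq2 : q2 = ch_q2 c1 c2 d1 d2 f1 f2 mu.
  have /eqP : evd A B 2 (q2 - ch_q2 c1 c2 d1 d2 f1 f2 mu) = 0.
    by rewrite evdB hev // ch_evd_q2 subrr.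
  rewrite e2 /ch_q2 /ch_n2 /ch_n3 (homog1_lin hl2); set u := l2@__; set v := l2@__; set w := l2@__.
  rewrite (_ : _ - _ = Z * (lin u v w + (lin d1 d2 (ch_d0 c2 d1 d2 f1) + mu *: lin f1 f2 (ch_f0 c1 d1 d2 f1 f2)))); last first.
    by move: u v w (ch_d0 _ _ _ _) (ch_f0 _ _ _ _ _) => u v w a0 g0; rewrite /lin -!mul_mpolyC; ring.
  rewrite linZ !linD ch_evdZlin => /eqP/rowP h0.
  have := h0 i0; have := h0 i1; have := h0 i2; rewrite !mxE /= => h2' h1' h0'.
  apply/eqP; rewrite -subr_eq0; apply/eqP.
  rewrite (_ : _ - _ = Z * (lin u v w + (lin d1 d2 (ch_d0 c2 d1 d2 f1) + mu *: lin f1 f2 (ch_f0 c1 d1 d2 f1 f2)))); last first.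
    by clear h0 h0' h1' h2'; move: u v w (ch_d0 _ _ _ _) (ch_f0 _ _ _ _ _) => u v w a0 g0; rewrite /lin -!mul_mpolyC; ring.
  by rewrite linZ !linD h2' h1' h0' /lin !scale0r !addr0 mulr0.
have [_ _ [a1 a2 a3] [b1 b2 b3]] := npq.
apply/(model_homog _ _ _ _ hp) => //; [exact: lin_span2|exact: lin_syz|].
case: d p hp Ip => [|[|[|[|d]]]] p hp Ip /=.
- exact: (Hpt_low HI _ hp Ip).
- exact: (Hpt_low HI _ hp Ip).
- have [|||c ->] := @Hpt_span _ I HI 2 [:: q1; q2] _ _ _ p Ip hp => //.
  + by move=> q; rewrite !inE => /orP[] /eqP ->.
  + exact: freeS_coef2 a1 b1 a2 b2.
  by exists (c 0%N), (c 1%N); rewrite !lcomb_cons lcomb_nil addr0 -eq1 -eq2.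
- have [|||c ->] := @Hpt_span _ I HI 3 (six q1 q2) _ _ _ p Ip hp => //.
  + move=> q; rewrite !inE => /or4P[/eqP ->|/eqP ->|/eqP ->|/or3P[/eqP ->|/eqP ->|/eqP ->]];
     (split; [exact: hiM|by [apply: homogXM|apply: homogYM|apply: homogZM]]).
  + exact: normal_pencil_free npq nz.
  rewrite six_lcomb -eq1 -eq2; exists (lin (c 0%N) (c 1%N) (c 2%N)), (lin (c 3%N) (c 4%N) (c 5%N)).
  by split=> //; apply: homog_lin.
- exact: hev.
Qed.

End NormalPencil.
End Pencils.

(** * Closed conditions on pairs of forms *)

Section ClosedConditions.
Variable k : closedFieldType.
Local Notation S := {mpoly k[3]}.
Implicit Types (p q : S) (I : ideal_pred k).
Local Notation closedG := (@closedG k 20 N5 (ideal_pred k) (@Hpt k) (@lowbasis k)).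

Definition pair_co (x : bool * 'X_{1..3}) (u : S * S) : k := (if x.1 then u.1 else u.2)@_x.2.

(** The components of degree [d] of two rows of a frame run through all pairs of elements of
    [J_d]. *)
Lemma closed_pairs d (f : S * S -> k) : (d <= 4)%N -> pfun pair_co f ->
  closedG (fun J => Hpt J /\ forall p q, J p -> J q -> homog_of d p -> homog_of d q -> f (p, q) = 0).
Proof.
move=> d4 pf; pose comp (T : 'M[k]_(20, N5)) i := hcomp d (rowpoly (row i T)).
exists (fun g => exists i j, g = fun T => f (comp T i, comp T j)); split=> [g [i [j ->]]|J].
  have pc l m : pfun (mx_co 20 N5) (fun T => (comp T l)@_m).
    case: (m \in mons d) /idP => [|hm]; last first.
      apply: (pf_ext (pf_const _ 0)) => T; rewrite mcoeff_hcomp ifN //.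
      by apply/negP => h; apply: hm; rewrite mem_mons.
    rewrite mem_mons => /eqP e.
    have m5 : (mdeg m < 5)%N by rewrite e ltnS.
    apply: (pf_ext (pf_coord _ (l, enum_rank (BMultinom m5)))) => T.
    by rewrite mcoeff_hcomp e eqxx (rowpoly_coef _ (BMultinom m5)) mxE.
  by apply: (pf_comp (h := fun T => (comp T i, comp T j))) pf => -[[] m]; apply: pc.
split=> [[HJ h]|[HJ h]]; split=> //.
  move=> g [i [j ->]] T.
  have hT : forall i, J (rowpoly (row i (T *m lowbasis J))) by apply/lowbasis_rows => //; exists T.
  by apply: h; try exact: hcomp_homog; apply: hihc => //; apply: Hpt_hideal.
move=> p q Jp Jq hp hq.
pose i0' : 'I_20 := ord0; pose i1' : 'I_20 := lift ord0 ord0.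
pose M : 'M[k]_(20, N5) := \matrix_i polyrow (if i == i0' then p else if i == i1' then q else 0).
have lw r : homog_of d r -> low r by apply: low_homog.
have [T eT] : exists T, M = T *m lowbasis J.
  apply/lowbasis_rows => // i; rewrite rowK; case: eqP => _; first by rewrite polyrowK //; apply: lw.
  case: eqP => _; first by rewrite polyrowK //; apply: lw.
  by rewrite polyrowK; [exact: (hi0 (Hpt_hideal HJ))|move=> m _; rewrite mcoeff0].
have := h _ (ex_intro _ i0' (ex_intro _ i1' erefl)) T; rewrite -eT /comp !rowK /=.
by rewrite !polyrowK ?hcomp_id //; apply: lw.
Qed.

End ClosedConditions.

(** * Pluecker coordinates of pencils of conics and their behaviour under substitution *)

Section CoprimePencils.
Variable k : closedFieldType.
Hypothesis char2 : (2%:R : k) != 0.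
Local Notation S := {mpoly k[3]}.
Local Notation X := (X3 k).
Local Notation Y := (Y3 k).
Local Notation Z := (Z3 k).
Implicit Types (p q u v : S) (M : 'M[k]_3).

Definition plu m m' u v : k := u@_m * v@_m' - u@_m' * v@_m.
Definition pencilP u v := plu (mon 2 0 0) (mon 1 1 0) u v.
(** The resultant of the restrictions of [u] and [v] to [z = 0]. The minor [pencilP] decides whether
    the pencil can be normalised to leading terms [x^2] and [x y]. *)
Definition pencilR u v := plu (mon 2 0 0) (mon 0 2 0) u v ^+ 2 +
  plu (mon 2 0 0) (mon 1 1 0) u v * plu (mon 0 2 0) (mon 1 1 0) u v.

Lemma substX3 M : subst M X = lin (M i0 i0) (M i0 i1) (M i0 i2).
Proof.
have -> : X = 'X_i0 by congr mpolyX; apply/monP; rewrite !monE !mnmE.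
by rewrite substX /linrow 3!big_ord_recl big_ord0 addr0 !mxE /lin addrA; congr (_ *: 'X_[_] + _ *: 'X_[_] + _ *: 'X_[_]);
  rewrite ?mxE; try (congr (M _ _); exact: val_inj); apply/monP; rewrite !monE !mnmE.
Qed.

Definition qval u (a b c : k) := u@_(mon 2 0 0) * a ^+ 2 + u@_(mon 1 1 0) * (a * b) + u@_(mon 0 2 0) * b ^+ 2 +
  u@_(mon 1 0 1) * (a * c) + u@_(mon 0 1 1) * (b * c) + u@_(mon 0 0 2) * c ^+ 2.

Definition qpol u (a b c a' b' c' : k) := u@_(mon 2 0 0) * (2%:R * a * a') + u@_(mon 1 1 0) * (a * b' + a' * b) +
  u@_(mon 0 2 0) * (2%:R * b * b') + u@_(mon 1 0 1) * (a * c' + a' * c) + u@_(mon 0 1 1) * (b * c' + b' * c) +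
  u@_(mon 0 0 2) * (2%:R * c * c').

Lemma substY3 M : subst M Y = lin (M i1 i0) (M i1 i1) (M i1 i2).
Proof.
have -> : Y = 'X_i1 by congr mpolyX; apply/monP; rewrite !monE !mnmE.
by rewrite substX /linrow 3!big_ord_recl big_ord0 addr0 !mxE /lin addrA; congr (_ *: 'X_[_] + _ *: 'X_[_] + _ *: 'X_[_]);
  rewrite ?mxE; try (congr (M _ _); exact: val_inj); apply/monP; rewrite !monE !mnmE.
Qed.

Lemma substZ3 M : subst M Z = lin (M i2 i0) (M i2 i1) (M i2 i2).
Proof.
have -> : Z = 'X_i2 by congr mpolyX; apply/monP; rewrite !monE !mnmE.
by rewrite substX /linrow 3!big_ord_recl big_ord0 addr0 !mxE /lin addrA; congr (_ *: 'X_[_] + _ *: 'X_[_] + _ *: 'X_[_]);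
  rewrite ?mxE; try (congr (M _ _); exact: val_inj); apply/monP; rewrite !monE !mnmE.
Qed.

Lemma coef_lin a b c : ((lin a b c : S)@_(mon 1 0 0) = a) * ((lin a b c : S)@_(mon 0 1 0) = b) * ((lin a b c : S)@_(mon 0 0 1) = c).
Proof. by rewrite /lin !mcoeffD !mcoeffZ !coef_mon /=; split; [split|]; ring. Qed.

Lemma subst_quad M u : homog_of 2 u ->
  [/\ (subst M u)@_(mon 2 0 0) = qval u (M i0 i0) (M i1 i0) (M i2 i0),
      (subst M u)@_(mon 0 2 0) = qval u (M i0 i1) (M i1 i1) (M i2 i1) &
      (subst M u)@_(mon 1 1 0) = qpol u (M i0 i0) (M i1 i0) (M i2 i0) (M i0 i1) (M i1 i1) (M i2 i1)].
Proof.
move=> hu; rewrite [subst M u](congr1 (subst M) (quad_form hu)) /qval /qpol {2}/lin !mulrDr -!scalerAr !rmorphD /= !substZ !rmorphM /= substX3 substY3 substZ3.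
move: (M i0 i0) (M i0 i1) (M i0 i2) (M i1 i0) (M i1 i1) (M i1 i2) (M i2 i0) (M i2 i1) (M i2 i2) => a b c d e f g h i.
by split; rewrite !mcoeffD !mcoeffZ !coef_linM !coefvar !coef_lin; ring.
Qed.
End CoprimePencils.

(** * General coordinates for a pencil without linear syzygy *)

Section CoprimePencils.
Variable k : closedFieldType.
Hypothesis char2 : (2%:R : k) != 0.
Local Notation S := {mpoly k[3]}.
Local Notation X := (X3 k).
Local Notation Y := (Y3 k).
Local Notation Z := (Z3 k).
Implicit Types (p q u v : S) (M : 'M[k]_3).

(** For two quadrics this says that they have no common factor. *)
Definition nosyz u v := forall a b, homog_of 1 a -> homog_of 1 b -> a * u + b * v = 0 -> a = 0 /\ b = 0.

Lemma horner_seq_eq0 (s : seq k) : (forall x, horner_rec s x = 0) -> forall i, s`_i = 0.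
Proof.
move=> h i; rewrite -coef_Poly; case: (eqVneq (Poly s) 0) => [->|n0]; first exact: coef0.
by have [x] := closed_field_nonroot n0; rewrite horner_Poly h eqxx.
Qed.

Lemma horner_seq_neq0 (s : seq k) i : s`_i != 0 -> exists x, horner_rec s x != 0.
Proof.
move=> si; apply: NNPP => hn; case/eqP: si; apply: horner_seq_eq0 => x.
by apply/eqP/negPn/negP => hx; apply: hn; exists x.
Qed.

Lemma mx3_unit (r r' : seq (seq k)) : mx3 r *m mx3 r' = 1%:M -> mx3 r \in unitmx.
Proof. by case/mulmx1_unit. Qed.

Lemma mx3_mul1 (a b c d e f g h i a' b' c' d' e' f' g' h' i' : k) :
  [/\ a * a' + b * d' + c * g' = 1, a * b' + b * e' + c * h' = 0 & a * c' + b * f' + c * i' = 0] ->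
  [/\ d * a' + e * d' + f * g' = 0, d * b' + e * e' + f * h' = 1 & d * c' + e * f' + f * i' = 0] ->
  [/\ g * a' + h * d' + i * g' = 0, g * b' + h * e' + i * h' = 0 & g * c' + h * f' + i * i' = 1] ->
  mx3 [:: [:: a; b; c]; [:: d; e; f]; [:: g; h; i]] \in unitmx.
Proof.
move=> [x1 x2 x3] [x4 x5 x6] [x7 x8 x9].
apply: (mx3_unit (r' := [:: [:: a'; b'; c']; [:: d'; e'; f']; [:: g'; h'; i']])).
apply/matrixP => l m; rewrite !mxE 3!big_ord_recl big_ord0 !mxE addr0 addrA /=.
by case: (ord3 l) => ->; case: (ord3 m) => -> /=.
Qed.

Lemma pencilP_lin c d u v : pencilP (c *: u) (v - d *: u) = c * pencilP u v.
Proof. by rewrite /pencilP /plu !mcoeffB !mcoeffZ; ring. Qed.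

Lemma pencilR_lin c d u v : pencilR (c *: u) (v - d *: u) = c ^+ 2 * pencilR u v.
Proof.
rewrite /pencilR /plu !mcoeffB !mcoeffZ.
by move: (u@__) (u@__) (u@__) (v@__) (v@__) (v@__) => a0 a1 a2 a3 a4 a5; ring.
Qed.

Lemma nosyz_subst M u v : M \in unitmx -> nosyz u v -> nosyz (subst M u) (subst M v).
Proof.
move=> uM h a b ha hb e.
have [|||a0 b0] := h (subst (invmx M) a) (subst (invmx M) b); try exact: homog_subst.
  by rewrite -(substK u uM) -(substK v uM) -!rmorphM -rmorphD e rmorph0.
by rewrite -(substVK a uM) -(substVK b uM) a0 b0 !rmorph0.
Qed.

Lemma nosyz_lin c d u v : c != 0 -> nosyz u v -> nosyz (c *: u) (v - d *: u).
Proof.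
move=> c0 h a b ha hb e; have [|||a0 b0] := h (c *: a - d *: b) b.
- by apply: homogB; apply: homogZ.
- by [].
- by rewrite -[RHS]e -!mul_mpolyC; ring.
move: a0; rewrite b0 scaler0 subr0 => /eqP; rewrite scaler_eq0 (negPf c0) => /eqP ->; by split.
Qed.

(* [P] becomes a nonzero quadratic polynomial in [t] under [y -> y + t x]; its discriminant is [4 R]. *)
Lemma pencilP_generic u v : homog_of 2 u -> homog_of 2 v -> pencilR u v != 0 ->
  exists2 M, M \in unitmx & pencilP (subst M u) (subst M v) != 0 /\ pencilR (subst M u) (subst M v) != 0.
Proof.
move=> hu hv R0; pose D := plu (mon 2 0 0) (mon 0 2 0) u v; pose E := plu (mon 0 2 0) (mon 1 1 0) u v.
have [t ht] : exists t, horner_rec [:: pencilP u v; 2%:R * D; - E] t != 0.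
  case: (eqVneq D 0) => [D0|D0].
    apply: (@horner_seq_neq0 _ 0) => /=; apply: contraNneq R0 => P0.
    by rewrite /pencilR -/D -/(pencilP u v) D0 P0 mul0r addr0 expr0n.
  by apply: (@horner_seq_neq0 _ 1); rewrite /= mulf_neq0.
pose M := mx3 [:: [:: 1; 0; 0]; [:: t; 1; 0]; [:: 0; 0; 1 : k]].
exists M; first by apply: (@mx3_mul1 _ _ _ _ _ _ _ _ _ 1 0 0 (- t) 1 0 0 0 1); split; ring.
have [u1 u2 u3] := subst_quad M hu; have [v1 v2 v3] := subst_quad M hv.
move: R0 ht; rewrite /pencilP /pencilR /plu u1 u2 u3 v1 v2 v3 /M /qval /qpol !mxE /= /D /E /pencilP /plu.
move: (u@_(mon 2 0 0)) (u@_(mon 1 1 0)) (u@_(mon 0 2 0)) (u@_(mon 1 0 1)) (u@_(mon 0 1 1)) (u@_(mon 0 0 2)) (v@_(mon 2 0 0)) (v@_(mon 1 1 0)) (v@_(mon 0 2 0)) (v@_(mon 1 0 1)) (v@_(mon 0 1 1)) (v@_(mon 0 0 2)) => u200 u110 u020 u101 u011 u002 v200 v110 v020 v101 v011 v002 R0 ht; split.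
  by move: ht; congr (_ != 0); ring.
by move: R0; congr (_ != 0); ring.
Qed.

Lemma quad_expand q : homog_of 2 q -> q = q@_(mon 2 0 0) *: (X * X) +
  X * (q@_(mon 1 1 0) *: Y + q@_(mon 1 0 1) *: Z) +
  (q@_(mon 0 2 0) *: (Y * Y) + q@_(mon 0 1 1) *: (Y * Z) + q@_(mon 0 0 2) *: (Z * Z)).
Proof.
move=> hq; rewrite {1}(quad_form hq) /lin -!mul_mpolyC.
move: (q@__)%:MP (q@__)%:MP (q@__)%:MP (q@__)%:MP (q@__)%:MP (q@__)%:MP => a0 a1 a2 a3 a4 a5; ring.
Qed.

(* If the resultant vanishes identically the two quadrics share the factor [x + g1 y + g0 z]. *)
Lemma pencilR_generic u v : homog_of 2 u -> homog_of 2 v -> u@_(mon 2 0 0) = 1 -> v@_(mon 2 0 0) = 0 ->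
  nosyz u v -> exists2 M, M \in unitmx & pencilR (subst M u) (subst M v) != 0.
Proof.
move=> hu hv; have := quad_expand hu; have := quad_expand hv.
set a1 := u@_(mon 1 1 0); set a0 := u@_(mon 1 0 1); set b2 := u@_(mon 0 2 0); set b1 := u@_(mon 0 1 1).
set b0 := u@_(mon 0 0 2); set al1 := v@_(mon 1 1 0); set al0 := v@_(mon 1 0 1); set be2 := v@_(mon 0 2 0).
set be1 := v@_(mon 0 1 1); set be0 := v@_(mon 0 0 2) => eu ev u1 v1 ns.
rewrite u1 scale1r in ev; rewrite v1 scale0r add0r in eu.
(* Coefficients of the resultant of [u] and [v] with respect to [x], a binary quartic in [y], [z]
   taken at [(t, 1)]. *)
pose r4 := be2 ^+ 2 - a1 * al1 * be2 + b2 * al1 ^+ 2.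
pose r3 := 2%:R * be2 * be1 - (a1 * al1 * be1 + (a1 * al0 + a0 * al1) * be2) + b2 * (2%:R * al1 * al0) + b1 * al1 ^+ 2.
pose r2 := be1 ^+ 2 + 2%:R * be2 * be0 - (a1 * al1 * be0 + (a1 * al0 + a0 * al1) * be1 + a0 * al0 * be2)
   + b2 * al0 ^+ 2 + b1 * (2%:R * al1 * al0) + b0 * al1 ^+ 2.
pose r1 := 2%:R * be1 * be0 - ((a1 * al0 + a0 * al1) * be0 + a0 * al0 * be1) + b1 * al0 ^+ 2 + b0 * (2%:R * al1 * al0).
pose r0 := be0 ^+ 2 - a0 * al0 * be0 + b0 * al0 ^+ 2.
apply: NNPP => hn.
have hr : forall t, horner_rec [:: r0; r1; r2; r3; r4] t = 0.
  move=> t; apply/eqP/negPn/negP => ht; apply: hn.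
  pose M := mx3 [:: [:: 1; 0; 0]; [:: 0; t; 1]; [:: 0; 1; 0 : k]].
  exists M; first by apply: (@mx3_mul1 _ _ _ _ _ _ _ _ _ 1 0 0 0 0 1 0 1 (- t)); split; ring.
  have [x1 x2 x3] := subst_quad M hu; have [y1 y2 y3] := subst_quad M hv.
  rewrite /pencilR /plu x1 x2 x3 y1 y2 y3 /M /qval /qpol !mxE /= u1 v1.
  rewrite -/a1 -/a0 -/b2 -/b1 -/b0 -/al1 -/al0 -/be2 -/be1 -/be0.
  move: ht; rewrite /= /r0 /r1 /r2 /r3 /r4; congr (_ != 0).
  move: (a1) (a0) (b2) (b1) (b0) (al1) (al0) (be2) (be1) (be0) => *; ring.
have {}hr := horner_seq_eq0 hr.
have {hr} [e0 e1 e2 e3 e4] : [/\ r0 = 0, r1 = 0, r2 = 0, r3 = 0 & r4 = 0].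
  by split; [exact: (hr 0%N)|exact: (hr 1%N)|exact: (hr 2%N)|exact: (hr 3%N)|exact: (hr 4%N)].
(* Either [v] is free of [x], and then the resultant is its square, or
   [v = (al1 y + al0 z) (x + g1 y + g0 z)] and the second factor divides [u]. *)
have [al|[g1 [g0 [f2 f1 f0 [w2 w1 w0]]]]] : (al1 = 0 /\ al0 = 0) \/ exists g1 g0,
   [/\ be2 = al1 * g1, be1 = al1 * g0 + al0 * g1, be0 = al0 * g0 &
    [/\ b2 = a1 * g1 - g1 ^+ 2, b1 = a1 * g0 + a0 * g1 - 2%:R * g1 * g0 & b0 = a0 * g0 - g0 ^+ 2]].
- move: e0 e1 e2 e3 e4; rewrite /r0 /r1 /r2 /r3 /r4.
  move: (a1) (a0) (b2) (b1) (b0) (al1) (al0) (be2) (be1) (be0).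
  clear => a1 a0 b2 b1 b0 al1 al0 be2 be1 be0 e0 e1 e2 e3 e4.
  have cancel (x y z : k) : x != 0 -> x ^+ 2 * (y - z) = 0 -> y = z.
    by move=> x0 /eqP; rewrite mulf_eq0 expf_eq0 /= (negPf x0) subr_eq0 => /eqP.
  case: (eqVneq al1 0) => [z1|z1].
    case: (eqVneq al0 0) => [z0|z0]; [by left|right].
    have be2_0 : be2 = 0.
      by apply/eqP; rewrite -sqrf_eq0; apply/eqP; rewrite -[RHS]e4 z1; ring.
    pose g1 := be1 / al0; pose g0 := be0 / al0.
    have f1 : be1 = al0 * g1 by rewrite mulrC divfK.
    have f0 : be0 = al0 * g0 by rewrite mulrC divfK.
    move: g1 g0 f1 f0 => g1 g0 f1 f0; exists g1, g0; subst al1 be2 be1 be0; split; [ring|ring|by []|split].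
    - by apply: (cancel _ _ _ z0); rewrite -[RHS]e2; ring.
    - by apply: (cancel _ _ _ z0); rewrite -[RHS]e1; ring.
    - by apply: (cancel _ _ _ z0); rewrite -[RHS]e0; ring.
  right; pose g1 := be2 / al1; pose g0 := (be1 - al0 * g1) / al1.
  have f2 : be2 = al1 * g1 by rewrite mulrC divfK.
  have f1 : be1 = al1 * g0 + al0 * g1 by rewrite /g0 mulrC divfK // subrK.
  have f0 : be0 = al0 * g0.
    set q0 := (X in X = 0) in e0; set q1 := (X in X = 0) in e1; set q2 := (X in X = 0) in e2.
    set q3 := (X in X = 0) in e3; set q4 := (X in X = 0) in e4.
    apply: (cancel _ _ _ z1); apply/eqP; rewrite -sqrf_eq0; apply/eqP.
    (* At the zero [(al0, - al1)] of [al1 y + al0 z] the resultant equals the square of the [x]-free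
       part of [v]. *)
    have -> : (al1 ^+ 2 * (be0 - al0 * g0)) ^+ 2 =
      (be2 * al0 ^+ 2 - be1 * al0 * al1 + be0 * al1 ^+ 2) ^+ 2 by rewrite f2 f1; ring.
    have -> : (be2 * al0 ^+ 2 - be1 * al0 * al1 + be0 * al1 ^+ 2) ^+ 2 =
      al0 ^+ 4 * q4 - al0 ^+ 3 * al1 * q3 + al0 ^+ 2 * al1 ^+ 2 * q2 - al0 * al1 ^+ 3 * q1 + al1 ^+ 4 * q0.
      by rewrite /q4 /q3 /q2 /q1 /q0; ring.
    by rewrite e0 e1 e2 e3 e4 !mulr0 !(subr0, addr0).
  move: g1 g0 f2 f1 f0 => g1 g0 f2 f1 f0; subst be2 be1 be0.
  have w2 : b2 = a1 * g1 - g1 ^+ 2 by apply: (cancel _ _ _ z1); rewrite -[RHS]e4; ring.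
  have w1 : b1 = a1 * g0 + a0 * g1 - 2%:R * g1 * g0.
    by apply: (cancel _ _ _ z1); rewrite -[RHS]e3 w2; ring.
  exists g1, g0; split=> //; split=> //.
  by apply: (cancel _ _ _ z1); rewrite -[RHS]e2 w2 w1; ring.
- have [a1_0 a0_0] := al.
  have v0 : v = 0.
    have sq (x : k) : x ^+ 2 = 0 -> x = 0 by move/eqP; rewrite sqrf_eq0 => /eqP.
    have z2 : be2 = 0 by apply: sq; rewrite -[RHS]e4 /r4 a1_0; ring.
    have z0 : be0 = 0 by apply: sq; rewrite -[RHS]e0 /r0 a0_0; ring.
    have z1 : be1 = 0 by apply: sq; rewrite -[RHS]e2 /r2 a1_0 a0_0 z2 z0; ring.
    by rewrite eu a1_0 a0_0 z2 z1 z0 !scale0r !addr0 mulr0.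
  have [|||_ /(congr1 (mcoeff (mon 1 0 0)))] := ns 0 X.
  - exact: homog0.
  - exact: homogX3.
  - by rewrite v0 mulr0 mul0r addr0.
  by rewrite coef_mon mcoeff0 => /eqP; rewrite oner_eq0.
have [|||_ /(congr1 (mcoeff (mon 1 0 0)))] := ns (- lin 0 al1 al0) (lin 1 (a1 - g1) (a0 - g0)).
- exact/homogN/homog_lin.
- exact: homog_lin.
- rewrite ev eu f2 f1 f0 w2 w1 w0 /lin -!mul_mpolyC.
  move: (a1) (a0) (al1) (al0) (g1) (g0) => x1 x0 y1 y0 z1 z0.
  rewrite !(mpolyCB, mpolyCD, mpolyCM, rmorphXn, rmorph_nat) /= mpolyC1 mpolyC0.
  by move: x1%:MP x0%:MP y1%:MP y0%:MP z1%:MP z0%:MP => a b c d e f; ring.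
by rewrite coef_lin mcoeff0 => /eqP; rewrite oner_eq0.
Qed.

Lemma quad_nonroot u : homog_of 2 u -> u != 0 -> exists2 M, M \in unitmx & (subst M u)@_(mon 2 0 0) != 0.
Proof.
move=> hu u0.
have [s [t st]] : exists s t, qval u 1 s t != 0.
  have aux (a b c : k) : a != 0 \/ b != 0 \/ c != 0 -> exists s, a + b * s + c * s ^+ 2 != 0.
    case=> [h|[h|h]]; [have := @horner_seq_neq0 [:: a; b; c] 0 h|have := @horner_seq_neq0 [:: a; b; c] 1 h|
      have := @horner_seq_neq0 [:: a; b; c] 2 h]; case=> s /= hs; exists s; move: hs; congr (_ != 0); ring.
  have aux2 s : u@_(mon 0 0 2) != 0 \/ u@_(mon 1 0 1) + u@_(mon 0 1 1) * s != 0 \/ qval u 1 s 0 != 0 ->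
      exists s t, qval u 1 s t != 0.
    move=> h; exists s; have [] := aux (qval u 1 s 0) (u@_(mon 1 0 1) + u@_(mon 0 1 1) * s) u@_(mon 0 0 2).
      by case: h => [h|[h|h]]; [right; right|right; left|left].
    by move=> t ht; exists t; move: ht; congr (_ != 0); rewrite /qval; ring.
  case: (eqVneq u@_(mon 0 0 2) 0) => [z1|z1]; last by apply: (aux2 0); left.
  case: (eqVneq u@_(mon 1 0 1) 0) => [z2|z2]; last by apply: (aux2 0); right; left; rewrite mulr0 addr0.
  case: (eqVneq u@_(mon 0 1 1) 0) => [z3|z3]; last by apply: (aux2 1); right; left; rewrite z2 mulr1 add0r.
  have [|s hs] := aux u@_(mon 2 0 0) u@_(mon 1 1 0) u@_(mon 0 2 0).
    case: (eqVneq u@_(mon 2 0 0) 0) => [y1|y1]; [right|by left].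
    case: (eqVneq u@_(mon 1 1 0) 0) => [y2|y2]; [right|by left].
    by apply: contraNneq u0 => y3; rewrite (quad_expand hu) z1 z2 z3 y1 y2 y3 !scale0r !addr0 mulr0 addr0 eqxx.
  by apply: (aux2 s); right; right; move: hs; congr (_ != 0); rewrite /qval; ring.
pose M := mx3 [:: [:: 1; 0; 0]; [:: s; 1; 0]; [:: t; 0; 1 : k]].
exists M; first by apply: (@mx3_mul1 _ _ _ _ _ _ _ _ _ 1 0 0 (- s) 1 0 (- t) 0 1); split; ring.
by have [-> _ _] := subst_quad M hu; rewrite !mxE.
Qed.

End CoprimePencils.

(** * Normal form of a coprime pencil *)

Section CoprimePencils.
Variable k : closedFieldType.
Hypothesis char2 : (2%:R : k) != 0.
Local Notation S := {mpoly k[3]}.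
Local Notation X := (X3 k).
Local Notation Y := (Y3 k).
Local Notation Z := (Z3 k).
Implicit Types (p q u v : S) (M : 'M[k]_3).

(** Three changes of coordinates: the first makes [x^2] occur in [u], so that it can be cleared from
    [v]; the second makes the resultant nonzero; the third makes [pencilP] nonzero and keeps the
    resultant. *)
Lemma nosyz_generic u v : homog_of 2 u -> homog_of 2 v -> nosyz u v ->
  exists2 M, M \in unitmx & pencilP (subst M u) (subst M v) != 0 /\ pencilR (subst M u) (subst M v) != 0.
Proof.
move=> hu hv ns; have [|M1 uM1 c0] := quad_nonroot hu.
  apply/negP => /eqP u0; have [|||/(congr1 (mcoeff (mon 1 0 0)))] := ns X 0.
  - exact: homogX3.
  - exact: homog0.
  - by rewrite u0 mulr0 mul0r addr0.
  by rewrite coef_mon mcoeff0 => /eqP; rewrite oner_eq0.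
set u1 := subst M1 u in c0; set v1 := subst M1 v; set c := u1@__ in c0.
pose u2 := c^-1 *: u1; pose v2 := v1 - (v1@_(mon 2 0 0) / c) *: u1.
have h1 : homog_of 2 u1 by apply: homog_subst.
have h2 : homog_of 2 v1 by apply: homog_subst.
have [||||M2 uM2] := @pencilR_generic k u2 v2 _ _ _ _ (@nosyz_lin _ _ _ _ _ (invr_neq0 c0) (nosyz_subst uM1 ns)).
- exact: homogZ.
- by apply/homogB/homogZ.
- by rewrite mcoeffZ mulVf.
- by rewrite mcoeffB mcoeffZ divfK // subrr.
rewrite /u2 /v2 rmorphB /= !substZ pencilR_lin mulf_eq0 negb_or => /andP[_ R0].
have [||M3 uM3 h3] := pencilP_generic char2 _ _ R0; try exact: homog_subst.
exists (M1 *m M2 *m M3); first by rewrite !unitmx_mul uM1 uM2.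
by rewrite -!subst_comp.
Qed.

(** Cramer's rule on the columns of [x^2] and [x y]; then [la + mu^2] is [pencilR] divided by the
    square of [pencilP]. *)
Lemma pencil_normalize u v : homog_of 2 u -> homog_of 2 v -> pencilP u v != 0 -> pencilR u v != 0 ->
  exists la mu c d e f, [/\ normal_pencil la mu (c *: u + d *: v) (e *: u + f *: v) & la + mu ^+ 2 != 0].
Proof.
move=> hu hv P0 R0; pose P := pencilP u v.
exists (plu (mon 0 2 0) (mon 1 1 0) u v / P), (plu (mon 2 0 0) (mon 0 2 0) u v / P).
exists (v@_(mon 1 1 0) / P), (- u@_(mon 1 1 0) / P), (- v@_(mon 2 0 0) / P), (u@_(mon 2 0 0) / P); split.
  by split; try (by apply: homogD; apply: homogZ); split; rewrite mcoeffD !mcoeffZ;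
    rewrite /P /pencilP /plu in P0 *; field.
apply: contraNneq R0 => e; rewrite -(mulr0 (P ^+ 2)) -e /pencilR -/(pencilP u v) -/P; apply/eqP; field.
exact: P0.
Qed.

End CoprimePencils.

(** * Generators of the ideal of three non-collinear points *)

Section ChartKernel.
Variable k : closedFieldType.
Local Notation S := {mpoly k[3]}.
Local Notation X := (X3 k).
Local Notation Y := (Y3 k).
Local Notation Z := (Z3 k).
Implicit Types (p q u v : S).
Variables (c1 c2 d1 d2 f1 f2 : k).
Local Notation n1 := (ch_n1 c1 c2 d1 d2 f2).
Local Notation n2 := (ch_n2 c2 d1 d2 f1).
Local Notation n3 := (ch_n3 c1 d1 d2 f1 f2).
Local Notation ev := (evd (chX c1 c2 d1 d2 f1 f2) (chY c1 c2 d1 d2 f1 f2)).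

Lemma ch_reduce d p : (2 <= d)%N -> homog_of d p -> exists a1 a2 a3 l,
  [/\ homog_of (d - 2) a1, homog_of (d - 2) a2, homog_of (d - 2) a3, homog_of 1 l &
      p = a1 * n1 + a2 * n2 + a3 * n3 + Z ^+ d.-1 * l].
Proof.
pose P d p := exists a1 a2 a3 l,
  [/\ homog_of (d - 2) a1, homog_of (d - 2) a2, homog_of (d - 2) a3, homog_of 1 l &
      p = a1 * n1 + a2 * n2 + a3 * n3 + Z ^+ d.-1 * l].
have hC (c : k) : homog_of 0 (c%:MP : S).
  have h1 : homog_of 0 (1 : S).
    by rewrite -mpolyX0; apply: homogX; apply: mdeg0.
  by rewrite -[c%:MP]mulr1 mul_mpolyC; apply: homogZ.
have PD e q r : P e q -> P e r -> P e (q + r).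
  move=> [a1 [a2 [a3 [l [h1 h2 h3 hl ->]]]]] [b1 [b2 [b3 [m [g1 g2 g3 hm ->]]]]].
  by exists (a1 + b1), (a2 + b2), (a3 + b3), (l + m); split; try exact: homogD; ring.
have P2 q : homog_of 2 q -> P 2 q.
  move=> hq; exists (q@_(mon 2 0 0))%:MP, (q@_(mon 1 1 0))%:MP, (q@_(mon 0 2 0))%:MP.
  exists (lin q@_(mon 1 0 1) q@_(mon 0 1 1) q@_(mon 0 0 2) + q@_(mon 2 0 0) *: lin c1 c2 (ch_c0 c1 c2 d1 d2 f2) +
    q@_(mon 1 1 0) *: lin d1 d2 (ch_d0 c2 d1 d2 f1) + q@_(mon 0 2 0) *: lin f1 f2 (ch_f0 c1 d1 d2 f1 f2)).
  split; rewrite ?subnn //; try exact: hC.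
    by do 3?apply: homogD; try exact: homog_lin; apply: homogZ; apply: homog_lin.
  rewrite {1}(quad_form hq) /ch_n1 /ch_n2 /ch_n3 /= expr1 -!mul_mpolyC.
  move: (lin _ _ _) (lin _ _ _) (lin _ _ _) (lin _ _ _) => l0 l1 l2 l3.
  move: (q@__)%:MP (q@__)%:MP (q@__)%:MP => a b c; ring.
move: d p; apply: homog_ind; [exact: PD|exact: P2|].
move=> d p d2' hp [a1 [a2 [a3 [l [h1 h2 h3 hl ->]]]]].
have Pl m : homog_of 2 m -> P d.+1 (Z ^+ d.-1 * m).
  move=> hm; have [a [b [c [r [ha hb hc hr e]]]]] := P2 m hm.
  have hz q : homog_of 0 q -> homog_of (d.+1 - 2) (Z ^+ d.-1 * q).
    by move=> hq; rewrite subSS subn1; have := homogZX (n := d.-1) hq; rewrite addn0.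
  exists (Z ^+ d.-1 * a), (Z ^+ d.-1 * b), (Z ^+ d.-1 * c), r; split; try exact: hz.
    by [].
  by rewrite e -[d.+1.-1](ltn_predK d2') exprS expr1; move: (Z ^+ _) => w; ring.
have Pv v : homog_of 1 v -> P d.+1 (v * (a1 * n1 + a2 * n2 + a3 * n3 + Z ^+ d.-1 * l)).
  move=> hv; rewrite mulrDr; apply: PD; last first.
    by rewrite mulrCA; apply: Pl; apply: (@homogM k 1 1).
  have hm a : homog_of (d - 2) a -> homog_of (d.+1 - 2) (v * a).
    by move=> ha; have := homogM hv ha; rewrite addnBA // add1n.
  exists (v * a1), (v * a2), (v * a3), 0; split; try exact: hm; first exact: homog0.
  by ring.
by split; apply: Pv; [exact: homogX3|exact: homogY3|exact: homogZ3].
Qed.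

Lemma ch_evd_mul d a n : homog_of 2 n -> ev 2 n = 0 -> homog_of d a -> ev (2 + d) (a * n) = 0.
Proof.
move=> hn en; elim: d a => [|d IH] a ha.
  by rewrite (homog0_const ha) mul_mpolyC addn0 evdZ en scaler0.
have [a0 [a1 [a2 [h0 h1 h2 ->]]]] := homog_split ha.
have AB := chXY c1 c2 d1 d2 f1 f2.
have hm b : homog_of d b -> homog_of (2 + d) (b * n) by move=> hb; rewrite addnC; apply: homogM.
rewrite addnS !mulrDl -!mulrA !evdD (evdXM AB (hm _ h0)) (evdYM (hm _ h1)) (evdZM (hm _ h2)).
by rewrite !IH // !mul0mx !addr0.
Qed.

Lemma evd_Zlin d l : homog_of 1 l -> ev d.+1 (Z ^+ d * l) = row3 l@_(mon 0 0 1) l@_(mon 1 0 0) l@_(mon 0 1 0).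
Proof.
move=> hl; elim: d => [|d IH].
  by rewrite expr0 mul1r {1}(homog1_lin hl) ch_evd1.
by rewrite exprS -mulrA (evdZM (p := Z ^+ d * l)) // -addn1; apply: homogZX.
Qed.

(** Division by the three conics leaves a remainder [z^(d-1) l], whose evaluation is the coordinate
    vector of [l]. The explicit generators make the quartics of [chartI] lift to polynomial
    sections. *)
Lemma ch_kernel d p : (2 <= d)%N -> homog_of d p -> ev d p = 0 -> exists a1 a2 a3,
  [/\ homog_of (d - 2) a1, homog_of (d - 2) a2, homog_of (d - 2) a3 & p = a1 * n1 + a2 * n2 + a3 * n3].
Proof.
move=> d2' hp; have [a1 [a2 [a3 [l [h1 h2 h3 hl ->]]]]] := ch_reduce d2' hp.
have z a n : homog_of (d - 2) a -> homog_of 2 n -> ev 2 n = 0 -> ev d (a * n) = 0.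
  by move=> ha hn en; have := ch_evd_mul hn en ha; rewrite subnKC.
rewrite !evdD (z _ _ h1 (@homog_n1 k c1 c2 d1 d2 f2) (ch_evd_n1 _ _ _ _ _ _)).
rewrite (z _ _ h2 (@homog_n2 k c2 d1 d2 f1) (ch_evd_n2 _ _ _ _ _ _)) (z _ _ h3 (@homog_n3 k c1 d1 d2 f1 f2) (ch_evd_n3 _ _ _ _ _ _)).
rewrite !add0r -[in ev d](ltn_predK d2') evd_Zlin // => /rowP h.
have := h i0; have := h i1; have := h i2; rewrite !mxE /= => z1 z2 z3.
by exists a1, a2, a3; rewrite (homog1_lin hl) z1 z2 z3 /lin !scale0r !addr0 mulr0 addr0.
Qed.

End ChartKernel.

(** * Polynomial sections of the ideals [chartI] *)

Section ChartFamilies.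
Variable k : closedFieldType.
Local Notation S := {mpoly k[3]}.
Local Notation X := (X3 k).
Local Notation Y := (Y3 k).
Local Notation Z := (Z3 k).
Implicit Types (p q u v : S).

Lemma psec_lin (A T : Type) (co : T -> A -> k) (a b c : A -> k) : pfun co a -> pfun co b -> pfun co c ->
  psec co (fun t => lin (a t) (b t) (c t)).
Proof. by move=> pa pb pc; do 2?apply: psecD; apply: psecZ => //; apply: psec_const. Qed.

Lemma chartI_mem c1 c2 d1 d2 f1 f2 la mu d p : homog_of d p ->
  chartI c1 c2 d1 d2 f1 f2 la mu p <-> piece (chX c1 c2 d1 d2 f1 f2) (chY c1 c2 d1 d2 f1 f2)
    (fun p => exists a b : k, p = a *: ch_q1 c1 c2 d1 d2 f1 f2 la + b *: ch_q2 c1 c2 d1 d2 f1 f2 mu)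
    (syz_span (ch_q1 c1 c2 d1 d2 f1 f2 la) (ch_q2 c1 c2 d1 d2 f1 f2 mu)) d p.
Proof. move=> hp; apply: model_homog => //; [exact: lin_span2|exact: lin_syz]. Qed.

Section Sections.
Variables (A T : Type) (co : T -> A -> k) (c1 c2 d1 d2 f1 f2 la mu : A -> k).
Hypotheses (pc1 : pfun co c1) (pc2 : pfun co c2) (pd1 : pfun co d1) (pd2 : pfun co d2)
  (pf1 : pfun co f1) (pf2 : pfun co f2) (pla : pfun co la) (pmu : pfun co mu).

Definition chart_fam a := chartI (c1 a) (c2 a) (d1 a) (d2 a) (f1 a) (f2 a) (la a) (mu a).

Lemma psec_n1 : psec co (fun a => ch_n1 (c1 a) (c2 a) (d1 a) (d2 a) (f2 a)).
Proof.
apply: psecB; first exact: psec_const.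
apply: psecM; [exact: psec_const|apply: psec_lin => //].
by apply: pf_sub; [apply: pf_sub; [apply: pf_add; [apply: pf_mul|apply: pf_exp]|apply: pf_mul]|apply: pf_mul].
Qed.

Lemma psec_n2 : psec co (fun a => ch_n2 (c2 a) (d1 a) (d2 a) (f1 a)).
Proof.
apply: psecB; first exact: psec_const.
apply: psecM; [exact: psec_const|apply: psec_lin => //].
by apply: pf_sub; apply: pf_mul.
Qed.

Lemma psec_n3 : psec co (fun a => ch_n3 (c1 a) (d1 a) (d2 a) (f1 a) (f2 a)).
Proof.
apply: psecB; first exact: psec_const.
apply: psecM; [exact: psec_const|apply: psec_lin => //].
by apply: pf_sub; [apply: pf_sub; [apply: pf_add; [apply: pf_exp|apply: pf_mul]|apply: pf_mul]|apply: pf_mul].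
Qed.

Lemma psec_q1 : psec co (fun a => ch_q1 (c1 a) (c2 a) (d1 a) (d2 a) (f1 a) (f2 a) (la a)).
Proof. by apply: psecD; [exact: psec_n1|apply: psecZ => //; exact: psec_n3]. Qed.

Lemma psec_q2 : psec co (fun a => ch_q2 (c1 a) (c2 a) (d1 a) (d2 a) (f1 a) (f2 a) (mu a)).
Proof. by apply: psecD; [exact: psec_n2|apply: psecZ => //; exact: psec_n3]. Qed.

Variable ok : A -> Prop.

Lemma chart_fam_ideal a : ok a -> is_hideal (chart_fam a).
Proof. by move=> _; apply: chartI_hideal. Qed.

Lemma fam_q1 a : chart_fam a (ch_q1 (c1 a) (c2 a) (d1 a) (d2 a) (f1 a) (f2 a) (la a)).
Proof.
apply/(chartI_mem _ _ _ _ _ _ _ _ (@homog_q1 k (c1 a) (c2 a) (d1 a) (d2 a) (f1 a) (f2 a) (la a))).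
by exists 1, 0; rewrite scale1r scale0r addr0.
Qed.

Lemma fam_q2 a : chart_fam a (ch_q2 (c1 a) (c2 a) (d1 a) (d2 a) (f1 a) (f2 a) (mu a)).
Proof.
apply/(chartI_mem _ _ _ _ _ _ _ _ (@homog_q2 k (c1 a) (c2 a) (d1 a) (d2 a) (f1 a) (f2 a) (mu a))).
by exists 0, 1; rewrite scale1r scale0r add0r.
Qed.

Lemma lifts_q1 a0 : lifts co ok chart_fam a0 (ch_q1 (c1 a0) (c2 a0) (d1 a0) (d2 a0) (f1 a0) (f2 a0) (la a0)).
Proof. by eexists; split; [exact: psec_q1|by []|move=> a _; exact: fam_q1]. Qed.

Lemma lifts_q2 a0 : lifts co ok chart_fam a0 (ch_q2 (c1 a0) (c2 a0) (d1 a0) (d2 a0) (f1 a0) (f2 a0) (mu a0)).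
Proof. by eexists; split; [exact: psec_q2|by []|move=> a _; exact: fam_q2]. Qed.

Lemma lifts_quartic a0 p : homog_of 4 p ->
  evd (chX (c1 a0) (c2 a0) (d1 a0) (d2 a0) (f1 a0) (f2 a0)) (chY (c1 a0) (c2 a0) (d1 a0) (d2 a0) (f1 a0) (f2 a0)) 4 p = 0 ->
  lifts co ok chart_fam a0 p.
Proof.
move=> hp ev0; have [|a1 [a2 [a3 [h1 h2 h3 ->]]]] := ch_kernel _ hp ev0; first by [].
have gen a F : homog_of 2 a -> psec co F -> (forall b, homog_of 2 (F b)) ->
    (forall b, evd (chX (c1 b) (c2 b) (d1 b) (d2 b) (f1 b) (f2 b)) (chY (c1 b) (c2 b) (d1 b) (d2 b) (f1 b) (f2 b)) 2 (F b) = 0) ->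
    lifts co ok chart_fam a0 (a * F a0).
  move=> ha pF hF eF; exists (fun b => a * F b); split=> [||b _] //.
    by apply: psecM => //; apply: psec_const.
  have h4 : homog_of 4 (a * F b) by apply: (@homogM k 2 2).
  apply/(chartI_mem _ _ _ _ _ _ _ _ h4); exact: (ch_evd_mul (hF b) (eF b) ha).
have cD := liftsD chart_fam_ideal.
apply: (cD); [apply: (cD)|].
- apply: (gen a1 _ h1 psec_n1) => b; [exact: homog_n1|exact: ch_evd_n1].
- apply: (gen a2 _ h2 psec_n2) => b; [exact: homog_n2|exact: ch_evd_n2].
- apply: (gen a3 _ h3 psec_n3) => b; [exact: homog_n3|exact: ch_evd_n3].
Qed.

Hypothesis ok_nz : forall a, ok a -> la a + mu a ^+ 2 != 0.

Lemma chart_fam_Hpt a : ok a -> Hpt (chart_fam a).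
Proof. by move=> /ok_nz; apply: chart_Hpt. Qed.

Lemma chart_lifts a0 : ok a0 -> @liftable k 20 N5 (ideal_pred k) (@lowbasis k) _ _ co ok chart_fam a0 (chart_fam a0).
Proof.
move=> oka; have H0 := chart_fam_Hpt oka; apply: lifts_liftable => //; first exact: chart_fam_ideal.
  exact: chart_fam_Hpt.
have cD := liftsD chart_fam_ideal; have cM := liftsM chart_fam_ideal; have cZ := liftsZ chart_fam_ideal.
have c0 := lifts0 co chart_fam_ideal a0.
move=> d p d4 Ip hp; have := Ip => /(chartI_mem _ _ _ _ _ _ _ _ hp).
case: d d4 hp => [|[|[|[|[|//]]]]] _ hp /=.
- by move=> ->.
- by move=> ->.
- by case=> [a [b ->]]; apply: (cD); apply: (cZ); [exact: lifts_q1|exact: lifts_q2].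
- by case=> [a [b [_ _ ->]]]; apply: (cD); apply: (cM); [exact: lifts_q1|exact: lifts_q2].
- exact: lifts_quartic.
Qed.

End Sections.
End ChartFamilies.

(** * The first family and its closure *)

Section GenericComponent.
Variable k : closedFieldType.
Local Notation S := {mpoly k[3]}.
Local Notation X := (X3 k).
Local Notation Y := (Y3 k).
Local Notation Z := (Z3 k).
Implicit Types (p q u v : S) (I : ideal_pred k) (M : 'M[k]_3).
Local Notation closedG := (@closedG k 20 N5 (ideal_pred k) (@Hpt k) (@lowbasis k)).
Local Notation cl := (@cl k 20 N5 (ideal_pred k) (@Hpt k) (@lowbasis k)).

Lemma nonvanishing_line n (f : ('I_n -> k) -> k) t t' : pfun (@vec_co k n) f -> f t != 0 ->
  exists2 e : {poly k}, e != 0 & forall s, e.[s] != 0 -> f (lin_path t t' s) != 0.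
Proof.
move=> /(pf_line t t')/pf_poly[P hP] ft; exists P => [|s]; last by rewrite -hP.
by apply: contraNneq ft => P0; rewrite -(lin_path0 t t') hP P0 horner0.
Qed.

Definition tc n (t : 'I_n.+1 -> k) (i : nat) : k := t (inord i).

Lemma pf_tc n i : pfun (@vec_co k n.+1) (fun t => tc t i).
Proof. exact: (pf_coord _ (inord i)). Qed.

Lemma tc_seq n (s : seq k) i : (i <= n)%N -> tc (fun j : 'I_n.+1 => s`_j) i = s`_i.
Proof. by move=> h; rewrite /tc inordK. Qed.

(* These coordinates are chosen so that the minors of the pencil cut out the coordinate flag successively. *)
Definition fam1 : ('I_8 -> k) -> ideal_pred k :=
  chart_fam (fun t : 'I_8 -> k => tc t 3 - tc t 1) (fun t => tc t 2 - (1 + tc t 0)) (fun t => tc t 5) (fun t => tc t 4)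
   (fun t => tc t 1) (fun t => 1 + tc t 0) (fun t => 1 + tc t 7) (fun t => tc t 6).

Definition ok1 (t : 'I_8 -> k) : Prop := 1 + tc t 7 + tc t 6 ^+ 2 != 0.

Lemma ok1_line t t' : ok1 t -> ok1 t' ->
  exists2 e : {poly k}, e != 0 & forall s, e.[s] != 0 -> ok1 (lin_path t t' s).
Proof.
move=> okt _; apply: (nonvanishing_line (f := fun t => 1 + tc t 7 + tc t 6 ^+ 2)) => //.
have p i := pf_tc 7 i.
by apply: (pf_add (f := fun t => 1 + tc t 7) (g := fun t => tc t 6 ^+ 2)); [apply: pf_add => //; apply: pf_const|apply: pf_exp].
Qed.

Lemma fam1_Hpt t : ok1 t -> Hpt (fam1 t).
Proof. exact: chart_Hpt. Qed.

Lemma fam1_lift t : ok1 t -> @liftable k 20 N5 (ideal_pred k) (@lowbasis k) _ _ (@vec_co k 8) ok1 fam1 t (fam1 t).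
Proof.
have p i := pf_tc 7 i.
have q i : pfun (@vec_co k 8) (fun t => 1 + tc t i) by apply: pf_add => //; apply: pf_const.
by move=> okt; exact: (chart_lifts (pf_sub (p 3) (p 1)) (pf_sub (p 2) (q 0)) (p 5) (p 4) (p 1) (q 0) (q 7) (p 6) (fun a ok => ok) okt).
Qed.

Definition X1 : subH k := fam_image fam1 ok1.

Lemma X1_Hpt I : X1 I -> Hpt I.
Proof. by move=> [t okt ->]; apply: fam1_Hpt. Qed.

Lemma chart_X1 c1 c2 d1 d2 f1 f2 la mu : la + mu ^+ 2 != 0 -> X1 (chartI c1 c2 d1 d2 f1 f2 la mu).
Proof.
move=> nz; exists (fun j => [:: f2 - 1; f1; c2 + f2; c1 + f1; d2; d1; mu; la - 1]`_j).
  by rewrite /ok1 !tc_seq //= [1 + (la - 1)]addrC subrK.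
rewrite /fam1 /chart_fam !tc_seq //=.
have e1 (a : k) : 1 + (a - 1) = a by ring.
by rewrite !e1 !addrK.
Qed.

(** The closed complement of the good points: off this set the pencil can be normalised in the given
    coordinates and the ideal lies in [X1]. *)
Definition Kgood : subH k := fun J => Hpt J /\ forall p q, J p -> J q -> homog_of 2 p -> homog_of 2 q ->
  pencilP p q * pencilR p q = 0.

Lemma Kgood_closed : closedG Kgood.
Proof.
suff h : pfun (@pair_co k) (fun w => pencilP w.1 w.2 * pencilR w.1 w.2) by exact: (@closed_pairs k 2 _ isT h).
have c1 m : pfun (@pair_co k) (fun w => w.1@_m) by apply: (pf_coord _ (true, m)).
have c2 m : pfun (@pair_co k) (fun w => w.2@_m) by apply: (pf_coord _ (false, m)).
have pp m m' : pfun (@pair_co k) (fun w => plu m m' w.1 w.2) by apply: pf_sub; apply: pf_mul.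
apply: pf_mul; first exact: pp.
by apply: pf_add; [apply: pf_exp; exact: pp|apply: pf_mul; exact: pp].
Qed.

Lemma good_chart I : Hpt I -> ~ Kgood I -> X1 I /\ regular I.
Proof.
move=> HI nK; have hI := Hpt_hideal HI.
have [p [q [Ip Iq [hp hq PR]]]] : exists p q, [/\ I p, I q & [/\ homog_of 2 p, homog_of 2 q & pencilP p q * pencilR p q != 0]].
  apply: NNPP => hn; apply: nK; split=> // p q Ip Iq hp hq; apply/eqP/negPn/negP => h.
  by apply: hn; exists p, q; split.
move: PR; rewrite mulf_eq0 negb_or => /andP[P0 R0].
have [la [mu [c [d [e [f [npq nz]]]]]]] := pencil_normalize hp hq P0 R0.
have I1 : I (c *: p + d *: q) by apply: (hiD hI); apply: (hiZ hI).
have I2 : I (e *: p + f *: q) by apply: (hiD hI); apply: (hiZ hI).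
have [c1 [c2 [d1 [d2 [f1 [f2 eI]]]]]] := pencil_chart HI npq nz I1 I2.
by split; [rewrite eI; apply: chart_X1|exact: zred_regular HI (pencil_zred HI npq nz I1 I2)].
Qed.

Lemma regular_act M I : M \in unitmx -> regular (act M I) -> regular I.
Proof.
move=> uM h d p d4 Ip hp Q Q0 QD QM Qb.
have := h d (subst M p) d4 (act_mem _ Ip) (@homog_subst _ _ M _ hp).
move=> /(_ (fun r => Q (subst (invmx M) r))); rewrite substK //; apply.
- by rewrite rmorph0.
- by move=> a b Qa Qb'; rewrite rmorphD; apply: QD.
- by move=> a b Qb'; rewrite rmorphM; apply: QM.
- by move=> b /(actP _ _ uM) Ib hb; apply: Qb => //; apply: homog_subst.
Qed.

Hypothesis char2 : (2%:R : k) != 0.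

(** Some translate of [I] avoids [Kgood], and translates avoiding it lie in [X1]. Moving the
    coordinates back to the original ones exhibits [I] as a limit. *)
Lemma coprime_pencil I u v : Hpt I -> I u -> I v -> homog_of 2 u -> homog_of 2 v -> nosyz u v ->
  cl X1 I /\ regular I.
Proof.
move=> HI Iu Iv hu hv ns; have [M uM [P0 R0]] := nosyz_generic char2 hu hv ns.
have nK : ~ Kgood (act M I).
  move=> [_ /(_ _ _ (act_mem M Iu) (act_mem M Iv) (@homog_subst _ _ M _ hu) (@homog_subst _ _ M _ hv))] /eqP.
  by rewrite mulf_eq0 (negPf P0) (negPf R0).
split; last by apply: (regular_act uM); case: (good_chart (Hpt_act uM HI) nK).
apply: (cl_translate Kgood_closed uM HI _ nK) => M' uM' nK'.
by case: (good_chart (Hpt_act uM' HI) nK').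
Qed.

End GenericComponent.

(** * Ideals given from degree 4 on by three points on the line [x = 0] *)

Section SpecialModel.
Variable k : closedFieldType.
Local Notation S := {mpoly k[3]}.
Local Notation X := (X3 k).
Local Notation Y := (Y3 k).
Local Notation Z := (Z3 k).
Implicit Types (p q : S) (I : ideal_pred k).

Section Cubic.
Variables (c1 c2 c3 : k).

(* The companion matrix of [sp_c], acting on row vectors. *)
Definition spB := mx3 [:: [:: 0; 1; 0]; [:: 0; 0; 1]; [:: - c3; - c2; - c1]].
Definition sp_c : S := Y * (Y * Y) + Z * (c1 *: (Y * Y) + c2 *: (Y * Z) + c3 *: (Z * Z)).
Local Notation ev := (evd (0 : 'M[k]_3) spB).

Lemma sp_comm : (0 : 'M[k]_3) * spB = spB * 0.
Proof. by rewrite mul0r mulr0. Qed.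

Lemma homog_tern a b c : homog_of 2 (a *: (Y * Y) + b *: (Y * Z) + c *: (Z * Z)).
Proof.
have hY := @homogY3 k; have hZ := @homogZ3 k.
by do 2?apply: homogD; apply: homogZ; [apply: homogYM|apply: homogYM|apply: homogZM].
Qed.

Lemma homog_sp_c : homog_of 3 sp_c.
Proof.
apply: homogD; first by apply/homogYM/homogYM; exact: homogY3.
by apply: homogZM; exact: homog_tern.
Qed.

Lemma row3_spB a b c : row3 a b c *m spB = row3 (- (c * c3)) (a - c * c2) (b - c * c1).
Proof.
apply/rowP => j; rewrite !mxE 3!big_ord_recl big_ord0 !mxE /=.
by case: (ord3 j) => -> /=; ring.
Qed.

Lemma sp_evdX d p : homog_of d p -> ev d.+1 (X * p) = 0.
Proof. by move=> hp; rewrite (evdXM sp_comm hp) mulmx0. Qed.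

Lemma sp_evd_tern a b c : ev 2 (a *: (Y * Y) + b *: (Y * Z) + c *: (Z * Z)) = row3 c b a.
Proof.
rewrite !evdD !evdZ (evdYM (@homogY3 k)) (evdYM (@homogZ3 k)) (evdZM (@homogZ3 k)).
rewrite linY1 linZ1 !evd1_lin !scale0r !scale1r !addr0 add0r delta_row3 !row3_spB !row3Z !row3D.
congr row3; ring.
Qed.

Lemma sp_evd_Zn n q : homog_of 2 q -> ev (n + 2) (Z ^+ n * q) = ev 2 q.
Proof.
move=> hq; elim: n => [|n IH]; first by rewrite mul1r.
by rewrite exprS -mulrA addSn (evdZM (@homogZX k n 2 q hq)).
Qed.

Lemma sp_evd_c : ev 3 sp_c = 0.
Proof.
have hY := @homogY3 k.
rewrite evdD (evdYM (homogYM hY)) (evdZM (@homog_tern c1 c2 c3)) sp_evd_tern.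
rewrite (_ : Y * Y = 1 *: (Y * Y) + 0 *: (Y * Z) + 0 *: (Z * Z)); last by rewrite scale1r !scale0r !addr0.
by rewrite sp_evd_tern row3_spB row3D; apply/rowP => j; rewrite !mxE; case: (ord3 j) => -> /=; ring.
Qed.

Lemma sp_evd_cM d q : homog_of d q -> ev (3 + d) (sp_c * q) = 0.
Proof.
elim: d q => [|d IH] q hq.
  by rewrite (homog0_const hq) mulrC mul_mpolyC evdZ sp_evd_c scaler0.
have [q0 [q1 [q2 [h0 h1 h2 ->]]]] := homog_split hq.
have hm b : homog_of d b -> homog_of (3 + d) (sp_c * b) by apply: homogM; exact: homog_sp_c.
rewrite addnS !mulrDr !(mulrCA sp_c) !evdD (evdXM sp_comm (hm _ h0)) (evdYM (hm _ h1)) (evdZM (hm _ h2)).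
by rewrite !IH // !mul0mx !addr0.
Qed.

Lemma sp_reduce d p : (3 <= d)%N -> homog_of d p -> exists p0 q a b c,
  [/\ homog_of d.-1 p0, homog_of (d - 3) q &
      p = X * p0 + sp_c * q + Z ^+ (d - 2) * (a *: (Y * Y) + b *: (Y * Z) + c *: (Z * Z))].
Proof.
pose P d p := exists p0 q a b c, [/\ homog_of d.-1 p0, homog_of (d - 3) q &
      p = X * p0 + sp_c * q + Z ^+ (d - 2) * (a *: (Y * Y) + b *: (Y * Z) + c *: (Z * Z))].
have hX := @homogX3 k; have hY := @homogY3 k; have hZ := @homogZ3 k.
have PD e q r : P e q -> P e r -> P e (q + r).
  move=> [p0 [q0 [a [b [c [h0 g0 ->]]]]]] [p1 [q1 [a' [b' [c' [h1 g1 ->]]]]]].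
  exists (p0 + p1), (q0 + q1), (a + a'), (b + b'), (c + c'); split; try exact: homogD.
  by rewrite -!mul_mpolyC !mpolyCD; move: (Z ^+ _) sp_c => w c0; ring.
have hC (c : k) : homog_of 0 (c%:MP : S).
  have h1 : homog_of 0 (1 : S) by rewrite -mpolyX0; apply: homogX; apply: mdeg0.
  by rewrite -[c%:MP]mulr1 mul_mpolyC; apply: homogZ.
have P3 q : homog_of 3 q -> P 3 q.
  move=> hq; have [p0 [p1 [p2 [h0 h1 h2 ->]]]] := homog_split hq.
  rewrite (quad_expand h1) (quad_expand h2).
  set m1 := p1@_(mon 1 1 0) *: Y + _; set m2 := p2@_(mon 1 1 0) *: Y + _.
  have hm1 : homog_of 1 m1 by apply: homogD; apply: homogZ.
  have hm2 : homog_of 1 m2 by apply: homogD; apply: homogZ.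
  exists (p0 + Y * (p1@_(mon 2 0 0) *: X + m1) + Z * (p2@_(mon 2 0 0) *: X + m2)), (p1@_(mon 0 2 0))%:MP.
  exists (p1@_(mon 0 1 1) - p1@_(mon 0 2 0) * c1 + p2@_(mon 0 2 0)).
  exists (p1@_(mon 0 0 2) - p1@_(mon 0 2 0) * c2 + p2@_(mon 0 1 1)).
  exists (p2@_(mon 0 0 2) - p1@_(mon 0 2 0) * c3); split; last 2 first.
  - exact: hC.
  - rewrite /sp_c expr1; clearbody m1 m2; rewrite -!mul_mpolyC.
    move: (p1@__) (p1@__) (p1@__) (p1@__) (p2@__) (p2@__) (p2@__) (p2@__) => a b c dd e f g h.
    rewrite !(mpolyCD, mpolyCN, mpolyCM).
    by move: a%:MP b%:MP c%:MP dd%:MP e%:MP f%:MP g%:MP h%:MP c1%:MP c2%:MP c3%:MP => *; ring.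
  have hh r m : homog_of 1 m -> homog_of 1 (r *: X + m) by move=> hm; apply: homogD => //; apply: homogZ.
  by apply: homogD; [apply: homogD => //; apply/homogYM/hh|apply/homogZM/hh].
move: d p; apply: homog_ind; [exact: PD|exact: P3|].
move=> d p d3 hp [p0 [q [a [b [c [h0 hq ->]]]]]].
have Pv v : homog_of 1 v -> P d.+1 (v * (X * p0 + sp_c * q + Z ^+ (d - 2) * (a *: (Y * Y) + b *: (Y * Z) + c *: (Z * Z)))).
  move=> hv; have [p1 [q1 [a' [b' [c' [h1 g1 e]]]]]] := P3 _ (homogM hv (@homog_tern a b c)).
  exists (v * p0 + Z ^+ (d - 2) * p1), (v * q + Z ^+ (d - 2) * q1), a', b', c'; split.
  - apply: homogD; first by have := homogM hv h0; rewrite add1n prednK // (ltn_trans _ d3).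
    by have := homogZX (n := d - 2) h1; rewrite /= subnK // ltnW.
  - apply: homogD; first by have := homogM hv hq; rewrite add1n subSn.
    by have := homogZX (n := d - 2) g1; rewrite addn0 subSS.
  rewrite mulrDr [v * (Z ^+ _ * _)]mulrCA e (_ : d.+1 - 2 = (d - 2).+1)%N; last by rewrite subSn // ltnW.
  by rewrite exprS expr1; move: (Z ^+ _) sp_c (_ + c' *: _) => w c0 w'; ring.
by split; apply: Pv.
Qed.

Lemma sp_kernel d p : (3 <= d)%N -> homog_of d p -> ev d p = 0 ->
  exists p0 q, [/\ homog_of d.-1 p0, homog_of (d - 3) q & p = X * p0 + sp_c * q].
Proof.
move=> d3 hp; have [p0 [q [a [b [c [h0 hq ->]]]]]] := sp_reduce d3 hp.
have d0 : (0 < d)%N by apply: leq_trans d3.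
have e1 : ev d (X * p0) = 0 by have := sp_evdX h0; rewrite prednK.
have e2 : ev d (sp_c * q) = 0 by have := sp_evd_cM hq; rewrite subnKC.
have e3 : ev d (Z ^+ (d - 2) * (a *: (Y * Y) + b *: (Y * Z) + c *: (Z * Z))) = row3 c b a.
  by rewrite -sp_evd_tern -(@sp_evd_Zn (d - 2)) ?subnK // ?(ltnW d3) //; apply: homog_tern.
rewrite !evdD e1 e2 e3 !add0r => /rowP h; exists p0, q; split=> //.
have := h i0; have := h i1; have := h i2; rewrite !mxE /= => -> -> ->.
by rewrite !scale0r !addr0 mulr0 addr0.
Qed.

Variables (q1 q2 e : S).
Hypotheses (h1 : homog_of 2 q1) (h2 : homog_of 2 q2).
Hypotheses (ev1 : ev 2 q1 = 0) (ev2 : ev 2 q2 = 0) (eve : ev 3 e = 0).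

Definition sp_W3 p := exists a b (c : k), [/\ homog_of 1 a, homog_of 1 b & p = a * q1 + b * q2 + c *: e].
(** In the application [q1] and [q2] have a linear syzygy and span only five cubics, whence the
    extra generator [e] of degree 3. *)
Definition special := model 0 spB (fun p => exists a b : k, p = a *: q1 + b *: q2) sp_W3.

Lemma lin_sp_W3 : lin_closed sp_W3.
Proof.
split=> [|p q [a [b [c [ha hb ->]]]] [a' [b' [c' [ha' hb' ->]]]]|t p [a [b [c [ha hb ->]]]]].
- by exists 0, 0, 0; split; try exact: homog0; rewrite scale0r; ring.
- by exists (a + a'), (b + b'), (c + c'); split; try exact: homogD; rewrite scalerDl; ring.
- by exists (t *: a), (t *: b), (t * c); split; try exact: homogZ; rewrite -!mul_mpolyC mpolyCM; ring.
Qed.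

Lemma sp_W23 p : homog_of 2 p -> (exists a b : k, p = a *: q1 + b *: q2) -> [/\ sp_W3 (X * p), sp_W3 (Y * p) & sp_W3 (Z * p)].
Proof.
move=> _ [a [b ->]]; have hX := @homogX3 k; have hY := @homogY3 k; have hZ := @homogZ3 k.
have g v : homog_of 1 v -> sp_W3 (v * (a *: q1 + b *: q2)).
  move=> hv; exists (a *: v), (b *: v), 0; split; try exact: homogZ.
  by rewrite scale0r -!mul_mpolyC; ring.
by split; apply: g.
Qed.

Lemma sp_W3e p : homog_of 3 p -> sp_W3 p -> ev 3 p = 0.
Proof.
move=> _ [a [b [c [ha hb ->]]]]; rewrite !evdD evdZ eve scaler0 addr0.
by rewrite (evd_lin_mul sp_comm ha h1 ev1) (evd_lin_mul sp_comm hb h2 ev2) addr0.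
Qed.

Lemma special_hideal : is_hideal special.
Proof. by apply: model_hideal; [exact: sp_comm|exact: lin_span2|exact: lin_sp_W3|exact: sp_W23|exact: sp_W3e]. Qed.

Lemma special_mem d p : homog_of d p ->
  special p <-> piece 0 spB (fun p => exists a b : k, p = a *: q1 + b *: q2) sp_W3 d p.
Proof. by move=> hp; apply: model_homog => //; [exact: lin_span2|exact: lin_sp_W3]. Qed.

Lemma special_Hpt s : freeS [:: q1; q2] -> size s = 6%N -> (forall p, p \in s -> sp_W3 p /\ homog_of 3 p) ->
  freeS s -> (forall p, sp_W3 p -> spanS s p) -> Hpt special.
Proof.
move=> f2 ss hs fs sp.
apply: (@model_Hpt _ 0 spB sp_comm _ _ (@lin_span2 k q1 q2) lin_sp_W3 sp_W23 sp_W3e (fun d i => mon 0 i (d - i))).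
- move=> d i d4; have := ltn_ord i => i3; split; first by rewrite mdeg_mon add0n subnKC //; lia.
  rewrite /evmon !monE expr0 mul1r; case: (ord3 i) => ->.
  + by rewrite expr0 mulmx1.
  + by rewrite expr1 delta_row3 row3_spB; apply/rowP => j; rewrite !mxE; case: (ord3 j) => -> /=; ring.
  + rewrite expr2 mulmxA delta_row3 !row3_spB; apply/rowP => j; rewrite !mxE; case: (ord3 j) => -> /=; ring.
- exists [:: q1; q2]; split=> //; apply/basis_ofP; split=> //.
    move=> p; rewrite !inE => /orP[/eqP ->|/eqP ->]; split=> //.
      by exists 1, 0; rewrite scale1r scale0r addr0.
    by exists 0, 1; rewrite scale1r scale0r add0r.
  move=> p [a [b ->]] _; exists (nth 0 [:: a; b]).
  by rewrite !lcomb_cons lcomb_nil addr0.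
- by exists s; split=> //; apply/basis_ofP; split=> // p Wp _; apply: sp.
Qed.

End Cubic.
End SpecialModel.

(** * The ideals of the second family for a fixed line *)

Section SpecialComponent.
Variable k : closedFieldType.
Local Notation S := {mpoly k[3]}.
Local Notation X := (X3 k).
Local Notation Y := (Y3 k).
Local Notation Z := (Z3 k).
Implicit Types (p q : S) (I : ideal_pred k) (M : 'M[k]_3).

Lemma multiples_closed (Q : S -> Prop) v e : (forall p q, Q p -> Q q -> Q (p + q)) -> (forall a p, Q p -> Q (a * p)) ->
  (forall p, homog_of e p -> Q (v * p)) -> forall d p, (e <= d)%N -> homog_of d p -> Q (v * p).
Proof.
move=> QD QM Qv; apply: homog_ind => [d a b IHa IHb|q hq|d q _ _ IH].
- by rewrite mulrDr; apply: QD.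
- exact: Qv.
- by split; rewrite mulrCA; apply: QM.
Qed.

Section OnePoint.
Variables (r1 r2 c1 c2 c3 al : k).

Definition sp_q1 : S := X * lin (- r1) 1 0.
Definition sp_q2 : S := X * lin (- r2) 0 1.
Definition sp_e : S := sp_c c1 c2 c3 + al *: (X * (X * X)).
(** The quadrics are the line [x = 0] times the lines through the point [(1 : r1 : r2)], [sp_c] cuts
    out three points on [x = 0], and [al] selects the sixth cubic. *)
Definition spI := special c1 c2 c3 sp_q1 sp_q2 sp_e.

Lemma homog_sp_q1 : homog_of 2 sp_q1. Proof. by apply/homogXM/homog_lin. Qed.
Lemma homog_sp_q2 : homog_of 2 sp_q2. Proof. by apply/homogXM/homog_lin. Qed.
Lemma homog_sp_e : homog_of 3 sp_e.
Proof. by apply: homogD; [exact: homog_sp_c|apply/homogZ/homogXM/homogXM/homogX3]. Qed.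

Lemma evd_sp_q1 : evd 0 (spB c1 c2 c3) 2 sp_q1 = 0.
Proof. by apply: sp_evdX; apply: homog_lin. Qed.
Lemma evd_sp_q2 : evd 0 (spB c1 c2 c3) 2 sp_q2 = 0.
Proof. by apply: sp_evdX; apply: homog_lin. Qed.
Lemma evd_sp_e : evd 0 (spB c1 c2 c3) 3 sp_e = 0.
Proof. by rewrite evdD evdZ sp_evd_c sp_evdX ?scaler0 ?addr0 //; apply/homogXM/homogX3. Qed.

Lemma spI_hideal : is_hideal spI.
Proof.
by apply: special_hideal; [exact: homog_sp_q1|exact: homog_sp_q2|exact: evd_sp_q1|exact: evd_sp_q2|exact: evd_sp_e].
Qed.

Lemma spI_mem d p : homog_of d p -> spI p <->
  piece 0 (spB c1 c2 c3) (fun p => exists a b : k, p = a *: sp_q1 + b *: sp_q2) (sp_W3 sp_q1 sp_q2 sp_e) d p.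
Proof. exact: special_mem. Qed.

Lemma spI_Hpt : Hpt spI.
Proof.
have hX := @homogX3 k; have hY := @homogY3 k; have hZ := @homogZ3 k.
(* The product [Z * sp_q1] is left out because of the syzygy
   [(z - r2 x) sp_q1 = (y - r1 x) sp_q2]. *)
pose s := [:: X * sp_q1; Y * sp_q1; X * sp_q2; Y * sp_q2; Z * sp_q2; sp_e].
have sE c : lcomb c s = lin (c 0%N) (c 1%N) 0 * sp_q1 + lin (c 2%N) (c 3%N) (c 4%N) * sp_q2 + c 5%N *: sp_e.
  by rewrite !lcomb_cons lcomb_nil /lin scale0r !addr0 !mulrDl -!scalerAl !addrA.
rewrite /spI; refine (@special_Hpt k c1 c2 c3 sp_q1 sp_q2 sp_e (@homog_sp_q1) (@homog_sp_q2) evd_sp_q1 evd_sp_q2 evd_sp_e s _ _ _ _ _) => //.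
- apply: (@freeS_coef2 _ _ _ (mon 1 1 0) (mon 1 0 1)); rewrite /sp_q1 /sp_q2 !coefvar /lin !mcoeffD !mcoeffZ !coef_mon /=; ring.
- move=> p; have o := @homog0 k 1; rewrite !inE => /or4P[/eqP ->|/eqP ->|/eqP ->|/or3P[/eqP ->|/eqP ->|/eqP ->]];
    (split; last by [apply/homogXM/homog_sp_q1|apply/homogYM/homog_sp_q1|apply/homogXM/homog_sp_q2|
       apply/homogYM/homog_sp_q2|apply/homogZM/homog_sp_q2|exact: homog_sp_e]).
  + by exists X, 0, 0; split=> //; rewrite scale0r; ring.
  + by exists Y, 0, 0; split=> //; rewrite scale0r; ring.
  + by exists 0, X, 0; split=> //; rewrite scale0r; ring.
  + by exists 0, Y, 0; split=> //; rewrite scale0r; ring.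
  + by exists 0, Z, 0; split=> //; rewrite scale0r; ring.
  + by exists 0, 0, 1; split=> //; rewrite scale1r; ring.
- move=> c; rewrite sE => e.
  have cf m := congr1 (mcoeff m) e.
  have hc5 : c 5%N = 0.
    have := cf (mon 0 3 0); rewrite !mcoeffD !mcoeffZ mcoeff0 !coef_linM /sp_q1 /sp_q2 /sp_e /sp_c !mcoeffD !mcoeffZ !coefvar.
    by rewrite coef_mon /= => h; rewrite -[RHS]h; ring.
  move: cf; rewrite hc5 => cf.
  have hc1 : c 1%N = 0.
    have := cf (mon 1 2 0); rewrite !mcoeffD !mcoeffZ mcoeff0 !coef_linM /sp_q1 /sp_q2 !coefvar !coef_lin => h.
    by rewrite -[RHS]h; ring.
  have hc4 : c 4%N = 0.
    have := cf (mon 1 0 2); rewrite !mcoeffD !mcoeffZ mcoeff0 !coef_linM /sp_q1 /sp_q2 !coefvar !coef_lin => h.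
    by rewrite -[RHS]h; ring.
  have hc3 : c 3%N = 0.
    have := cf (mon 1 1 1); rewrite !mcoeffD !mcoeffZ mcoeff0 !coef_linM /sp_q1 /sp_q2 !coefvar !coef_lin => h.
    by rewrite -[RHS]h; ring.
  have hc0 : c 0%N = 0.
    have := cf (mon 2 1 0); rewrite !mcoeffD !mcoeffZ mcoeff0 !coef_linM /sp_q1 /sp_q2 !coefvar !coef_lin hc1 hc3 => h.
    by rewrite -[RHS]h; ring.
  have hc2 : c 2%N = 0.
    have := cf (mon 2 0 1); rewrite !mcoeffD !mcoeffZ mcoeff0 !coef_linM /sp_q1 /sp_q2 !coefvar !coef_lin hc4 => h.
    by rewrite -[RHS]h; ring.
  by case=> [|[|[|[|[|[|]]]]]].
- move=> p [a [b [c [ha hb ->]]]]; rewrite (homog1_lin ha) (homog1_lin hb).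
  move: (a@__) (a@__) (a@__) (b@__) (b@__) (b@__) => a2 a1 a0 b2 b1 b0.
  exists (nth 0 [:: a0 + a2 * r2; a1; b0 - a2 * r1; b1 + a2; b2; c]); rewrite sE /=; congr (_ + _).
  rewrite /sp_q1 /sp_q2 /lin -!mul_mpolyC !(mpolyCD, mpolyCN, mpolyCM, mpolyC1, mpolyC0).
  by move: a0%:MP a1%:MP a2%:MP b0%:MP b1%:MP b2%:MP r1%:MP r2%:MP => *; ring.
Qed.

(* The generators determine an ideal of the Hilbert scheme because they have the right codimension. *)
Lemma spI_unique I : Hpt I -> I sp_q1 -> I sp_q2 -> I sp_e -> (forall p, homog_of 3 p -> I (X * p)) -> I = spI.
Proof.
move=> HI I1 I2 Ie Ix; have hI := Hpt_hideal HI.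
apply: ideal_ext => p; suff : forall p, spI p <-> I p by move=> ->.
apply: Hpt_eq => //; first exact: spI_Hpt.
have Ixd := multiples_closed (hiD hI) (hiM hI) Ix.
have Icv v : homog_of 1 v -> I (sp_c c1 c2 c3 * v).
  move=> hv; rewrite (_ : _ * v = v * sp_e - al *: (X * (X * X * v))); last first.
    by rewrite /sp_e -!mul_mpolyC; move: (sp_c _ _ _) => w; ring.
  apply: (hiB hI); first exact: (hiM hI).
  by apply: (hiZ hI); apply: Ix; rewrite -mulrA; apply/homogXM/homogXM.
move=> d q hq /(spI_mem hq); case: d hq => [|[|[|[|d]]]] hq /=.
- by move=> ->; apply: (hi0 hI).
- by move=> ->; apply: (hi0 hI).
- by case=> [a [b ->]]; apply: (hiD hI); apply: (hiZ hI).
- by case=> [a [b [c [_ _ ->]]]]; apply: (hiD hI); [apply: (hiD hI); apply: (hiM hI)|apply: (hiZ hI)].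
move=> ev0; have [|p0 [r [h0 hr ->]]] := sp_kernel _ hq ev0; first by [].
apply: (hiD hI); first exact: (Ixd _ _ _ h0).
have [r0 [r1' [r2' [_ _ _ ->]]]] := homog_split hr; rewrite !mulrDr ![_ * (_ * _)]mulrA ![_ * _ * _]mulrC.
by do 2?apply: (hiD hI); apply: (hiM hI); apply: Icv; [exact: homogX3|exact: homogY3|exact: homogZ3].
Qed.

End OnePoint.
End SpecialComponent.

(** * The second family: moving the line adds two parameters *)

Section SpecialFamily.
Variable k : closedFieldType.
Local Notation S := {mpoly k[3]}.
Local Notation X := (X3 k).
Local Notation Y := (Y3 k).
Local Notation Z := (Z3 k).
Implicit Types (p q : S) (I : ideal_pred k) (M : 'M[k]_3).

Definition trans (s1 s2 : k) := mx3 [:: [:: 1; s1; s2]; [:: 0; 1; 0]; [:: 0; 0; 1]].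

Lemma trans_unit s1 s2 : trans s1 s2 \in unitmx.
Proof. by apply: (@mx3_mul1 _ _ _ _ _ _ _ _ _ _ 1 (- s1) (- s2) 0 1 0 0 0 1); split; ring. Qed.

(* In this order of the coordinates the flag of coordinate subspaces is cut out by coefficients of
   quadrics and cubics. *)
Definition fam2 (t : 'I_8 -> k) : ideal_pred k :=
  act (trans (tc t 6) (tc t 7)) (spI (tc t 4) (tc t 5) (tc t 2) (tc t 1) (tc t 0) (tc t 3)).

Definition ok2 (t : 'I_8 -> k) : Prop := True.

Lemma fam2_Hpt t : ok2 t -> Hpt (fam2 t).
Proof. by move=> _; apply/Hpt_act/spI_Hpt/trans_unit. Qed.

Lemma ok2_line t t' : ok2 t -> ok2 t' ->
  exists2 e : {poly k}, e != 0 & forall s, e.[s] != 0 -> ok2 (lin_path t t' s).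
Proof. by exists 1; rewrite ?oner_neq0. Qed.

Lemma fam2_lift t : ok2 t -> @liftable k 20 N5 (ideal_pred k) (@lowbasis k) _ _ (@vec_co k 8) ok2 fam2 t (fam2 t).
Proof.
move=> _; have hfam a : ok2 a -> is_hideal (fam2 a) by move=> /fam2_Hpt/Hpt_hideal.
apply: lifts_liftable => [|||d p d4]; [exact: hfam|exact: fam2_Hpt|exact: (fam2_Hpt (t := t) Logic.I)|].
have ptc i : pfun (@vec_co k 8) (fun t => tc t i) by apply: pf_tc.
have ptr i j : pfun (@vec_co k 8) (fun t => trans (tc t 6) (tc t 7) i j).
  case: (ord3 i) => ->; case: (ord3 j) => ->; first
    [by apply: (pf_ext (pf_const _ 1)) => a; rewrite mxE|by apply: (pf_ext (pf_const _ 0)) => a; rewrite mxE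
    |by apply: (pf_ext (ptc 6)) => a; rewrite mxE|by apply: (pf_ext (ptc 7)) => a; rewrite mxE].
pose L q := lifts (@vec_co k 8) ok2 fam2 t (subst (trans (tc t 6) (tc t 7)) q).
have LD a b : L a -> L b -> L (a + b) by rewrite /L rmorphD; apply: liftsD.
have LM a b : L b -> L (a * b) by rewrite /L rmorphM; apply: liftsM.
have LZ (a : k) b : L b -> L (a *: b) by rewrite /L substZ; apply: liftsZ.
have Lgen e (F : ('I_8 -> k) -> S) : psec (@vec_co k 8) F -> (forall a, homog_of e (F a)) ->
    (forall a, spI (tc a 4) (tc a 5) (tc a 2) (tc a 1) (tc a 0) (tc a 3) (F a)) -> L (F t).
  move=> pF hF IF; exists (fun a => subst (trans (tc a 6) (tc a 7)) (F a)); split=> [||a _] //.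
    exact: psec_subst ptr pF hF.
  exact: act_mem.
have psq1 : psec (@vec_co k 8) (fun a => sp_q1 (tc a 4)).
  by apply: psecM; [exact: psec_const|apply: psec_lin; [apply: pf_opp|apply: pf_const|apply: pf_const]].
have psq2 : psec (@vec_co k 8) (fun a => sp_q2 (tc a 5)).
  by apply: psecM; [exact: psec_const|apply: psec_lin; [apply: pf_opp|apply: pf_const|apply: pf_const]].
have psc : psec (@vec_co k 8) (fun a => sp_c (tc a 2) (tc a 1) (tc a 0)).
  apply: psecD; first exact: psec_const.
  apply: psecM; first exact: psec_const.
  by do 2?apply: psecD; apply: psecZ => //; apply: psec_const.
have pse : psec (@vec_co k 8) (fun a => sp_e (tc a 2) (tc a 1) (tc a 0) (tc a 3)).
  by apply: psecD => //; apply: psecZ => //; apply: psec_const.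
have Lq1 : L (sp_q1 (tc t 4)).
  apply: (Lgen 2 (fun a => sp_q1 (tc a 4))) => // a; first exact: homog_sp_q1.
  by apply/(spI_mem _ _ _ _ _ _ (@homog_sp_q1 k (tc a 4))); exists 1, 0; rewrite scale1r scale0r addr0.
have Lq2 : L (sp_q2 (tc t 5)).
  apply: (Lgen 2 (fun a => sp_q2 (tc a 5))) => // a; first exact: homog_sp_q2.
  by apply/(spI_mem _ _ _ _ _ _ (@homog_sp_q2 k (tc a 5))); exists 0, 1; rewrite scale1r scale0r add0r.
have Le : L (sp_e (tc t 2) (tc t 1) (tc t 0) (tc t 3)).
  apply: (Lgen 3 (fun a => sp_e (tc a 2) (tc a 1) (tc a 0) (tc a 3))) => // a; first exact: homog_sp_e.
  apply/(spI_mem _ _ _ _ _ _ (@homog_sp_e k (tc a 2) (tc a 1) (tc a 0) (tc a 3))).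
  by exists 0, 0, 1; split; try exact: homog0; rewrite scale1r !mul0r !add0r.
have uT := trans_unit (tc t 6) (tc t 7).
move=> /(actP _ _ uT) Ip hp; rewrite -(substVK p uT).
move: Ip (@homog_subst _ d (invmx (trans (tc t 6) (tc t 7))) _ hp); set q := subst _ p => Iq hq.
rewrite -/(L q); move: Iq => /(spI_mem _ _ _ _ _ _ hq); move: hq; move: q => q.
have L0 : L 0 by rewrite /L rmorph0; apply: lifts0.
case: d d4 hp => [|[|[|[|[|//]]]]] _ hp hq /=.
- by move=> ->.
- by move=> ->.
- by case=> [a [b ->]]; apply: (LD); apply: (LZ).
- by case=> [a [b [c [_ _ ->]]]]; apply: (LD); [apply: (LD); apply: (LM)|apply: (LZ)].
move=> ev0; have [|p0 [r [h0 hr ->]]] := sp_kernel _ hq ev0; first by [].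
apply: (LD).
  apply: (Lgen 4 (fun=> X * p0)) => [|a|a]; [exact: psec_const|exact: homogXM|].
  by apply/(spI_mem _ _ _ _ _ _ (homogXM h0)); apply: sp_evdX h0.
apply: (Lgen 4 (fun a => sp_c (tc a 2) (tc a 1) (tc a 0) * r)) => [|a|a].
- by apply: psecM => //; apply: psec_const.
- by apply: (@homogM k 3 1) => //; apply: homog_sp_c.
- have h4 : homog_of 4 (sp_c (tc a 2) (tc a 1) (tc a 0) * r) by apply: (@homogM k 3 1) => //; apply: homog_sp_c.
  by apply/(spI_mem _ _ _ _ _ _ h4); apply: (@sp_evd_cM _ _ _ _ 1).
Qed.

Definition X2 : subH k := fam_image fam2 ok2.

Lemma X2_Hpt I : X2 I -> Hpt I.
Proof. by move=> [t okt ->]; apply: fam2_Hpt. Qed.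

Lemma trans_X2 s1 s2 r1 r2 c1 c2 c3 al : X2 (act (trans s1 s2) (spI r1 r2 c1 c2 c3 al)).
Proof.
exists (fun j => [:: c3; c2; c1; al; r1; r2; s1; s2]`_j) => //.
by rewrite /fam2 !tc_seq.
Qed.

Lemma spI_X2 r1 r2 c1 c2 c3 al : X2 (spI r1 r2 c1 c2 c3 al).
Proof.
have := trans_X2 0 0 r1 r2 c1 c2 c3 al; suff -> : trans 0 0 = 1%:M by rewrite act1.
by apply/matrixP => i j; rewrite !mxE; case: (ord3 i) => ->; case: (ord3 j) => ->.
Qed.

End SpecialFamily.

(** * Coordinate changes that fix the line [x = 0] *)

Section SpecialStable.
Variable k : closedFieldType.
Local Notation S := {mpoly k[3]}.
Local Notation X := (X3 k).
Local Notation Y := (Y3 k).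
Local Notation Z := (Z3 k).
Implicit Types (p q : S) (I : ideal_pred k) (M : 'M[k]_3).
Local Notation closedG := (@closedG k 20 N5 (ideal_pred k) (@Hpt k) (@lowbasis k)).
Local Notation cl := (@cl k 20 N5 (ideal_pred k) (@Hpt k) (@lowbasis k)).

Lemma cubic_expand p : homog_of 3 p -> exists p0 a b c,
  homog_of 2 p0 /\ p = X * p0 + p@_(mon 0 3 0) *: (Y * (Y * Y)) + Z * (a *: (Y * Y) + b *: (Y * Z) + c *: (Z * Z)).
Proof.
move=> hp; have [//|p0 [q [a [b [c [h0 /homog0_const hq e]]]]]] := @sp_reduce k 0 0 0 3 p _ hp.
rewrite hq [sp_c _ _ _ * _]mulrC mul_mpolyC [(3 - 2)%N]/= expr1 in e.
exists p0, a, b, c; split=> //; rewrite {1}e.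
have -> : p@_(mon 0 3 0) = q@_0%MM.
  rewrite e /sp_c !scale0r !addr0 mulr0 addr0 !mcoeffD mcoeffZ !coefvar coef_mon /=; ring.
by rewrite /sp_c !scale0r !addr0 mulr0 addr0.
Qed.

(** Modulo the two quadrics the multiples of [x] among the cubics reduce to multiples of [x^3].
    Dividing [e] by its coefficient of [y^3] therefore brings it to the form [sp_e], and
    [spI_unique] applies. *)
Lemma spI_of_cubic I r1 r2 e : Hpt I -> I (sp_q1 r1) -> I (sp_q2 r2) -> (forall p, homog_of 3 p -> I (X * p)) ->
  I e -> homog_of 3 e -> e@_(mon 0 3 0) != 0 -> exists c1 c2 c3 al, I = spI r1 r2 c1 c2 c3 al.
Proof.
move=> HI I1 I2 Ix Ie he e0; have hI := Hpt_hideal HI.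
have [p0 [a [b [c [h0 ee]]]]] := cubic_expand he; set g := e@__ in e0 ee.
(* The number [d] is the value of [p0] at [(1 : r1 : r2)], the common zero of the two linear
   forms. *)
have [A [B [d eA]]] : exists A B (d : k), p0 = A * lin (- r1) 1 0 + B * lin (- r2) 0 1 + d *: (X * X).
  rewrite (quad_expand h0).
  move: (p0@__) (p0@__) (p0@__) (p0@__) (p0@__) (p0@__) => x6 x5 x4 x3 x2 x1.
  exists (x2 *: X + x4 *: (Y + r1 *: X) + x5 *: Z), (x3 *: X + x5 *: (r1 *: X) + x6 *: (Z + r2 *: X)).
  exists (x1 + x2 * r1 + x3 * r2 + x4 * (r1 * r1) + x5 * (r1 * r2) + x6 * (r2 * r2)).
  rewrite /lin -!mul_mpolyC !(mpolyCD, mpolyCN, mpolyCM, mpolyC1, mpolyC0).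
  by move: x1%:MP x2%:MP x3%:MP x4%:MP x5%:MP x6%:MP r1%:MP r2%:MP => *; ring.
exists (a / g), (b / g), (c / g), (d / g); apply: spI_unique => //.
have -> : sp_e (a / g) (b / g) (c / g) (d / g) = g^-1 *: (e - A * sp_q1 r1 - B * sp_q2 r2).
  apply: (scalerI e0); rewrite scalerA divff // scale1r ee eA /sp_e /sp_c /sp_q1 /sp_q2.
  have sc (x : k) (q : S) : g *: ((x / g) *: q) = x *: q by rewrite scalerA mulrC divfK.
  move: (lin _ _ _) (lin _ _ _) => l l'.
  rewrite [Z * (_ + (c / g) *: _)]mulrDr [Z * (_ + (b / g) *: _)]mulrDr -!scalerAr !scalerDr !sc -!mul_mpolyC.
  by move: a%:MP b%:MP c%:MP d%:MP g%:MP => *; ring.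
by apply: (hiZ hI); apply: (hiB hI); [apply: (hiB hI) => //|]; apply: (hiM hI).
Qed.

Lemma spI_mem_q1 (r1 r2 c1 c2 c3 al : k) : spI r1 r2 c1 c2 c3 al (sp_q1 r1).
Proof. by apply/(spI_mem _ _ _ _ _ _ (@homog_sp_q1 k r1)); exists 1, 0; rewrite scale1r scale0r addr0. Qed.

Lemma spI_mem_q2 (r1 r2 c1 c2 c3 al : k) : spI r1 r2 c1 c2 c3 al (sp_q2 r2).
Proof. by apply/(spI_mem _ _ _ _ _ _ (@homog_sp_q2 k r2)); exists 0, 1; rewrite scale1r scale0r add0r. Qed.

Lemma spI_mem_e (r1 r2 c1 c2 c3 al : k) : spI r1 r2 c1 c2 c3 al (sp_e c1 c2 c3 al).
Proof.
apply/(spI_mem _ _ _ _ _ _ (@homog_sp_e k c1 c2 c3 al)).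
by exists 0, 0, 1; split; try exact: homog0; rewrite scale1r !mul0r !add0r.
Qed.

Lemma spI_mem_X (r1 r2 c1 c2 c3 al : k) p : homog_of 3 p -> spI r1 r2 c1 c2 c3 al (X * p).
Proof. by move=> hp; apply/(spI_mem _ _ _ _ _ _ (homogXM hp)); apply: sp_evdX hp. Qed.

Lemma sp_e030 (c1 c2 c3 al : k) : (sp_e c1 c2 c3 al : S)@_(mon 0 3 0) = 1.
Proof. by rewrite /sp_e /sp_c !mcoeffD !mcoeffZ !coefvar coef_mon /=; ring. Qed.

Lemma lin_row M i : linrow (row i M) = lin (M i i0) (M i i1) (M i i2).
Proof.
rewrite -substX; case: (ord3 i) => ->.
- by rewrite -substX3; congr subst; congr mpolyX; apply/monP; rewrite !monE !mnmE.
- by rewrite -substY3; congr subst; congr mpolyX; apply/monP; rewrite !monE !mnmE.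
- by rewrite -substZ3; congr subst; congr mpolyX; apply/monP; rewrite !monE !mnmE.
Qed.

(* [act N] with [N x = m x] is a change of coordinates of the line [x = 0] and of the plane of linear forms. *)
Lemma act_spI N (m r1 r2 c1 c2 c3 al : k) : N \in unitmx -> subst N X = m *: X -> m != 0 ->
  (subst N (sp_e c1 c2 c3 al))@_(mon 0 3 0) != 0 ->
  exists r1' r2' c1' c2' c3' al', act N (spI r1 r2 c1 c2 c3 al) = spI r1' r2' c1' c2' c3' al'.
Proof.
move=> uN NX m0 e0; have HJ := Hpt_act uN (spI_Hpt r1 r2 c1 c2 c3 al).
set J := act N _ in HJ *; have hJ := Hpt_hideal HJ.
have JX q : spI r1 r2 c1 c2 c3 al (X * q) -> J (X * subst N q).
  move=> Iq; have := act_mem N Iq; rewrite rmorphM /= NX -scalerAl => /(hiZ hJ m^-1).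
  by rewrite scalerA mulVf // scale1r.
have Jlin v a b c : v = subst N (lin a b c) -> J (X * (v - (((a + b * r1 + c * r2) * m) *: X))).
  move=> ->; have -> : subst N (lin a b c) - ((a + b * r1 + c * r2) * m) *: X =
     subst N (b *: lin (- r1) 1 0 + c *: lin (- r2) 0 1).
    rewrite -scalerA -NX -substZ -rmorphB; congr subst; rewrite !linZ linD.
    rewrite /lin -!mul_mpolyC !(mpolyCD, mpolyCN, mpolyCM, mpolyC1, mpolyC0).
    by move: a%:MP b%:MP c%:MP r1%:MP r2%:MP => *; ring.
  apply: JX; rewrite mulrDr -!scalerAr; have hI := spI_hideal r1 r2 c1 c2 c3 al.
  by apply: (hiD hI); apply: (hiZ hI); [exact: spI_mem_q1|exact: spI_mem_q2].
pose V := invmx N.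
pose r1' := (V i1 i0 + V i1 i1 * r1 + V i1 i2 * r2) * m.
pose r2' := (V i2 i0 + V i2 i1 * r1 + V i2 i2 * r2) * m.
have := @spI_of_cubic J r1' r2' (subst N (sp_e c1 c2 c3 al)) HJ.
case=> //.
- have := Jlin Y _ _ _ _; rewrite -/r1' /sp_q1; set q := lin _ _ _.
  have -> : q = Y - r1' *: X by rewrite /q /lin scale1r scale0r addr0 scaleNr addrC.
  by apply; rewrite -substY3 substVK.
- have := Jlin Z _ _ _ _; rewrite -/r2' /sp_q2; set q := lin _ _ _.
  have -> : q = Z - r2' *: X by rewrite /q /lin scale1r scale0r addr0 scaleNr addrC.
  by apply; rewrite -substZ3 substVK.
- by move=> p hp; rewrite -(substVK p uN); apply: JX; apply: spI_mem_X; apply: homog_subst.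
- by apply: act_mem; apply: spI_mem_e.
- by apply: homog_subst; apply: homog_sp_e.
by move=> c1' [c2' [c3' [al' e]]]; exists r1', r2', c1', c2', c3', al'.
Qed.

End SpecialStable.

(** * Stability of the closure of the second family under coordinate changes *)

Section SpecialTranslates.
Variable k : closedFieldType.
Local Notation S := {mpoly k[3]}.
Local Notation X := (X3 k).
Local Notation Y := (Y3 k).
Local Notation Z := (Z3 k).
Implicit Types (p q : S) (I : ideal_pred k) (M : 'M[k]_3).
Local Notation closedG := (@closedG k 20 N5 (ideal_pred k) (@Hpt k) (@lowbasis k)).
Local Notation cl := (@cl k 20 N5 (ideal_pred k) (@Hpt k) (@lowbasis k)).

(** Clears the first row of a matrix without division: [trans (m1 / m0) (m2 / m0)] times this matrix
    is the diagonal matrix with entries [1, m0, m0]. *)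
Definition clear_row (m0 m1 m2 : k) := mx3 [:: [:: 1; - m1; - m2]; [:: 0; m0; 0]; [:: 0; 0; m0]].

(** [M] factors as [N *m T] with [subst N X = m *: X] and [T] a [trans]; the ideal goes to another
    [spI] under [N] and into [X2] under [T]. Stated through [clear_row], the condition on [y^3] is
    polynomial in [M], which [X2_stable] requires. *)
Lemma act_spI_generic M (r1 r2 c1 c2 c3 al : k) (m := M i0 i0) : M \in unitmx -> m != 0 ->
  (subst (M *m clear_row m (M i0 i1) (M i0 i2)) (sp_e c1 c2 c3 al))@_(mon 0 3 0) != 0 ->
  X2 (act M (spI r1 r2 c1 c2 c3 al)).
Proof.
move=> uM m0; set U := clear_row _ _ _; pose T := trans (M i0 i1 / m) (M i0 i2 / m).
have uT : T \in unitmx by apply: trans_unit.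
pose N := M *m invmx T; have uN : N \in unitmx by rewrite unitmx_mul uM unitmx_inv.
have NT : N *m T = M by rewrite /N -mulmxA mulVmx // mulmx1.
have NX : subst N X = m *: X.
  have -> : subst N X = subst (invmx T) (m *: subst T X); last by rewrite substZ substK.
  rewrite /N -subst_comp; congr (subst _ _); rewrite !substX3 linZ !mxE /=.
  by rewrite mulr1 ![m * (_ / m)]mulrC !divfK.
rewrite -NT -mulmxA -subst_comp; set e := subst N _; have he : homog_of 3 e by apply/homog_subst/homog_sp_e.
have TU : T *m U = mx3 [:: [:: 1; 0; 0]; [:: 0; m; 0]; [:: 0; 0; m]].
  apply/matrixP => i j; rewrite !mxE 3!big_ord_recl big_ord0 !mxE /=.
  by case: (ord3 i) => ->; case: (ord3 j) => -> /=; field.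
have -> : (subst (T *m U) e)@_(mon 0 3 0) = m ^+ 3 * e@_(mon 0 3 0).
  have [p0 [a [b [c [h0 ee]]]]] := cubic_expand he; rewrite [in LHS]ee TU.
  rewrite !rmorphD !rmorphM /= substZ !rmorphM /= substX3 substY3 substZ3 !mxE /=.
  have -> : lin 0 m 0 = m *: Y by rewrite /lin !scale0r add0r addr0.
  have -> : lin 0 0 m = m *: Z by rewrite /lin !scale0r !add0r.
  have -> : lin 1 0 0 = X by rewrite -linX1.
  rewrite -!scalerAl -!scalerAr !scalerA !mcoeffD !mcoeffZ !coefvar coef_mon /=; ring.
rewrite mulf_eq0 negb_or => /andP[_ e0].
have [r1' [r2' [c1' [c2' [c3' [al' eJ]]]]]] := act_spI r1 r2 uN NX m0 e0.
by rewrite -act_comp eJ; apply: trans_X2.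
Qed.

(** On the line of matrices from the identity to [M] the conditions of [act_spI_generic] are
    polynomial and hold at the identity, hence almost everywhere; [M] is a limit. *)
Lemma X2_stable J M : M \in unitmx -> X2 J -> cl (@X2 k) (act M J).
Proof.
move=> uM [t _ ->]; rewrite /fam2 act_comp.
move: (tc t 4) (tc t 5) (tc t 2) (tc t 1) (tc t 0) (tc t 3) => r1 r2 c1 c2 c3 al.
have {uM} : trans (tc t 6) (tc t 7) *m M \in unitmx by rewrite unitmx_mul trans_unit.
move: (_ *m M) => {}M uM.
pose Ms := mxline 1%:M M; pose Us s := clear_row (Ms s i0 i0) (Ms s i0 i1) (Ms s i0 i2).
have pM i j : pfun line_co (fun s => Ms s i j) by apply: pf_mxline.
have pU i j : pfun line_co (fun s => Us s i j).
  case: (ord3 i) => ->; case: (ord3 j) => ->; first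
    [by apply: (pf_ext (pf_const _ 1)) => a; rewrite [Us a _ _]mxE|by apply: (pf_ext (pf_const _ 0)) => a; rewrite [Us a _ _]mxE
    |by apply: (pf_ext (pM i0 i0)) => a; rewrite [Us a _ _]mxE
    |by apply: (pf_ext (pf_opp (pM i0 i1))) => a; rewrite [Us a _ _]mxE|by apply: (pf_ext (pf_opp (pM i0 i2))) => a; rewrite [Us a _ _]mxE].
have pe : pfun line_co (fun s => (subst (Ms s *m Us s) (sp_e c1 c2 c3 al))@_(mon 0 3 0)).
  apply: (@psec_subst _ _ _ _ _ _ 3) => [i j||s]; [exact: pf_mulmx|exact: psec_const|exact: homog_sp_e].
have [E hE] := pf_poly (pf_mul (pf_mul (pf_det pM) (pM i0 i0)) pe).
have Ms0 : Ms 0 = 1%:M by rewrite /Ms /mxline scale0r addr0.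
have Ms1 : Ms 1 = M by rewrite /Ms /mxline scale1r addrC subrK.
have E0 : E != 0.
  apply/eqP => E0; have := hE 0; rewrite E0 horner0 /Us Ms0 det1 mul1mx !mxE /=.
  have -> : clear_row 1 0 0 = 1%:M :> 'M[k]_3.
    by apply/matrixP => i j; rewrite !mxE; case: (ord3 i) => ->; case: (ord3 j) => -> /=; rewrite ?oppr0.
  by rewrite subst1 sp_e030 !mul1r => /eqP; rewrite oner_eq0.
have HI := spI_Hpt r1 r2 c1 c2 c3 al.
have Eu s : E.[s] != 0 -> [/\ Ms s \in unitmx, Ms s i0 i0 != 0 & (subst (Ms s *m Us s) (sp_e c1 c2 c3 al))@_(mon 0 3 0) != 0].
  by rewrite -hE !mulf_eq0 !negb_or -andbA unitmxE unitfE => /and3P[].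
apply: (closed_limit (e := E) (fam := fun s => act (Ms s) (spI r1 r2 c1 c2 c3 al)) (s0 := 1)) => //.
- by apply: cl_closed; exact: X2_Hpt.
- exact: Hpt_act.
- by move=> s /Eu[us m0 e0]; apply: cl_incl; apply: act_spI_generic.
apply: lifts_liftable => [s /Eu[us _ _]|s /Eu[us _ _]||d p d4 Ip hp].
- exact/Hpt_hideal/Hpt_act.
- exact: Hpt_act.
- exact: Hpt_act.
case: Ip hp => r Ir -> hr; exists (fun s => subst (Ms s) r); split=> // [||s _].
- apply: (@psec_subst _ _ _ _ _ _ d) => [//||_]; first exact: psec_const.
  by rewrite -[r](substK _ uM); apply: homog_subst.
- by rewrite Ms1.
- exact: act_mem.
Qed.

Lemma clX2_stable J M : M \in unitmx -> cl (@X2 k) J -> cl (@X2 k) (act M J).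
Proof.
move=> uM; apply: cl_act => //; first exact: X2_Hpt.
by move=> I; apply: X2_stable.
Qed.

End SpecialTranslates.

(** * Pencils of conics with a linear syzygy *)

Section LinearSyzygies.
Variable k : closedFieldType.
Local Notation S := {mpoly k[3]}.
Local Notation X := (X3 k).
Local Notation Y := (Y3 k).
Local Notation Z := (Z3 k).
Implicit Types (p q u v : S) (I : ideal_pred k) (M : 'M[k]_3).

Lemma mx3_unitE (a b c d e f g h i : k) (D := a * (e * i - f * h) - b * (d * i - f * g) + c * (d * h - e * g)) :
  D != 0 -> mx3 [:: [:: a; b; c]; [:: d; e; f]; [:: g; h; i]] \in unitmx.
Proof.
move=> D0; apply: (@mx3_mul1 _ _ _ _ _ _ _ _ _ _ ((e * i - f * h) / D) ((c * h - b * i) / D) ((b * f - c * e) / D)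
  ((f * g - d * i) / D) ((a * i - c * g) / D) ((c * d - a * f) / D)
  ((d * h - e * g) / D) ((b * g - a * h) / D) ((a * e - b * d) / D)); split;
  rewrite !mulrA -!mulrDl; (apply: (canLR (mulfK D0)) || idtac); rewrite ?mul0r ?mul1r /D; ring.
Qed.

Definition lin_free u v := forall x y : k, x *: u + y *: v = 0 -> x = 0 /\ y = 0.

Lemma lin_free_basis u v : homog_of 1 u -> homog_of 1 v -> lin_free u v ->
  exists2 M, M \in unitmx & subst M u = X /\ subst M v = Y.
Proof.
move=> hu hv fr; rewrite (homog1_lin hu) (homog1_lin hv) in fr *.
move: (u@__) (u@__) (u@__) (v@__) (v@__) (v@__) fr => {hu hv} a2 a1 a0 b2 b1 b0 fr.
suff [c0 [c1 [c2 D0]]] : exists c0 c1 c2, a0 * (b1 * c2 - b2 * c1) - a1 * (b0 * c2 - b2 * c0) + a2 * (b0 * c1 - b1 * c0) != 0.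
  pose A := mx3 [:: [:: a0; a1; a2]; [:: b0; b1; b2]; [:: c0; c1; c2]].
  have uA : A \in unitmx by apply: mx3_unitE.
  exists (invmx A); first by rewrite unitmx_inv.
  have eX : subst A X = lin a0 a1 a2 by rewrite substX3 !mxE.
  have eY : subst A Y = lin b0 b1 b2 by rewrite substY3 !mxE.
  by rewrite -eX -eY !substK.
apply: NNPP => hn.
have mz c0 c1 c2 : a0 * (b1 * c2 - b2 * c1) - a1 * (b0 * c2 - b2 * c0) + a2 * (b0 * c1 - b1 * c0) = 0.
  by apply/eqP/negPn/negP => h; apply: hn; exists c0, c1, c2.
have m01 : a0 * b1 - a1 * b0 = 0 by rewrite -[RHS](mz 0 0 1); ring.
have m02 : a0 * b2 - a2 * b0 = 0 by rewrite -[LHS]opprK -[in RHS]oppr0 -[X in _ = - X](mz 0 1 0); ring.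
have m12 : a1 * b2 - a2 * b1 = 0 by rewrite -[RHS](mz 1 0 0); ring.
have kill x y : x * a0 + y * b0 = 0 -> x * a1 + y * b1 = 0 -> x * a2 + y * b2 = 0 -> x = 0 /\ y = 0.
  by move=> e0 e1 e2; apply: fr; rewrite !linZ linD e0 e1 e2 /lin !scale0r !addr0.
have [||| _ /eqP] := kill b0 (- a0); [ring|by rewrite -[RHS]oppr0 -m01; ring|by rewrite -[RHS]oppr0 -m02; ring|].
rewrite oppr_eq0 => /eqP z0.
have [||| _ /eqP] := kill b1 (- a1); [by rewrite -[RHS]m01; ring|ring|by rewrite -[RHS]oppr0 -m12; ring|].
rewrite oppr_eq0 => /eqP z1.
have [||| _ /eqP] := kill b2 (- a2); [by rewrite -[RHS]m02; ring|by rewrite -[RHS]m12; ring|ring|].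
rewrite oppr_eq0 => /eqP z2.
have [||| /eqP] := kill 1 0; [rewrite z0; ring|rewrite z1; ring|rewrite z2; ring|].
by rewrite oner_eq0.
Qed.

Lemma divisible_Y d p : homog_of d.+1 p -> (forall a c, p@_(mon a 0 c) = 0) -> exists2 q, homog_of d q & p = Y * q.
Proof.
move=> hp h0; exists (\sum_(m <- mons d) p@_(m + mon 0 1 0)%MM *: 'X_[m]).
  by rewrite big_seq; apply: homog_sum => m; rewrite mem_mons => /eqP e; apply: homogZ; exact: homogX.
have cf m : (\sum_(m <- mons d) p@_(m + mon 0 1 0)%MM *: 'X_[m] : S)@_m = if mdeg m == d then p@_(m + mon 0 1 0)%MM else 0.
  rewrite raddf_sum /=; case: ifP => hm.
    rewrite (bigD1_seq m) ?uniq_mons ?mem_mons //= mcoeffZ mcoeffX eqxx mulr1 big1 ?addr0 // => m' ne.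
    by rewrite mcoeffZ mcoeffX (negPf ne) mulr0.
  rewrite big_seq big1 // => m'; rewrite mem_mons => /eqP e; rewrite mcoeffZ mcoeffX.
  by case: (m' =P m) => [e'|_]; [rewrite -e' e eqxx in hm|rewrite mulr0].
apply/mpolyP => m; rewrite (mon_eta m); case: (m i1) => [|b].
  by rewrite h0 coefY0.
rewrite coefYS cf addmon !addn0 addn1; case: ifP => // hm.
by apply: (homog_coef hp); move: hm; rewrite !mdeg_mon addnS addSn eqSS => ->.
Qed.

Lemma XY_syzygy d u v : homog_of d.+1 u -> homog_of d.+1 v -> X * u + Y * v = 0 ->
  exists2 c, homog_of d c & u = Y * c /\ v = - (X * c).
Proof.
move=> hu hv e; have [|c hc eu] := divisible_Y hu.
  by move=> a c; have := congr1 (mcoeff (mon a.+1 0 c)) e; rewrite mcoeffD !coefvar addr0 mcoeff0.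
exists c => //; split=> //; have : Y * (X * c + v) = 0 by rewrite -e eu; ring.
have Y0 : Y != 0 by apply/eqP => /(congr1 (mcoeff (mon 0 1 0)))/eqP; rewrite coef_mon mcoeff0 oner_eq0.
by move/eqP; rewrite mulf_eq0 (negPf Y0) addrC addr_eq0 => /eqP.
Qed.

Lemma lin_syzygy d a b u v : homog_of 1 a -> homog_of 1 b -> lin_free a b -> homog_of d.+1 u -> homog_of d.+1 v ->
  a * u + b * v = 0 -> exists2 c, homog_of d c & u = b * c /\ v = - (a * c).
Proof.
move=> ha hb fr hu hv e; have [M uM [aX bY]] := lin_free_basis ha hb fr.
have [|||c hc [eu ev]] := @XY_syzygy d (subst M u) (subst M v); try exact: homog_subst.
  by rewrite -aX -bY -!rmorphM -rmorphD e rmorph0.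
exists (subst (invmx M) c); first exact: homog_subst.
have eX : subst (invmx M) X = a by rewrite -aX substK.
have eY : subst (invmx M) Y = b by rewrite -bY substK.
by rewrite -(substK u uM) -(substK v uM) eu ev rmorphN !rmorphM /= eX eY.
Qed.

Lemma lin_syzygy_free d a b u v : homog_of 1 a -> homog_of 1 b -> homog_of d u -> homog_of d v -> freeS [:: u; v] ->
  a * u + b * v = 0 -> ~ (a = 0 /\ b = 0) -> lin_free a b.
Proof.
move=> ha hb hu hv fr e ab x y exy.
have prop (s : k) w w' p q : freeS [:: p; q] -> w' = s *: w -> w * p + w' * q = 0 -> w = 0.
  move=> fpq ew; rewrite ew -scalerAl scalerAr -mulrDr => /eqP; rewrite mulf_eq0 => /orP[/eqP //|/eqP pq].
  have := fpq (nth 0 [:: 1; s]); rewrite !lcomb_cons lcomb_nil /= scale1r addr0 => /(_ pq 0%N isT) /= /eqP.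
  by rewrite oner_eq0.
have fr' : freeS [:: v; u].
  move=> c; rewrite !lcomb_cons lcomb_nil addr0 addrC => ec.
  have := fr (nth 0 [:: c 1%N; c 0%N]); rewrite !lcomb_cons lcomb_nil addr0 /= => /(_ ec) h.
  by case=> [|[|//]] _; [exact: (h 1%N isT)|exact: (h 0%N isT)].
case: (eqVneq y 0) => [y0|y0]; case: (eqVneq x 0) => [x0|x0] //.
- have a0 : a = 0.
    by move/eqP: exy; rewrite y0 scale0r addr0 scaler_eq0 (negPf x0) => /eqP.
  case: ab; split=> //; apply: (prop 0 b a v u fr'); first by rewrite scale0r.
  by rewrite addrC.
- have b0 : b = 0.
    by move/eqP: exy; rewrite x0 scale0r add0r scaler_eq0 (negPf y0) => /eqP.
  by case: ab; split=> //; apply: (prop 0 a b u v fr); first by rewrite scale0r.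
have eb : b = (- (x / y)) *: a.
  apply: (scalerI y0); rewrite scalerA mulrN mulrCA divff // mulr1 scaleNr.
  by apply/eqP; rewrite -addr_eq0 addrC exy.
by case: ab; have a0 := prop _ a b u v fr eb e; split=> //; rewrite eb a0 scaler0.
Qed.

(* Up to a change of coordinates, a pencil of conics with a linear syzygy is [l <x, y>] with [l = x] or [l = x - z]. *)
Lemma special_normal I : Hpt I -> (forall u v, I u -> I v -> homog_of 2 u -> homog_of 2 v -> freeS [:: u; v] -> ~ nosyz u v) ->
  exists2 M, M \in unitmx & exists e : k, act M I (X * (X - e *: Z)) /\ act M I (Y * (X - e *: Z)).
Proof.
move=> HI hs; have hI := Hpt_hideal HI.
have [s [ss hs2 fs _]] := Hpt_basis HI 2; move: ss hs2 fs.
case: s => [|u [|v [|//]]] //= _ hs2 fs.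
have [Iu hu] := hs2 u (mem_head _ _); have [|Iv hv] := hs2 v; first by rewrite !inE eqxx orbT.
have [a [b [[ha hb] e ab]]] : exists a b, [/\ homog_of 1 a /\ homog_of 1 b, a * u + b * v = 0 & ~ (a = 0 /\ b = 0)].
  apply: NNPP => hn; apply: (hs u v) => // a b ha hb e; apply: NNPP => h; apply: hn.
  by exists a, b.
have fr := lin_syzygy_free ha hb hu hv fs e ab.
have [c hc [eu ev]] := @lin_syzygy 1 a b u v ha hb fr hu hv e.
have [M uM [aX bY]] := lin_free_basis ha hb fr.
have c0 : c != 0.
  apply/eqP => c0; have := fs (fun=> 1); rewrite eu ev c0 !mulr0 oppr0 !lcomb_cons lcomb_nil !scaler0 !addr0.
  by move=> /(_ erefl 0%N isT)/eqP; rewrite oner_eq0.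
have HM := Hpt_act uM HI; have hM := Hpt_hideal HM.
pose c' := subst M c; have hc' : homog_of 1 c' by apply: homog_subst.
have Xc : act M I (X * c').
  by have := hiZ hM (-1) (act_mem M Iv); rewrite ev rmorphN rmorphM /= aX scaleN1r opprK.
have Yc : act M I (Y * c') by have := act_mem M Iu; rewrite eu rmorphM /= bY.
have c'0 : c' != 0.
  by apply: contraNneq c0 => h; rewrite -(substK c uM) -/c' h rmorph0.
move: c' hc' Xc Yc c'0 => c' /homog1_lin ->.
move: (c'@__) (c'@__) (c'@__) => ga be al Xc Yc c'0.
suff [N uN [e' [XN YN]]] : exists2 N, N \in unitmx & exists e' : k,
    (exists x y : k, X * (X - e' *: Z) = subst N ((x *: X + y *: Y) * lin al be ga)) /\
    (exists x y : k, Y * (X - e' *: Z) = subst N ((x *: X + y *: Y) * lin al be ga)).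
  have gen p : (exists x y : k, p = subst N ((x *: X + y *: Y) * lin al be ga)) -> act (M *m N) I p.
    move=> [x [y ->]]; rewrite -act_comp; apply: act_mem; rewrite mulrDl -!scalerAl.
    by apply: (hiD hM); apply: (hiZ hM).
  by exists (M *m N); [rewrite unitmx_mul uM|exists e'; split; apply: gen].
have sub N x y : subst N ((x *: X + y *: Y) * lin al be ga) = (x *: subst N X + y *: subst N Y) *
    (al *: subst N X + be *: subst N Y + ga *: subst N Z) by rewrite rmorphM /= /lin !rmorphD /= !substZ.
have [x1 [y1 z1]] : X = lin 1 0 0 /\ Y = lin 0 1 0 /\ Z = lin 0 0 1 by split; [exact: linX1|split; [exact: linY1|exact: linZ1]].
(* If the common factor [al x + be y + ga z] involves [z] it can be moved to [x - z] with [x], [y]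
   fixed; otherwise it lies in the span of [x] and [y] and becomes [x]. *)
case: (eqVneq ga 0) => [g0|g0]; last first.
  exists (mx3 [:: [:: 1; 0; 0]; [:: 0; 1; 0]; [:: (1 - al) / ga; - be / ga; - 1 / ga]]).
    by apply: mx3_unitE; rewrite !mul0r !mul1r !subr0 !addr0 mulNr mul1r oppr_eq0 invr_eq0.
  have es : al *: X + be *: Y + ga *: lin ((1 - al) / ga) (- be / ga) (- 1 / ga) = X - 1 *: Z.
    rewrite /lin !scalerDr !scalerA ![ga * (_ / ga)]mulrC !divfK // -!mul_mpolyC !(mpolyCD, mpolyCN, mpolyC1).
    by move: al%:MP be%:MP => *; ring.
  exists 1; split; [exists 1, 0|exists 0, 1]; rewrite sub substX3 substY3 substZ3 !mxE /= -x1 -y1 es !scale0r !scale1r.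
    by rewrite addr0.
  by rewrite add0r.
case: (eqVneq al 0) => [a0|a0]; last first.
  exists (mx3 [:: [:: 1 / al; - be / al; 0]; [:: 0; 1; 0]; [:: 0; 0; 1]]).
    by apply: mx3_unitE; rewrite !(mulr0, mul0r, mulr1, mul1r, subr0, addr0) invr_eq0.
  have es : al *: lin (1 / al) (- be / al) 0 + be *: Y + 0 *: Z = X - 0 *: Z.
    rewrite /lin !scalerDr !scalerA ![al * (_ / al)]mulrC !divfK // mulr0 -!mul_mpolyC !(mpolyCD, mpolyCN, mpolyC1, mpolyC0).
    by move: be%:MP => *; ring.
  have e2 : al *: lin (1 / al) (- be / al) 0 + be *: Y = X - 0 *: Z by rewrite -es scale0r addr0.
  exists 0; split; [exists al, be|exists 0, 1]; rewrite sub substX3 substY3 substZ3 !mxE /= -y1 -z1 g0 es ?e2.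
    by rewrite scale0r subr0.
  by rewrite !scale0r add0r scale1r.
have b0 : be != 0.
  by apply: contraNneq c'0 => b0; rewrite a0 b0 g0 /lin !scale0r !addr0.
exists (mx3 [:: [:: 0; 1; 0]; [:: 1; 0; 0]; [:: 0; 0; 1]]).
  by apply: mx3_unitE; rewrite !(mulr0, mul0r, mulr1, mul1r, subr0, addr0) sub0r oppr_eq0 oner_eq0.
by exists 0; split; [exists 0, be^-1|exists be^-1, 0]; rewrite sub substX3 substY3 substZ3 !mxE /= -x1 -y1 -z1 g0 a0
  !scale0r !(addr0, add0r, subr0) -scalerAl -scalerAr scalerA mulVf // scale1r.
Qed.

End LinearSyzygies.

(** * Ideals containing [x S_3] and the multiples of a cubic by linear forms *)

Section LineAndCubic.
Variable k : closedFieldType.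
Local Notation S := {mpoly k[3]}.
Local Notation X := (X3 k).
Local Notation Y := (Y3 k).
Local Notation Z := (Z3 k).
Implicit Types (p q u v : S).
Local Notation closedG := (@closedG k 20 N5 (ideal_pred k) (@Hpt k) (@lowbasis k)).
Local Notation cl := (@cl k 20 N5 (ideal_pred k) (@Hpt k) (@lowbasis k)).

Lemma Hpt_codim_le (I : ideal_pred k) d t : Hpt I ->
  (forall p, homog_of d p -> exists a, [/\ I a, homog_of d a & spanS t (p - a)]) -> ('C(d.+2, 2) <= hdim d + size t)%N.
Proof.
move=> HI h; rewrite leqNgt; apply/negP => lt; have [u [su hu _ hu']] := Hpt_basis HI d.
apply: (@steinitz_dep _ _ [seq 'X_[m] : S | m <- mons d] (u ++ t)) (@mons_free k d).
  move=> p /mapP[m]; rewrite mem_mons => /eqP hm ->.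
  have [a [Ia ha sa]] := h 'X_[m] (@homogX k m d hm).
  by rewrite -(subrK a 'X_[m]); apply: spanSD; [apply: spanS_catr|apply: spanS_catl; apply: hu'].
by rewrite size_cat su size_map size_mons.
Qed.

Variables (I : ideal_pred k) (HI : Hpt I) (s0 c1 c2 c3 : k).
Local Notation c := (sp_c c1 c2 c3).
Hypotheses (I1 : I (X * Y)) (I2 : I (X * (X - s0 *: Z))) (IX : forall p, homog_of 3 p -> I (X * p)).
Hypotheses (IcY : I (c * Y)) (IcZ : I (c * Z)).

Let hI := Hpt_hideal HI.
Let hX := @homogX3 k.
Let hY := @homogY3 k.
Let hZ := @homogZ3 k.

Let Icv v : homog_of 1 v -> I (c * v).
Proof.
move=> /homog1_lin ->; rewrite /lin !mulrDr -!scalerAr.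
apply: (hiD hI); [apply: (hiD hI)|]; apply: (hiZ hI) => //.
by rewrite mulrC; apply: IX; apply: homog_sp_c.
Qed.

Let IXd := multiples_closed (hiD hI) (hiM hI) IX.
Let Icd := multiples_closed (hiD hI) (hiM hI) Icv.

(** The multiples of [x] and of [c] lie in [I], so three forms span a quotient of dimension 3. *)
Lemma lc_tern d (x y z : k) : (4 <= d)%N -> I (Z ^+ (d - 2) * (x *: (Y * Y) + y *: (Y * Z) + z *: (Z * Z))) -> [/\ x = 0, y = 0 & z = 0].
Proof.
move=> d4; pose t := [:: Z ^+ (d - 2) * (Y * Y); Z ^+ (d - 2) * (Y * Z); Z ^+ (d - 2) * (Z * Z)].
have tE x' y' z' : lcomb (nth 0 [:: x'; y'; z']) t = Z ^+ (d - 2) * (x' *: (Y * Y) + y' *: (Y * Z) + z' *: (Z * Z)).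
  by rewrite lcomb3 !mulrDr -!scalerAr.
rewrite -tE => It; have d2 : (d - 2 + 2 = d)%N by rewrite subnK // ltnW // ltnW.
have h := @Hpt_codim _ I HI d t _ _ (nth 0 [:: x; y; z]) It.
have {}h : forall i, (i < 3)%N -> nth 0 [:: x; y; z] i = 0.
  apply: h.
  - by rewrite (hdim_ge4 d4) subnK // (leq_trans (_ : 3 <= 'C(6, 2))%N) // leq_bin2l.
  - move=> p hp; have [|p0 [q [a [b [e [h0 hq ->]]]]]] := @sp_reduce k c1 c2 c3 d p _ hp; first exact: ltnW.
    have d0 : (0 < d)%N by apply: leq_trans d4.
    exists (X * p0 + c * q); split.
    + by apply: (hiD hI); [apply: (IXd _ h0)|apply: (Icd _ hq)]; move: d4; case: (d) => [|[|[|[|]]]].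
    + apply: homogD; first by have := homogXM h0; rewrite prednK.
      by have := homogM (@homog_sp_c k c1 c2 c3) hq; rewrite subnKC // ltnW.
    + by exists (nth 0 [:: a; b; e]); rewrite tE; ring.
  - by rewrite tE -[d in homog_of d]d2; apply: homogZX; apply: homog_tern.
by split; [exact: (h 0%N)|exact: (h 1%N)|exact: (h 2%N)].
Qed.

Lemma lc_high d p : (4 <= d)%N -> I p -> homog_of d p -> exists p0 q, [/\ homog_of d.-1 p0, homog_of (d - 3) q & p = X * p0 + c * q].
Proof.
move=> d4 Ip hp; have [|p0 [q [a [b [e [h0 hq ep]]]]]] := @sp_reduce k c1 c2 c3 d p _ hp; first exact: ltnW.
exists p0, q; split=> //; have [|a0 b0 e0] := @lc_tern d a b e d4.
  rewrite (_ : _ * _ = p - (X * p0 + c * q)); last by rewrite ep; ring.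
  by apply: (hiB hI) => //; apply: (hiD hI); [apply: (IXd _ h0)|apply: (Icd _ hq)]; move: d4; case: (d) => [|[|[|[|]]]].
by rewrite ep a0 b0 e0 !scale0r !addr0 mulr0 addr0.
Qed.

Lemma lc_regular : regular I.
Proof.
move=> d p d4 Ip hp Q Q0 QD QM Qb; have [p0 [q [h0 hq ->]]] := lc_high d4 Ip hp.
apply: (QD).
  apply: (@multiples_closed k Q X 3 QD QM _ _ _ _ h0); last by move: d4; case: (d) => [|[|[|[|]]]].
  by move=> r hr; apply: Qb; [exact: IX|exact: homogXM].
apply: (@multiples_closed k Q c 1 QD QM _ _ _ _ hq); last by move: d4; case: (d) => [|[|[|[|]]]].
by move=> r hr; apply: Qb; [exact: Icv|apply: (@homogM k 3 1) => //; exact: homog_sp_c].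
Qed.

(** Multiplication by [z] leads to degree 4, where [lc_tern] allows no remainder off [x] and [c].
    Modulo the quadrics, [x z^2] is the only multiple of [x] left. *)
Lemma lc_cubic p : I p -> homog_of 3 p -> exists A B (be de : k),
  [/\ homog_of 1 A, homog_of 1 B & p = A * (X * Y) + B * (X * (X - s0 *: Z)) + (be *: c + de *: (X * (Z * Z)))].
Proof.
move=> Ip hp; have [|p0 [q [a [b [e [h0 /homog0_const hq ep]]]]]] := @sp_reduce k c1 c2 c3 3 p _ hp; first by [].
have [|a0 b0 e0] := @lc_tern 4 a b e isT.
  rewrite (_ : _ * _ = Z * p - (X * (Z * p0) + c * (Z * q))); last by rewrite ep [(4 - 2)%N]/= [(3 - 2)%N]/= !exprS; ring.
  apply: (hiB hI); first exact: (hiM hI).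
  apply: (hiD hI); first exact/IX/homogZM.
  by rewrite mulrA mulrC; apply: (hiM hI).
move: ep; rewrite a0 b0 e0 !scale0r !addr0 mulr0 addr0 hq.
move: (quad_expand h0) => ->.
move: (p0@__) (p0@__) (p0@__) (p0@__) (p0@__) (p0@__) => x6 x5 x4 x3 x2 x1.
move: (q@_0) => be ->.
exists (x2 *: X + x4 *: Y + x5 *: Z), (x1 *: (X + s0 *: Z) + x3 *: Z), be, (x1 * (s0 * s0) + x3 * s0 + x6); split.
- by do 2?apply: homogD; apply: homogZ.
- by apply: homogD; apply: homogZ => //; apply: homogD => //; apply: homogZ.
rewrite [c * _]mulrC -!mul_mpolyC !(mpolyCD, mpolyCM).
move: c => c; move: x1%:MP x2%:MP x3%:MP x4%:MP x5%:MP x6%:MP s0%:MP be%:MP => *; ring.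
Qed.

Let five := [:: X * (X * Y); Y * (X * Y); Z * (X * Y); X * (X * (X - s0 *: Z)); Z * (X * (X - s0 *: Z))].

(** The quadrics account for at most five of the six dimensions of [I_3], and [lc_cubic] says where
    the sixth must come from. *)
Lemma lc_cubic_gen : exists be de : k, ~ (be = 0 /\ de = 0) /\ I (be *: c + de *: (X * (Z * Z))).
Proof.
apply: NNPP => hn; have [u [su hu fu _]] := Hpt_basis HI 3.
apply: (@steinitz_dep _ _ u five) fu => [p /hu[Ip hp]|]; last by rewrite su.
have [A [B [be [de [hA hB ep]]]]] := lc_cubic Ip hp.
have [be0 de0] : be = 0 /\ de = 0.
  apply: NNPP => ne; apply: hn; exists be, de; split=> //.
  rewrite (_ : _ + _ = p - (A * (X * Y) + B * (X * (X - s0 *: Z)))); last by rewrite ep; ring.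
  by apply: (hiB hI) => //; apply: (hiD hI); apply: (hiM hI).
rewrite ep be0 de0 !scale0r !addr0 (homog1_lin hA) (homog1_lin hB).
move: (A@__) (A@__) (A@__) (B@__) (B@__) (B@__) => a2 a1 a0 b2 b1 b0.
exists (nth 0 [:: a0 + b1; a1; a2 - b1 * s0; b0; b2]); rewrite !lcomb_cons lcomb_nil /= /lin -!mul_mpolyC !(mpolyCB, mpolyCD, mpolyCM, mpolyCN).
by move: a0%:MP a1%:MP a2%:MP b0%:MP b1%:MP b2%:MP s0%:MP => *; ring.
Qed.

(** Two independent combinations would put [c] and [x z^2] in [I], and three forms would span the
    quotient in degree 3, of dimension 4. *)
Lemma lc_cubic_uniq (be de be' de' : k) : I (be *: c + de *: (X * (Z * Z))) -> I (be' *: c + de' *: (X * (Z * Z))) ->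
  be * de' - be' * de = 0.
Proof.
move=> h1 h2; apply/eqP; apply: contraT => D0; set D := _ - _ in D0.
have Ic : I c.
  have := hiZ hI D^-1 (hiB hI (hiZ hI de' h1) (hiZ hI de h2)); congr I.
  apply: (scalerI D0); rewrite scalerA divff // scale1r /D -!mul_mpolyC !(mpolyCD, mpolyCN, mpolyCM).
  by move: (sp_c _ _ _) be%:MP de%:MP be'%:MP de'%:MP => *; ring.
have Iz : I (X * (Z * Z)).
  have := hiZ hI D^-1 (hiB hI (hiZ hI be h2) (hiZ hI be' h1)); congr I.
  apply: (scalerI D0); rewrite scalerA divff // scale1r /D -!mul_mpolyC !(mpolyCD, mpolyCN, mpolyCM).
  by move: (sp_c _ _ _) be%:MP de%:MP be'%:MP de'%:MP => *; ring.
have := @Hpt_codim_le I 3 [:: Z * (Y * Y); Z * (Y * Z); Z * (Z * Z)] HI; rewrite /= => h.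
suff : false by []; apply: h => p hp.
have [|p0 [q [a [b [e [h0 /homog0_const hq ->]]]]]] := @sp_reduce k c1 c2 c3 3 p _ hp; first by [].
exists (X * p0 + c * q); split.
- apply: (hiD hI); last by rewrite mulrC; apply: (hiM hI).
  rewrite (quad_expand h0); move: (p0@__) (p0@__) (p0@__) (p0@__) (p0@__) (p0@__) => x6 x5 x4 x3 x2 x1.
  rewrite (_ : X * _ = (x2 *: X + x4 *: Y + x5 *: Z) * (X * Y) + (x1 *: (X + s0 *: Z) + x3 *: Z) * (X * (X - s0 *: Z)) +
     (x1 * (s0 * s0) + x3 * s0 + x6) *: (X * (Z * Z))).
    by apply: (hiD hI); [apply: (hiD hI); apply: (hiM hI)|apply: (hiZ hI)].
  rewrite -!mul_mpolyC !(mpolyCD, mpolyCM).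
  by move: x1%:MP x2%:MP x3%:MP x4%:MP x5%:MP x6%:MP s0%:MP => *; ring.
- apply: homogD; first exact: (homogXM h0).
  by rewrite hq mulrC mul_mpolyC; apply: homogZ; apply: homog_sp_c.
- by exists (nth 0 [:: a; b; e]); rewrite lcomb3 expr1 !mulrDr -!scalerAr; ring.
Qed.

End LineAndCubic.

(** * Limits of the second family *)

Section LineType.
Variable k : closedFieldType.
Local Notation S := {mpoly k[3]}.
Local Notation X := (X3 k).
Local Notation Y := (Y3 k).
Local Notation Z := (Z3 k).
Implicit Types (p q u v : S).
Local Notation closedG := (@closedG k 20 N5 (ideal_pred k) (@Hpt k) (@lowbasis k)).
Local Notation cl := (@cl k 20 N5 (ideal_pred k) (@Hpt k) (@lowbasis k)).

Lemma polyXaddC_neq0 (a : k) : 'X + a%:P != 0.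
Proof. by rewrite -[a]opprK polyCN polyXsubC_eq0. Qed.

(* The arc moves the plane of linear forms away from the line [x] and the generator [be c + de x z^2]
   towards a cubic with nonzero [y^3]. *)
Lemma lc_limit (I : ideal_pred k) (s0 c1 c2 c3 : k) : Hpt I -> I (X * Y) -> I (X * (X - s0 *: Z)) ->
  (forall p, homog_of 3 p -> I (X * p)) -> I (sp_c c1 c2 c3 * Y) -> I (sp_c c1 c2 c3 * Z) -> cl (@X2 k) I.
Proof.
move=> HI I1 I2 IX IcY IcZ; have hI := Hpt_hideal HI.
have [be [de [nz Ibd]]] := lc_cubic_gen HI I1 I2 IX IcY IcZ.
pose r2 s := (s + s0)^-1; pose fam s := spI 0 (r2 s) c1 c2 c3 (de * r2 s ^+ 2 / (s + be)).
pose E := ('X + s0%:P) * ('X + be%:P) : {poly k}.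
have E0 : E != 0 by rewrite mulf_neq0 ?polyXaddC_neq0.
have Es s : E.[s] != 0 -> s + s0 != 0 /\ s + be != 0.
  by rewrite hornerM !hornerD !hornerX !hornerC mulf_eq0 negb_or => /andP[].
have hfam s : is_hideal (fam s) by apply: spI_hideal.
apply: (@closed_limit k 20 N5 _ (@Hpt k) (@lowbasis k) (cl (@X2 k)) E fam 0) => [|//|//||].
- by apply: cl_closed; exact: X2_Hpt.
- by move=> s _; apply: cl_incl; apply: spI_X2.
apply: lifts_liftable => [s _|s _||d p d4 Ip hp]; [exact: hfam|exact: spI_Hpt|exact: HI|].
have famI s : (fun s => E.[s] != 0) s -> is_hideal (fam s) by move=> _; apply: hfam.
have LD := liftsD famI; have LM := liftsM famI; have LZ := liftsZ famI.
have L1 : lifts line_co (fun s => E.[s] != 0) fam 0 (X * Y).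
  exists (fun=> X * Y); split=> [|//|s _]; first exact: psec_const.
  have := spI_mem_q1 0 (r2 s) c1 c2 c3 (de * r2 s ^+ 2 / (s + be)).
  by rewrite /sp_q1 oppr0 -linY1.
have ps (f : k) : pfun (@line_co k) (fun s => s + f) by apply: pf_add; [exact: (pf_coord line_co tt)|exact: pf_const].
have L2 : lifts line_co (fun s => E.[s] != 0) fam 0 (X * (X - s0 *: Z)).
  exists (fun s => X * (X - (s + s0) *: Z)); split=> [||s /Es[n1 n2]].
  - apply: psecM; first exact: psec_const.
    by apply: psecB; [exact: psec_const|apply: psecZ => //; exact: psec_const].
  - by rewrite add0r.
  have -> : X * (X - (s + s0) *: Z) = - (s + s0) *: sp_q2 (r2 s).
    rewrite /sp_q2 scalerAr /lin; congr (X * _).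
    have e : (s + s0)%:MP * (r2 s)%:MP = 1 :> S by rewrite -mpolyCM divff // mpolyC1.
    rewrite scale0r addr0 scale1r -!mul_mpolyC !mpolyCN -[X in X - _]mul1r -e.
    by move: (s + s0)%:MP (r2 s)%:MP => a b; ring.
  exact: (hiZ (hfam s)) (spI_mem_q2 _ _ _ _ _ _).
have L3 : lifts line_co (fun s => E.[s] != 0) fam 0 (be *: sp_c c1 c2 c3 + de *: (X * (Z * Z))).
  exists (fun s => (s + be) *: sp_c c1 c2 c3 + de *: (X * (Z * Z))); split=> [||s /Es[n1 n2]].
  - by apply: psecD; [apply: psecZ => //; exact: psec_const|exact: psec_const].
  - by rewrite add0r.
  set al := de * r2 s ^+ 2 / (s + be).
  have -> : (s + be) *: sp_c c1 c2 c3 + de *: (X * (Z * Z)) =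
      (s + be) *: sp_e c1 c2 c3 al + de *: ((Z + r2 s *: X) * sp_q2 (r2 s)).
    rewrite /sp_e; move: (sp_c _ _ _) => c; rewrite scalerDr scalerA [(s + be) * al]mulrC divfK // -addrA; congr (_ + _).
    rewrite /sp_q2 /lin scale0r addr0 scale1r -!mul_mpolyC !(mpolyCN, mpolyCM, rmorphXn).
    by move: de%:MP (r2 s)%:MP => *; ring.
  apply: (hiD (hfam s)); apply: (hiZ (hfam s)); first exact: spI_mem_e.
  by apply: (hiM (hfam s)); apply: spI_mem_q2.
case: d d4 hp => [|[|[|[|[|//]]]]] _ hp.
- by rewrite (Hpt_low HI _ hp Ip) //; apply: lifts0.
- by rewrite (Hpt_low HI _ hp Ip) //; apply: lifts0.
- have [|||c ->] := @Hpt_span _ I HI 2 [:: X * Y; X * (X - s0 *: Z)] _ _ _ p Ip hp => //.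
  + have hX := @homogX3 k; have hY := @homogY3 k; have hZ := @homogZ3 k.
    move=> q; rewrite !inE => /orP[] /eqP -> //; split=> //; apply: homogXM => //.
    by apply: homogB => //; apply: homogZ.
  + apply: (@freeS_coef2 _ _ _ (mon 1 1 0) (mon 2 0 0)); rewrite !coefvar ?mcoeffB ?mcoeffZ ?coefvar ?coef_mon /=; ring.
  by rewrite !lcomb_cons lcomb_nil addr0; apply: (LD); apply: (LZ).
- have [A [B [be' [de' [hA hB ep]]]]] := lc_cubic HI s0 IX IcY IcZ Ip hp.
  rewrite ep; apply: (LD); first by apply: (LD); apply: (LM).
  have Ibd' : I (be' *: sp_c c1 c2 c3 + de' *: (X * (Z * Z))).
    rewrite (_ : _ + _ = p - (A * (X * Y) + B * (X * (X - s0 *: Z)))); last by rewrite ep; ring.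
    by apply: (hiB hI) => //; apply: (hiD hI); apply: (hiM hI).
  have D0 := lc_cubic_uniq HI I1 I2 Ibd Ibd'.
  have [l [e1 e2]] : exists l, be' = l * be /\ de' = l * de.
    case: (eqVneq be 0) => [b0|b0].
      have d0 : de != 0 by apply/eqP => d0; apply: nz.
      exists (de' / de); rewrite divfK // b0 mulr0; split=> //.
      by move/eqP: D0; rewrite b0 mul0r sub0r oppr_eq0 mulf_eq0 (negPf d0) orbF => /eqP.
    exists (be' / be); rewrite divfK //; split=> //.
    by apply: (mulfI b0); rewrite [RHS]mulrA [be * (_ / _)]mulrC divfK //; apply/eqP; rewrite -subr_eq0 D0.
  by rewrite e1 e2 -!scalerA -scalerDr; apply: (LZ).
have [p0 [q [h0 hq ->]]] := @lc_high k I HI c1 c2 c3 IX IcY IcZ 4 p isT Ip hp; apply: (LD).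
  exists (fun=> X * p0); split=> [|//|s _]; first exact: psec_const.
  exact: spI_mem_X.
exists (fun=> sp_c c1 c2 c3 * q); split=> [|//|s _]; first exact: psec_const.
have h4 : homog_of 4 (sp_c c1 c2 c3 * q) by apply: (@homogM k 3 1) => //; apply: homog_sp_c.
by apply/(spI_mem _ _ _ _ _ _ h4); apply: (@sp_evd_cM _ _ _ _ 1).
Qed.

End LineType.

(** * Pencils [l <x, y>] with [l S_3] contained in the ideal *)

Section LineTypeReduction.
Variable k : closedFieldType.
Local Notation S := {mpoly k[3]}.
Local Notation X := (X3 k).
Local Notation Y := (Y3 k).
Local Notation Z := (Z3 k).
Implicit Types (p q u v : S).
Local Notation closedG := (@closedG k 20 N5 (ideal_pred k) (@Hpt k) (@lowbasis k)).
Local Notation cl := (@cl k 20 N5 (ideal_pred k) (@Hpt k) (@lowbasis k)).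

(** Replacing [z] by [t y + z] makes the coefficient of [y^3] equal to the value [G] of the binary
    cubic at [(1, t)], nonzero for suitable [t]; this reduces to [lc_limit]. *)
Lemma line_monic (I : ideal_pred k) (s0 g a b d : k) : Hpt I -> I (X * Y) -> I (X * (X - s0 *: Z)) ->
  (forall p, homog_of 3 p -> I (X * p)) ->
  (let c := g *: (Y * (Y * Y)) + Z * (a *: (Y * Y) + b *: (Y * Z) + d *: (Z * Z)) in [/\ I (c * Y), I (c * Z) & c != 0]) ->
  cl (@X2 k) I /\ regular I.
Proof.
move=> HI I1 I2 IX /=; set c := _ + _ => -[IcY IcZ c0].
have [t ht] : exists t, horner_rec [:: g; a; b; d] t != 0.
  apply: NNPP => hn; case/negP: c0; have h i : [:: g; a; b; d]`_i = 0.
    by apply: horner_seq_eq0 => x; apply/eqP/negPn/negP => h; apply: hn; exists x.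
  by move: (h 0%N) (h 1%N) (h 2%N) (h 3%N) => /= g0 a0 b0 d0; rewrite /c g0 a0 b0 d0 !scale0r !addr0 mulr0 addr0 eqxx.
pose G := g + a * t + b * t ^+ 2 + d * t ^+ 3.
have G0 : G != 0 by move: ht; congr (_ != 0); rewrite /G /=; ring.
pose N := mx3 [:: [:: 1; 0; 0]; [:: 0; 1; 0]; [:: 0; t; 1]].
have uN : N \in unitmx by apply: mx3_unitE; rewrite !(mulr0, mul0r, mulr1, mul1r, subr0, addr0) oner_neq0.
have NX : subst N X = X by rewrite substX3 !mxE /= -linX1.
have NY : subst N Y = Y by rewrite substY3 !mxE /= -linY1.
have NZ : subst N Z = t *: Y + Z by rewrite substZ3 !mxE /= /lin scale0r add0r scale1r.
have HJ := Hpt_act uN HI; have hJ := Hpt_hideal HJ.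
pose c1 := (a + 2%:R * b * t + 3%:R * d * t ^+ 2) / G; pose c2 := (b + 3%:R * d * t) / G; pose c3 := d / G.
have ec : subst N c = G *: sp_c c1 c2 c3.
  rewrite /c rmorphD /= substZ !rmorphM !rmorphD /= !substZ !rmorphM /= NY NZ /sp_c.
  have sc (x : k) (q : S) : G *: ((x / G) *: q) = x *: q by rewrite scalerA mulrC divfK.
  rewrite [Z * (_ + c3 *: _)]mulrDr [Z * (_ + c2 *: _)]mulrDr -!scalerAr !scalerDr !sc -!mul_mpolyC.
  rewrite /G !(mpolyCD, mpolyCM, rmorphXn, rmorph_nat) /=.
  by move: a%:MP b%:MP d%:MP g%:MP t%:MP => *; ring.
have J1 : act N I (X * Y) by have := act_mem N I1; rewrite rmorphM /= NX NY.
have J2 : act N I (X * (X - s0 *: Z)).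
  have := act_mem N I2; rewrite rmorphM rmorphB /= substZ NX NZ => h.
  have := hiD hJ h (hiZ hJ (s0 * t) J1); congr (act N I).
  by rewrite -!mul_mpolyC mpolyCM; move: s0%:MP t%:MP => *; ring.
have JX p : homog_of 3 p -> act N I (X * p).
  move=> hp; have := act_mem N (IX _ (@homog_subst _ _ (invmx N) _ hp)).
  by rewrite rmorphM /= NX substVK.
have JY : act N I (sp_c c1 c2 c3 * Y).
  have := act_mem N IcY; rewrite rmorphM /= NY ec -scalerAl => /(hiZ hJ G^-1).
  by rewrite scalerA mulVf // scale1r.
have JZ : act N I (sp_c c1 c2 c3 * Z).
  have := act_mem N IcZ; rewrite rmorphM /= NZ ec -scalerAl => /(hiZ hJ G^-1).
  rewrite scalerA mulVf // scale1r mulrDr -scalerAr => h.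
  by have := hiB hJ h (hiZ hJ t JY); rewrite addrC addKr.
split; last by apply: (regular_act uN); apply: (lc_regular HJ JX JY JZ).
rewrite -(actK I uN); apply: clX2_stable; first by rewrite unitmx_inv.
exact: (lc_limit HJ J1 J2 JX JY JZ).
Qed.

Lemma monomial_relation (I : ideal_pred k) d (t : seq 'X_{1..3}) : Hpt I -> uniq t -> (forall m, m \in t -> mdeg m = d) ->
  ('C(d.+2, 2) < hdim d + size t)%N ->
  exists e, [/\ I e, homog_of d e, exists2 m, m \in t & e@_m != 0 & forall m, m \notin t -> e@_m = 0].
Proof.
move=> HI ut dt tz; have tE c m : (lcomb c [seq 'X_[m] : S | m <- t])@_m = if m \in t then c (index m t) else 0.
  rewrite lcomb_coef size_map; case: ifP => hm.
    have im : (index m t < size t)%N by rewrite index_mem.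
    rewrite (bigD1 (Ordinal im)) //= (nth_map 0%MM) // nth_index // mcoeffX eqxx mulr1 big1 ?addr0 // => j ne.
    rewrite (nth_map 0%MM) // mcoeffX; case: eqP => [e|]; last by rewrite mulr0.
    by case/eqP: ne; apply: val_inj; rewrite /= -e index_uniq.
  rewrite big1 // => j _; rewrite (nth_map 0%MM) // mcoeffX; case: eqP => [e|]; last by rewrite mulr0.
  by rewrite -e mem_nth in hm.
have ht p : p \in [seq 'X_[m] : S | m <- t] -> homog_of d p by case/mapP => m /dt hm ->; apply: homogX.
have [||c [Ic [i it ci]]] := @Hpt_relation _ I HI d [seq 'X_[m] : S | m <- t]; [exact: ht|by rewrite size_map|].
exists (lcomb c [seq 'X_[m] : S | m <- t]); split=> //; first exact: homog_lcomb.
  by rewrite size_map in it; exists (nth 0%MM t i); rewrite ?mem_nth // tE mem_nth // index_uniq.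
by move=> m hm; rewrite tE (negPf hm).
Qed.

(** The relation is a syzygy [A e1 + B e2 = 0] with linear forms in [y] and [z]. These are
    independent, so [e1 = B c] and [e2 = - A c]; and as [A], [B] span the same plane as [y], [z],
    the products [c y] and [c z] are combinations of [e1] and [e2]. *)
Lemma YZ_syzygy d (e1 e2 : S) (c4 : nat -> k) : homog_of d.+1 e1 -> homog_of d.+1 e2 -> freeS [:: e1; e2] ->
  lcomb c4 [:: Y * e1; Z * e1; Y * e2; Z * e2] = 0 -> (exists2 i, (i < 4)%N & c4 i != 0) ->
  exists c, [/\ homog_of d c, exists B, e1 = B * c, exists x y : k, c * Y = x *: e1 + y *: e2 &
    exists x y : k, c * Z = x *: e1 + y *: e2].
Proof.
move=> he1 he2 fe ec4 nz4.
pose A := c4 0%N *: Y + c4 1%N *: Z; pose B := c4 2%N *: Y + c4 3%N *: Z.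
have hY := @homogY3 k; have hZ := @homogZ3 k.
have hA : homog_of 1 A by apply: homogD; apply: homogZ.
have hB : homog_of 1 B by apply: homogD; apply: homogZ.
have AB : A * e1 + B * e2 = 0.
  by rewrite -ec4 !lcomb_cons lcomb_nil /A /B -!mul_mpolyC; move: (c4 _)%:MP (c4 _)%:MP (c4 _)%:MP (c4 _)%:MP => *; ring.
have cY x y : (x *: Y + y *: Z : S)@_(mon 0 1 0) = x by rewrite mcoeffD !mcoeffZ !coef_mon /=; ring.
have cZ x y : (x *: Y + y *: Z : S)@_(mon 0 0 1) = y by rewrite mcoeffD !mcoeffZ !coef_mon /=; ring.
have ABn : ~ (A = 0 /\ B = 0).
  move=> [A0 B0]; case: nz4 => i i4 /eqP; apply.
  case: i i4 => [|[|[|[|//]]]] _; [rewrite -(cY (c4 0%N) (c4 1%N)) -/A A0|rewrite -(cZ (c4 0%N) (c4 1%N)) -/A A0|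
     rewrite -(cY (c4 2%N) (c4 3%N)) -/B B0|rewrite -(cZ (c4 2%N) (c4 3%N)) -/B B0]; by rewrite mcoeff0.
have fr := lin_syzygy_free hA hB he1 he2 fe AB ABn.
have [c hc [ee1 ee2]] := @lin_syzygy _ d A B e1 e2 hA hB fr he1 he2 AB.
pose D := c4 0%N * c4 3%N - c4 1%N * c4 2%N.
have D0 : D != 0.
  apply/eqP => D0.
  have [h1 h2] : c4 2%N = 0 /\ - c4 0%N = 0.
    apply: fr; rewrite /A /B !scalerDr !scalerA; apply/mpolyP => q.
    by rewrite !mcoeffD !mcoeffZ mcoeff0; move: D0; rewrite /D => D0; rewrite -[RHS](mul0r (Z@_q)) -oppr0 -D0; ring.
  have [h3 h4] : c4 3%N = 0 /\ - c4 1%N = 0.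
    apply: fr; rewrite /A /B !scalerDr !scalerA; apply/mpolyP => q.
    by rewrite !mcoeffD !mcoeffZ mcoeff0; move: D0; rewrite /D => D0; rewrite -[RHS](mul0r (Y@_q)) -D0; ring.
  apply: ABn; rewrite /A /B h1 h3; move/eqP: h2; move/eqP: h4; rewrite !oppr_eq0 => /eqP -> /eqP ->.
  by rewrite !scale0r addr0.
exists c; split=> //; first by exists B.
- exists (- (D^-1 * c4 1%N)), (- (D^-1 * c4 3%N)).
  apply: (scalerI D0); rewrite scalerDr !scalerA !mulrN !mulrA divff // !mul1r ee1 ee2 /A /B /D -!mul_mpolyC !(mpolyCD, mpolyCN, mpolyCM).
  by move: (c4 _)%:MP (c4 _)%:MP (c4 _)%:MP (c4 _)%:MP => *; ring.
exists (D^-1 * c4 0%N), (D^-1 * c4 2%N).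
apply: (scalerI D0); rewrite scalerDr !scalerA !mulrA divff // !mul1r ee1 ee2 /A /B /D -!mul_mpolyC !(mpolyCD, mpolyCN, mpolyCM).
by move: (c4 _)%:MP (c4 _)%:MP (c4 _)%:MP (c4 _)%:MP => *; ring.
Qed.

(* [I_4 = x S_3 + <e1, e2>] with forms [e1], [e2] in [y], [z]; comparing dimensions in degree 5 these
   have a linear syzygy, hence are multiples of one cubic. *)
Lemma line_type (I : ideal_pred k) (s0 : k) : Hpt I -> I (X * Y) -> I (X * (X - s0 *: Z)) ->
  (forall p, homog_of 3 p -> I (X * p)) -> cl (@X2 k) I /\ regular I.
Proof.
move=> HI I1 I2 IX; have hI := Hpt_hideal HI.
pose bin p := forall n b c, p@_(mon n.+1 b c) = 0.
pose ms := [:: mon 0 4 0; mon 0 3 1; mon 0 2 2; mon 0 1 3; mon 0 0 4].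
have bin0 : bin 0 by move=> n b c; rewrite mcoeff0.
have binD p q : bin p -> bin q -> bin (p + q) by move=> hp hq n b c; rewrite mcoeffD hp hq addr0.
have binZ (x : k) p : bin p -> bin (x *: p) by move=> hp n b c; rewrite mcoeffZ hp mulr0.
have rel (t : seq 'X_{1..3}) : uniq t -> {subset t <= ms} -> (3 < size t)%N ->
    exists e, [/\ I e, homog_of 4 e, bin e & (exists2 m, m \in t & e@_m != 0) /\ forall m, m \notin t -> e@_m = 0].
  move=> ut st tz; have [m /st|//|e [Ie he e1 e2]] := @monomial_relation I 4 t HI ut.
    by rewrite !inE => /or4P[|||/orP[]] /eqP ->; rewrite mdeg_mon.
  exists e; split=> // n b c; apply: e2; apply/negP => /st.
  by rewrite !inE !eq_mon.
(* Any four of the five monomials are dependent modulo [I_4], of codimension 3. Leaving out a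
   monomial [m] of [e1] makes [e2] independent of [e1]. *)
have [e1 [Ie1 he1 be1 [[m mt em] _]]] := rel (behead ms) isT ltac:(by move=> m; rewrite !inE => /or4P[] ->; rewrite ?orbT) isT.
have mms : m \in ms by rewrite inE mt orbT.
have [|||e2 [Ie2 he2 be2 [[m' mt' em'] zm']]] := rel (rem m ms) _ _ _.
- by apply: rem_uniq.
- by move=> m' /mem_rem.
- by rewrite size_rem.
have fe : freeS [:: e1; e2].
  have e2m : e2@_m = 0 by apply: zm'; rewrite mem_rem_uniq // inE eqxx.
  move=> c; rewrite !lcomb_cons lcomb_nil addr0 => ec.
  have c0 : c 0%N = 0.
    by have /eqP := congr1 (mcoeff m) ec; rewrite mcoeffD !mcoeffZ e2m mulr0 addr0 mcoeff0 mulf_eq0 (negPf em) orbF => /eqP.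
  have c1 : c 1%N = 0.
    by have /eqP := congr1 (mcoeff m') ec; rewrite c0 scale0r add0r mcoeffZ mcoeff0 mulf_eq0 (negPf em') orbF => /eqP.
  by case=> [|[|]].
pose four := [:: Y * e1; Z * e1; Y * e2; Z * e2].
have bY p : bin p -> bin (Y * p).
  by move=> hp n [|b] c; rewrite !coefvar.
have bZ p : bin p -> bin (Z * p).
  by move=> hp n b [|c]; rewrite !coefvar.
have bfour p : p \in four -> bin p.
  by rewrite !inE => /or4P[] /eqP ->; [apply: bY|apply: bZ|apply: bY|apply: bZ].
(* The 15 products of [x] with quartic monomials and these four quintics exceed [hdim 5 = 18]. *)
have [c4 [ec4 nz4]] : exists c4, lcomb c4 four = 0 /\ exists2 i, (i < 4)%N & c4 i != 0.
  apply: NNPP => hn; pose s := [seq X * 'X_[m] : S | m <- mons 4].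
  apply: (@Hpt_dep _ I HI 5 (s ++ four)).
  - move=> p; rewrite mem_cat => /orP[/mapP[q]|].
      rewrite mem_mons => /eqP hq ->; split; last by apply: homogXM; apply: homogX.
      by apply: (multiples_closed (hiD hI) (hiM hI) IX (d := 4)) => //; apply: homogX.
    by rewrite !inE => /or4P[] /eqP ->; (split; first exact: (hiM hI)); [apply: homogYM|apply: homogZM|apply: homogYM|apply: homogZM].
  - by rewrite size_cat size_map size_mons.
  apply: freeS_cat => [|c [d ed] i i4].
    move=> c; have := @mons_free k 4 c; rewrite size_map => h ec i si; apply: h; last by rewrite size_map.
    have X0 : X != 0 by apply/eqP => /(congr1 (mcoeff (mon 1 0 0)))/eqP; rewrite coef_mon mcoeff0 oner_eq0.
    apply: (mulfI X0); rewrite mulr0 -ec /lcomb mulr_sumr !size_map; apply: eq_bigr => j _.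
    by rewrite !(nth_map 0%MM) ?size_map // scalerAr.
  apply/eqP; apply: contraT => ci; case: hn; exists c; split; last by exists i.
  apply/mpolyP => m0; rewrite mcoeff0 (mon_eta m0); case: (m0 i0) => [|n].
    rewrite ed /s; elim: (mons 4) d {ed} => [|m1 l IH] d; first by rewrite lcomb_nil mcoeff0.
    by rewrite /= lcomb_cons mcoeffD mcoeffZ coefX0 mulr0 add0r IH.
  by have : bin (lcomb c four) by apply: lcomb_closed.
have [c [hc [B ee1] [x [y eY]] [x' [y' eZ]]]] := YZ_syzygy he1 he2 fe ec4 nz4.
have IcY : I (c * Y) by rewrite eY; apply: (hiD hI); apply: (hiZ hI).
have IcZ : I (c * Z) by rewrite eZ; apply: (hiD hI); apply: (hiZ hI).
have hY := @homogY3 k; have hZ := @homogZ3 k.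
have [p0 [a [b [d [h0 ec]]]]] := cubic_expand hc.
apply: (line_monic (s0 := s0) (g := c@_(mon 0 3 0)) (a := a) (b := b) (d := d)) => //= .
set c' := _ + _; have ec' : c' = c - X * p0 by rewrite [W in W - _]ec /c'; ring.
split.
- rewrite ec' mulrBl; apply: (hiB hI) => //; rewrite -mulrA; apply: IX.
  by have := homogM h0 hY.
- rewrite ec' mulrBl; apply: (hiB hI) => //; rewrite -mulrA; apply: IX.
  by have := homogM h0 hZ.
apply/eqP => c'0; case/eqP: em.
have m0 : m i0 = 0%N by move: mms; rewrite !inE => /or4P[|||/orP[]] /eqP ->; rewrite monE.
rewrite ee1 (_ : c = X * p0); last by apply/eqP; rewrite -subr_eq0 -ec' c'0.
by rewrite mulrCA (mon_eta m) m0 coefX0.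
Qed.

End LineTypeReduction.

(** * Pencils [l <x, y>] with [l S_3] not in the ideal: restriction to the line [l = 0] *)

Section BinaryForms.
Variable k : closedFieldType.
Local Notation S := {mpoly k[3]}.
Local Notation X := (X3 k).
Local Notation Y := (Y3 k).
Local Notation Z := (Z3 k).
Implicit Types (p q u v : S).
Variables (I : ideal_pred k) (HI : Hpt I) (e : k).
Local Notation l := (X - e *: Z).
Hypotheses (I1 : I (X * l)) (I2 : I (Y * l)) (nI : ~ forall p, homog_of 3 p -> I (l * p)).

Let hI := Hpt_hideal HI.
Let hX := @homogX3 k.
Let hY := @homogY3 k.
Let hZ := @homogZ3 k.

(* Restriction to the line [l = 0]. *)
Let phi := subst (mx3 [:: [:: 0; 0; e]; [:: 0; 1; 0]; [:: 0; 0; 1]]).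

Let phiX : phi X = e *: Z. Proof. by rewrite /phi substX3 !mxE /= /lin !scale0r !add0r. Qed.
Let phiY : phi Y = Y. Proof. by rewrite /phi substY3 !mxE /= -linY1. Qed.
Let phiZ : phi Z = Z. Proof. by rewrite /phi substZ3 !mxE /= -linZ1. Qed.
Let phil : phi l = 0. Proof. by rewrite /phi rmorphB /= substZ -/(phi X) phiX -/(phi Z) phiZ subrr. Qed.

Let phi_lcomb c s : phi (lcomb c s) = lcomb c (map phi s). Proof. exact: lcomb_subst. Qed.

Let l_neq0 : l != 0.
Proof.
apply/eqP => /(congr1 (mcoeff (mon 1 0 0))); rewrite mcoeffB mcoeffZ !coef_mon mcoeff0 /= => h.
by have /eqP := oner_neq0 k; apply; rewrite -[RHS]h; ring.
Qed.

Let hl : homog_of 1 l. Proof. by apply: homogB => //; apply: homogZ. Qed.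

(** Restriction kills the multiples of [l]. If [t] were free on the line, its lifts to [I] together
    with the products of [l] with [ms] would be free and too many for [I_(d+1)]. *)
Lemma restriction_dep d ms t : uniq ms -> (forall m, m \in ms -> mdeg m = d /\ I (l * 'X_[m])) ->
  (forall p, p \in t -> [/\ homog_of d.+1 p, phi p = p & exists q, homog_of d q /\ I (p + l * q)]) ->
  (hdim d.+1 < size ms + size t)%N -> ~ freeS t.
Proof.
move=> ums hms ht sz ft.
have [F hF] : exists F : S -> S, forall p, p \in t -> homog_of d (F p) /\ I (p + l * F p).
  pose P p q := p \in t -> homog_of d q /\ I (p + l * q).
  have ex p : {q | P p q}.
    apply: constructive_indefinite_description; rewrite /P; case: (boolP (p \in t)) => [/ht[_ _ [q h]]|_]; by [exists q|exists 0].
  by exists (fun p => sval (ex p)) => p pt; apply: (svalP (ex p)).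
pose s := [seq l * 'X_[m] : S | m <- ms].
apply: (@Hpt_dep _ I HI d.+1 (s ++ [seq p + l * F p | p <- t])).
- move=> p; rewrite mem_cat => /orP[/mapP[m /hms[hm Im] ->]|/mapP[q qt ->]].
    by split=> //; apply: (@homogM k 1 d) => //; apply: homogX.
  have [hF1 hF2] := hF q qt; split=> //; have [hq _ _] := ht q qt.
  by apply: homogD => //; apply: (@homogM k 1 d).
- by rewrite size_cat !size_map.
apply: freeS_cat => [|c [a ea] i].
  move=> c ec i; rewrite size_map => im.
  have fm : freeS [seq 'X_[m] : S | m <- ms].
    by apply: free_triangular => // m m' _ _; rewrite mcoeffX.
  apply: (fm c); last by rewrite size_map.
  apply: (mulfI l_neq0); rewrite mulr0 -ec /lcomb mulr_sumr !size_map; apply: eq_bigr => j _.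
  by rewrite !(nth_map 0%MM) // scalerAr.
rewrite size_map; apply: (ft c).
have := congr1 phi ea; rewrite !phi_lcomb -map_comp -[in RHS]map_comp.
have -> : map (phi \o (fun p => p + l * F p)) t = t.
  rewrite -[RHS]map_id; apply/eq_in_map => p pt /=; have [_ ep _] := ht p pt.
  by rewrite /phi rmorphD rmorphM /= -/(phi l) phil mul0r addr0.
move=> ->; elim: (ms) a {ea} => [|m r IH] a; first by rewrite lcomb_nil.
by rewrite /= lcomb_cons /= /phi rmorphM /= -/(phi l) phil mul0r scaler0 add0r IH.
Qed.

Lemma l_monomial (m : 'X_{1..3}) : m i2 != mdeg m -> I (l * 'X_[m]).
Proof.
have g v p : I (v * l) -> I (l * (v * p)).
  move=> h; have -> : l * (v * p) = p * (v * l) by ring.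
  exact: (hiM hI).
rewrite (mon_eta m) mdeg_mon monE; move: (m i0) (m i1) (m i2) => [|a] [|b] c h.
- by rewrite !add0n eqxx in h.
- have -> : 'X_[mon 0 b.+1 c] = Y * 'X_[mon 0 b c] :> S by rewrite mulmon.
  exact: g.
- have -> : 'X_[mon a.+1 0 c] = X * 'X_[mon a 0 c] :> S by rewrite mulmon.
  exact: g.
- have -> : 'X_[mon a.+1 b.+1 c] = X * 'X_[mon a b.+1 c] :> S by rewrite mulmon.
  exact: g.
Qed.

Lemma nlZ3 (t : k) : I (t *: (l * (Z * (Z * Z)))) -> t = 0.
Proof.
move=> It; apply/eqP; apply: contraT => t0; case: nI => p hp.
rewrite (homog_span hp) big_seq mulr_sumr; apply: (hi_sum hI) => m; rewrite mem_mons => /eqP e3.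
rewrite -scalerAr; apply: (hiZ hI).
case: (eqVneq (m i2) (mdeg m)) => [e2|]; last exact: l_monomial.
have -> : 'X_[m] = Z * (Z * Z) :> S.
  rewrite !mulmon (mon_eta m); move: e2 e3; rewrite mdeg3; move: (m i0) (m i1) (m i2) => a b c e2 e3.
  have [-> -> ->] : [/\ a = 0%N, b = 0%N & c = 3%N] by split; lia.
  by [].
by have := hiZ hI t^-1 It; rewrite scalerA mulVf // scale1r.
Qed.

Let full_rem d : uniq (rem (mon 0 0 d) (mons d)) /\ forall m, m \in rem (mon 0 0 d) (mons d) -> mdeg m = d /\ I (l * 'X_[m]).
Proof.
split; first by apply/rem_uniq/uniq_mons.
move=> m; rewrite mem_rem_uniq ?uniq_mons // inE mem_mons => /andP[ne /eqP em]; split=> //.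
apply: l_monomial; apply: contraNneq ne => e2; apply/eqP.
rewrite (mon_eta m); move: e2 em; rewrite mdeg3; move: (m i0) (m i1) (m i2) => a b c e2 e3.
by have [-> -> ->] : [/\ a = 0%N, b = 0%N & c = d] by split; lia.
Qed.

Lemma size_full_rem d : size (rem (mon 0 0 d) (mons d)) = ('C(d.+2, 2)).-1.
Proof. by rewrite size_rem ?size_mons // mem_mons mdeg_mon. Qed.

(** Binary quartics in [y], [z] that lift to [I]. As [x l] and [y l] lie in [I], [l z^3] is the only
    correction to consider. *)
Let E f := homog_of 4 f /\ phi f = f /\ exists t : k, I (f + t *: (l * (Z * (Z * Z)))).

Let E0 : E 0.
Proof. by split; [exact: homog0|split; [exact: rmorph0|exists 0; rewrite scale0r addr0; apply: (hi0 hI)]]. Qed.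

Let ED f g : E f -> E g -> E (f + g).
Proof.
move=> [hf [pf [t It]]] [hg [pg [t' It']]]; split; first exact: homogD.
split; first by rewrite /phi rmorphD /= -/(phi f) pf -/(phi g) pg.
by exists (t + t'); rewrite scalerDl addrACA; apply: (hiD hI).
Qed.

Let EZ (x : k) f : E f -> E (x *: f).
Proof.
move=> [hf [pf [t It]]]; split; first exact: homogZ.
split; first by rewrite /phi substZ -/(phi f) pf.
by exists (x * t); rewrite -scalerA -scalerDr; apply: (hiZ hI).
Qed.

Let E_of q : I q -> (forall m, m \notin [:: mon 0 4 0; mon 0 3 1; mon 0 2 2; mon 0 1 3; mon 0 0 4; mon 1 0 3] -> q@_m = 0) ->
  homog_of 4 q -> E (phi q) /\ q = phi q + q@_(mon 1 0 3) *: (l * (Z * (Z * Z))).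
Proof.
move=> Iq hm hq; pose b := q - q@_(mon 1 0 3) *: (X * (Z * (Z * Z))).
have bE : b = q@_(mon 0 4 0) *: (Y * (Y * (Y * Y))) + q@_(mon 0 3 1) *: (Y * (Y * (Y * Z))) + q@_(mon 0 2 2) *: (Y * (Y * (Z * Z))) +
    q@_(mon 0 1 3) *: (Y * (Z * (Z * Z))) + q@_(mon 0 0 4) *: (Z * (Z * (Z * Z))).
  apply/mpolyP => m; rewrite /b !mulmon mcoeffB !mcoeffD !mcoeffZ !mcoeffX.
  case: (boolP (m \in [:: mon 0 4 0; mon 0 3 1; mon 0 2 2; mon 0 1 3; mon 0 0 4; mon 1 0 3])) => hmm; last first.
    rewrite (hm _ hmm); move: hmm; rewrite !inE !negb_or ![m == _]eq_sym.
    by move=> /and5P[/negPf -> /negPf -> /negPf -> /negPf -> /andP[/negPf -> /negPf ->]] /=; ring.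
  by move: hmm; rewrite !inE => /or4P[|||/or3P[]] /eqP ->; rewrite !eq_mon /=; ring.
have pb : phi b = b.
  by rewrite bE /phi !rmorphD /= !substZ !rmorphM /= -/(phi Y) -/(phi Z) phiY phiZ.
have eq : q = b + q@_(mon 1 0 3) *: (X * (Z * (Z * Z))) by rewrite /b subrK.
have epq : phi q = b + (q@_(mon 1 0 3) * e) *: (Z * (Z * (Z * Z))).
  by rewrite [in LHS]eq /phi rmorphD /= substZ !rmorphM /= -/(phi b) -/(phi X) -/(phi Z) pb phiX phiZ -scalerAl scalerA.
have eq2 : q = phi q + q@_(mon 1 0 3) *: (l * (Z * (Z * Z))).
  rewrite epq [LHS]eq -!mul_mpolyC mpolyCM; move: (b) (q@__)%:MP => b' t; ring.
split=> //; split; first by apply: homog_subst.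
split; last by exists q@_(mon 1 0 3); rewrite -eq2.
by rewrite epq /phi rmorphD /= -/(phi b) pb substZ !rmorphM /= -/(phi Z) phiZ.
Qed.

(** The span of the five binary quartic monomials and [x z^3] meets [I_4], of codimension 3, in
    dimension at least three; restriction is injective there because [l z^3] is not in [I]. *)
Lemma three_quartics : exists f1 f2 f3, [/\ E f1, E f2, E f3 & freeS [:: f1; f2; f3]].
Proof.
pose ms := [:: mon 0 4 0; mon 0 3 1; mon 0 2 2; mon 0 1 3; mon 0 0 4; mon 1 0 3].
have msd m : m \in ms -> mdeg m = 4%N by rewrite !inE => /or4P[|||/or3P[]] /eqP ->; rewrite mdeg_mon.
have ums : uniq ms by rewrite /ms !cons_uniq !inE !eq_mon.
have rel t := @monomial_relation _ I 4 t HI.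
have sub1 : {subset take 4 ms <= ms} by move=> m; exact: mem_take.
have [||q1 [Iq1 hq1 [m1 t1 n1] z1]] := rel (take 4 ms) (take_uniq 4 ums); [by move=> m /sub1/msd|by []|].
pose s2 := rem m1 (take 5 ms).
have sub2 : {subset s2 <= ms} by move=> m /mem_rem; exact: mem_take.
have m1s : m1 \in take 5 ms by move: t1; rewrite !inE => /or4P[] ->; rewrite ?orbT.
have us2 : uniq s2 by apply/rem_uniq/take_uniq.
have [||q2 [Iq2 hq2 [m2 t2 n2] z2]] := rel s2 us2; [by move=> m /sub2/msd|by rewrite size_rem|].
pose s3 := rem m2 (rem m1 ms).
have sub3 : {subset s3 <= ms} by move=> m /mem_rem/mem_rem.
have m1m : m1 \in ms by exact: (mem_take t1).
have us1 : uniq (rem m1 ms) by apply: rem_uniq.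
have m2s : m2 \in rem m1 ms.
  apply: rem_mem; last by exact: sub2.
  by apply/eqP => e21; move: t2; rewrite e21 mem_rem_uniqF // take_uniq.
have [||q3 [Iq3 hq3 [m3 t3 n3] z3]] := rel s3 (rem_uniq _ us1).
- by move=> m /sub3/msd.
- by rewrite !size_rem.
have sup (q : S) (s : seq 'X_{1..3}) : {subset s <= ms} -> (forall m, m \notin s -> q@_m = 0) -> forall m, m \notin ms -> q@_m = 0.
  by move=> ss hz m hm; apply: hz; apply/negP => /ss h; rewrite h in hm.
have [Ef1 e1] := E_of Iq1 (sup _ _ sub1 z1) hq1.
have [Ef2 e2] := E_of Iq2 (sup _ _ sub2 z2) hq2.
have [Ef3 e3] := E_of Iq3 (sup _ _ sub3 z3) hq3.
exists (phi q1), (phi q2), (phi q3); split=> // c; rewrite !lcomb_cons lcomb_nil addr0 => ec.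
pose q := c 0%N *: q1 + (c 1%N *: q2 + c 2%N *: q3).
have Iq : I q by do 2?apply: (hiD hI); apply: (hiZ hI).
have q0 : q = 0.
  have eq : q = (c 0%N * q1@_(mon 1 0 3) + c 1%N * q2@_(mon 1 0 3) + c 2%N * q3@_(mon 1 0 3)) *: (l * (Z * (Z * Z))).
    rewrite /q {1}e1 {1}e2 {1}e3 -[RHS]add0r -ec -!mul_mpolyC !(mpolyCD, mpolyCM).
    move: (phi q1) (phi q2) (phi q3) (q1@__)%:MP (q2@__)%:MP (q3@__)%:MP (c _)%:MP (c _)%:MP (c _)%:MP => *; ring.
  by move: Iq; rewrite eq => /nlZ3 ->; rewrite scale0r.
have cf m : c 0%N * q1@_m + (c 1%N * q2@_m + c 2%N * q3@_m) = 0.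
  by rewrite -!mcoeffZ -!mcoeffD -/q q0 mcoeff0.
have z21 : q2@_m1 = 0 by apply: z2; rewrite (mem_rem_uniq _ (take_uniq 5 ums)) in_simpl /= eqxx.
have z31 : q3@_m1 = 0 by apply: z3; apply/negP => /mem_rem; rewrite (mem_rem_uniq _ ums) in_simpl /= eqxx.
have z32 : q3@_m2 = 0 by apply: z3; rewrite (mem_rem_uniq _ us1) in_simpl /= eqxx.
have c0 : c 0%N = 0.
  by have /eqP := cf m1; rewrite z21 z31 !mulr0 !addr0 mulf_eq0 (negPf n1) orbF => /eqP.
have c1 : c 1%N = 0.
  by have /eqP := cf m2; rewrite c0 z32 mul0r add0r mulr0 addr0 mulf_eq0 (negPf n2) orbF => /eqP.
have c2 : c 2%N = 0.
  by have /eqP := cf m3; rewrite c0 c1 !mul0r !add0r mulf_eq0 (negPf n3) orbF => /eqP.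
by case=> [|[|[|]]].
Qed.

Let E_Y f : E f -> I (Y * f).
Proof.
move=> [_ [_ [t It]]].
have -> : Y * f = Y * (f + t *: (l * (Z * (Z * Z)))) - (t%:MP * (Z * (Z * Z))) * (Y * l).
  by rewrite -mul_mpolyC; move: l => w; ring.
by apply: (hiB hI); apply: (hiM hI).
Qed.

Let E_Z f : E f -> exists q, homog_of 4 q /\ I (Z * f + l * q).
Proof.
move=> [_ [_ [t It]]]; exists (t *: (Z * (Z * (Z * Z)))); split; first by apply: homogZ; do 3?apply: homogZM.
have -> : Z * f + l * (t *: (Z * (Z * (Z * Z)))) = Z * (f + t *: (l * (Z * (Z * Z)))).
  by rewrite -!mul_mpolyC; move: l => w; ring.
exact: (hiM hI).
Qed.

Let quintic p : (exists2 f, E f & p = Y * f \/ p = Z * f) ->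
  [/\ homog_of 5 p, phi p = p & exists q, homog_of 4 q /\ I (p + l * q)].
Proof.
move=> [f Ef [->|->]]; have [hf [pf _]] := Ef.
  split; [exact: homogYM|by rewrite /phi rmorphM /= -/(phi f) -/(phi Y) pf phiY|].
  by exists 0; split; [exact: homog0|rewrite mulr0 addr0; exact: E_Y].
split; [exact: homogZM|by rewrite /phi rmorphM /= -/(phi f) -/(phi Z) pf phiZ|exact: E_Z].
Qed.

(** Products of [l] with the 14 quartic monomials other than [z^4] lie in [I], and [14 + 5] exceeds
    [hdim 5 = 18]. *)
Let quintic_dep t : size t = 5 -> (forall p, p \in t -> exists2 f, E f & p = Y * f \/ p = Z * f) ->
  exists c, lcomb c t = 0 /\ exists2 i, (i < 5)%N & c i != 0.
Proof.
move=> st ht; apply: NNPP => hn; have [u hu] := full_rem 4.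
apply: (restriction_dep u hu (t := t)) => [p /ht/quintic //||c ec i].
  by rewrite size_full_rem st.
by rewrite st => i5; apply/eqP; apply: contraT => ci; case: hn; exists c; split=> //; exists i.
Qed.

Let lin_freeYZ : lin_free Y Z.
Proof.
move=> x y exy; split.
  by have := congr1 (mcoeff (mon 0 1 0)) exy; rewrite mcoeffD !mcoeffZ !coef_mon mcoeff0 /= mulr1 mulr0 addr0.
by have := congr1 (mcoeff (mon 0 0 1)) exy; rewrite mcoeffD !mcoeffZ !coef_mon mcoeff0 /= mulr1 mulr0 add0r.
Qed.

Let Z_neq0 : Z != 0.
Proof. by apply/eqP => /(congr1 (mcoeff (mon 0 0 1)))/eqP; rewrite coef_mon mcoeff0 oner_eq0. Qed.

(** The six quintics [y f_i], [z f_i] span at most four dimensions, so there are two independent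
    relations [y F + z G = 0]. Each gives [F = z h] and [G = - y h] for a cubic [h]. *)
Lemma two_cubics : exists h1 h2, [/\ homog_of 3 h1 /\ homog_of 3 h2, phi h1 = h1 /\ phi h2 = h2,
  E (Y * h1) /\ E (Z * h1), E (Y * h2) /\ E (Z * h2) & freeS [:: h1; h2]].
Proof.
have [f1 [f2 [f3 [E1 E2 E3 fr]]]] := three_quartics.
pose F (c : nat -> k) := c 0%N *: f1 + c 1%N *: f2 + c 2%N *: f3.
pose G (c : nat -> k) := c 3%N *: f1 + c 4%N *: f2 + c 5%N *: f3.
have EF c : E (F c) by apply: ED; [apply: ED|]; apply: EZ.
have EG c : E (G c) by apply: ED; [apply: ED|]; apply: EZ.
have rel j : (j < 6)%N -> exists c, [/\ Y * F c + Z * G c = 0, c j = 0 & exists2 i, (i < 6)%N & c i != 0].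
  move=> j6; pose t := [seq (nth 0 [:: Y * f1; Y * f2; Y * f3; Z * f1; Z * f2; Z * f3] i) | i <- rem j (iota 0 6)].
  have [||c [ec [i i5 ci]]] := @quintic_dep t.
  - by rewrite size_map size_rem ?mem_iota.
  - move=> p /mapP[i /mem_rem]; rewrite mem_iota => /andP[_]; case: i => [|[|[|[|[|[|//]]]]]] _ ->;
      [exists f1|exists f2|exists f3|exists f1|exists f2|exists f3] => //; by [left|right].
  exists (fun n => if (n < j)%N then c n else if n == j then 0 else c n.-1); split.
  - rewrite -ec /t /F /G; case: j j6 {t ec} => [|[|[|[|[|[|//]]]]]] _ /=;
      rewrite !lcomb_cons lcomb_nil /= -!mul_mpolyC ?mpolyC0;
      move: (c 0%N)%:MP (c 1%N)%:MP (c 2%N)%:MP (c 3%N)%:MP (c 4%N)%:MP => *; ring.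
  - by rewrite ltnn eqxx.
  case: (ltnP i j) => ij; first by exists i; rewrite ?ij // ltnW.
  by exists i.+1 => //; rewrite ltnNge (leq_trans ij) // gtn_eqF //= ltnS.
have gen c : Y * F c + Z * G c = 0 -> exists h, [/\ homog_of 3 h, phi h = h, F c = Z * h & G c = - (Y * h)].
  move=> ec; have [hF [pF _]] := EF c; have [hG _] := EG c.
  have [h hh [e1 e2]] := @lin_syzygy _ 3 Y Z _ _ hY hZ lin_freeYZ hF hG ec.
  exists h; split=> //; apply: (mulfI Z_neq0); rewrite -e1 -pF [in RHS]e1 /phi rmorphM /= -/(phi Z) -/(phi h) phiZ.
  by [].
(* The second relation omits an index [i] at which the first is nonzero, so the two are
   independent. *)
have [c [ec _ [i i6 ci]]] := rel 0%N isT; have [d [ed di [j j6 dj]]] := rel i i6.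
have [h1 [hh1 p1 F1 G1]] := gen c ec; have [h2 [hh2 p2 F2 G2]] := gen d ed.
exists h1, h2; split=> //.
- by split; [have := EZ (-1) (EG c); rewrite G1 scaleN1r opprK|rewrite -F1].
- by split; [have := EZ (-1) (EG d); rewrite G2 scaleN1r opprK|rewrite -F2].
move=> x; rewrite !lcomb_cons lcomb_nil addr0 => ex.
have c3 a0 a1 a2 : a0 *: f1 + a1 *: f2 + a2 *: f3 = 0 -> [/\ a0 = 0, a1 = 0 & a2 = 0].
  move=> e0; have h := fr (nth 0 [:: a0; a1; a2]); rewrite lcomb3 in h.
  by split; [exact: (h e0 0%N)|exact: (h e0 1%N)|exact: (h e0 2%N)].
have eF : x 0%N *: F c + x 1%N *: F d = 0.
  by rewrite F1 F2 !scalerAr -mulrDr ex mulr0.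
have eG : x 0%N *: G c + x 1%N *: G d = 0.
  by rewrite G1 G2 !scalerN -opprD !scalerAr -mulrDr ex mulr0 oppr0.
have [a0 a1 a2] : [/\ x 0%N * c 0%N + x 1%N * d 0%N = 0, x 0%N * c 1%N + x 1%N * d 1%N = 0 & x 0%N * c 2%N + x 1%N * d 2%N = 0].
  by apply: c3; rewrite -[RHS]eF /F -!mul_mpolyC !(mpolyCD, mpolyCM); move: (c _)%:MP (c _)%:MP (c _)%:MP (d _)%:MP (d _)%:MP (d _)%:MP (x _)%:MP (x _)%:MP => *; ring.
have [a3 a4 a5] : [/\ x 0%N * c 3%N + x 1%N * d 3%N = 0, x 0%N * c 4%N + x 1%N * d 4%N = 0 & x 0%N * c 5%N + x 1%N * d 5%N = 0].
  by apply: c3; rewrite -[RHS]eG /G -!mul_mpolyC !(mpolyCD, mpolyCM); move: (c _)%:MP (c _)%:MP (c _)%:MP (d _)%:MP (d _)%:MP (d _)%:MP (x _)%:MP (x _)%:MP => *; ring.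
have all6 n : (n < 6)%N -> x 0%N * c n + x 1%N * d n = 0.
  by case: n => [|[|[|[|[|[|]]]]]].
have x0 : x 0%N = 0.
  by have /eqP := all6 i i6; rewrite di mulr0 addr0 mulf_eq0 (negPf ci) orbF => /eqP.
have x1 : x 1%N = 0.
  by have /eqP := all6 j j6; rewrite x0 mul0r add0r mulf_eq0 (negPf dj) orbF => /eqP.
by case=> [|[|]].
Qed.

(** One degree lower, nine products of [l] and four quartics exceed [hdim 4 = 12], so [h1] and [h2]
    have a linear syzygy and are multiples of one quadric. *)
Lemma base_quadric : exists g, [/\ homog_of 2 g, g != 0, phi g = g & [/\ E (Y * (Y * g)), E (Y * (Z * g)) & E (Z * (Z * g))]].
Proof.
have [h1 [h2 [[hh1 hh2] [p1 p2] [EY1 EZ1] [EY2 EZ2] fr]]] := two_cubics.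
have [c [ec nz]] : exists c, lcomb c [:: Y * h1; Z * h1; Y * h2; Z * h2] = 0 /\ exists2 i, (i < 4)%N & c i != 0.
  apply: NNPP => hn; have [u hu] := full_rem 3.
  apply: (restriction_dep u hu (t := [:: Y * h1; Z * h1; Y * h2; Z * h2])) => [p||c ec i i4].
  - rewrite !inE => hp; have [hp4 [pp [t It]]] : E p by case/or4P: hp => /eqP ->.
    split=> //; exists (t *: (Z * (Z * Z))); split; first by apply: homogZ; do 2?apply: homogZM.
    by rewrite -scalerAr.
  - by rewrite size_full_rem.
  by apply/eqP; apply: contraT => ci; case: hn; exists c; split=> //; exists i.
have [g [hg [B eB] [x [y eY]] [x' [y' eZ]]]] := YZ_syzygy hh1 hh2 fr ec nz.
have g0 : g != 0.
  apply/eqP => g0; have := fr (nth 0 [:: 1; 0]); rewrite !lcomb_cons lcomb_nil /= eB g0 mulr0 scaler0 scale0r !addr0.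
  by move=> /(_ erefl 0%N isT)/eqP; rewrite oner_eq0.
exists g; split=> //.
  apply: (mulfI Z_neq0); rewrite -[in LHS]phiZ -rmorphM /= mulrC eZ rmorphD /= !substZ -/(phi h1) -/(phi h2) p1 p2.
  by rewrite -eZ mulrC.
have sp v : E (v * h1) -> E (v * h2) -> E (v * (Y * g)) /\ E (v * (Z * g)).
  move=> a b; rewrite ![_ * g]mulrC eY eZ !mulrDr -!scalerAr.
  by split; apply: ED; apply: EZ.
have [? ?] := sp Y EY1 EY2; have [? ?] := sp Z EZ1 EZ2.
by split.
Qed.

(** By the count [15 + 4 > 18] in degree 5, [l z^4] is not in [I]. Hence the corrections of [y^2 g]
    and [y z g] vanish; that of [z^2 g] is absorbed by adding a multiple of [l z] to [g].
    Multiplying the result by [l z^2] shows that the new conic has no [z^2]. *)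
Lemma conic_through : exists g, [/\ homog_of 2 g, g@_(mon 0 0 2) = 0, phi g != 0 &
  [/\ I (Y * (Y * g)), I (Y * (Z * g)) & I (Z * (Z * g))]].
Proof.
have [g [hg g0 pg [[_ [_ [t1 It1]]] [_ [_ [t2 It2]]] [_ [_ [t3 It3]]]]]] := base_quadric.
have EYY : E (Y * (Y * g)).
  split; first by do 2?apply: homogYM.
  by split; [rewrite /phi !rmorphM /= -/(phi Y) -/(phi g) phiY pg|exists t1].
have EYZ : E (Y * (Z * g)).
  split; first by apply: homogYM; apply: homogZM.
  by split; [rewrite /phi !rmorphM /= -/(phi Y) -/(phi Z) -/(phi g) phiY phiZ pg|exists t2].
have EZZ : E (Z * (Z * g)).
  split; first by do 2?apply: homogZM.
  by split; [rewrite /phi !rmorphM /= -/(phi Z) -/(phi g) phiZ pg|exists t3].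
have nlZ4 (t : k) : I (t *: (l * (Z * (Z * (Z * Z))))) -> t = 0.
  move=> It; apply/eqP; apply: contraT => t0.
  have {}It : I (l * (Z * (Z * (Z * Z)))) by have := hiZ hI t^-1 It; rewrite scalerA mulVf // scale1r.
  exfalso; apply: (@restriction_dep 4 (mons 4) [:: Y * (Y * (Y * g)); Y * (Y * (Z * g)); Y * (Z * (Z * g)); Z * (Z * (Z * g))]).
  - exact: uniq_mons.
  - move=> m; rewrite mem_mons => /eqP em; split=> //.
    case: (eqVneq (m i2) (mdeg m)) => [e2|]; last exact: l_monomial.
    have -> : 'X_[m] = Z * (Z * (Z * Z)) :> S; last by [].
    rewrite !mulmon (mon_eta m); move: e2 em; rewrite mdeg3; move: (m i0) (m i1) (m i2) => a b c e2 e3.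
    have [-> -> ->] : [/\ a = 0%N, b = 0%N & c = 4%N] by split; lia.
    by [].
  - move=> p; rewrite !inE => hp; apply: quintic.
    by case/or4P: hp => /eqP ->; [exists (Y * (Y * g))|exists (Y * (Z * g))|exists (Z * (Z * g))|exists (Z * (Z * g))] => //; by [left|right].
  - by rewrite size_mons.
  move=> c ec; have {}ec : (c 0%N *: (Y * (Y * Y)) + c 1%N *: (Y * (Y * Z)) + c 2%N *: (Y * (Z * Z)) + c 3%N *: (Z * (Z * Z))) * g = 0.
    rewrite -[RHS]ec !lcomb_cons lcomb_nil -!mul_mpolyC.
    by move: (c _)%:MP (c _)%:MP (c _)%:MP (c _)%:MP => *; ring.
  move/eqP: ec; rewrite mulf_eq0 (negPf g0) orbF => /eqP ec.
  have cf m := congr1 (mcoeff m) ec.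
  have z0 : c 0%N = 0 by have := cf (mon 0 3 0); rewrite !mulmon !mcoeffD !mcoeffZ !coef_mon mcoeff0 /= => h; rewrite -[RHS]h; ring.
  have z1 : c 1%N = 0 by have := cf (mon 0 2 1); rewrite !mulmon !mcoeffD !mcoeffZ !coef_mon mcoeff0 /= => h; rewrite -[RHS]h; ring.
  have z2 : c 2%N = 0 by have := cf (mon 0 1 2); rewrite !mulmon !mcoeffD !mcoeffZ !coef_mon mcoeff0 /= => h; rewrite -[RHS]h; ring.
  have z3 : c 3%N = 0 by have := cf (mon 0 0 3); rewrite !mulmon !mcoeffD !mcoeffZ !coef_mon mcoeff0 /= => h; rewrite -[RHS]h; ring.
  by case=> [|[|[|[|]]]].
have t1_0 : t1 = 0.
  apply: nlZ4; rewrite (_ : _ *: _ = Z * (Y * (Y * g) + t1 *: (l * (Z * (Z * Z)))) - Y * (Y * (Z * g) + t2 *: (l * (Z * (Z * Z)))) +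
     (t2%:MP * (Z * (Z * Z))) * (Y * l)); last by rewrite -!mul_mpolyC; move: l => w; ring.
  by apply: (hiD hI); [apply: (hiB hI)|]; apply: (hiM hI).
have t2_0 : t2 = 0.
  apply: nlZ4; rewrite (_ : _ *: _ = Z * (Y * (Z * g) + t2 *: (l * (Z * (Z * Z)))) - Y * (Z * (Z * g) + t3 *: (l * (Z * (Z * Z)))) +
     (t3%:MP * (Z * (Z * Z))) * (Y * l)); last by rewrite -!mul_mpolyC; move: l => w; ring.
  by apply: (hiD hI); [apply: (hiB hI)|]; apply: (hiM hI).
rewrite t1_0 t2_0 !scale0r !addr0 in It1 It2.
pose g' := g + t3 *: (l * Z).
have hg' : homog_of 2 g' by apply: homogD => //; apply: homogZ; apply: (@homogM k 1 1).
have IZZ : I (Z * (Z * g')).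
  by rewrite (_ : _ * _ = Z * (Z * g) + t3 *: (l * (Z * (Z * Z)))) // /g' -!mul_mpolyC; move: l => w; ring.
have IYY : I (Y * (Y * g')).
  rewrite (_ : _ * _ = Y * (Y * g) + (t3%:MP * (Z * Y)) * (Y * l)); last by rewrite /g' -!mul_mpolyC; move: l => w; ring.
  by apply: (hiD hI) => //; apply: (hiM hI).
have IYZ : I (Y * (Z * g')).
  rewrite (_ : _ * _ = Y * (Z * g) + (t3%:MP * (Z * Z)) * (Y * l)); last by rewrite /g' -!mul_mpolyC; move: l => w; ring.
  by apply: (hiD hI) => //; apply: (hiM hI).
exists g'; split=> //; last first.
  by rewrite /g' /phi rmorphD /= substZ rmorphM /= -/(phi g) -/(phi l) phil mul0r scaler0 addr0 pg.
apply: nlZ4; have eg := quad_form hg'.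
set a := g'@_(mon 2 0 0) in eg; set b := g'@_(mon 1 1 0) in eg; set c := g'@_(mon 0 2 0) in eg.
rewrite /lin in eg; set d := g'@_(mon 1 0 1) in eg; set f := g'@_(mon 0 1 1) in eg; set q := g'@__ in eg *.
have -> : q *: (l * (Z * (Z * (Z * Z)))) = l * (Z * (Z * g')) - (a *: X + b *: Y + d *: Z) * (Z * Z) * (X * l) -
     (c *: Y + f *: Z) * (Z * Z) * (Y * l).
  by rewrite eg -!mul_mpolyC; move: l a%:MP b%:MP c%:MP d%:MP f%:MP q%:MP => *; ring.
by do 2?apply: (hiB hI); apply: (hiM hI).
Qed.

End BinaryForms.

(** * Normal forms in degree 4 from the pencil and the additional conic *)

Section PointType.
Variable k : closedFieldType.
Local Notation S := {mpoly k[3]}.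
Local Notation X := (X3 k).
Local Notation Y := (Y3 k).
Local Notation Z := (Z3 k).
Implicit Types (p q u v : S).
Local Notation closedG := (@closedG k 20 N5 (ideal_pred k) (@Hpt k) (@lowbasis k)).
Local Notation cl := (@cl k 20 N5 (ideal_pred k) (@Hpt k) (@lowbasis k)).
Variables (I : ideal_pred k) (HI : Hpt I) (e : k).
Local Notation l := (X - e *: Z).
Hypotheses (I1 : I (X * l)) (I2 : I (Y * l)).
Variable g : S.
Hypotheses (hg : homog_of 2 g) (gz : g@_(mon 0 0 2) = 0) (gy : g@_(mon 0 2 0) != 0).
Hypotheses (IYY : I (Y * (Y * g))) (IYZ : I (Y * (Z * g))) (IZZ : I (Z * (Z * g))).

Let hI := Hpt_hideal HI.
Let hX := @homogX3 k.
Let hY := @homogY3 k.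
Let hZ := @homogZ3 k.

(** The conics [x l], [y l], [g] rewrite [x^2], [x y] and [y^2]. As [g] is available only with the
    factors [y^2], [y z], [z^2], the quartics divisible by [z^2] are reduced first, then those
    divisible by [z], then the others. *)
Lemma point_zred p : homog_of 4 p -> exists a m, [/\ I a, homog_of 4 a, homog_of 1 m & p = a + Z ^+ 3 * m].
Proof.
pose P p := homog_of 4 p -> exists a m, [/\ I a, homog_of 4 a, homog_of 1 m & p = a + Z ^+ 3 * m].
pose Q p := exists a m, I a /\ homog_of 1 m /\ p = a + Z ^+ 3 * m.
suff hQ : homog_of 4 p -> Q p.
  move=> hp; have [a [m [Ia [hm ep]]]] := hQ hp; exists a, m; split=> //.
  by rewrite (_ : a = p - Z ^+ 3 * m); [apply: homogB => //; apply: (@homogZX k 3 1)|rewrite ep; ring].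
have QD a b : Q a -> Q b -> Q (a + b).
  move=> [x [m [Ix [hm ->]]]] [y [n [Iy [hn ->]]]]; exists (x + y), (m + n).
  by split; [exact: (hiD hI)|split; [exact: homogD|ring]].
have QZ (c : k) a : Q a -> Q (c *: a).
  move=> [x [m [Ix [hm ->]]]]; exists (c *: x), (c *: m).
  by split; [exact: (hiZ hI)|split; [exact: homogZ|rewrite -!mul_mpolyC; ring]].
have QI a : I a -> Q a by move=> Ia; exists a, 0; split=> //; split; [exact: homog0|ring].
have QB a b : Q a -> Q b -> Q (a - b) by move=> Qa Qb; rewrite -scaleN1r; apply: (QD) => //; apply: (QZ).
have Qz m : homog_of 1 m -> Q (Z * (Z * (Z * m))).
  by move=> hm; exists 0, m; split; [exact: (hi0 hI)|split=> //; ring].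
have Qxx r : Q (Z * (X * r)) -> Q (X * (X * r)).
  move=> Qr; rewrite (_ : X * (X * r) = r * (X * l) + e *: (Z * (X * r))); last by rewrite -!mul_mpolyC; ring.
  by apply: (QD); [apply/QI/(hiM hI)|apply: (QZ)].
have Qxy r : Q (Z * (Y * r)) -> Q (X * (Y * r)).
  move=> Qr; rewrite (_ : X * (Y * r) = r * (Y * l) + e *: (Z * (Y * r))); last by rewrite -!mul_mpolyC; ring.
  by apply: (QD); [apply/QI/(hiM hI)|apply: (QZ)].
have eg := quad_form hg; move: gz gy => gz0 gy0; set c := g@_(mon 0 2 0) in eg gy0.
have [x [y [d [f eg']]]] : exists x y d f : k, g = x *: (X * X) + y *: (X * Y) + c *: (Y * Y) + Z * (d *: X + f *: Y).
  by exists g@_(mon 2 0 0), g@_(mon 1 1 0), g@_(mon 1 0 1), g@_(mon 0 1 1); rewrite {1}eg /lin gz0 scale0r addr0.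
have Qyy r : I (r * g) -> Q (r * (X * X)) -> Q (r * (X * Y)) -> Q (r * (Z * X)) -> Q (r * (Z * Y)) -> Q (r * (Y * Y)).
  move=> Ir Q1 Q2 Q3 Q4.
  rewrite (_ : r * (Y * Y) = c^-1 *: (r * g - (x *: (r * (X * X)) + y *: (r * (X * Y)) + d *: (r * (Z * X)) + f *: (r * (Z * Y))))).
    by apply: (QZ); apply: (QB); [exact: QI|do 3?apply: (QD); apply: (QZ)].
  apply: (scalerI gy0); rewrite scalerA divff // scale1r eg' -!mul_mpolyC.
  by move: c%:MP x%:MP y%:MP d%:MP f%:MP => *; ring.
have perm a b a' b' : Q a -> a = b -> Q b by move=> Qa <-.
have Qzz r : homog_of 2 r -> Q (Z * (Z * r)).
  have zxx : Q (Z * (Z * (X * X))).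
    have := Qxx (Z * Z); rewrite (_ : X * (X * (Z * Z)) = Z * (Z * (X * X))); last by ring.
    by apply; rewrite (_ : Z * _ = Z * (Z * (Z * X))); [exact: Qz|ring].
  have zxy : Q (Z * (Z * (X * Y))).
    have := Qxy (Z * Z); rewrite (_ : X * (Y * (Z * Z)) = Z * (Z * (X * Y))); last by ring.
    by apply; rewrite (_ : Z * _ = Z * (Z * (Z * Y))); [exact: Qz|ring].
  have zyy : Q (Z * (Z * (Y * Y))).
    have := Qyy (Z * Z); rewrite -![Z * Z * _]mulrA; apply => //; exact: Qz.
  move=> hr; rewrite (quad_form hr); have := @homog_lin k r@_(mon 1 0 1) r@_(mon 0 1 1) r@_(mon 0 0 2).
  move: (lin _ _ _) => m hm; rewrite !mulrDr -!scalerAr.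
  by do 3?apply: (QD); first [apply: (QZ)|apply: (Qz)].
have Qzv v r : Q (Z * (v * (X * X))) -> Q (Z * (v * (X * Y))) -> Q (Z * (v * (Y * Y))) -> homog_of 1 v -> homog_of 2 r -> Q (Z * (v * r)).
  move=> q1 q2 q3 hv hr; rewrite (quad_form hr); set m := lin _ _ _.
  have hm : homog_of 1 m by apply: homog_lin.
  move: m hm => m hm; rewrite (_ : Z * _ = r@_(mon 2 0 0) *: (Z * (v * (X * X))) + r@_(mon 1 1 0) *: (Z * (v * (X * Y))) +
    r@_(mon 0 2 0) *: (Z * (v * (Y * Y))) + Z * (Z * (v * m))); last first.
    by rewrite -!mul_mpolyC; move: (r@__)%:MP (r@__)%:MP (r@__)%:MP => *; ring.
  by do 3?apply: (QD); try apply: (QZ) => //; apply: (Qzz); apply: (homogM hv).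
have Qzx r : homog_of 2 r -> Q (Z * (X * r)).
  apply: (Qzv X) => //.
  - rewrite (_ : Z * _ = X * (X * (Z * X))); last by ring.
    by apply: (Qxx); rewrite (_ : Z * _ = Z * (Z * (X * X))); [apply/Qzz/homogXM|ring].
  - rewrite (_ : Z * _ = X * (X * (Z * Y))); last by ring.
    by apply: (Qxx); rewrite (_ : Z * _ = Z * (Z * (X * Y))); [apply/Qzz/homogXM|ring].
  - rewrite (_ : Z * _ = X * (Y * (Z * Y))); last by ring.
    by apply: (Qxy); rewrite (_ : Z * _ = Z * (Z * (Y * Y))); [apply/Qzz/homogYM|ring].
have Qzy r : homog_of 2 r -> Q (Z * (Y * r)).
  apply: (Qzv Y) => //.
  - by rewrite (_ : Z * _ = Z * (X * (X * Y))); [apply/Qzx/homogXM|ring].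
  - by rewrite (_ : Z * _ = Z * (X * (Y * Y))); [apply/Qzx/homogYM|ring].
  - have := Qyy (Y * Z); rewrite -[Y * Z * g]mulrA => h.
    rewrite (_ : Z * _ = Y * Z * (Y * Y)); last by ring.
    apply: h => //.
    + have -> : Y * Z * (X * X) = Z * (X * (X * Y)) by ring.
      by apply/Qzx/homogXM.
    + have -> : Y * Z * (X * Y) = Z * (X * (Y * Y)) by ring.
      by apply/Qzx/homogYM.
    + have -> : Y * Z * (Z * X) = Z * (Z * (X * Y)) by ring.
      by apply/Qzz/homogXM.
    + have -> : Y * Z * (Z * Y) = Z * (Z * (Y * Y)) by ring.
      by apply/Qzz/homogYM.
have Qyy2 r : homog_of 2 r -> Q (Y * (Y * r)).
  move=> hr; rewrite (quad_form hr); set m := lin _ _ _.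
  have hm : homog_of 1 m by apply: homog_lin.
  have q1 : Q (Y * (Y * (X * X))).
    rewrite (_ : Y * _ = X * (X * (Y * Y))); last by ring.
    by apply/Qxx/Qzx/homogYM.
  have q2 : Q (Y * (Y * (X * Y))).
    rewrite (_ : Y * _ = X * (Y * (Y * Y))); last by ring.
    by apply/Qxy/Qzy/homogYM.
  have q3 : Q (Y * (Y * (Y * Y))).
    have := Qyy (Y * Y); rewrite -![Y * Y * _]mulrA; apply => //.
      by rewrite (_ : Y * _ = Z * (Y * (X * Y))); [apply/Qzy/homogXM|ring].
    by rewrite (_ : Y * _ = Z * (Y * (Y * Y))); [apply/Qzy/homogYM|ring].
  move: m hm => m hm; rewrite (_ : Y * _ = r@_(mon 2 0 0) *: (Y * (Y * (X * X))) + r@_(mon 1 1 0) *: (Y * (Y * (X * Y))) +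
    r@_(mon 0 2 0) *: (Y * (Y * (Y * Y))) + Z * (Y * (Y * m))); last first.
    by rewrite -!mul_mpolyC; move: (r@__)%:MP (r@__)%:MP (r@__)%:MP => *; ring.
  by do 3?apply: (QD); try apply: (QZ) => //; apply/Qzy/homogYM.
move=> hp; have [p0 [p1 [p2 [h0 h1 h2 ->]]]] := homog_split hp.
have [a0 [a1 [a2 [k0 k1 k2 ->]]]] := homog_split h0.
have [b0 [b1 [b2 [m0 m1 m2 ->]]]] := homog_split h1.
have [d0 [d1 [d2 [n0 n1 n2 ->]]]] := homog_split h2.
rewrite !mulrDr; do ?apply: (QD).
- by apply: (Qxx); apply: (Qzx).
- by apply: (Qxy); apply: (Qzy).
- by rewrite mulrCA; apply: (Qzx).
- by rewrite mulrCA; apply: (Qxy); apply: (Qzy).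
- exact: Qyy2.
- by rewrite mulrCA; apply: (Qzy).
- exact: Qzx.
- exact: Qzy.
- exact: Qzz.
Qed.

End PointType.

(** * An arc in the first family with limit of the form [l <x, y>] *)

Section PointLimit.
Variable k : closedFieldType.
Local Notation S := {mpoly k[3]}.
Local Notation X := (X3 k).
Local Notation Y := (Y3 k).
Local Notation Z := (Z3 k).
Implicit Types (p q u v : S).
Local Notation closedG := (@closedG k 20 N5 (ideal_pred k) (@Hpt k) (@lowbasis k)).
Local Notation cl := (@cl k 20 N5 (ideal_pred k) (@Hpt k) (@lowbasis k)).

Section Arc.
Variables (I : ideal_pred k) (HI : Hpt I) (e f1 f2 : k).
Local Notation l := (X - e *: Z).
Local Notation n3 := (Y * Y - Z * (f1 *: X + f2 *: Y)).
Hypotheses (I1 : I (X * l)) (I2 : I (Y * l)).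
Hypothesis hev : forall d p, (0 < d)%N -> I p -> homog_of d p -> evd (chX e 0 0 e f1 f2) (chY e 0 0 e f1 f2) d p = 0.

Let hI := Hpt_hideal HI.
Let hX := @homogX3 k.
Let hY := @homogY3 k.
Let hZ := @homogZ3 k.

Lemma arc_n1 : ch_n1 e 0 0 e f2 = X * l :> S.
Proof.
rewrite /ch_n1 /ch_c0 (_ : 0 * 0 + e ^+ 2 - e * e - 0 * f2 = 0); last by ring.
by rewrite /lin !scale0r !addr0 -!mul_mpolyC; ring.
Qed.

Lemma arc_n2 : ch_n2 0 0 e f1 = Y * l :> S.
Proof.
rewrite /ch_n2 /ch_d0 (_ : 0 * f1 - 0 * e = 0); last by ring.
by rewrite /lin !scale0r add0r addr0 -!mul_mpolyC; ring.
Qed.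

Lemma arc_n3 : ch_n3 e 0 e f1 f2 = n3 :> S.
Proof.
rewrite /ch_n3 /ch_f0 (_ : 0 ^+ 2 + e * f1 - f1 * e - f2 * 0 = 0); last by ring.
by rewrite /lin scale0r addr0.
Qed.

Lemma arc_kernel d p : (2 <= d)%N -> I p -> homog_of d p -> exists a1 a2 a3,
  [/\ homog_of (d - 2) a1, homog_of (d - 2) a2, homog_of (d - 2) a3 & p = a1 * (X * l) + a2 * (Y * l) + a3 * n3].
Proof.
move=> d2 Ip hp; have [//|a1 [a2 [a3 [h1 h2 h3 ep]]]] := ch_kernel d2 hp (hev _ Ip hp); first exact: ltnW.
by exists a1, a2, a3; rewrite ep arc_n1 arc_n2 arc_n3.
Qed.

Let l_n3 : l * n3 = (Y - f2 *: Z) * (Y * l) - (f1 *: Z) * (X * l).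
Proof. by rewrite -!mul_mpolyC; move: f1%:MP f2%:MP e%:MP => *; ring. Qed.

Let I_ln3 : I (l * n3).
Proof. by rewrite l_n3; apply: (hiB hI); apply: (hiM hI). Qed.

Let line a : homog_of 1 a -> exists (y z : k), a = a@_(mon 1 0 0) *: l + (y *: Y + z *: Z).
Proof.
move=> ha; exists a@_(mon 0 1 0), (a@_(mon 0 0 1) + e * a@_(mon 1 0 0)).
rewrite {1}(homog1_lin ha) /lin -!mul_mpolyC mpolyCD mpolyCM.
by move: (a@__)%:MP (a@__)%:MP (a@__)%:MP e%:MP => *; ring.
Qed.

Let split_n3 a : homog_of 1 a -> I (a * n3) -> exists y z : k, I ((y *: Y + z *: Z) * n3) /\
  exists c : k, a * n3 = c *: (l * n3) + (y *: Y + z *: Z) * n3.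
Proof.
move=> ha; have [y [z ->]] := line ha => Ia; exists y, z; split; last first.
  by exists a@_(mon 1 0 0); rewrite mulrDl -scalerAl.
by have := hiB hI Ia (hiZ hI a@_(mon 1 0 0) I_ln3); rewrite mulrDl -scalerAl addrC addKr.
Qed.

(** The pencil accounts for at most five dimensions of [I_3] and already yields [l n3], so the sixth
    cubic can be sought in [<y, z> n3]. If both [y n3] and [z n3] were in [I], the codimension in
    degree 3 would be too small. *)
Lemma arc_direction : exists y z : k, [/\ ~ (y = 0 /\ z = 0), I ((y *: Y + z *: Z) * n3) &
  forall y' z' : k, I ((y' *: Y + z' *: Z) * n3) -> exists c : k, y' = c * y /\ z' = c * z].
Proof.
have [y [z [nz Iyz]]] : exists y z : k, ~ (y = 0 /\ z = 0) /\ I ((y *: Y + z *: Z) * n3).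
  apply: NNPP => hn; have [u [su hu fu _]] := Hpt_basis HI 3.
  pose five := [:: X * (X * l); Y * (X * l); Z * (X * l); Y * (Y * l); Z * (Y * l)].
  apply: (@steinitz_dep _ _ u five) fu => [p /hu[Ip hp]|]; last by rewrite su.
  have [a1 [a2 [a3 [h1 h2 h3 ep]]]] := @arc_kernel 3 p isT Ip hp.
  have Ia : I (a3 * n3).
    rewrite (_ : _ * _ = p - (a1 * (X * l) + a2 * (Y * l))); last by rewrite ep; ring.
    by apply: (hiB hI) => //; apply: (hiD hI); apply: (hiM hI).
  have [y [z [Iyz [c ec]]]] := split_n3 h3 Ia.
  have [y0 z0] : y = 0 /\ z = 0 by apply: NNPP => nz; apply: hn; exists y, z.
  rewrite ep ec y0 z0 !scale0r addr0 mul0r addr0 l_n3 (homog1_lin h1) (homog1_lin h2).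
  move: (a1@__) (a1@__) (a1@__) (a2@__) (a2@__) (a2@__) => x2 x1 x0 y2 y1 y0'.
  exists (nth 0 [:: x0; x1 + y0'; x2 - c * f1; y1 + c; y2 - c * f2]); rewrite !lcomb_cons lcomb_nil /= /lin -!mul_mpolyC.
  rewrite !(mpolyCD, mpolyCN, mpolyCM).
  by move: l x0%:MP x1%:MP x2%:MP y0'%:MP y1%:MP y2%:MP c%:MP f1%:MP f2%:MP => *; ring.
exists y, z; split=> // y' z' Iyz'.
have D0 : y * z' - y' * z = 0.
  apply/eqP; apply: contraT => D0; set D := _ - _ in D0.
  have IY : I (Y * n3).
    have := hiZ hI D^-1 (hiB hI (hiZ hI z' Iyz) (hiZ hI z Iyz')); congr I.
    apply: (scalerI D0); rewrite scalerA divff // scale1r /D -!mul_mpolyC !(mpolyCD, mpolyCN, mpolyCM).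
    by move: n3 y%:MP z%:MP y'%:MP z'%:MP => *; ring.
  have IZ : I (Z * n3).
    have := hiZ hI D^-1 (hiB hI (hiZ hI y Iyz') (hiZ hI y' Iyz)); congr I.
    apply: (scalerI D0); rewrite scalerA divff // scale1r /D -!mul_mpolyC !(mpolyCD, mpolyCN, mpolyCM).
    by move: n3 y%:MP z%:MP y'%:MP z'%:MP => *; ring.
  have := @Hpt_codim_le k I 3 [:: Z ^+ 2 * X; Z ^+ 2 * Y; Z ^+ 2 * Z] HI; rewrite /= => h.
  suff : false by []; apply: h => p hp.
  have [//|a1 [a2 [a3 [m [h1 h2 h3 hm ep]]]]] := @ch_reduce k e 0 0 e f1 f2 3 p _ hp.
  rewrite arc_n1 arc_n2 arc_n3 in ep.
  exists (p - Z ^+ 2 * m); split.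
  - rewrite ep (_ : _ - _ = a1 * (X * l) + a2 * (Y * l) + a3 * n3); last by rewrite /=; ring.
    apply: (hiD hI); first by apply: (hiD hI); apply: (hiM hI).
    have [y1 [z1 ->]] := line h3; rewrite !mulrDl -!scalerAl.
    by do 2?apply: (hiD hI); apply: (hiZ hI).
  - by apply: homogB => //; apply: (@homogZX k 2 1).
  exists (nth 0 [:: m@_(mon 1 0 0); m@_(mon 0 1 0); m@_(mon 0 0 1)]).
  by rewrite lcomb3 {1}(homog1_lin hm) /lin !mulrDr -!scalerAr; ring.
case: (eqVneq y 0) => [y0|y0].
  have z0 : z != 0 by apply/eqP => z0; apply: nz.
  exists (z' / z); rewrite divfK // y0 mulr0; split=> //.
  by move/eqP: D0; rewrite y0 mul0r sub0r oppr_eq0 mulf_eq0 (negPf z0) orbF => /eqP.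
exists (y' / y); rewrite divfK //; split=> //.
by apply: (mulfI y0); rewrite [RHS]mulrA [y * (_ / _)]mulrC divfK //; apply/eqP; rewrite -subr_eq0 D0.
Qed.

(* For [c2 = - s z] and [la = s y + s^3] the cubic [(y Y + z Z + s^2 Y) n3] lies in the ideal of the chart. *)
Lemma arc_limit : cl (@X1 k) I.
Proof.
have [y [z [nz Iyz hyz]]] := arc_direction.
pose cc (a : k) (s : k) := a; pose c2 s := - (s * z); pose la s := s * y + s ^+ 3.
have ps : pfun (@line_co k) (fun s => s) := pf_coord line_co tt.
have pc a : pfun (@line_co k) (cc a) := pf_const _ a.
have pc2 : pfun (@line_co k) c2 by apply: pf_opp; apply: pf_mul => //; exact: pf_const.
have pla : pfun (@line_co k) la by apply: pf_add; [apply: pf_mul => //; exact: pf_const|exact: pf_exp].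
pose fam := chart_fam (cc e) c2 (cc 0) (cc e) (cc f1) (cc f2) la (cc 0).
pose E := 'X * ('X ^+ 2 + y%:P) : {poly k}.
have E0 : E != 0.
  rewrite mulf_neq0 ?polyX_eq0 //; apply/eqP => /(congr1 (fun p : {poly k} => p`_2)).
  by rewrite coefD coefXn coefC coef0 /= addr0 => /eqP; rewrite oner_eq0.
have Es s : E.[s] != 0 -> s != 0 /\ la s + cc 0 s ^+ 2 != 0.
  rewrite hornerM hornerX hornerD hornerXn hornerC mulf_eq0 negb_or => /andP[s0 h]; split=> //.
  rewrite (_ : _ + _ = s * (s ^+ 2 + y)); last by rewrite /la /cc; ring.
  exact: mulf_neq0.
have c20 : c2 0 = 0 by rewrite /c2 mul0r oppr0.
have la0 : la 0 = 0 by rewrite /la mul0r expr0n addr0.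
pose ok s := E.[s] != 0.
have famI s : ok s -> is_hideal (fam s) by move=> _; apply: chartI_hideal.
have famH s : ok s -> Hpt (fam s) by move=> /Es[_ ?]; apply: chart_Hpt.
apply: (@closed_limit k 20 N5 _ (@Hpt k) (@lowbasis k) (cl (@X1 k)) E fam 0) => [|//|//||].
- by apply: cl_closed; exact: X1_Hpt.
- by move=> s /Es[_ nzs]; apply: cl_incl; apply: chart_X1.
apply: lifts_liftable => // d p d4 Ip hp.
have LD := liftsD famI; have LM := liftsM famI; have LZ := liftsZ famI.
have L1 : lifts line_co ok fam 0 (X * l).
  have := @lifts_q1 k _ _ _ _ _ _ _ _ _ _ (cc 0) (pc e) pc2 (pc 0) (pc e) (pc f1) (pc f2) pla ok 0.
  by rewrite /ch_q1 /cc c20 la0 scale0r addr0 arc_n1.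
have L2 : lifts line_co ok fam 0 (Y * l).
  have := @lifts_q2 k _ _ _ _ _ _ _ _ _ la _ (pc e) pc2 (pc 0) (pc e) (pc f1) (pc f2) (pc 0) ok 0.
  by rewrite /ch_q2 /cc c20 scale0r addr0 arc_n2.
have L3 : lifts line_co ok fam 0 ((y *: Y + z *: Z) * n3).
  exists (fun s => (y *: Y + z *: Z + s ^+ 2 *: Y) * n3); split=> [||s /Es[s0 nzs]].
  - apply: psecM; last exact: psec_const.
    by apply: psecD; [exact: psec_const|apply: psecZ; [exact: pf_exp|exact: psec_const]].
  - by rewrite expr0n scale0r addr0.
  have q1 := fam_q1 (cc e) c2 (cc 0) (cc e) (cc f1) (cc f2) la (cc 0) s.
  have q2 := fam_q2 (cc e) c2 (cc 0) (cc e) (cc f1) (cc f2) la (cc 0) s.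
  have hs : is_hideal (fam s) by apply: chartI_hideal.
  have := hiZ hs s^-1 (hiB hs (hiM hs Y q1) (hiM hs X q2)); congr (fam s).
  apply: (scalerI s0); rewrite scalerA divff // scale1r /ch_q1 /ch_q2 /ch_n1 /ch_n2 /cc arc_n3 scale0r addr0.
  rewrite /ch_c0 /ch_d0 /lin /c2 /la scale0r add0r -!mul_mpolyC !(mpolyCD, mpolyCN, mpolyCM, mpolyC0, rmorphXn) /=.
  by move: e%:MP f1%:MP f2%:MP s%:MP y%:MP z%:MP => *; ring.
case: d d4 hp => [|[|[|[|[|//]]]]] _ hp.
- by rewrite (Hpt_low HI _ hp Ip) //; apply: lifts0.
- by rewrite (Hpt_low HI _ hp Ip) //; apply: lifts0.
- have [|||c ->] := @Hpt_span _ I HI 2 [:: X * l; Y * l] _ _ _ p Ip hp => //.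
  + have hl : homog_of 1 l by apply: homogB => //; apply: homogZ.
    by move=> q; rewrite !inE => /orP[] /eqP ->; split=> //; [apply: homogXM|apply: homogYM].
  + apply: (@freeS_coef2 _ _ _ (mon 2 0 0) (mon 1 1 0)); rewrite !coefvar ?mcoeffB ?mcoeffZ ?coefvar ?coef_mon /=; ring.
  by rewrite !lcomb_cons lcomb_nil addr0; apply: (LD); apply: (LZ).
- have [a1 [a2 [a3 [h1 h2 h3 ep]]]] := @arc_kernel 3 p isT Ip hp.
  have Ia : I (a3 * n3).
    rewrite (_ : _ * _ = p - (a1 * (X * l) + a2 * (Y * l))); last by rewrite ep; ring.
    by apply: (hiB hI) => //; apply: (hiD hI); apply: (hiM hI).
  have [y' [z' [Iyz' [c ec]]]] := split_n3 h3 Ia; have [t [ey ez]] := hyz y' z' Iyz'.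
  rewrite ep ec ey ez l_n3; apply: (LD); first by apply: (LD); apply: (LM).
  apply: (LD); first by apply: (LZ); rewrite -mulNr; apply: (LD); apply: (LM).
  by rewrite -!scalerA -scalerDr -scalerAl; apply: (LZ).
have := @lifts_quartic k _ _ _ _ _ _ _ _ _ la (cc 0) (pc e) pc2 (pc 0) (pc e) (pc f1) (pc f2) ok 0 p hp.
by rewrite /cc c20; apply; apply: hev.
Qed.

End Arc.

Variables (I : ideal_pred k) (HI : Hpt I) (e : k).
Local Notation l := (X - e *: Z).
Hypotheses (I1 : I (X * l)) (I2 : I (Y * l)).

(** That [x l] and [y l] vanish at the three points fixes the structure constants [c1 = d2 = e],
    [c2 = d1 = 0], the situation of [arc_limit]. *)
Lemma point_monic g : homog_of 2 g -> g@_(mon 0 0 2) = 0 -> g@_(mon 0 2 0) != 0 ->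
  I (Y * (Y * g)) -> I (Y * (Z * g)) -> I (Z * (Z * g)) -> cl (@X1 k) I /\ regular I.
Proof.
move=> hg gz gy IYY IYZ IZZ; have zr := @point_zred k I HI e I1 I2 g hg gz gy IYY IYZ IZZ.
split; last exact: zred_regular HI zr.
have [c1 [c2 [d1 [d2 [f1 [f2 [hev _]]]]]]] := zred_chart HI zr.
have hl : homog_of 1 l by apply: homogB; [exact: homogX3|apply: homogZ; exact: homogZ3].
have e1 := hev 2 _ isT I1 (homogXM hl); have e2 := hev 2 _ isT I2 (homogYM hl).
have x1 : X * l = ch_n1 c1 c2 d1 d2 f2 + Z * lin (c1 - e) c2 (ch_c0 c1 c2 d1 d2 f2).
  rewrite /ch_n1; move: (ch_c0 _ _ _ _ _) => c0; rewrite /lin -!mul_mpolyC !(mpolyCD, mpolyCN).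
  by move: c1%:MP c2%:MP e%:MP => *; ring.
have x2 : Y * l = ch_n2 c2 d1 d2 f1 + Z * lin d1 (d2 - e) (ch_d0 c2 d1 d2 f1).
  rewrite /ch_n2; move: (ch_d0 _ _ _ _) => c0; rewrite /lin -!mul_mpolyC !(mpolyCD, mpolyCN).
  by move: d1%:MP d2%:MP e%:MP => *; ring.
move: e1 e2; rewrite x1 x2 (evdD _ _ _ (ch_n1 _ _ _ _ _)) (evdD _ _ _ (ch_n2 _ _ _ _)) ch_evd_n1 ch_evd_n2 !add0r !ch_evdZlin => /rowP r1 /rowP r2.
move: (r1 i1) (r1 i2) (r2 i1) (r2 i2); rewrite !mxE /= => /eqP; rewrite subr_eq0 => /eqP z1 z2 z3 /eqP.
rewrite subr_eq0 => /eqP z4; rewrite z1 z2 z3 z4 in hev.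
exact: (arc_limit HI I1 I2 hev).
Qed.

End PointLimit.

(** * Every point lies in one of the two closures *)

Section Classification.
Variable k : closedFieldType.
Hypothesis char2 : (2%:R : k) != 0.
Local Notation S := {mpoly k[3]}.
Local Notation X := (X3 k).
Local Notation Y := (Y3 k).
Local Notation Z := (Z3 k).
Implicit Types (p q u v : S) (I J : ideal_pred k) (M : 'M[k]_3).
Local Notation closedG := (@closedG k 20 N5 (ideal_pred k) (@Hpt k) (@lowbasis k)).
Local Notation cl := (@cl k 20 N5 (ideal_pred k) (@Hpt k) (@lowbasis k)).

Lemma six_nosyz u v : freeS (six u v) -> nosyz u v.
Proof.
move=> fr a b ha hb; rewrite (homog1_lin ha) (homog1_lin hb).
move: (a@__) (a@__) (a@__) (b@__) (b@__) (b@__) => a2 a1 a0 b2 b1 b0 ab.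
have h := fr (nth 0 [:: a0; a1; a2; b0; b1; b2]); rewrite six_lcomb in h.
have {}h i : (i < 6)%N -> nth 0 [:: a0; a1; a2; b0; b1; b2] i = 0 by apply: (h ab).
move: (h 0%N isT) (h 1%N isT) (h 2%N isT) (h 3%N isT) (h 4%N isT) (h 5%N isT) => /= -> -> -> -> -> ->.
by rewrite /lin !scale0r !addr0.
Qed.

(** The translated pencil of a member of [X1] still has no linear syzygy, so [coprime_pencil]
    applies to it. *)
Lemma clX1_stable J M : M \in unitmx -> cl (@X1 k) J -> cl (@X1 k) (act M J).
Proof.
move=> uM; apply: cl_act => //; first exact: X1_Hpt.
move=> {}J XJ; have HJ := X1_Hpt XJ; case: XJ HJ => t okt -> HJ.
have q1 := fam_q1 (fun t : 'I_8 -> k => tc t 3 - tc t 1) (fun t => tc t 2 - (1 + tc t 0)) (fun t => tc t 5) (fun t => tc t 4)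
   (fun t => tc t 1) (fun t => 1 + tc t 0) (fun t => 1 + tc t 7) (fun t => tc t 6) t.
have q2 := fam_q2 (fun t : 'I_8 -> k => tc t 3 - tc t 1) (fun t => tc t 2 - (1 + tc t 0)) (fun t => tc t 5) (fun t => tc t 4)
   (fun t => tc t 1) (fun t => 1 + tc t 0) (fun t => 1 + tc t 7) (fun t => tc t 6) t.
have ns := nosyz_subst uM (six_nosyz (normal_pencil_free (ch_normal_pencil (tc t 3 - tc t 1) (tc t 2 - (1 + tc t 0)) (tc t 5) (tc t 4)
   (tc t 1) (1 + tc t 0) (1 + tc t 7) (tc t 6)) okt)).
have [] := coprime_pencil char2 (Hpt_act uM HJ) (act_mem M q1) (act_mem M q2) _ _ ns => //.
  by apply: homog_subst; apply: homog_q1.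
by apply: homog_subst; apply: homog_q2.
Qed.

(** A change of coordinates that fixes [l] and [y] and sends [z] to [t y + z] makes [y^2] occur in
    the conic of [conic_through]; then [point_monic] applies. *)
Lemma point_type I (e : k) : Hpt I -> I (X * (X - e *: Z)) -> I (Y * (X - e *: Z)) ->
  ~ (forall p, homog_of 3 p -> I ((X - e *: Z) * p)) -> cl (@X1 k) I /\ regular I.
Proof.
move=> HI I1 I2 nI; have [g [hg gz pg [IYY IYZ IZZ]]] := conic_through HI I1 I2 nI.
have := quad_form hg; rewrite gz; set a := g@_(mon 2 0 0); set b := g@_(mon 1 1 0); set c := g@_(mon 0 2 0).
set d := g@_(mon 1 0 1); set f := g@_(mon 0 1 1) => eg.
have {}eg : g = a *: (X * X) + b *: (X * Y) + c *: (Y * Y) + Z * (d *: X + f *: Y) by rewrite {1}eg /lin scale0r addr0.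
(* This is the restriction of [g] to [l = 0], taken at [y = 1], [z = t]. *)
have [t ht] : exists t, horner_rec [:: c; b * e + f; a * e * e + d * e] t != 0.
  apply: NNPP => hn; case/negP: pg.
  have h i : [:: c; b * e + f; a * e * e + d * e]`_i = 0.
    by apply: horner_seq_eq0 => x; apply/eqP/negPn/negP => h; apply: hn; exists x.
  move: (h 0%N) (h 1%N) (h 2%N) => /= h0 h1 h2.
  rewrite [in X in X == _]eg !rmorphD /= !substZ !rmorphM /= rmorphD /= !substZ substX3 substY3 substZ3 !mxE /=.
  have -> : lin 0 0 e = e *: Z by rewrite /lin !scale0r !add0r.
  rewrite -linY1 -linZ1 (_ : _ + _ = c *: (Y * Y) + (b * e + f) *: (Y * Z) + (a * e * e + d * e) *: (Z * Z)).
    by rewrite h0 h1 h2 !scale0r !addr0.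
  rewrite -!mul_mpolyC !(mpolyCD, mpolyCM); move: a%:MP b%:MP c%:MP d%:MP e%:MP f%:MP => *; ring.
pose N := mx3 [:: [:: 1; e * t; 0]; [:: 0; 1; 0]; [:: 0; t; 1]].
have uN : N \in unitmx by apply: mx3_unitE; rewrite !(mulr0, mul0r, mulr1, mul1r, subr0, addr0) oner_neq0.
have NX : subst N X = X + (e * t) *: Y by rewrite substX3 !mxE /= /lin scale0r addr0 scale1r.
have NY : subst N Y = Y by rewrite substY3 !mxE /= -linY1.
have NZ : subst N Z = t *: Y + Z by rewrite substZ3 !mxE /= /lin scale0r add0r scale1r.
have Nl : subst N (X - e *: Z) = X - e *: Z.
  rewrite rmorphB /= substZ NX NZ -!mul_mpolyC mpolyCM; move: e%:MP t%:MP => *; ring.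
have HJ := Hpt_act uN HI; have hJ := Hpt_hideal HJ.
have J2 : act N I (Y * (X - e *: Z)) by rewrite -NY -Nl -rmorphM; apply: act_mem.
have J1 : act N I (X * (X - e *: Z)).
  have := act_mem N I1; rewrite rmorphM /= Nl NX mulrDl -scalerAl => h.
  by have := hiB hJ h (hiZ hJ (e * t) J2); rewrite addrK.
set g' := subst N g; have hg' : homog_of 2 g' by apply: homog_subst.
have eg' : g' = a *: (X * X) + (2%:R * a * e * t + b + d * t) *: (X * Y) +
    (c + (b * e + f) * t + (a * e * e + d * e) * t * t) *: (Y * Y) + Z * (d *: X + (d * e * t + f) *: Y).
  rewrite /g' {1}eg !rmorphD /= !substZ !rmorphM /= rmorphD /= !substZ NX NY NZ -!mul_mpolyC.
  rewrite !(mpolyCD, mpolyCM, rmorph_nat) /=; move: a%:MP b%:MP c%:MP d%:MP e%:MP f%:MP t%:MP => *; ring.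
have g'z : g'@_(mon 0 0 2) = 0.
  by rewrite eg' !mcoeffD !mcoeffZ !coefvar ?mcoeffD ?mcoeffZ ?coefvar ?coef_mon /=; ring.
have g'y : g'@_(mon 0 2 0) != 0.
  rewrite eg' !mcoeffD !mcoeffZ !coefvar ?mcoeffD ?mcoeffZ ?coefvar ?coef_mon /=.
  by move: ht; congr (_ != 0); rewrite /=; ring.
have JYY : act N I (Y * (Y * g')) by have := act_mem N IYY; rewrite !rmorphM /= NY.
have JYZ : act N I (Y * (Z * g')).
  have := act_mem N IYZ; rewrite !rmorphM /= NY NZ -/g' mulrDl mulrDr -scalerAl -scalerAr => h.
  by have := hiB hJ h (hiZ hJ t JYY); rewrite addrC addKr.
have JZZ : act N I (Z * (Z * g')).
  have := act_mem N IZZ; rewrite !rmorphM /= NZ -/g' => h.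
  have := hiB hJ (hiB hJ h (hiZ hJ (t ^+ 2) JYY)) (hiZ hJ (2%:R * t) JYZ); congr (act N I).
  by rewrite -!mul_mpolyC !(mpolyCM, rmorphXn, rmorph_nat) /=; move: t%:MP (g') => *; ring.
have [cJ rJ] := point_monic HJ J1 J2 hg' g'z g'y JYY JYZ JZZ.
split; last exact: (regular_act uN).
by rewrite -(actK I uN); apply: clX1_stable; rewrite ?unitmx_inv.
Qed.

(** The cases are: no linear syzygy in [I_2]; [I_2 = l <x, y>] with [l S_3] not in [I]; and [l S_3]
    in [I]. In the last case a substitution moves [l] to [x] before [line_type] is applied. *)
Theorem Hpt_classification I : Hpt I -> (cl (@X1 k) I \/ cl (@X2 k) I) /\ regular I.
Proof.
move=> HI; have hI := Hpt_hideal HI.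
case: (classic (exists u v, [/\ I u, I v & [/\ homog_of 2 u, homog_of 2 v & nosyz u v]])) => [|hn].
  move=> [u [v [Iu Iv [hu hv ns]]]]; have [c r] := coprime_pencil char2 HI Iu Iv hu hv ns.
  by split=> //; left.
have [|M uM [e [J1 J2]]] := special_normal HI.
  by move=> u v Iu Iv hu hv _ ns; apply: hn; exists u, v; split.
have HJ := Hpt_act uM HI.
case: (classic (forall p, homog_of 3 p -> act M I ((X - e *: Z) * p))) => [JX|nJ]; last first.
  have [c r] := point_type HJ J1 J2 nJ; split; last exact: (regular_act uM).
  by left; rewrite -(actK I uM); apply: clX1_stable; rewrite ?unitmx_inv.
pose N := mx3 [:: [:: 1; 0; e]; [:: 0; 1; 0]; [:: 0; 0; 1]].
have uN : N \in unitmx by apply: mx3_unitE; rewrite !(mulr0, mul0r, mulr1, mul1r, subr0, addr0) oner_neq0.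
have NX : subst N X = X + e *: Z by rewrite substX3 !mxE /= /lin scale0r addr0 scale1r.
have NY : subst N Y = Y by rewrite substY3 !mxE /= -linY1.
have NZ : subst N Z = Z by rewrite substZ3 !mxE /= -linZ1.
have Nl : subst N (X - e *: Z) = X by rewrite rmorphB /= substZ NX NZ addrK.
have HK := Hpt_act uN HJ.
have K1 : act N (act M I) (X * Y) by rewrite mulrC -NY -Nl -rmorphM; apply: act_mem.
have K2 : act N (act M I) (X * (X - (- e) *: Z)).
  by rewrite scaleNr opprK mulrC -{2}Nl -NX -rmorphM; apply: act_mem.
have K3 p : homog_of 3 p -> act N (act M I) (X * p).
  by move=> hp; rewrite -Nl -(substVK p uN) -rmorphM; apply: act_mem; apply: JX; apply: homog_subst.
have [c r] := line_type HK K1 K2 K3; split; last exact: (regular_act uM (regular_act uN r)).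
right; rewrite -(actK I uM); apply: clX2_stable; first by rewrite unitmx_inv.
by rewrite -(actK (act M I) uN); apply: clX2_stable => //; rewrite unitmx_inv.
Qed.

End Classification.

(** * A chain of length 8 in the first component *)

Section Chains.
Variable k : closedFieldType.
Hypothesis char2 : (2%:R : k) != 0.
Local Notation S := {mpoly k[3]}.
Local Notation X := (X3 k).
Local Notation Y := (Y3 k).
Local Notation Z := (Z3 k).
Implicit Types (p q : S) (I J : ideal_pred k).
Local Notation closedG := (@closedG k 20 N5 (ideal_pred k) (@Hpt k) (@lowbasis k)).
Local Notation irrG := (@irrG k 20 N5 (ideal_pred k) (@Hpt k) (@lowbasis k)).
Local Notation cl := (@cl k 20 N5 (ideal_pred k) (@Hpt k) (@lowbasis k)).

Definition pairK d (f : S * S -> k) : subH k := fun J =>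
  Hpt J /\ forall p q, J p -> J q -> homog_of d p -> homog_of d q -> f (p, q) = 0.

(** Linear in the Pluecker coordinates, so its vanishing depends on the pencil only and can be
    tested on one basis. *)
Definition minors (m : 'X_{1..3} * 'X_{1..3} * k * 'X_{1..3} * 'X_{1..3}) (w : S * S) : k :=
  let: (a, b, s, c, d) := m in plu a b w.1 w.2 + s * plu c d w.1 w.2.

Lemma pf_minors m : pfun (@pair_co k) (minors m).
Proof.
case: m => [[[[a b] s] c] d].
have c1 m : pfun (@pair_co k) (fun w => w.1@_m) by apply: (pf_coord _ (true, m)).
have c2 m : pfun (@pair_co k) (fun w => w.2@_m) by apply: (pf_coord _ (false, m)).
have pp m m' : pfun (@pair_co k) (fun w => plu m m' w.1 w.2) by apply: pf_sub; apply: pf_mul.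
by apply: pf_add; [exact: pp|apply: pf_mul; [exact: pf_const|exact: pp]].
Qed.

Lemma minors_lin m (a b c d : k) u v :
  minors m (a *: u + b *: v, c *: u + d *: v) = (a * d - b * c) * minors m (u, v).
Proof.
case: m => [[[[m1 m2] s] m3] m4]; rewrite /minors /plu /= !mcoeffD !mcoeffZ.
by move: (u@__) (u@__) (u@__) (u@__) (v@__) (v@__) (v@__) (v@__) => *; ring.
Qed.

Let xx := mon 2 0 0. Let xy := mon 1 1 0. Let yy := mon 0 2 0.
Let xz := mon 1 0 1. Let yz := mon 0 1 1. Let zz := mon 0 0 2.

(** On the basis [q1], [q2] of a chart pencil the values are: 1 plus the coefficient of [z^2] in
    [q1]; the coefficients of [z^2] in [q2], of [y z] and [x z] in [q1], of [y z] and [x z] in [q2];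
    then [mu] and [la - 1]. The [j]-th is zero when the coordinates of [fam1] from [j] on are. *)
Definition flag1 (j : 'I_8) := nth (zz, zz, 0 : k, zz, zz)
  [:: (zz, xy, 1, xx, xy); (xx, zz, 0, xx, xx); (yz, xy, 0, xx, xx); (xz, xy, 0, xx, xx); (xx, yz, 0, xx, xx);
      (xx, xz, 0, xx, xx); (xx, yy, 0, xx, xx); (yy, xy, -1, xx, xy)] j.

Lemma pairK_chart c1 c2 d1 d2 f1 f2 la mu m : la + mu ^+ 2 != 0 ->
  pairK 2 (minors m) (chartI c1 c2 d1 d2 f1 f2 la mu) <->
  minors m (ch_q1 c1 c2 d1 d2 f1 f2 la, ch_q2 c1 c2 d1 d2 f1 f2 mu) = 0.
Proof.
move=> nz; have HJ := chart_Hpt c1 c2 d1 d2 f1 f2 nz; split=> [[_ h]|h].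
  apply: h; try exact: homog_q1; try exact: homog_q2.
  - apply/(chartI_mem _ _ _ _ _ _ _ _ (@homog_q1 k c1 c2 d1 d2 f1 f2 la)).
    by exists 1, 0; rewrite scale1r scale0r addr0.
  - apply/(chartI_mem _ _ _ _ _ _ _ _ (@homog_q2 k c1 c2 d1 d2 f1 f2 mu)).
    by exists 0, 1; rewrite scale1r scale0r add0r.
split=> // p q /[swap] Jq /[swap] hp /(chartI_mem _ _ _ _ _ _ _ _ hp) /= [a [b ->]].
by move: Jq => /[swap] hq /(chartI_mem _ _ _ _ _ _ _ _ hq) /= [c [d ->]]; rewrite minors_lin h mulr0.
Qed.

Lemma ch_q_coefs (c1 c2 d1 d2 f1 f2 la mu : k) (q1 := ch_q1 c1 c2 d1 d2 f1 f2 la) (q2 := ch_q2 c1 c2 d1 d2 f1 f2 mu) :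
  [/\ q1@_xx = 1, q1@_xy = 0, q1@_yy = la &
   [/\ q1@_xz = - (c1 + la * f1), q1@_yz = - (c2 + la * f2) &
     q1@_zz = - ((d1 * c2 + d2 ^+ 2 - c1 * d2 - c2 * f2) + la * (d1 ^+ 2 + d2 * f1 - f1 * c1 - f2 * d1))]] /\
  [/\ q2@_xx = 0, q2@_xy = 1, q2@_yy = mu &
   [/\ q2@_xz = - (d1 + mu * f1), q2@_yz = - (d2 + mu * f2) &
     q2@_zz = - ((c2 * f1 - d1 * d2) + mu * (d1 ^+ 2 + d2 * f1 - f1 * c1 - f2 * d1))]].
Proof.
rewrite /q1 /q2 /ch_q1 /ch_q2 /ch_n1 /ch_n2 /ch_n3 /xx /xy /yy /xz /yz /zz.
split; (split; last split); rewrite !(mcoeffD, mcoeffN, mcoeffZ) !coefvar ?coef_mon ?coef_lin /=; rewrite /ch_c0 /ch_d0 /ch_f0; ring.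
Qed.

Lemma ok1_0 : ok1 (fun=> 0 : k).
Proof. by rewrite /ok1 /tc expr0n !addr0 oner_neq0. Qed.

Lemma X1_chain : exists c : nat -> subH k,
  (forall i, (i <= 8)%N -> [/\ closedG (c i), irrG (c i) & forall J, c i J -> cl (@X1 k) J]) /\
  (forall i, (i < 8)%N -> (forall J, c i J -> c i.+1 J) /\ ~ (forall J, c i.+1 J -> c i J)).
Proof.
have val1 (j : 'I_8) t : ok1 t -> pairK 2 (minors (flag1 j)) (fam1 t) <-> minors (flag1 j)
    (ch_q1 (tc t 3 - tc t 1) (tc t 2 - (1 + tc t 0)) (tc t 5) (tc t 4) (tc t 1) (1 + tc t 0) (1 + tc t 7),
     ch_q2 (tc t 3 - tc t 1) (tc t 2 - (1 + tc t 0)) (tc t 5) (tc t 4) (tc t 1) (1 + tc t 0) (tc t 6)) = 0.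
  by move=> okt; apply: pairK_chart.
apply: (closure_chain (@ok1_line k) (@fam1_Hpt k) (@fam1_lift k) ok1_0 (K := fun j => pairK 2 (minors (flag1 j)))).
- by move=> j; apply: (@closed_pairs k 2 _ isT (pf_minors (flag1 j))).
- move=> j t okt h0; apply/(val1 j t okt).
  have {}h0 i : (j <= i < 8)%N -> tc t i = 0.
    by move=> /andP[ji i8]; apply: h0; rewrite inordK.
  have [[e1 e2 e3 [e4 e5 e6]] [g1 g2 g3 [g4 g5 g6]]] := ch_q_coefs (tc t 3 - tc t 1) (tc t 2 - (1 + tc t 0)) (tc t 5) (tc t 4) (tc t 1) (1 + tc t 0) (1 + tc t 7) (tc t 6).
  have [k0 k1 k2 k3] : [/\ (j <= 0)%N -> tc t 0 = 0, (j <= 1)%N -> tc t 1 = 0, (j <= 2)%N -> tc t 2 = 0 & (j <= 3)%N -> tc t 3 = 0].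
    by split=> jl; apply: h0; rewrite jl.
  have [k4 k5 k6 k7] : [/\ (j <= 4)%N -> tc t 4 = 0, (j <= 5)%N -> tc t 5 = 0, (j <= 6)%N -> tc t 6 = 0 & (j <= 7)%N -> tc t 7 = 0].
    by split=> jl; apply: h0; rewrite jl.
  rewrite /flag1; case: j {h0 okt} k0 k1 k2 k3 k4 k5 k6 k7 => [[|[|[|[|[|[|[|[|//]]]]]]]] hj] /= k0 k1 k2 k3 k4 k5 k6 k7;
    rewrite /plu ?e1 ?e2 ?e3 ?e4 ?e5 ?e6 ?g1 ?g2 ?g3 ?g4 ?g5 ?g6;
    try rewrite !(k0 isT); try rewrite !(k1 isT); try rewrite !(k2 isT); try rewrite !(k3 isT);
    try rewrite !(k4 isT); try rewrite !(k5 isT); try rewrite !(k6 isT); try rewrite !(k7 isT); ring.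
(* For [j = 0] the condition reads [1 - f2^2 = 0] with [f2 = 1 + w]. The value [-1] violates it
   always, whereas [1] would satisfy it in characteristic 3. *)
move=> j; pose w : k := if val j == 0%N then -1 else 1.
pose t (i : 'I_8) : k := if i == j then w else 0.
have tE i : (i < 8)%N -> tc t i = if i == val j then w else 0.
  by move=> i8; rewrite /tc /t -val_eqE /= inordK.
have okt : ok1 t.
  rewrite /ok1 !tE // /w; case: j {t w tE} => [[|[|[|[|[|[|[|[|//]]]]]]]] hj] /=; rewrite ?expr0n ?expr1n ?addr0 ?oner_neq0 //.
exists t; split=> //.
  by move=> i ji; rewrite /t; case: eqP => // e; rewrite e ltnn in ji.
move=> /(val1 j t okt).
have [[e1 e2 e3 [e4 e5 e6]] [g1 g2 g3 [g4 g5 g6]]] := ch_q_coefs (tc t 3 - tc t 1) (tc t 2 - (1 + tc t 0)) (tc t 5) (tc t 4) (tc t 1) (1 + tc t 0) (1 + tc t 7) (tc t 6).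
move: e1 e2 e3 e4 e5 e6 g1 g2 g3 g4 g5 g6; rewrite !tE // /w /flag1.
case: j {t w tE okt} => [[|[|[|[|[|[|[|[|//]]]]]]]] hj] /= e1 e2 e3 e4 e5 e6 g1 g2 g3 g4 g5 g6; rewrite /minors /plu /= ?e1 ?e2 ?e3 ?e4 ?e5 ?e6 ?g1 ?g2 ?g3 ?g4 ?g5 ?g6 => h.
all: have /eqP := oner_neq0 k; apply.
all: first [by rewrite -[RHS]h; ring|by rewrite -[RHS]oppr0 -h; ring].
Qed.

End Chains.

(** * A chain of length 8 in the second component *)

Section SpecialChain.
Variable k : closedFieldType.
Local Notation S := {mpoly k[3]}.
Local Notation X := (X3 k).
Local Notation Y := (Y3 k).
Local Notation Z := (Z3 k).
Implicit Types (p q : S) (I J : ideal_pred k).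
Local Notation closedG := (@closedG k 20 N5 (ideal_pred k) (@Hpt k) (@lowbasis k)).
Local Notation irrG := (@irrG k 20 N5 (ideal_pred k) (@Hpt k) (@lowbasis k)).
Local Notation cl := (@cl k 20 N5 (ideal_pred k) (@Hpt k) (@lowbasis k)).

Lemma trans00 : trans 0 0 = 1%:M :> 'M[k]_3.
Proof. by apply/matrixP => i j; rewrite !mxE; case: (ord3 i) => ->; case: (ord3 j) => ->. Qed.

Lemma fam2_spI (t : 'I_8 -> k) : tc t 6 = 0 -> tc t 7 = 0 ->
  fam2 t = spI (tc t 4) (tc t 5) (tc t 2) (tc t 1) (tc t 0) (tc t 3).
Proof. by rewrite /fam2 => -> ->; rewrite trans00 act1. Qed.

Definition coefK m (w : S * S) : k := w.1@_m.

Lemma pf_coefK m : pfun (@pair_co k) (coefK m).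
Proof. exact: (pf_coord _ (true, m)). Qed.

(** In the order of [fam2]: the coefficients of [sp_c], then [al], [r1], [r2], and the movement of
    the line, seen in [y^2] and [z^2]. For [r2] a minor is used, since [r1] need not be zero at that
    stage. *)
Definition K2 (j : nat) : subH k := match j with
  | 0 => pairK 3 (coefK (mon 0 0 3))
  | 1 => pairK 3 (coefK (mon 0 1 2))
  | 2 => pairK 3 (coefK (mon 0 2 1))
  | 3 => pairK 3 (coefK (mon 3 0 0))
  | 4 => pairK 2 (coefK (mon 2 0 0))
  | 5 => pairK 2 (minors (mon 2 0 0, mon 1 1 0, 0, mon 2 0 0, mon 2 0 0))
  | 6 => pairK 2 (coefK (mon 0 2 0))
  | _ => pairK 2 (coefK (mon 0 0 2))
  end.

Lemma K2_closed j : closedG (K2 j).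
Proof.
case: j => [|[|[|[|[|[|[|j]]]]]]] /=; first [exact: (@closed_pairs k 3 _ isT (pf_coefK _))
  |exact: (@closed_pairs k 2 _ isT (pf_coefK _))|exact: (@closed_pairs k 2 _ isT (pf_minors _))].
Qed.

Lemma spI_cubic_coef (r1 r2 c1 c2 c3 al : k) p : homog_of 3 p -> spI r1 r2 c1 c2 c3 al p -> exists g : k,
  [/\ p@_(mon 0 0 3) = g * c3, p@_(mon 0 1 2) = g * c2, p@_(mon 0 2 1) = g * c1 &
   r1 = 0 -> r2 = 0 -> p@_(mon 3 0 0) = g * al].
Proof.
move=> hp /(spI_mem _ _ _ _ _ _ hp) /= [a [b [g [ha hb ->]]]]; exists g.
rewrite (homog1_lin ha) (homog1_lin hb) /sp_q1 /sp_q2 /sp_e /sp_c.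
split=> [|||-> ->]; rewrite !(mcoeffD, mcoeffZ, coef_linM) !coefvar ?(mcoeffD, mcoeffZ, coef_linM) ?coefvar ?coef_lin ?coef_mon /=; ring.
Qed.

Lemma spI_quadric (r1 r2 c1 c2 c3 al : k) p : homog_of 2 p -> spI r1 r2 c1 c2 c3 al p ->
  exists a b : k, p = a *: sp_q1 r1 + b *: sp_q2 r2.
Proof. by move=> hp /(spI_mem _ _ _ _ _ _ hp). Qed.

Lemma sp_q_coef (r1 r2 : k) : [/\ (sp_q1 r1 : S)@_(mon 2 0 0) = - r1, (sp_q1 r1 : S)@_(mon 1 1 0) = 1,
  (sp_q2 r2 : S)@_(mon 2 0 0) = - r2 & (sp_q2 r2 : S)@_(mon 1 1 0) = 0].
Proof. by rewrite /sp_q1 /sp_q2 !coefvar !coef_lin. Qed.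

Lemma X2_chain : exists c : nat -> subH k,
  (forall i, (i <= 8)%N -> [/\ closedG (c i), irrG (c i) & forall J, c i J -> cl (@X2 k) J]) /\
  (forall i, (i < 8)%N -> (forall J, c i J -> c i.+1 J) /\ ~ (forall J, c i.+1 J -> c i J)).
Proof.
have ok0 : ok2 (fun=> 0 : k) by [].
apply: (closure_chain (@ok2_line k) (@fam2_Hpt k) (@fam2_lift k) ok0 (K := fun j : 'I_8 => K2 j)).
- by move=> j; apply: K2_closed.
- move=> j t okt h0; have HJ := fam2_Hpt okt.
  have {}h0 i : (j <= i < 8)%N -> tc t i = 0.
    by move=> /andP[ji i8]; apply: h0; rewrite inordK.
  have sp : (j <= 6)%N -> fam2 t = spI (tc t 4) (tc t 5) (tc t 2) (tc t 1) (tc t 0) (tc t 3).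
    by move=> j6; apply: fam2_spI; apply: h0; rewrite ?j6 // ltnW.
  case: j h0 sp => [[|[|[|[|[|[|[|[|//]]]]]]]] hj] h0 sp; split=> // p q.
  + by rewrite sp //= /coefK /= => Jp _ hp _; have [g [-> _ _ _]] := spI_cubic_coef hp Jp; rewrite h0 // mulr0.
  + by rewrite sp //= /coefK /= => Jp _ hp _; have [g [_ -> _ _]] := spI_cubic_coef hp Jp; rewrite h0 // mulr0.
  + by rewrite sp //= /coefK /= => Jp _ hp _; have [g [_ _ -> _]] := spI_cubic_coef hp Jp; rewrite h0 // mulr0.
  + rewrite sp //= /coefK /= => Jp _ hp _; have [g [_ _ _ e]] := spI_cubic_coef hp Jp.
    by rewrite e; [rewrite (h0 3%N) // mulr0|apply: h0|apply: h0].
  + rewrite sp //= /coefK /= => Jp _ hp _; have [a [b ->]] := spI_quadric hp Jp; have [e1 _ e2 _] := sp_q_coef (tc t 4) (tc t 5).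
    by rewrite mcoeffD !mcoeffZ e1 e2 !h0 // oppr0 !mulr0 addr0.
  + rewrite sp //= => Jp Jq hp hq; have [a [b ->]] := spI_quadric hp Jp; have [c [d ->]] := spI_quadric hq Jq.
    have [e1 e2 e3 e4] := sp_q_coef (tc t 4) (tc t 5).
    have z5 : tc t 5 = 0 by apply: h0.
    by have := minors_lin (mon 2 0 0, mon 1 1 0, 0, mon 2 0 0, mon 2 0 0) a b c d (sp_q1 (tc t 4)) (sp_q2 (tc t 5)); rewrite /= => ->;
      rewrite /plu e1 e2 e3 e4 z5; ring.
  + rewrite sp //= /coefK /= => Jp _ hp _; have [a [b ->]] := spI_quadric hp Jp.
    by rewrite mcoeffD !mcoeffZ /sp_q1 /sp_q2 !coefvar !mulr0 addr0.
  rewrite /= /coefK /= => Jp _ hp _; have uT := trans_unit (tc t 6) (tc t 7).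
  move: Jp; rewrite /fam2 => /(actP _ _ uT) Ir.
  have hr := @homog_subst _ _ (invmx (trans (tc t 6) (tc t 7))) _ hp.
  have [a [b er]] := spI_quadric hr Ir; rewrite -(substVK p uT) er rmorphD /= !substZ /sp_q1 /sp_q2 !rmorphM /= substX3 !mxE /=.
  by rewrite (h0 7%N) // mcoeffD !mcoeffZ !coef_linM !coefvar; ring.
move=> j; pose t (i : 'I_8) : k := if i == j then 1 else 0.
have tE i : (i < 8)%N -> tc t i = if i == val j then 1 else 0.
  by move=> i8; rewrite /tc /t -val_eqE /= inordK.
exists t; split=> //.
  by move=> i ji; rewrite /t; case: eqP => // e; rewrite e ltnn in ji.
have one0 : 1 = 0 :> k -> False by move/eqP; rewrite oner_eq0.
have sp : (j <= 5)%N -> fam2 t = spI (tc t 4) (tc t 5) (tc t 2) (tc t 1) (tc t 0) (tc t 3).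
  by move=> j5; apply: fam2_spI; rewrite tE // ifN // gtn_eqF // ltnS // ltnW.
have mt p : spI (tc t 4) (tc t 5) (tc t 2) (tc t 1) (tc t 0) (tc t 3) p -> fam2 t (subst (trans (tc t 6) (tc t 7)) p).
  exact: act_mem.
move: t tE sp mt => t tE sp mt.
have nE m c1 c2 c3 al r1 r2 : (sp_e c1 c2 c3 al : S)@_m = 1 -> ~ pairK 3 (coefK m) (spI r1 r2 c1 c2 c3 al).
  move=> e [_ h]; apply: one0; rewrite -e.
  have Je := spI_mem_e r1 r2 c1 c2 c3 al; have he := @homog_sp_e k c1 c2 c3 al.
  exact: (h _ _ Je Je he he).
have nQ m p : homog_of 2 p -> (subst (trans (tc t 6) (tc t 7)) p)@_m = 1 ->
    spI (tc t 4) (tc t 5) (tc t 2) (tc t 1) (tc t 0) (tc t 3) p -> ~ pairK 2 (coefK m) (fam2 t).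
  move=> hp e /mt Jp [_ h]; apply: one0; rewrite -e.
  have he := @homog_subst _ _ (trans (tc t 6) (tc t 7)) _ hp.
  exact: (h _ _ Jp Jp he he).
case: j sp tE => [[|[|[|[|[|[|[|[|//]]]]]]]] hj] /= sp tE.
- by rewrite sp // !tE //=; apply: nE; rewrite /sp_e /sp_c !(mcoeffD, mcoeffZ) !coefvar !(mcoeffD, mcoeffZ) !coefvar !coef_mon /=; ring.
- by rewrite sp // !tE //=; apply: nE; rewrite /sp_e /sp_c !(mcoeffD, mcoeffZ) !coefvar !(mcoeffD, mcoeffZ) !coefvar !coef_mon /=; ring.
- by rewrite sp // !tE //=; apply: nE; rewrite /sp_e /sp_c !(mcoeffD, mcoeffZ) !coefvar !(mcoeffD, mcoeffZ) !coefvar !coef_mon /=; ring.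
- by rewrite sp // !tE //=; apply: nE; rewrite /sp_e /sp_c !(mcoeffD, mcoeffZ) !coefvar ?coef_mon /=; ring.
- rewrite sp // !tE //= => -[_ h]; apply: one0; have J1 := @spI_mem_q1 k 1 0 0 0 0 0; have h1 := @homog_sp_q1 k 1.
  have := h _ _ J1 J1 h1 h1; rewrite /coefK /=; have [-> _ _ _] := sp_q_coef 1 0.
  by move/eqP; rewrite oppr_eq0 => /eqP.
- rewrite sp // !tE //= => -[_ h]; apply: one0.
  have J1 := @spI_mem_q1 k 0 1 0 0 0 0; have J2 := @spI_mem_q2 k 0 1 0 0 0 0.
  have := h _ _ J1 J2 (@homog_sp_q1 k 0) (@homog_sp_q2 k 1); rewrite /minors /plu /=.
  by have [-> -> -> ->] := sp_q_coef 0 1 => h1; rewrite -[RHS]h1; ring.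
- apply: (nQ _ (sp_q1 (tc t 4))); [exact: homog_sp_q1| |exact: spI_mem_q1].
  rewrite /sp_q1 rmorphM /= substX3 !tE //= oppr0 /lin !scale0r !addr0 add0r !scale1r substY3 !mxE /= -linY1 !scale1r !scale0r addr0 mulrDl.
  by rewrite mcoeffD !coefvar coef_mon /=; ring.
apply: (nQ _ (sp_q2 (tc t 5))); [exact: homog_sp_q2| |exact: spI_mem_q2].
rewrite /sp_q2 rmorphM /= substX3 !tE //= oppr0 /lin !scale0r !addr0 !add0r !scale1r substZ3 !mxE /= -linZ1 !scale1r !scale0r addr0 mulrDl.
by rewrite mcoeffD !coefvar coef_mon /=; ring.
Qed.

End SpecialChain.

(** * The lexicographic ideal and its membership in the second component *)

Section Lex.
Variable k : closedFieldType.
Local Notation S := {mpoly k[3]}.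
Local Notation X := (X3 k).
Local Notation Y := (Y3 k).
Local Notation Z := (Z3 k).
Implicit Types (p q : S) (L : ideal_pred k).
Local Notation cl := (@cl k 20 N5 (ideal_pred k) (@Hpt k) (@lowbasis k)).

(* The monomials of the ideal [(x^2, xy, xz^2, y^4, y^3 z)]. *)
Definition in_lex (m : 'X_{1..3}) : bool :=
  [|| (1 < m i0)%N, (m i0 == 1%N) && ((0 < m i1)%N || (1 < m i2)%N) | (2 < m i1)%N && (3 < m i1 + m i2)%N].

Definition lexI : ideal_pred k := fun p => forall m, p@_m != 0 -> in_lex m.

Lemma in_lexD m m' : in_lex m -> in_lex (m' + m)%MM.
Proof. by rewrite /in_lex !mnmDE; lia. Qed.

Lemma lexI_monomial m : in_lex m -> lexI 'X_[m].
Proof. by move=> h m'; rewrite mcoeffX; case: (eqVneq m m') => [<- //|_] /=; rewrite eqxx. Qed.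

Lemma lexI_hideal : is_hideal lexI.
Proof.
split=> [m|p q Ip Iq m|p q Iq m|d p Ip m].
- by rewrite mcoeff0 eqxx.
- rewrite mcoeffD => h; case: (eqVneq p@_m 0) => [p0|/Ip //]; apply: Iq.
  by rewrite p0 add0r in h.
- rewrite mcoeffM => h; apply: contraNT h => nm; rewrite big1 // => -[m1 m2] /= /eqP em.
  case: (eqVneq q@_(bmnm m2) 0) => [->|/Iq h2]; first by rewrite mulr0.
  by case/negP: nm; rewrite em; apply: in_lexD.
- by rewrite mcoeff_hcomp; case: ifP => // _; [exact: Ip|rewrite eqxx].
Qed.

Definition lex_std d : seq 'X_{1..3} := match d with
  | 0 => [:: mon 0 0 0]
  | 1 => [:: mon 1 0 0; mon 0 1 0; mon 0 0 1]
  | 2 => [:: mon 1 0 1; mon 0 2 0; mon 0 1 1; mon 0 0 2]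
  | 3 => [:: mon 0 3 0; mon 0 2 1; mon 0 1 2; mon 0 0 3]
  | d' => [:: mon 0 0 d'; mon 0 1 d'.-1; mon 0 2 d'.-2]
  end.

Lemma lexI_Hpt : Hpt lexI.
Proof.
split; first exact: lexI_hideal.
move=> d; exists [seq 'X_[m] : S | m <- mons d & in_lex m]; split.
  apply/basis_ofP; split.
  - move=> p /mapP[m]; rewrite mem_filter mem_mons => /andP[hm /eqP em] ->.
    by split; [exact: lexI_monomial|exact: homogX].
  - apply: free_triangular; first by rewrite filter_uniq ?uniq_mons.
    by move=> m m' _ _; rewrite mcoeffX.
  move=> p Ip hp; rewrite (homog_span hp); apply: spanS_sum => m _.
  case: (eqVneq p@_m 0) => [->|pm]; first by rewrite scale0r; apply: spanS0.
  apply/spanSZ/spanS_mem/map_f; rewrite mem_filter (Ip _ pm) mem_mons /=.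
  by apply: contraNT pm => ne; apply/eqP; apply: (homog_coef hp).
rewrite size_map size_filter; have := count_predC in_lex (mons d); rewrite size_mons.
have -> : count (predC in_lex) (mons d) = size (lex_std d).
  rewrite -size_filter; apply/perm_size/uniq_perm; first by rewrite filter_uniq ?uniq_mons.
    by case: d => [|[|[|[|d]]]]; rewrite /= ?inE ?eq_mon.
  move=> m; rewrite mem_filter mem_mons (mon_eta m) /= /in_lex !monE mdeg_mon.
  move: (m i0) (m i1) (m i2) => a b c.
  by case: d => [|[|[|[|d]]]]; rewrite /= !inE !eq_mon; apply/idP/idP; lia.
change (count [eta in_lex] (mons d)) with (count in_lex (mons d)); move: (count _ _) => n.
by case: d => [|[|[|[|d]]]]; rewrite /hdim /=; last (by move=> <-; rewrite addnK); rewrite bin2 /= => h; lia.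
Qed.

Lemma in_lex_gen (P : S -> Prop) : (forall a p, P p -> P (a * p)) ->
  P (X * X) -> P (X * Y) -> P (X * (Z * Z)) -> P (Y * (Y * (Y * Y))) -> P (Y * (Y * (Y * Z))) ->
  forall m, in_lex m -> P 'X_[m].
Proof.
move=> PM P1 P2 P3 P4 P5 m; rewrite (mon_eta m) /in_lex !monE.
move: (m i0) (m i1) (m i2) => a b c.
have sh a' b' c' (q : S) : P q -> 'X_[mon a b c] = 'X_[mon a' b' c'] * q -> P 'X_[mon a b c].
  by move=> Pq ->; apply: PM.
case/or3P => [h|/andP[/eqP a1 /orP[h|h]]|/andP[h1 h2]].
- by apply: (sh (a - 2)%N b c _ P1); rewrite !mulmon; congr (mpolyX _ (mon _ _ _)); lia.
- by apply: (sh (a - 1)%N (b - 1)%N c _ P2); rewrite !mulmon; congr (mpolyX _ (mon _ _ _)); lia.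
- by apply: (sh (a - 1)%N b (c - 2)%N _ P3); rewrite !mulmon; congr (mpolyX _ (mon _ _ _)); lia.
case: (ltnP 3 b) => hb.
  by apply: (sh a (b - 4)%N c _ P4); rewrite !mulmon; congr (mpolyX _ (mon _ _ _)); lia.
by apply: (sh a (b - 3)%N (c - 1)%N _ P5); rewrite !mulmon; congr (mpolyX _ (mon _ _ _)); lia.
Qed.

Lemma lex_gtE (m m' : 'X_{1..3}) : lex_gt m m' <->
  [\/ (m i0 > m' i0)%N, m i0 = m' i0 /\ (m i1 > m' i1)%N | m i0 = m' i0 /\ m i1 = m' i1 /\ (m i2 > m' i2)%N].
Proof.
have e1 : inord 1 = i1 :> 'I_3 by apply: val_inj; rewrite /= inordK.
have e2 : inord 2 = i2 :> 'I_3 by apply: val_inj; rewrite /= inordK.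
have e0 : ord0 = i0 :> 'I_3 by apply: val_inj.
by rewrite /lex_gt e0 e1 e2; split=> [[h|[h|h]]|[h|h|h]]; [constructor 1|constructor 2|constructor 3|left|right; left|right; right].
Qed.

Lemma lexI_is_lex : is_lex lexI.
Proof.
split; first exact: lexI_hideal.
- move=> p; split=> h m; rewrite ?mcoeff_msupp => hm; first by apply: lexI_monomial; exact: h.
  by have := h m; rewrite mcoeff_msupp => /(_ hm) /(_ m); rewrite mcoeffX eqxx oner_neq0 => /(_ isT).
move=> m m' em /lex_gtE h /(_ m); rewrite mcoeffX eqxx oner_neq0 => /(_ isT) hm; apply: lexI_monomial.
move: em h hm; rewrite !mdeg3 /in_lex; move: (m i0) (m i1) (m i2) (m' i0) (m' i1) (m' i2) => a b c a' b' c' em h hm.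
by case: h; lia.
Qed.

(** If [m] were not in [L], all monomials of [L_d] would be larger than [m], and there are too few
    of those to span [L_d]. *)
Lemma lex_count L d m (t : seq 'X_{1..3}) : Hpt L -> is_lex L -> mdeg m = d ->
  (forall m', mdeg m' = d -> lex_gt m' m -> m' \in t) -> (size t < hdim d)%N -> L 'X_[m].
Proof.
move=> HL [_ hmon hlex] dm ht st; apply: NNPP => nL; have [u [su hu fu _]] := Hpt_basis HL d.
apply: (@steinitz_dep _ _ u [seq 'X_[m] : S | m <- t]) fu => [p /hu[Lp hp]|]; last by rewrite size_map su.
rewrite (homog_span hp) big_seq; apply: spanS_sum => m'; rewrite mem_mons => /eqP dm'.
case: (eqVneq p@_m' 0) => [->|pm]; first by rewrite scale0r; apply: spanS0.
have Lm' : L 'X_[m'] by apply: ((hmon p).1 Lp); rewrite mcoeff_msupp.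
apply/spanSZ/spanS_mem/map_f; apply: ht => //; apply/lex_gtE; apply: NNPP => ngt; apply: nL.
case: (m =P m') => [-> //|ne]; apply: (hlex m' m); rewrite ?dm ?dm' //; apply/lex_gtE.
move: ngt ne dm'; rewrite -dm !mdeg3 (monP m m'); move: (m i0) (m i1) (m i2) (m' i0) (m' i1) (m' i2) => a b c a' b' c' ngt ne e.
case: (ltngtP a a') => [h|h|e0]; [by case: ngt; constructor 1|by constructor 1|].
case: (ltngtP b b') => [h|h|e1]; [by case: ngt; constructor 2|by constructor 2|].
by case: ne; split=> //; lia.
Qed.

(** The monomials [x y], [x z^2], [y^3 z] are the second, sixth and twelfth in degrees 2, 3, 4,
    hence in [L] by [lex_count]. With the larger [x^2] and [y^4] they generate [lexI], and equal
    dimensions conclude. *)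
Lemma lex_unique L : Hpt L -> is_lex L -> L = lexI.
Proof.
move=> HL lL; have hL := Hpt_hideal HL; have [_ hmon hlex] := lL.
have cnt d m t := @lex_count L d m t HL lL.
have XY : L (X * Y).
  rewrite mulmon; apply: (cnt 2 _ [:: mon 2 0 0]) => // [|m]; first by rewrite mdeg_mon.
  rewrite mdeg3 => dm /lex_gtE; rewrite (mon_eta m) !inE !eq_mon !monE; move: dm; move: (m i0) (m i1) (m i2) => a b c.
  case: a => [|[|[|[|[|a]]]]]; case: b => [|[|[|[|[|b]]]]]; case: c => [|[|[|[|[|c]]]]] dm h;
    first [by []|by exfalso; lia|by exfalso; case: h; lia].
have XX : L (X * X).
  move: XY; rewrite !mulmon; apply: hlex; rewrite ?mdeg_mon //; apply/lex_gtE; rewrite !monE; by constructor 1.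
have XZZ : L (X * (Z * Z)).
  rewrite !mulmon; apply: (cnt 3 _ [:: mon 3 0 0; mon 2 1 0; mon 2 0 1; mon 1 2 0; mon 1 1 1]) => // [|m]; first by rewrite mdeg_mon.
  rewrite mdeg3 => dm /lex_gtE; rewrite (mon_eta m) !inE !eq_mon !monE; move: dm; move: (m i0) (m i1) (m i2) => a b c.
  case: a => [|[|[|[|[|a]]]]]; case: b => [|[|[|[|[|b]]]]]; case: c => [|[|[|[|[|c]]]]] dm h;
    first [by []|by exfalso; lia|by exfalso; case: h; lia].
have YYYZ : L (Y * (Y * (Y * Z))).
  rewrite !mulmon; apply: (cnt 4 _ [:: mon 4 0 0; mon 3 1 0; mon 3 0 1; mon 2 2 0; mon 2 1 1; mon 2 0 2; mon 1 3 0; mon 1 2 1; mon 1 1 2; mon 1 0 3; mon 0 4 0]) => // [|m].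
    by rewrite mdeg_mon.
  rewrite mdeg3 => dm /lex_gtE; rewrite (mon_eta m) !inE !eq_mon !monE; move: dm; move: (m i0) (m i1) (m i2) => a b c.
  case: a => [|[|[|[|[|a]]]]]; case: b => [|[|[|[|[|b]]]]]; case: c => [|[|[|[|[|c]]]]] dm h;
    first [by []|by exfalso; lia|by exfalso; case: h; lia].
have YYYY : L (Y * (Y * (Y * Y))).
  move: YYYZ; rewrite !mulmon; apply: hlex; rewrite ?mdeg_mon //; apply/lex_gtE; rewrite !monE; by constructor 2.
apply: ideal_ext => p; apply: iff_sym; apply: Hpt_eq => //; first exact: lexI_Hpt.
move=> d q _ Iq; apply/(hmon q) => m; rewrite mcoeff_msupp => /Iq hm.
by apply: (in_lex_gen _ XX XY XZZ YYYY YYYZ) => // a r; apply: (hiM hL).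
Qed.

(** The case [s0 = 0] of [line_type]: the vertex of the pencil lies on the line [x = 0]. *)
Lemma lexI_X2 : cl (@X2 k) lexI.
Proof.
have hm m : in_lex m -> lexI 'X_[m] by apply: lexI_monomial.
have [] := @line_type k lexI 0 lexI_Hpt _ _ _ => //.
- by rewrite mulmon; apply: hm; rewrite /in_lex !monE.
- by rewrite scale0r subr0 mulmon; apply: hm; rewrite /in_lex !monE.
move=> p hp m; rewrite (mon_eta m); case: (m i0) => [|a]; first by rewrite coefX0 eqxx.
rewrite coefXS => pm; have : mdeg (mon a (m i1) (m i2)) = 3%N.
  by apply/eqP; apply: contraNT pm => ne; apply/eqP; apply: (homog_coef hp).
by rewrite mdeg_mon /in_lex !monE; move: (m i1) (m i2) => b c; lia.
Qed.

End Lex.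

(** * An arc of curvilinear triple points *)

Section LexArc.
Variable k : closedFieldType.
Local Notation S := {mpoly k[3]}.
Local Notation X := (X3 k).
Local Notation Y := (Y3 k).
Local Notation Z := (Z3 k).
Implicit Types (p q : S).
Local Notation cl := (@cl k 20 N5 (ideal_pred k) (@Hpt k) (@lowbasis k)).

(** The scheme is the triple point of the conic [x z = s y^2] at [(0 : 0 : 1)], so [n3] is
    proportional to [N]. With these [la] and [mu] the quadrics become [x^2 + (s^3 + s^4) N] and
    [x y + s N], tending to [x^2] and [x y], while [la + mu^2 = - s^5] stays nonzero for nonzero
    [s]. *)
Definition lex_arc (s : k) : ideal_pred k := chartI 0 0 0 0 s^-1 0 (- (s ^+ 4 + s ^+ 5)) (- s ^+ 2).

Variable s : k.
Hypothesis s0 : s != 0.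
Local Notation J := (lex_arc s).
Local Notation N := (X * Z - s *: (Y * Y) : S).
Local Notation q1 := (X * X + (s ^+ 3 + s ^+ 4) *: N).
Local Notation q2 := (X * Y + s *: N).

Let hJ : is_hideal J := chartI_hideal _ _ _ _ _ _ _ _.

Lemma lex_arc_n3 : ch_n3 0 0 0 s^-1 0 = - s^-1 *: N :> S.
Proof.
rewrite /ch_n3 /ch_f0 /lin !(mulr0, mul0r, subr0, addr0, add0r, expr0n) /= !scale0r !addr0.
by rewrite scalerBr [_ *: (_ *: (Y * Y))]scalerA mulNr mulVf // scaleN1r opprK oppr0 scale0r addr0 -scalerAr [Z * X]mulrC scaleNr addrC.
Qed.

Lemma lex_arc_q1 : J q1.
Proof.
have <- : ch_q1 0 0 0 0 s^-1 0 (- (s ^+ 4 + s ^+ 5)) = q1.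
  rewrite /ch_q1 lex_arc_n3 scalerA mulrNN mulrDl !exprSr !mulfK // /ch_n1 /ch_c0 /lin.
  by rewrite !(mulr0, mul0r, subr0, addr0, add0r, expr0n) /= ?oppr0 !(scale0r, addr0, mulr0, subr0, add0r).
apply/(chartI_mem 0 0 0 0 s^-1 0 (- (s ^+ 4 + s ^+ 5)) (- s ^+ 2) (@homog_q1 k 0 0 0 0 s^-1 0 _)).
by exists 1, 0; rewrite scale1r scale0r addr0.
Qed.

Lemma lex_arc_q2 : J q2.
Proof.
have <- : ch_q2 0 0 0 0 s^-1 0 (- s ^+ 2) = q2.
  rewrite /ch_q2 lex_arc_n3 scalerA mulrNN expr2 mulfK // /ch_n2 /ch_d0 /lin.
  by rewrite !(mulr0, mul0r, subr0, addr0, add0r, expr0n) /= ?oppr0 !(scale0r, addr0, mulr0, subr0, add0r).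
apply/(chartI_mem 0 0 0 0 s^-1 0 (- (s ^+ 4 + s ^+ 5)) (- s ^+ 2) (@homog_q2 k 0 0 0 0 s^-1 0 _)).
by exists 0, 1; rewrite scale1r scale0r add0r.
Qed.

Lemma lex_arc_N q : homog_of 2 q -> J (N * q).
Proof.
move=> hq; have hn := @homog_n3 k 0 0 0 s^-1 0.
have : J (q * ch_n3 0 0 0 s^-1 0).
  apply/(chartI_mem _ _ _ _ _ _ _ _ (@homogM k 2 2 _ _ hq hn)).
  by apply: (ch_evd_mul hn (ch_evd_n3 _ _ _ _ _ _) hq).
rewrite lex_arc_n3 => /(hiZ hJ (- s)); rewrite -scalerAr scalerA mulrNN mulfV // scale1r mulrC.
by [].
Qed.

Lemma scale_cancel (a : k) q : a != 0 -> J (a *: q) -> J q.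
Proof. by move=> na /(hiZ hJ a^-1); rewrite scalerA mulVf // scale1r. Qed.

(** The cubic that tends to the missing generator [x z^2]; [s^4] times it is a combination of the
    products of [q1] and [q2] with linear forms. *)
Lemma lex_arc_cubic : J (Z * N - s *: (Y * (Y * Y))).
Proof.
apply: (scale_cancel (a := s ^+ 4)); first by rewrite expf_neq0.
have -> : s ^+ 4 *: (Z * N - s *: (Y * (Y * Y))) =
    Y * q1 - X * q2 + s *: (Z * q1 - s *: (Y * q2) - s ^+ 3 *: (Z * q2)).
  rewrite -!mul_mpolyC !(mpolyCD, rmorphXn) /=; move: s%:MP => a; ring.
have hM := hiM hJ; have hZ := hiZ hJ; have hB := hiB hJ.
have h1 := lex_arc_q1; have h2 := lex_arc_q2.
by apply: (hiD hJ); [apply: (hB)|apply: (hZ); apply: (hB); [apply: (hB)|apply: (hZ)]]; try (apply: (hM)); try exact: h1; try exact: h2; apply: (hZ); apply: (hM).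
Qed.

Lemma lex_arc_YYYZ : J (Y * (Y * (Y * Z))).
Proof.
apply: (scale_cancel s0).
have -> : s *: (Y * (Y * (Y * Z))) = N * (Z * Z) - Z * (Z * N - s *: (Y * (Y * Y))).
  rewrite -!mul_mpolyC; move: s%:MP => a; ring.
apply: (hiB hJ); last by apply: (hiM hJ); exact: lex_arc_cubic.
by apply: lex_arc_N; apply: (@homogM k 1 1); exact: homogZ3.
Qed.

Lemma lex_arc_YYYY : J (Y * (Y * (Y * Y))).
Proof.
apply: (scale_cancel s0).
have -> : s *: (Y * (Y * (Y * Y))) = (Y * Z) * q2 - N * (Y * Y) - s *: ((Z * Z) * q2)
    + s *: (s *: (Y * (Y * (Y * Z)))) + s *: (s *: (N * (Z * Z))).
  rewrite -!mul_mpolyC; move: s%:MP => a; ring.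
have hM := hiM hJ; have hZ := hiZ hJ; have hB := hiB hJ; have hD := hiD hJ.
have NN := lex_arc_N.
have YY : homog_of 2 (Y * Y) by apply: (@homogM k 1 1); exact: homogY3.
have ZZ : homog_of 2 (Z * Z) by apply: (@homogM k 1 1); exact: homogZ3.
apply: (hD); [apply: (hD); [apply: (hB); [apply: (hB)|]|]|].
- by apply: (hM); exact: lex_arc_q2.
- exact: NN.
- by apply: (hZ); apply: (hM); exact: lex_arc_q2.
- by do 2!apply: (hZ); exact: lex_arc_YYYZ.
- by do 2!apply: (hZ); exact: NN.
Qed.

End LexArc.

(** * The lexicographic ideal as a limit of the first family *)

Section LexX1.
Variable k : closedFieldType.
Local Notation S := {mpoly k[3]}.
Local Notation X := (X3 k).
Local Notation Y := (Y3 k).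
Local Notation Z := (Z3 k).
Implicit Types (p q : S).
Local Notation cl := (@cl k 20 N5 (ideal_pred k) (@Hpt k) (@lowbasis k)).

Lemma lexI_X1 : cl (@X1 k) (@lexI k).
Proof.
pose E : {poly k} := 'X * ('X + 1%:P).
have E0 : E != 0 by rewrite mulf_neq0 ?polyX_eq0 ?polyXaddC_neq0.
have Es s : E.[s] != 0 -> s != 0 /\ s + 1 != 0.
  by rewrite hornerM !hornerD !hornerX !hornerC mulf_eq0 negb_or => /andP[].
have hJ s : is_hideal (lex_arc s) by apply: chartI_hideal.
have in1 s : E.[s] != 0 -> X1 (lex_arc s).
  move=> /Es[n0 n1]; apply: chart_X1; rewrite sqrrN -exprM opprD addrAC addNr add0r oppr_eq0.
  exact: expf_neq0.
apply: (@closed_limit k 20 N5 _ (@Hpt k) (@lowbasis k) (cl (@X1 k)) E (@lex_arc k) 0) => [|//||s /in1 hs|].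
- by apply: cl_closed; exact: X1_Hpt.
- exact: lexI_Hpt.
- exact: cl_incl.
apply: lifts_liftable => [s _|s /in1/X1_Hpt//||d p d4 Ip hp]; [exact: hJ|exact: lexI_Hpt|].
have famI s : (fun s => E.[s] != 0) s -> is_hideal (lex_arc s) by move=> _; apply: hJ.
have ps : pfun (@line_co k) (fun s => s) := pf_coord line_co tt.
have pc (q : S) : psec (@line_co k) (fun=> q) by apply: psec_const.
have pN : psec (@line_co k) (fun s => X * Z - s *: (Y * Y)) by apply: psecB => //; apply: psecZ.
have li (F : k -> S) q : psec (@line_co k) F -> F 0 = q -> (forall s, s != 0 -> lex_arc s (F s)) ->
    lifts line_co (fun s => E.[s] != 0) (@lex_arc k) 0 q.
  by move=> pF F0 FJ; exists F; split=> // s /Es[n0 _]; apply: FJ.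
have mon_lifts m : in_lex m -> lifts line_co (fun s => E.[s] != 0) (@lex_arc k) 0 'X_[m].
  apply: in_lex_gen => [a q||||| ]; first exact: (liftsM famI).
  - apply: (li (fun s => X * X + (s ^+ 3 + s ^+ 4) *: (X * Z - s *: (Y * Y)))); last exact: lex_arc_q1.
      by apply: psecD => //; apply: psecZ => //; apply: pf_add; apply: pf_exp.
    by rewrite !expr0n addr0 scale0r addr0.
  - apply: (li (fun s => X * Y + s *: (X * Z - s *: (Y * Y)))); last exact: lex_arc_q2.
      by apply: psecD => //; apply: psecZ.
    by rewrite scale0r addr0.
  - apply: (li (fun s => Z * (X * Z - s *: (Y * Y)) - s *: (Y * (Y * Y)))); last exact: lex_arc_cubic.
      by apply: psecB; [apply: psecM|apply: psecZ].
    by rewrite !scale0r !subr0 mulrCA.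
  - by apply: (li (fun=> Y * (Y * (Y * Y)))) => //; exact: lex_arc_YYYY.
  - by apply: (li (fun=> Y * (Y * (Y * Z)))) => //; exact: lex_arc_YYYZ.
have LD := liftsD famI; have LZ := liftsZ famI.
rewrite [p]mpolyE; elim/big_rec: _ => [|m q _ Lq]; first exact: lifts0.
apply: (LD) => //; case: (eqVneq p@_m 0) => [->|/Ip/mon_lifts]; last exact: (LZ).
by rewrite scale0r; apply: lifts0.
Qed.

End LexX1.

(** * Neither closure contains the other *)

Section Separation.
Variable k : closedFieldType.
Local Notation S := {mpoly k[3]}.
Local Notation X := (X3 k).
Implicit Types (p q : S) (I : ideal_pred k).
Local Notation closedG := (@closedG k 20 N5 (ideal_pred k) (@Hpt k) (@lowbasis k)).
Local Notation irrG := (@irrG k 20 N5 (ideal_pred k) (@Hpt k) (@lowbasis k)).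
Local Notation cl := (@cl k 20 N5 (ideal_pred k) (@Hpt k) (@lowbasis k)).

(* The quadrics of a point of [X2] share a linear factor, so their [pencilR] vanishes. *)
Lemma X2_Kgood I : X2 I -> Kgood I.
Proof.
move=> XI; split; first exact: X2_Hpt.
case: XI => t _ -> p q Ip Iq hp hq; set M := trans (tc t 6) (tc t 7) in Ip Iq *.
have uM : M \in unitmx by apply: trans_unit.
have hL l : homog_of 1 l -> homog_of 1 (subst M l) by move=> hl; apply: homog_subst.
have fac w : homog_of 2 w -> act M (spI (tc t 4) (tc t 5) (tc t 2) (tc t 1) (tc t 0) (tc t 3)) w ->
    exists2 l, homog_of 1 l & w = subst M X * l.
  move=> hw [r Ir ew]; have hr : homog_of 2 r.
    by rewrite -[r](substK _ uM) -ew; apply: homog_subst.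
  have [a [b er]] := spI_quadric hr Ir.
  exists (subst M (a *: lin (- tc t 4) 1 0 + b *: lin (- tc t 5) 0 1)).
    by apply: hL; apply: homogD; apply: homogZ; apply: homog_lin.
  rewrite ew er -rmorphM; congr (subst M _); rewrite /sp_q1 /sp_q2 -!mul_mpolyC.
  by move: (lin _ _ _) (lin _ _ _) a%:MP b%:MP => l1 l2 a' b'; ring.
have [l hl ->] := fac p hp Ip; have [l' hl' ->] := fac q hq Iq.
have hX := hL _ (@homogX3 k).
suff -> : pencilR (subst M X * l) (subst M X * l') = 0 by rewrite mulr0.
rewrite (homog1_lin hX) (homog1_lin hl) (homog1_lin hl') /pencilR /plu !coef_linM !coefvar /= ?coef_lin; ring.
Qed.

(** The closed condition [Kgood] holds on the second closure and fails at the chart point with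
    [la = 1], [mu = 0] and zero structure constants. *)
Lemma clX1_not_X2 : ~ sub_incl (cl (@X1 k)) (cl (@X2 k)).
Proof.
move=> h; have nz : 1 + 0 ^+ 2 != 0 :> k by rewrite expr0n addr0 oner_neq0.
have hX1 := chart_X1 0 0 0 0 0 0 nz.
have [_ K] := cl_min (@Kgood_closed k) X2_Kgood (h _ (cl_incl hX1)).
have := K _ _ (@fam_q1 k unit (fun=> 0) (fun=> 0) (fun=> 0) (fun=> 0) (fun=> 0) (fun=> 0) (fun=> 1) (fun=> 0) tt)
  (@fam_q2 k unit (fun=> 0) (fun=> 0) (fun=> 0) (fun=> 0) (fun=> 0) (fun=> 0) (fun=> 1) (fun=> 0) tt)
  (@homog_q1 k _ _ _ _ _ _ _) (@homog_q2 k _ _ _ _ _ _ _).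
have [_ _ [a1 a2 a3] [b1 b2 b3]] := @ch_normal_pencil k 0 0 0 0 0 0 1 0.
rewrite /pencilP /pencilR /plu a1 a2 a3 b1 b2 b3 !(mulr0, mul0r, mulr1, subr0, expr0n, add0r) /=.
by apply/eqP; rewrite oner_neq0.
Qed.

Lemma no_chain1 (c : nat -> subH k) :
  (forall i, (i <= 9)%N -> [/\ closedG (c i), irrG (c i) & sub_incl (c i) (cl (@X1 k))]) ->
  (forall i, (i < 9)%N -> strict_incl (c i) (c i.+1)) -> False.
Proof.
exact: (closure_no_chain (@lowbasis_free k) (@ok1_line k) (@fam1_Hpt k) (@fam1_lift k)).
Qed.

Lemma no_chain2 (c : nat -> subH k) :
  (forall i, (i <= 9)%N -> [/\ closedG (c i), irrG (c i) & sub_incl (c i) (cl (@X2 k))]) ->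
  (forall i, (i < 9)%N -> strict_incl (c i) (c i.+1)) -> False.
Proof.
exact: (closure_no_chain (@lowbasis_free k) (@ok2_line k) (@fam2_Hpt k) (@fam2_lift k)).
Qed.

Lemma clX1_irr : irrG (cl (@X1 k)).
Proof.
apply/irr_cl/(family_irr (@ok1_line k) (@fam1_Hpt k) (@fam1_lift k)).
by exists (fun=> 0); exact: ok1_0.
Qed.

Lemma clX2_irr : irrG (cl (@X2 k)).
Proof.
apply/irr_cl/(family_irr (@ok2_line k) (@fam2_Hpt k) (@fam2_lift k)).
by exists (fun=> 0).
Qed.

(* Otherwise a chain in [cl X2] could be prolonged by [cl X1], against the bound on the length of
   chains in [cl X1]. *)
Lemma clX2_not_X1 : ~ sub_incl (cl (@X2 k)) (cl (@X1 k)).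
Proof.
move=> h; have [c [hc hs]] := X2_chain k.
pose c' i := if (i <= 8)%N then c i else cl (@X1 k).
have c'E i : (i <= 8)%N -> c' i = c i by rewrite /c' => ->.
have c'N i : (8 < i)%N -> c' i = cl (@X1 k) by rewrite /c' ltnNge => /negbTE ->.
move: c' c'E c'N => c' c'E c'N.
apply: (@no_chain1 c') => i hi.
  case: (leqP i 8) => hi8; first by rewrite (c'E _ hi8); have [c1 c2 c3] := hc i hi8; split=> // J /c3/h.
  by rewrite (c'N _ hi8); split=> //; [apply: cl_closed; exact: X1_Hpt|exact: clX1_irr].
case: (ltnP i 8) => hi8; first by rewrite (c'E _ (ltnW hi8)) (c'E _ hi8); apply: hs.
have -> : i = 8 by lia.
rewrite (c'E 8) // (c'N 9) //; have [_ _ c3] := hc 8 isT.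
by split=> [J /c3/h //|h']; apply: clX1_not_X2 => J /h'/c3.
Qed.

End Separation.

(** * Assembly of the two components *)

Theorem theorem3p7 (k : closedFieldType) (hchar : (2%:R : k) != 0) :
  exists Z1 Z2 : subH k,
    [/\ componentH Z1 /\ componentH Z2,
        ~ (forall I : ideal_pred k, Z1 I <-> Z2 I),
        (forall I : ideal_pred k, Hpt I <-> (Z1 I \/ Z2 I)),
        dimH Z1 8 /\ dimH Z2 8 &
        (exists L : ideal_pred k, Hpt L /\ is_lex L) /\
        (forall L : ideal_pred k, Hpt L -> is_lex L -> Z1 L /\ Z2 L)].
Proof.
pose Z1 := @cl k 20 N5 (ideal_pred k) (@Hpt k) (@lowbasis k) (@X1 k).
pose Z2 := @cl k 20 N5 (ideal_pred k) (@Hpt k) (@lowbasis k) (@X2 k).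
have reg (I : ideal_pred k) : Hpt I -> regular I by move=> HI; case: (Hpt_classification hchar HI).
(* Regularity of all points identifies the two topologies, so irreducibility and chains transfer in
   both directions. *)
have cG (C : subH k) : closedH C -> closedG (@Hpt k) (@lowbasis k) C := closedH_closedG reg (C := C).
have cl1 : closedG (@Hpt k) (@lowbasis k) Z1 by apply: cl_closed; exact: X1_Hpt.
have cl2 : closedG (@Hpt k) (@lowbasis k) Z2 by apply: cl_closed; exact: X2_Hpt.
have irrH (Z : subH k) : irrG (@Hpt k) (@lowbasis k) Z -> irreducibleH Z.
  by case=> h1 h2 h3; split=> // C1 C2 /cG g1 /cG g2; apply: h3.
have irrG' (Z : subH k) : irreducibleH Z -> irrG (@Hpt k) (@lowbasis k) Z.
  by case=> h1 h2 h3; split=> // C1 C2 /closedG_closedH g1 /closedG_closedH g2; apply: h3.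
have HZ (I : ideal_pred k) : Hpt I <-> Z1 I \/ Z2 I.
  split=> [HI|[]]; [by case: (Hpt_classification hchar HI)|apply: cl_sub; exact: X1_Hpt|apply: cl_sub; exact: X2_Hpt].
(* An irreducible set containing [Z] lies in [Z] or in [Z'], and the latter would place [Z] inside
   [Z']. *)
have comp (Z Z' : subH k) : irreducibleH Z -> closedH Z -> closedH Z' -> (forall I, Hpt I -> Z I \/ Z' I) ->
    ~ sub_incl Z Z' -> componentH Z.
  move=> iZ cZ cZ' cov nZ; split=> // W [W1 W2 W3] ZW.
  have [//|h] := W3 Z Z' cZ cZ' (fun I WI => cov I (W1 I WI)).
  by case: nZ => I /ZW/h.
have dim (Z : subH k) : (exists c : nat -> subH k,
      (forall i, (i <= 8)%N -> [/\ closedG (@Hpt k) (@lowbasis k) (c i), irrG (@Hpt k) (@lowbasis k) (c i) & sub_incl (c i) Z]) /\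
      (forall i, (i < 8)%N -> strict_incl (c i) (c i.+1))) ->
    (forall c : nat -> subH k,
      (forall i, (i <= 9)%N -> [/\ closedG (@Hpt k) (@lowbasis k) (c i), irrG (@Hpt k) (@lowbasis k) (c i) & sub_incl (c i) Z]) ->
      (forall i, (i < 9)%N -> strict_incl (c i) (c i.+1)) -> False) -> dimH Z 8.
  move=> [c [hc hs]] nc; split.
    by exists c; split=> // i /hc[/closedG_closedH ci /irrH ii si].
  by case=> c' [hc' hs']; apply: (nc c') => // i /hc'[/cG ci /irrG' ii si].
exists Z1, Z2; split.
- split.
    apply: (comp _ Z2); [exact/irrH/clX1_irr|exact: closedG_closedH|exact: closedG_closedH|by move=> I /HZ|].
    exact: clX1_not_X2.
  apply: (comp _ Z1); [exact/irrH/clX2_irr|exact: closedG_closedH|exact: closedG_closedH|by move=> I /HZ; tauto|].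
  exact: clX2_not_X1.
- by move=> h; apply: (@clX1_not_X2 k) => I /h.
- exact: HZ.
- by split; apply: dim; [exact: X1_chain|exact: no_chain1|exact: X2_chain|exact: no_chain2].
split; first by exists (@lexI k); split; [exact: lexI_Hpt|exact: lexI_is_lex].
by move=> L HL /(lex_unique HL) ->; split; [exact: lexI_X1|exact: lexI_X2].
Qed.
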